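(* Assume $\gamma_1\neq\gamma_2$. Then for every $\lambda\in(2\max_{[p_0,0]}\Gamma,\infty)$ the bounded linear operator $(L,T):X\to Y\times Z$ defined in the context is a Fredholm operator of index zero.
   Context: Setting: - $\mathbb S=\mathbb R/2\pi\mathbb Z$, and $g>0$, $\sigma>0$. - $p_0<p_1<0$, and $\gamma_1,\gamma_2$ are real constants. - $\gamma=\gamma_1$ on $(p_0,p_1)$, $\gamma=\gamma_2$ on $(p_1,0)$, and $\Gamma(p)=\int_0^p\gamma(s)ds$. - $\Omega_1=\mathbb S\times(p_0,p_1)$ and $\Omega_2=\mathbb S\times(p_1,0)$. - Fix $\alpha\in(0,1)$. - For $\lambda>2\max_{[p_0,0]}\Gamma$ set $a(p):=\sqrt{\lambda-2\Gamma(p)}$. Banach spaces: - $X:=\{(v,V)\in C^{2+\alpha}(\overline{\Omega_1})\times C^{2+\alpha}(\overline{\Omega_2}):\ v=V,\ v_p=V_p\text{ on }p=p_1,\ v=0\text{ on }p=p_0\}$; - $Y:=C^\alpha(\overline{\Omega_1})\times C^\alpha(\overline{\Omega_2})$; - $Z:=C^\alpha(\mathbb S)$, with $\mathbb S$ identified with $\{p=0\}$. The operator is $(L,T)(v,V):=((L_1v,L_2V),TV)$, where - $L_1v:=v_{pp}+a^{-2}v_{qq}-3\gamma_1a^{-2}v_p$; - $L_2V:=V_{pp}+a^{-2}V_{qq}-3\gamma_2a^{-2}V_p$; - $TV:=\frac2\lambda\big[gV-\lambda^{3/2}V_p-\sigma V_{qq}\big]\big|_{p=0}$. (This operator is the Fréchet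 derivative at $(v,V)=0$ of the nonlinear water-wave operator linearized around the laminar flow.) *)

(* Defs.v *)
From Stdlib Require Import Reals.
Open Scope R_scope.

(* Functions on the strip are u : R -> R -> R, read as u q p
   (q = periodic horizontal variable, p = vertical variable). *)

Definition dist2 (q1 p1 q2 p2 : R) : R := sqrt ((q1 - q2) ^ 2 + (p1 - p2) ^ 2).

Definition periodic2 (a b : R) (u : R -> R -> R) : Prop :=
  forall q p, a <= p <= b -> u (q + 2 * PI) p = u q p.

Definition holder2 (alpha a b : R) (u : R -> R -> R) : Prop :=
  (exists M, forall q p, a <= p <= b -> Rabs (u q p) <= M) /\
  (exists C, forall q1 p1 q2 p2, a <= p1 <= b -> a <= p2 <= b ->
     0 < dist2 q1 p1 q2 p2 ->
     Rabs (u q1 p1 - u q2 p2) <= C * Rpower (dist2 q1 p1 q2 p2) alpha).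

Definition inCa2 (alpha a b : R) (u : R -> R -> R) : Prop :=
  periodic2 a b u /\ holder2 alpha a b u.

Definition inCa1 (alpha : R) (z : R -> R) : Prop :=
  (forall q, z (q + 2 * PI) = z q) /\
  (exists M, forall q, Rabs (z q) <= M) /\
  (exists C, forall q1 q2, q1 <> q2 ->
     Rabs (z q1 - z q2) <= C * Rpower (Rabs (q1 - q2)) alpha).

(* Derivative data: first and second partial derivatives, extended
   (uniquely, by Hoelder continuity) to the closed strip. *)
Record Der2 : Type := mkDer2 {
  dp : R -> R -> R; dq : R -> R -> R;
  dpp : R -> R -> R; dpq : R -> R -> R; dqq : R -> R -> R }.

(* u belongs to C^{2+alpha}(closed S x [a,b]) with derivatives d:
   u is C^2 in the open strip, and u together with all its partial
   derivatives up to order 2 are bounded and uniformly alpha-Hoelder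
   (Gilbarg-Trudinger definition); d gives their continuous extensions. *)
Definition IsC2a (alpha a b : R) (u : R -> R -> R) (d : Der2) : Prop :=
  inCa2 alpha a b u /\
  holder2 alpha a b (dp d) /\ holder2 alpha a b (dq d) /\
  holder2 alpha a b (dpp d) /\ holder2 alpha a b (dpq d) /\
  holder2 alpha a b (dqq d) /\
  (forall q p, a < p < b ->
     derivable_pt_lim (fun s => u q s) p (dp d q p) /\
     derivable_pt_lim (fun s => u s p) q (dq d q p) /\
     derivable_pt_lim (fun s => dp d q s) p (dpp d q p) /\
     derivable_pt_lim (fun s => dp d s p) q (dpq d q p) /\
     derivable_pt_lim (fun s => dq d q s) p (dpq d q p) /\
     derivable_pt_lim (fun s => dq d s p) q (dqq d q p)).

(* Gamma(p) = int_0^p gamma, gamma = g1 on (p0,p1), g2 on (p1,0) *)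
Definition Gam (g1 g2 p1 p : R) : R :=
  if Rle_dec p1 p then g2 * p else g2 * p1 + g1 * (p - p1).

Definition aa (lam g1 g2 p1 p : R) : R := sqrt (lam - 2 * Gam g1 g2 p1 p).

Record XE : Type := mkXE { xv : R -> R -> R; xV : R -> R -> R }.
Record YZE : Type := mkYZE { y1 : R -> R -> R; y2 : R -> R -> R; yz : R -> R }.

Definition inX (alpha p0 p1 : R) (x : XE) : Prop :=
  exists dv dV, IsC2a alpha p0 p1 (xv x) dv /\ IsC2a alpha p1 0 (xV x) dV /\
    (forall q, xv x q p1 = xV x q p1 /\ dp dv q p1 = dp dV q p1) /\
    (forall q, xv x q p0 = 0).

Definition inYZ (alpha p0 p1 : R) (y : YZE) : Prop :=
  inCa2 alpha p0 p1 (y1 y) /\ inCa2 alpha p1 0 (y2 y) /\ inCa1 alpha (yz y).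

(* equality of elements (functions are only relevant on their domains) *)
Definition Xeq (p0 p1 : R) (x x' : XE) : Prop :=
  (forall q p, p0 <= p <= p1 -> xv x q p = xv x' q p) /\
  (forall q p, p1 <= p <= 0 -> xV x q p = xV x' q p).

Definition YZeq (p0 p1 : R) (y y' : YZE) : Prop :=
  (forall q p, p0 <= p <= p1 -> y1 y q p = y1 y' q p) /\
  (forall q p, p1 <= p <= 0 -> y2 y q p = y2 y' q p) /\
  (forall q, yz y q = yz y' q).

Definition LT (g sigma g1 g2 alpha p0 p1 lam : R) (x : XE) (y : YZE) : Prop :=
  exists dv dV, IsC2a alpha p0 p1 (xv x) dv /\ IsC2a alpha p1 0 (xV x) dV /\
    (forall q p, p0 <= p <= p1 ->
       y1 y q p = dpp dv q p + dqq dv q p / (aa lam g1 g2 p1 p) ^ 2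
                  - 3 * g1 * dp dv q p / (aa lam g1 g2 p1 p) ^ 2) /\
    (forall q p, p1 <= p <= 0 ->
       y2 y q p = dpp dV q p + dqq dV q p / (aa lam g1 g2 p1 p) ^ 2
                  - 3 * g2 * dp dV q p / (aa lam g1 g2 p1 p) ^ 2) /\
    (forall q, yz y q = 2 / lam *
       (g * xV x q 0 - lam * sqrt lam * dp dV q 0 - sigma * dqq dV q 0)).

Fixpoint lc2 (n : nat) (c : nat -> R) (f : nat -> R -> R -> R) : R -> R -> R :=
  match n with
  | O => fun _ _ => 0
  | S m => fun q p => lc2 m c f q p + c m * f m q p
  end.
Fixpoint lc1 (n : nat) (c : nat -> R) (f : nat -> R -> R) : R -> R :=
  match n with
  | O => fun _ => 0
  | S m => fun q => lc1 m c f q + c m * f m q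
  end.

Definition Xlc (n : nat) (c : nat -> R) (e : nat -> XE) : XE :=
  mkXE (lc2 n c (fun i => xv (e i))) (lc2 n c (fun i => xV (e i))).
Definition YZlc (n : nat) (c : nat -> R) (f : nat -> YZE) : YZE :=
  mkYZE (lc2 n c (fun i => y1 (f i))) (lc2 n c (fun i => y2 (f i)))
        (lc1 n c (fun i => yz (f i))).
Definition YZadd (y y' : YZE) : YZE :=
  mkYZE (fun q p => y1 y q p + y1 y' q p) (fun q p => y2 y q p + y2 y' q p)
        (fun q => yz y q + yz y' q).
Definition X0 : XE := mkXE (fun _ _ => 0) (fun _ _ => 0).
Definition YZ0 : YZE := mkYZE (fun _ _ => 0) (fun _ _ => 0) (fun _ => 0).

Definition ker_dim (g sigma g1 g2 alpha p0 p1 lam : R) (n : nat) : Prop :=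
  exists e : nat -> XE,
    (forall i, (i < n)%nat ->
       inX alpha p0 p1 (e i) /\ LT g sigma g1 g2 alpha p0 p1 lam (e i) YZ0) /\
    (forall x, inX alpha p0 p1 x -> LT g sigma g1 g2 alpha p0 p1 lam x YZ0 ->
       exists c, Xeq p0 p1 x (Xlc n c e)) /\
    (forall c, Xeq p0 p1 (Xlc n c e) X0 -> forall i, (i < n)%nat -> c i = 0).

(* codim range (L,T) = n : f_0..f_{n-1} span an algebraic complement of
   the range in Y x Z (direct sum). *)
Definition coker_dim (g sigma g1 g2 alpha p0 p1 lam : R) (n : nat) : Prop :=
  exists f : nat -> YZE,
    (forall i, (i < n)%nat -> inYZ alpha p0 p1 (f i)) /\
    (forall y, inYZ alpha p0 p1 y ->
       exists x w c, inX alpha p0 p1 x /\ LT g sigma g1 g2 alpha p0 p1 lam x w /\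
         YZeq p0 p1 y (YZadd w (YZlc n c f))) /\
    (forall x w c, inX alpha p0 p1 x -> LT g sigma g1 g2 alpha p0 p1 lam x w ->
       YZeq p0 p1 (YZadd w (YZlc n c f)) YZ0 -> forall i, (i < n)%nat -> c i = 0).

Definition fredholm_index0 (g sigma g1 g2 alpha p0 p1 lam : R) : Prop :=
  exists n : nat, ker_dim g sigma g1 g2 alpha p0 p1 lam n /\
                  coker_dim g sigma g1 g2 alpha p0 p1 lam n.

(* Main.v *)
(** In each layer the substitution [ds = dp / a], [w = a v] turns [L] into the flat Laplacian, so
    the problem becomes a transmission problem for [w_ss + w_qq = F] with a Wentzell condition at
    the top, which decouples into Fourier modes in [q].  Mode [k] has, up to a factor, one
    homogeneous solution satisfying the bottom and interface conditions; let [t_k] be its value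
    under the top boundary operator.

    At high frequency the mode problem is solved by Duhamel integrals plus three decaying
    exponentials, whose amplitudes solve a linear system that is a small perturbation of the
    identity because [sigma k^2] dominates the top condition.  Hoelder bounds for the resulting
    Fourier series use that a function is [C^b] iff the gradient of its Poisson extension at
    height [d] is [O(d^(b-1))]; they are uniform over Fejer means and pass to the limit.  In
    particular [t_k <> 0] for large [k], and every low mode with [t_k <> 0] is an invertible
    two-point problem.  The finitely many pairs ([k], cosine or sine) with [t_k = 0] contribute
    one kernel element each, and one cokernel element each, namely the trigonometric function at
    the top boundary; hence the index is zero. *)
Require Import Defs.
From Stdlib Require Import Reals Lra Lia Psatz Arith List IndefiniteDescription.
From Coquelicot Require Import Coquelicot.
Open Scope R_scope.

(** Every estimate has to be uniform in the number of modes: summing absolute values of coefficients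
    loses too much, and conjugation is not bounded on sup norms. Hence the unknowns at high
    frequency are [k^2 w] and [k w_s], of the same order as the data, and all bounds are operator
    bounds on trigonometric polynomials, free of the degree. Fejer means of a Hoelder function stay
    bounded in [C^al] but need not converge there; they are Cauchy in [C^(al/2)], which produces the
    limits, while the [al] bound survives pointwise. The flattening is exact because
    [a a_p = - gamma] in each layer; the jump of the vorticity survives only in the interface
    condition [w_s(lower) - w_s(upper) = kap w]. For the index, solvability up to a correction at
    the top alone shows that range and listed functions span. Conversely, an arbitrary classical
    solution is controlled one Fourier coefficient at a time: each solves an ordinary differential
    equation, so with zero interior data its top value is a multiple of [t_k]. This one fact serves
    both the kernel and the directness of the complement. *)

(** * Finite sums *)

Fixpoint rsum (n : nat) (f : nat -> R) : R :=
  match n with O => 0 | S m => rsum m f + f m end.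

Lemma rsum_ext n f g : (forall k, (k < n)%nat -> f k = g k) -> rsum n f = rsum n g.
Proof.
  induction n as [|n IH]; simpl; intros H; [reflexivity|].
  rewrite IH by (intros; apply H; lia). rewrite H by lia. reflexivity.
Qed.

Lemma rsum_plus n f g : rsum n (fun k => f k + g k) = rsum n f + rsum n g.
Proof. induction n as [|n IH]; simpl; [ring|]. rewrite IH; ring. Qed.

Lemma rsum_scal n c f : rsum n (fun k => c * f k) = c * rsum n f.
Proof. induction n as [|n IH]; simpl; [ring|]. rewrite IH; ring. Qed.

Lemma rsum_0 n f : (forall k, (k < n)%nat -> f k = 0) -> rsum n f = 0.
Proof.
  intros H. rewrite (rsum_ext n f (fun _ => 0 * 0)).
  - rewrite (rsum_scal n 0 (fun _ => 0)). ring.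
  - intros k Hk. rewrite H by exact Hk. ring.
Qed.

Lemma rsum_le n f g : (forall k, (k < n)%nat -> f k <= g k) -> rsum n f <= rsum n g.
Proof.
  induction n as [|n IH]; simpl; intros H; [lra|].
  assert (rsum n f <= rsum n g) by (apply IH; intros; apply H; lia).
  assert (f n <= g n) by (apply H; lia). lra.
Qed.

Lemma rsum_abs n f : Rabs (rsum n f) <= rsum n (fun k => Rabs (f k)).
Proof.
  induction n as [|n IH]; simpl; [rewrite Rabs_R0; lra|].
  eapply Rle_trans; [apply Rabs_triang|]. lra.
Qed.

Lemma rsum_single n j f : (j < n)%nat ->
  (forall k, (k < n)%nat -> k <> j -> f k = 0) -> rsum n f = f j.
Proof.
  induction n as [|n IH]; intros Hj H; [lia|]. simpl.
  destruct (Nat.eq_dec j n) as [->|E].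
  - rewrite rsum_0; [ring|]. intros; apply H; lia.
  - rewrite IH; [|lia|intros; apply H; lia]. rewrite (H n) by lia. ring.
Qed.

Lemma rsum_le_ext n m f : (n <= m)%nat ->
  (forall k, (n <= k < m)%nat -> f k = 0) -> rsum m f = rsum n f.
Proof.
  induction 1 as [|m Hm IH]; intros H; [reflexivity|].
  simpl. rewrite IH by (intros; apply H; lia). rewrite H by lia. ring.
Qed.

Lemma is_derive_rsum n (f : nat -> R -> R) (df : nat -> R) x :
  (forall k, (k < n)%nat -> is_derive (f k) x (df k)) ->
  is_derive (fun y => rsum n (fun k => f k y)) x (rsum n df).
Proof.
  induction n as [|n IH]; intros H; simpl.
  - apply @is_derive_const.
  - apply (is_derive_plus (fun y => rsum n (fun k => f k y)) (f n) x).
    + apply IH; intros; apply H; lia.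
    + apply H; lia.
Qed.

Lemma continuous_rsum n (f : nat -> R -> R) x :
  (forall k, (k < n)%nat -> continuous (f k) x) ->
  continuous (fun y => rsum n (fun k => f k y)) x.
Proof.
  induction n as [|n IH]; intros H; simpl.
  - apply continuous_const.
  - apply (continuous_plus (fun y => rsum n (fun k => f k y)) (f n)).
    + apply IH; intros; apply H; lia.
    + apply H; lia.
Qed.

(** * Riemann integrals and rules of differentiation *)

Definition RI (f : R -> R) (a b l : R) : Prop := @is_RInt R_NormedModule f a b l.

Lemma RI_ext f g a b l : (forall x, f x = g x) -> RI f a b l -> RI g a b l.
Proof. intros H; apply is_RInt_ext; intros; apply H. Qed.

Lemma RI_ext_in f g a b l : a <= b -> (forall x, a < x < b -> f x = g x) ->
  RI f a b l -> RI g a b l.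
Proof.
  intros Hab H; apply is_RInt_ext. rewrite Rmin_left, Rmax_right by exact Hab. exact H.
Qed.

Lemma RI_plus f g a b l m : RI f a b l -> RI g a b m -> RI (fun x => f x + g x) a b (l + m).
Proof. intros; apply (is_RInt_plus f g); assumption. Qed.

Lemma RI_minus f g a b l m : RI f a b l -> RI g a b m -> RI (fun x => f x - g x) a b (l - m).
Proof. intros; apply (is_RInt_minus f g); assumption. Qed.

Lemma RI_scal c f a b l : RI f a b l -> RI (fun x => c * f x) a b (c * l).
Proof. intros; apply (is_RInt_scal f); assumption. Qed.

Lemma RI_const c a b : RI (fun _ => c) a b ((b - a) * c).
Proof. apply (is_RInt_const a b c). Qed.

Lemma RI_unique f a b l m : RI f a b l -> RI f a b m -> l = m.
Proof.
  intros H1 H2. rewrite <- (is_RInt_unique _ _ _ _ H1). exact (is_RInt_unique _ _ _ _ H2).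
Qed.

Lemma RI_chasles f a b c l m : RI f a b l -> RI f b c m -> RI f a c (l + m).
Proof. intros; apply (is_RInt_Chasles f a b c); assumption. Qed.

Lemma RI_le f g a b l m : a <= b -> (forall x, a < x < b -> f x <= g x) ->
  RI f a b l -> RI g a b m -> l <= m.
Proof. intros Hab H Hf Hg. exact (is_RInt_le f g a b l m Hab Hf Hg H). Qed.

Lemma RI_abs_le f g a b l m : a <= b -> (forall x, a < x < b -> Rabs (f x) <= g x) ->
  RI f a b l -> RI g a b m -> Rabs l <= m.
Proof.
  intros Hab H Hf Hg. apply Rabs_le. split.
  - assert (HN : -1 * m <= l).
    { apply (RI_le (fun x => -1 * g x) f a b); auto using RI_scal.
      intros x Hx. specialize (H x Hx). apply Rabs_le_between in H. lra. }
    lra.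
  - apply (RI_le f g a b); auto. intros x Hx. specialize (H x Hx).
    apply Rabs_le_between in H. lra.
Qed.

Lemma RI_rsum n (f : nat -> R -> R) (l : nat -> R) a b :
  (forall k, (k < n)%nat -> RI (f k) a b (l k)) ->
  RI (fun x => rsum n (fun k => f k x)) a b (rsum n l).
Proof.
  induction n as [|n IH]; intros H; simpl.
  - pose proof (RI_const 0 a b) as E. rewrite Rmult_0_r in E. exact E.
  - apply RI_plus; [apply IH; intros|]; apply H; lia.
Qed.

Lemma RI_derive (f df : R -> R) (a b : R) : a <= b ->
  (forall x, a <= x <= b -> is_derive f x (df x)) ->
  (forall x, a <= x <= b -> continuous df x) -> RI df a b (f b - f a).
Proof.
  intros Hab H1 H2. apply (is_RInt_derive f df);
  rewrite Rmin_left, Rmax_right by exact Hab; assumption.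
Qed.

Definition integral (f : R -> R) (a b : R) : R := @RInt R_CompleteNormedModule f a b.

Lemma integral_unique f a b l : RI f a b l -> integral f a b = l.
Proof. exact (@is_RInt_unique R_CompleteNormedModule f a b l). Qed.

Lemma RI_continuous (f : R -> R) (a b : R) : (forall x, continuous f x) -> RI f a b (integral f a b).
Proof.
  intros H. apply (@RInt_correct R_CompleteNormedModule).
  apply (@ex_RInt_continuous R_CompleteNormedModule). auto.
Qed.

Lemma derive_cont (f : R -> R) (x l : R) : is_derive f x l -> continuous f x.
Proof. intros H. apply @ex_derive_continuous. exists l; exact H. Qed.

Lemma continuous_pt (f : R -> R) x : continuous f x <-> continuity_pt f x.
Proof. symmetry. apply continuity_pt_filterlim. Qed.

Lemma cont_plus (f g : R -> R) x : continuous f x -> continuous g x -> continuous (fun y => f y + g y) x.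
Proof. apply @continuous_plus. Qed.
Lemma cont_mult (f g : R -> R) x : continuous f x -> continuous g x -> continuous (fun y => f y * g y) x.
Proof. apply @continuous_mult. Qed.
Lemma cont_minus (f g : R -> R) x : continuous f x -> continuous g x -> continuous (fun y => f y - g y) x.
Proof. apply @continuous_minus. Qed.

Lemma D_plus (f g : R -> R) (x l m : R) : is_derive f x l -> is_derive g x m ->
  is_derive (fun y => f y + g y) x (l + m).
Proof. exact (@is_derive_plus R_AbsRing R_NormedModule f g x l m). Qed.

Lemma D_minus (f g : R -> R) (x l m : R) : is_derive f x l -> is_derive g x m ->
  is_derive (fun y => f y - g y) x (l - m).
Proof. exact (@is_derive_minus R_AbsRing R_NormedModule f g x l m). Qed.

Lemma D_scal (f : R -> R) (c x l : R) : is_derive f x l -> is_derive (fun y => c * f y) x (c * l).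
Proof. exact (is_derive_scal f x c l). Qed.

Lemma D_scal_r (f : R -> R) (c x l : R) : is_derive f x l -> is_derive (fun y => f y * c) x (l * c).
Proof. exact (is_derive_scal_l f x l c). Qed.

Lemma D_mult (f g : R -> R) (x l m : R) : is_derive f x l -> is_derive g x m ->
  is_derive (fun y => f y * g y) x (l * g x + f x * m).
Proof. intros Hf Hg. exact (is_derive_mult f g x l m Hf Hg Rmult_comm). Qed.

Lemma D_comp (f g : R -> R) (x l m : R) : is_derive f (g x) l -> is_derive g x m ->
  is_derive (fun y => f (g y)) x (m * l).
Proof. exact (is_derive_comp f g x l m). Qed.

Lemma D_ext (f g : R -> R) (x l : R) : (forall y, f y = g y) -> is_derive f x l -> is_derive g x l.
Proof. exact (is_derive_ext f g x l). Qed.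

Lemma D_eq (f : R -> R) (x l m : R) : l = m -> is_derive f x l -> is_derive f x m.
Proof. intros ->; exact (fun H => H). Qed.

Lemma D_const (c x : R) : is_derive (fun _ : R => c) x 0.
Proof. exact (@is_derive_const R_AbsRing R_NormedModule c x). Qed.

(** * Mean value inequalities *)

Lemma increasing_derive (f df : R -> R) (a b : R) : a <= b ->
  (forall x, a < x < b -> is_derive f x (df x)) ->
  (forall x, a <= x <= b -> continuous f x) ->
  (forall x, a < x < b -> 0 <= df x) -> f a <= f b.
Proof.
  intros Hab H1 H2 H3.
  (* [MVT_gen] places [c] only in the closed interval, while the sign of [df] is known in the open
     one; the derivative is therefore replaced by 0 at the end points. *)
  destruct (MVT_gen f a b (fun x => if Rlt_dec a x then if Rlt_dec x b then df x else 0 else 0))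
    as [c [Hc E]].
  - rewrite Rmin_left, Rmax_right by exact Hab. intros x Hx.
    destruct (Rlt_dec a x); [|lra]. destruct (Rlt_dec x b); [|lra]. apply H1; lra.
  - rewrite Rmin_left, Rmax_right by exact Hab. intros x Hx. apply continuous_pt, H2, Hx.
  - assert (0 <= f b - f a); [|lra]. rewrite E. apply Rmult_le_pos; [|lra].
    destruct (Rlt_dec a c); [|lra]. destruct (Rlt_dec c b); [|lra]. apply H3; lra.
Qed.

(** Monotonicity of [g + f] and of [g - f]. Derivatives are required in the open interval only,
    because the majorant used later, a multiple of [d^b] with [b < 1], has infinite slope at 0. *)
Lemma compare_derive (f g df dg : R -> R) (a b : R) : a <= b ->
  (forall x, a < x < b -> is_derive f x (df x)) ->
  (forall x, a < x < b -> is_derive g x (dg x)) ->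
  (forall x, a <= x <= b -> continuous f x) ->
  (forall x, a <= x <= b -> continuous g x) ->
  (forall x, a < x < b -> Rabs (df x) <= dg x) -> Rabs (f b - f a) <= g b - g a.
Proof.
  intros Hab Hf Hg Cf Cg H. apply Rabs_le. split.
  - assert (g a + f a <= g b + f b); [|lra].
    apply (increasing_derive (fun x => g x + f x) (fun x => dg x + df x)); auto.
    + intros x Hx. apply (is_derive_plus g f); auto.
    + intros x Hx. apply cont_plus; auto.
    + intros x Hx. specialize (H x Hx). apply Rabs_le_between in H. lra.
  - assert (g a - f a <= g b - f b); [|lra].
    apply (increasing_derive (fun x => g x - f x) (fun x => dg x - df x)); auto.
    + intros x Hx. apply (is_derive_minus g f); auto.
    + intros x Hx. apply cont_minus; auto.
    + intros x Hx. specialize (H x Hx). apply Rabs_le_between in H. lra.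
Qed.

Lemma is_derive_linear c x : is_derive (fun y => c * y) x c.
Proof. auto_derive; [exact I|ring]. Qed.

Lemma lipschitz_derive (f df : R -> R) (M a b : R) : a <= b ->
  (forall x, a < x < b -> is_derive f x (df x)) ->
  (forall x, a <= x <= b -> continuous f x) ->
  (forall x, a < x < b -> Rabs (df x) <= M) -> Rabs (f b - f a) <= M * (b - a).
Proof.
  intros Hab H1 H2 H3. replace (M * (b - a)) with (M * b - M * a) by ring.
  apply (compare_derive f (fun x => M * x) df (fun _ => M)); auto.
  - intros; apply is_derive_linear.
  - intros x _. apply (derive_cont _ _ _ (is_derive_linear M x)).
Qed.

Lemma lipschitz_derive_R (f df : R -> R) (M a b : R) :
  (forall x, is_derive f x (df x)) -> (forall x, Rabs (df x) <= M) ->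
  Rabs (f b - f a) <= M * Rabs (b - a).
Proof.
  intros H1 H2. assert (C : forall x, continuous f x) by (intros x; exact (derive_cont _ _ _ (H1 x))).
  destruct (Rle_dec a b).
  - rewrite (Rabs_right (b - a)) by lra. apply (lipschitz_derive f df); auto.
  - rewrite Rabs_minus_sym, (Rabs_minus_sym b), (Rabs_right (a - b)) by lra.
    apply (lipschitz_derive f df); auto; lra.
Qed.

(* [Rpower 0 b = 1] in Rocq, hence the explicit value at [0]. *)
Definition pw (b x : R) : R := if Rle_dec x 0 then 0 else Rpower x b.

(** * Powers as moduli of continuity *)

Lemma pw_Rpower b x : 0 < x -> pw b x = Rpower x b.
Proof. intros H; unfold pw. destruct (Rle_dec x 0); [lra|reflexivity]. Qed.

Lemma pw_0 b x : x <= 0 -> pw b x = 0.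
Proof. intros H; unfold pw. destruct (Rle_dec x 0); [reflexivity|lra]. Qed.

Lemma pw_nonneg b x : 0 <= pw b x.
Proof. unfold pw. destruct (Rle_dec x 0); [lra|]. left; apply exp_pos. Qed.

Lemma Rpower_pos x b : 0 < Rpower x b.
Proof. apply exp_pos. Qed.

Lemma pw_le b x y : 0 <= b -> x <= y -> pw b x <= pw b y.
Proof.
  intros Hb H. unfold pw. destruct (Rle_dec x 0), (Rle_dec y 0); try lra.
  - left; apply exp_pos.
  - apply Rle_Rpower_l; lra.
Qed.

Lemma pw_mult b x y : 0 <= x -> 0 <= y -> pw b (x * y) = pw b x * pw b y.
Proof.
  intros Hx Hy. destruct (Req_dec x 0) as [->|Nx]; [rewrite Rmult_0_l, (pw_0 b 0) by lra; ring|].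
  destruct (Req_dec y 0) as [->|Ny]; [rewrite Rmult_0_r, (pw_0 b 0) by lra; ring|].
  assert (0 < x) by lra; assert (0 < y) by lra.
  rewrite !pw_Rpower by (auto; apply Rmult_lt_0_compat; auto).
  symmetry; apply Rpower_mult_distr; auto.
Qed.

Lemma Rpower_ge_id b x : 0 <= b <= 1 -> 0 < x <= 1 -> x <= Rpower x b.
Proof.
  intros Hb Hx. rewrite <- (Rpower_1 x) at 1 by lra. unfold Rpower.
  assert (L : ln x <= 0). { rewrite <- ln_1. apply ln_le; lra. }
  destruct (Req_dec (1 * ln x) (b * ln x)) as [->|N]; [lra|]. left. apply exp_increasing. nra.
Qed.

Lemma pw_ge_id b x : 0 <= b <= 1 -> 0 <= x <= 1 -> x <= pw b x.
Proof.
  intros Hb Hx. destruct (Req_dec x 0) as [->|N]; [apply pw_nonneg|].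
  rewrite pw_Rpower by lra. apply Rpower_ge_id; lra.
Qed.

Lemma pw_ge_1 b x : 0 <= b -> 1 <= x -> 1 <= pw b x.
Proof.
  intros Hb Hx. rewrite pw_Rpower by lra. unfold Rpower. rewrite <- exp_0 at 1.
  assert (0 <= ln x) by (rewrite <- ln_1; apply ln_le; lra).
  destruct (Req_dec 0 (b * ln x)) as [<-|N]; [lra|].
  left. apply exp_increasing. nra.
Qed.

Lemma pw_pow2 b x : 0 <= x -> pw (b / 2) x * pw (b / 2) x = pw b x.
Proof.
  intros Hx. destruct (Req_dec x 0) as [->|N]; [rewrite !pw_0 by lra; ring|].
  rewrite !pw_Rpower by lra. rewrite <- Rpower_plus. f_equal; lra.
Qed.

(** For [d <= 1] the Lipschitz bound suffices since [d <= d^b]; for [d > 1] the sup bound does since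
    [1 <= d^b]. *)
Lemma lip_pw b L B d D : 0 <= b <= 1 -> 0 <= L -> 0 <= d -> D <= L * d -> D <= B ->
  D <= (L + Rabs B) * pw b d.
Proof.
  intros Hb HL Hd H1 H2. pose proof (pw_nonneg b d). pose proof (Rabs_pos B).
  pose proof (Rle_abs B).
  destruct (Rle_dec d 1).
  - assert (d <= pw b d) by (apply pw_ge_id; lra). nra.
  - assert (1 <= pw b d) by (apply pw_ge_1; lra). nra.
Qed.

Lemma is_derive_Rpower_l b x : 0 < x -> is_derive (fun y => Rpower y b) x (b * Rpower x (b - 1)).
Proof. intros H. apply is_derive_Reals. apply derivable_pt_lim_power. exact H. Qed.

Lemma pw_small b eps : 0 < b -> 0 < eps -> exists d, 0 < d /\ forall x, x < d -> pw b x < eps.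
Proof.
  intros Hb He. exists (Rpower eps (/ b)). split; [apply exp_pos|].
  intros x Hx. unfold pw. destruct (Rle_dec x 0); [exact He|].
  replace eps with (Rpower (Rpower eps (/ b)) b).
  - unfold Rpower at 1 2. apply exp_increasing. apply Rmult_lt_compat_l; [exact Hb|].
    apply ln_increasing; lra.
  - rewrite Rpower_mult, Rinv_l by lra. apply Rpower_1. exact He.
Qed.

Lemma pw_continuous b x : 0 < b -> continuous (pw b) x.
Proof.
  intros Hb. destruct (Rtotal_order x 0) as [H|[->|H]].
  - apply (continuous_ext_loc _ (fun _ => 0)); [|apply continuous_const].
    exists (mkposreal (- x) ltac:(lra)). intros y Hy. symmetry; apply pw_0.
    change (Rabs (y - x) < - x) in Hy. apply Rabs_lt_between in Hy. lra.
  - apply continuous_pt. intros eps He. destruct (pw_small b eps Hb He) as [d [Hd H]].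
    exists d; split; [exact Hd|]. intros y [_ Hy].
    change (Rabs (y - 0) < d) in Hy. change (Rabs (pw b y - pw b 0) < eps).
    rewrite (pw_0 b 0), Rminus_0_r, Rabs_right by (try apply Rle_ge; try apply pw_nonneg; lra).
    apply H. rewrite Rminus_0_r in Hy. pose proof (Rle_abs y); lra.
  - apply (continuous_ext_loc _ (fun y => Rpower y b)).
    + exists (mkposreal x H). intros y Hy. symmetry; apply pw_Rpower.
      change (Rabs (y - x) < x) in Hy. apply Rabs_lt_between in Hy. lra.
    + exact (derive_cont _ _ _ (is_derive_Rpower_l b x H)).
Qed.

Lemma is_derive_pw b x : 0 < x -> is_derive (pw b) x (b * Rpower x (b - 1)).
Proof.
  intros H. apply (is_derive_ext_loc (fun y => Rpower y b)).
  - exists (mkposreal x H). intros y Hy. symmetry; apply pw_Rpower.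
    change (Rabs (y - x) < x) in Hy. apply Rabs_lt_between in Hy. lra.
  - apply is_derive_Rpower_l; exact H.
Qed.

Lemma Rpower_decr b x y : b <= 0 -> 0 < x <= y -> Rpower y b <= Rpower x b.
Proof.
  intros Hb H. unfold Rpower. assert (ln x <= ln y) by (apply ln_le; lra).
  destruct (Req_dec (b * ln y) (b * ln x)) as [->|N]; [lra|]. left. apply exp_increasing. nra.
Qed.

(** The boundary term at [L] has a favourable sign and is dropped, so the bound does not depend on
    [L]. Trading the power [b - 2] for [b - 1] is how the Duhamel integrals gain a derivative. *)
Lemma RI_shift_power b x L : b < 1 -> 0 < x -> 0 <= L ->
  exists l, RI (fun t => Rpower (t + x) (b - 2)) 0 L l /\ 0 <= l <= Rpower x (b - 1) / (1 - b).
Proof.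
  intros Hb Hx HL.
  exists (Rpower (L + x) (b - 1) / (b - 1) - Rpower (0 + x) (b - 1) / (b - 1)).
  split.
  - apply (RI_derive (fun t => Rpower (t + x) (b - 1) / (b - 1))); [exact HL| |].
    + intros t Ht.
      replace (Rpower (t + x) (b - 2)) with (1 * ((b - 1) * Rpower (t + x) (b - 1 - 1)) * / (b - 1)).
      2:{ replace (b - 1 - 1) with (b - 2) by ring. field; lra. }
      apply (is_derive_scal_l (fun t => Rpower (t + x) (b - 1)) t _ (/ (b - 1))).
      apply (is_derive_comp (fun y => Rpower y (b - 1)) (fun t => t + x)).
      * apply is_derive_Rpower_l; lra.
      * auto_derive; [exact I|ring].
    + intros t Ht. apply (derive_cont _ _ (1 * ((b - 2) * Rpower (t + x) (b - 2 - 1)))).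
      apply (is_derive_comp (fun y => Rpower y (b - 2)) (fun t => t + x)).
      * apply is_derive_Rpower_l; lra.
      * auto_derive; [exact I|ring].
  - rewrite Rplus_0_l. pose proof (Rpower_pos (L + x) (b - 1)).
    assert (Rpower (L + x) (b - 1) <= Rpower x (b - 1)) by (apply Rpower_decr; lra).
    replace (Rpower (L + x) (b - 1) / (b - 1) - Rpower x (b - 1) / (b - 1))
      with ((Rpower x (b - 1) - Rpower (L + x) (b - 1)) / (1 - b)) by (field; lra).
    assert (0 < / (1 - b)) by (apply Rinv_0_lt_compat; lra).
    unfold Rdiv. split.
    + apply Rmult_le_pos; lra.
    + apply Rmult_le_compat_r; lra.
Qed.

(** * Trigonometric polynomials and the Poisson kernel *)

(** [true] labels cosines and [false] sines; the entry at [false, 0] multiplies the zero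
    function. *)
Definition coef : Type := bool -> nat -> R.

Definition trig (n : nat) (c : coef) (q : R) : R :=
  rsum n (fun k => c true k * cos (INR k * q) + c false k * sin (INR k * q)).
Definition mul (m : nat -> R) (c : coef) : coef := fun i k => m k * c i k.
Definition cadd (c d : coef) : coef := fun i k => c i k + d i k.
(** Up to sign the conjugate function (periodic Hilbert transform), normalised so that the
    derivative in [q] is [mul INR (conj c)]. *)
Definition conj (c : coef) : coef := fun i k => if i then c false k else - c true k.
Definition shift (h : R) (c : coef) : coef := fun i k =>
  if i then c true k * cos (INR k * h) + c false k * sin (INR k * h)
  else c false k * cos (INR k * h) - c true k * sin (INR k * h).

Lemma trig_ext n c d q : (forall i k, (k < n)%nat -> c i k = d i k) -> trig n c q = trig n d q.
Proof. intros H. apply rsum_ext. intros k Hk. rewrite !H by exact Hk. reflexivity. Qed.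

Lemma trig_add n c d q : trig n (cadd c d) q = trig n c q + trig n d q.
Proof.
  unfold trig. rewrite <- rsum_plus. apply rsum_ext. intros; unfold cadd; ring.
Qed.

Lemma trig_scal n r c q : trig n (mul (fun _ => r) c) q = r * trig n c q.
Proof. unfold trig. rewrite <- rsum_scal. apply rsum_ext. intros; unfold mul; ring. Qed.

Lemma trig_shift n h c q : trig n (shift h c) q = trig n c (q + h).
Proof.
  unfold trig. apply rsum_ext. intros k _. unfold shift.
  rewrite Rmult_plus_distr_l, cos_plus, sin_plus. ring.
Qed.

Lemma is_derive_trig n c q : is_derive (trig n c) q (trig n (mul INR (conj c)) q).
Proof.
  unfold trig. apply is_derive_rsum. intros k _. unfold mul, conj.
  auto_derive; [exact I|]. ring.
Qed.

Lemma trig_continuous n c q : continuous (trig n c) q.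
Proof. exact (derive_cont _ _ _ (is_derive_trig n c q)). Qed.

Lemma trig_periodic n c q : trig n c (q + 2 * PI) = trig n c q.
Proof.
  unfold trig. apply rsum_ext. intros k _.
  replace (INR k * (q + 2 * PI)) with (INR k * q + 2 * INR k * PI) by ring.
  rewrite cos_period, sin_period. reflexivity.
Qed.

Lemma sin_INR_PI k : sin (INR k * PI) = 0.
Proof. apply sin_eq_0_1. exists (Z.of_nat k). rewrite INR_IZR_INZ. reflexivity. Qed.

Lemma RI_cos k : RI (fun y => cos (INR k * y)) (- PI) PI (if Nat.eq_dec k 0 then 2 * PI else 0).
Proof.
  pose proof PI_RGT_0. destruct (Nat.eq_dec k 0) as [->|N].
  - replace (2 * PI) with ((PI - - PI) * 1) by ring.
    apply (RI_ext (fun _ => 1)); [|apply RI_const].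
    intros y. simpl INR. rewrite Rmult_0_l, cos_0. reflexivity.
  - assert (INR k <> 0) by (apply not_0_INR; exact N).
    replace 0 with (sin (INR k * PI) / INR k - sin (INR k * - PI) / INR k).
    + apply (RI_derive (fun y => sin (INR k * y) / INR k)); [lra| |].
      * intros y _. auto_derive; [auto|field; assumption].
      * intros y _. apply @ex_derive_continuous. auto_derive. exact I.
    + replace (INR k * - PI) with (- (INR k * PI)) by ring.
      rewrite sin_neg, sin_INR_PI. field; assumption.
Qed.

Lemma RI_odd f a l : (forall x, f (- x) = - f x) -> RI f (- a) a l -> l = 0.
Proof.
  intros Ho H.
  assert (H1 : RI f a (- a) l).
  { apply (RI_ext (fun y => - f (- y))).
    - intros y. rewrite Ho. ring.
    - apply (@is_RInt_comp_opp R_NormedModule f a (- a) l). rewrite Ropp_involutive. exact H. }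
  assert (H2 : RI f a (- a) (- l)) by exact (@is_RInt_swap R_NormedModule f _ _ _ H).
  pose proof (RI_unique _ _ _ _ _ H1 H2). lra.
Qed.

Lemma bounded_geometric r d B : 1 < r -> (forall k : nat, Rabs (r ^ k * d) <= B) -> d = 0.
Proof.
  intros Hr H. destruct (Req_dec d 0) as [E|N]; [exact E|exfalso].
  assert (Hd : 0 < Rabs d) by (apply Rabs_pos_lt; exact N).
  assert (Ha : Rabs r > 1) by (rewrite Rabs_right; lra).
  destruct (Pow_x_infinity r Ha ((B + 1) / Rabs d)) as [k Hk].
  specialize (Hk k (le_n k)). specialize (H k). rewrite Rabs_mult in H.
  assert ((B + 1) / Rabs d * Rabs d <= Rabs (r ^ k) * Rabs d) by (apply Rmult_le_compat_r; lra).
  unfold Rdiv in H0. rewrite Rmult_assoc, Rinv_l in H0 by lra. lra.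
Qed.

Lemma exp_mult_opp x : exp x * exp (- x) = 1.
Proof. rewrite <- exp_plus, Rplus_opp_r. apply exp_0. Qed.

Lemma sinh_ge x : 0 <= x -> x <= sinh x.
Proof.
  intros Hx. destruct (Req_dec x 0) as [->|N]; [rewrite sinh_0; lra|].
  assert (sinh 0 - 0 <= sinh x - x).
  { apply (increasing_derive (fun y => sinh y - y) (fun y => cosh y - 1)); [lra| | |].
    - intros y _. apply is_derive_Reals. apply derivable_pt_lim_minus;
      [apply derivable_pt_lim_sinh|apply derivable_pt_lim_id].
    - intros y _. apply (derive_cont _ _ (cosh y - 1)). apply is_derive_Reals. apply derivable_pt_lim_minus;
      [apply derivable_pt_lim_sinh|apply derivable_pt_lim_id].
    - intros y _. unfold cosh. pose proof (exp_pos y). pose proof (exp_pos (- y)).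
      pose proof (exp_mult_opp y). pose proof (Rle_0_sqr (exp y - exp (- y))) as S. unfold Rsqr in S.
      assert (2 <= exp y + exp (- y)) by nra. lra. }
  rewrite sinh_0 in *. lra.
Qed.

Lemma cosh_sinh_sqr x : cosh x * cosh x = 1 + sinh x * sinh x.
Proof.
  unfold cosh, sinh. assert (exp x * exp (- x) = 1) by apply exp_mult_opp. nra.
Qed.

Lemma cosh_minus_sinh x : cosh x - sinh x = exp (- x).
Proof. unfold cosh, sinh. field. Qed.

Lemma cosh_ge x : 0 <= x -> 1 + x * x / 2 <= cosh x.
Proof.
  intros Hx.
  assert (E : cosh x = 1 + 2 * (sinh (x / 2) * sinh (x / 2))).
  { unfold cosh, sinh. replace x with (x / 2 + x / 2) at 1 2 by field.
    rewrite Ropp_plus_distr, !exp_plus.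
    assert (exp (x / 2) * exp (- (x / 2)) = 1) by apply exp_mult_opp. nra. }
  pose proof (sinh_ge (x / 2) ltac:(lra)). rewrite E. nra.
Qed.

(** The characteristic roots are [exp x] and [exp (-x)]. The combination [E (S k) - exp (-x) E k]
    isolates the growing root; boundedness forces [sinh x * E 0 = 0], and then everything
    vanishes. *)
Lemma poisson_recursion (E : nat -> R) x B : 0 < x ->
  (forall k, E (S (S k)) = 2 * cosh x * E (S k) - E k) -> E 1%nat = cosh x * E 0%nat ->
  (forall k, Rabs (E k) <= B) -> forall k, E k = 0.
Proof.
  intros Hx Hrec H1 HB.
  assert (P : exp x * exp (- x) = 1) by apply exp_mult_opp.
  assert (D : forall k, E (S k) - exp (- x) * E k = exp x ^ k * (sinh x * E 0%nat)).
  { induction k as [|k IH].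
    - rewrite H1, <- cosh_minus_sinh. simpl. ring.
    - rewrite Hrec.
      replace (exp x ^ S k * (sinh x * E 0%nat)) with (exp x * (exp x ^ k * (sinh x * E 0%nat)))
        by (simpl; ring).
      rewrite <- IH.
      replace (2 * cosh x) with (exp x + exp (- x)) by (unfold cosh; field).
      transitivity (exp x * E (S k) - 1 * E k); [ring|rewrite <- P; ring]. }
  assert (Hd : sinh x * E 0%nat = 0).
  { apply (bounded_geometric (exp x) _ (2 * B)).
    - rewrite <- exp_0. apply exp_increasing. exact Hx.
    - intros k. rewrite <- D.
      assert (0 < exp (- x) < 1) by (split; [apply exp_pos|rewrite <- exp_0; apply exp_increasing; lra]).
      unfold Rminus. eapply Rle_trans; [apply Rabs_triang|]. rewrite Rabs_Ropp, Rabs_mult.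
      rewrite (Rabs_right (exp (- x))) by lra.
      pose proof (HB k); pose proof (HB (S k)); pose proof (Rabs_pos (E k)). nra. }
  assert (E0 : E 0%nat = 0).
  { pose proof (sinh_ge x ltac:(lra)). apply Rmult_integral in Hd. destruct Hd; [lra|assumption]. }
  induction k as [|k IH]; [exact E0|].
  specialize (D k). rewrite E0, IH in D. nra.
Qed.

(** * The Poisson kernel and its Fourier coefficients *)

(** With [r = exp (-x)], the product [sinh x * pker x y] is the classical kernel
    [(1 - r^2) / (1 - 2 r cos y + r^2)]. *)
Definition pker (x y : R) : R := / (cosh x - cos y).

Lemma pker_den x y : 0 < x -> 0 < cosh x - cos y.
Proof. intros Hx. pose proof (cosh_ge x ltac:(lra)). pose proof (COS_bound y). nra. Qed.

Lemma pker_pos x y : 0 < x -> 0 < pker x y.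
Proof. intros; apply Rinv_0_lt_compat, pker_den; assumption. Qed.

(* [poisson] is the Poisson kernel, [poisson_t] and [poisson_y] are minus its derivatives
   in [x] and [y]; both are bounded by [poisson / sinh x]. *)
Definition poisson (x y : R) : R := sinh x * pker x y.
Definition poisson_t (x y : R) : R := (cosh x * cos y - 1) * (pker x y * pker x y).
Definition poisson_y (x y : R) : R := sinh x * sin y * (pker x y * pker x y).

Lemma ex_derive_pker x y : 0 < x -> is_derive (pker x) y (- (sin y * (pker x y * pker x y))).
Proof.
  intros Hx. unfold pker. pose proof (pker_den x y Hx).
  auto_derive; [lra|]. field. lra.
Qed.

Lemma pker_cont x y : 0 < x -> continuous (pker x) y.
Proof. intros Hx. exact (derive_cont _ _ _ (ex_derive_pker x y Hx)). Qed.

Lemma cos_cont y : continuous cos y.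
Proof. apply @ex_derive_continuous. auto_derive. exact I. Qed.
Lemma sin_cont y : continuous sin y.
Proof. apply @ex_derive_continuous. auto_derive. exact I. Qed.
Lemma cosk_cont k y : continuous (fun y => cos (INR k * y)) y.
Proof. apply @ex_derive_continuous. auto_derive. exact I. Qed.
Lemma sink_cont k y : continuous (fun y => sin (INR k * y)) y.
Proof. apply @ex_derive_continuous. auto_derive. exact I. Qed.

Ltac solve_cont :=
  match goal with
  | |- continuous (fun y => ?c) _ => apply continuous_const
  | |- continuous (fun y => _ + _) _ => apply cont_plus; solve_cont
  | |- continuous (fun y => _ - _) _ => apply cont_minus; solve_cont
  | |- continuous (fun y => _ * _) _ => apply cont_mult; solve_cont
  | |- continuous (fun y => cos (INR _ * y)) _ => apply cosk_cont
  | |- continuous (fun y => sin (INR _ * y)) _ => apply sink_cont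
  | |- continuous cos _ => apply cos_cont
  | |- continuous sin _ => apply sin_cont
  | |- continuous (pker _) _ => apply pker_cont; assumption
  | |- continuous (fun y => cos y) _ => apply cos_cont
  | |- continuous (fun y => sin y) _ => apply sin_cont
  | |- continuous (fun y => pker _ y) _ => apply pker_cont; assumption
  | |- _ => idtac
  end.

Lemma poisson_cont x y : 0 < x -> continuous (poisson x) y.
Proof. intros Hx. unfold poisson. solve_cont. Qed.
Lemma poisson_t_cont x y : 0 < x -> continuous (poisson_t x) y.
Proof. intros Hx. unfold poisson_t. solve_cont. Qed.
Lemma poisson_y_cont x y : 0 < x -> continuous (poisson_y x) y.
Proof. intros Hx. unfold poisson_y. solve_cont. Qed.

(** One factor [pker] cancels because [(cosh x - cos y)^2 = (cosh x cos y - 1)^2 + (sinh x sin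
    y)^2]. The same identity serves for [poisson_y]. *)
Lemma poisson_t_le x y : 0 < x -> Rabs (poisson_t x y) <= pker x y.
Proof.
  intros Hx. pose proof (pker_den x y Hx) as D. pose proof (pker_pos x y Hx) as Q.
  unfold poisson_t. rewrite Rabs_mult, (Rabs_right (pker x y * pker x y)) by nra.
  rewrite <- Rmult_assoc. rewrite <- (Rmult_1_l (pker x y)) at 3.
  apply Rmult_le_compat_r; [lra|].
  assert (Rabs (cosh x * cos y - 1) <= cosh x - cos y).
  { pose proof (cosh_sinh_sqr x). pose proof (sin2_cos2 y) as S. unfold Rsqr in S.
    rewrite <- (Rabs_right (cosh x - cos y)) by lra. apply Rsqr_le_abs_0. unfold Rsqr.
    assert (0 <= (sinh x * sinh x) * (sin y * sin y)) by (apply Rmult_le_pos; nra). nra. }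
  apply Rle_trans with ((cosh x - cos y) * pker x y); [apply Rmult_le_compat_r; lra|].
  unfold pker. rewrite Rinv_r; lra.
Qed.

Lemma poisson_y_le x y : 0 < x -> Rabs (poisson_y x y) <= pker x y.
Proof.
  intros Hx. pose proof (pker_den x y Hx) as D. pose proof (pker_pos x y Hx) as Q.
  unfold poisson_y. rewrite Rabs_mult, (Rabs_right (pker x y * pker x y)) by nra.
  rewrite <- Rmult_assoc. rewrite <- (Rmult_1_l (pker x y)) at 3.
  apply Rmult_le_compat_r; [lra|].
  assert (Rabs (sinh x * sin y) <= cosh x - cos y).
  { pose proof (cosh_sinh_sqr x). pose proof (sin2_cos2 y) as S. unfold Rsqr in S.
    rewrite <- (Rabs_right (cosh x - cos y)) by lra. apply Rsqr_le_abs_0. unfold Rsqr.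
    assert (0 <= (cosh x * cos y - 1) * (cosh x * cos y - 1)) by apply Rle_0_sqr.
    assert ((sinh x * sin y) * (sinh x * sin y) = (cosh x * cosh x - 1) * (1 - cos y * cos y)) by nra.
    nra. }
  apply Rle_trans with ((cosh x - cos y) * pker x y); [apply Rmult_le_compat_r; lra|].
  unfold pker. rewrite Rinv_r; lra.
Qed.

Lemma cos_S_S k y : cos (INR (S (S k)) * y) = 2 * cos y * cos (INR (S k) * y) - cos (INR k * y).
Proof.
  rewrite !S_INR.
  replace ((INR k + 1 + 1) * y) with ((INR k + 1) * y + y) by ring.
  replace (cos (INR k * y)) with (cos ((INR k + 1) * y - y)) by (f_equal; ring).
  rewrite cos_plus, cos_minus. ring.
Qed.

(* The cosine coefficients of [K] satisfy the same three-term recurrence as [m], whose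
   homogeneous solutions with this initial condition are unbounded. *)
Lemma cos_coef_unique x (K G : R -> R) (m : nat -> R) B : 0 < x ->
  (forall y, continuous K y) ->
  (forall y, (cosh x - cos y) * K y = G y) ->
  (forall k, RI (fun y => G y * cos (INR k * y)) (- PI) PI
     (match k with O => cosh x * m O - m 1%nat
      | S j => cosh x * m (S j) - (m (S (S j)) + m j) / 2 end)) ->
  (forall k, Rabs (m k) <= B) ->
  forall k, RI (fun y => K y * cos (INR k * y)) (- PI) PI (m k).
Proof.
  intros Hx CK HG HI Hm.
  pose (I k := integral (fun y => K y * cos (INR k * y)) (- PI) PI).
  assert (HIk : forall k, RI (fun y => K y * cos (INR k * y)) (- PI) PI (I k)).
  { intros k. apply RI_continuous. intros y. apply cont_mult; [apply CK|apply cosk_cont]. }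
  assert (R0 : cosh x * I 0%nat - I 1%nat = cosh x * m 0%nat - m 1%nat).
  { apply (RI_unique (fun y => G y * cos (INR 0 * y)) (- PI) PI); [|apply (HI 0%nat)].
    apply (RI_ext (fun y => cosh x * (K y * cos (INR 0 * y)) - K y * cos (INR 1 * y))).
    - intros y. rewrite <- HG. simpl INR. rewrite Rmult_0_l, cos_0, Rmult_1_l. ring.
    - apply RI_minus; [apply RI_scal|]; apply HIk. }
  assert (RS : forall j, cosh x * I (S j) - (I (S (S j)) + I j) / 2
                         = cosh x * m (S j) - (m (S (S j)) + m j) / 2).
  { intros j. apply (RI_unique (fun y => G y * cos (INR (S j) * y)) (- PI) PI); [|apply (HI (S j))].
    apply (RI_ext (fun y => cosh x * (K y * cos (INR (S j) * y))
                  - (/ 2) * (K y * cos (INR (S (S j)) * y) + K y * cos (INR j * y)))).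
    - intros y. rewrite <- HG, cos_S_S. field.
    - unfold Rdiv. rewrite (Rmult_comm _ (/ 2)).
      apply RI_minus; [apply RI_scal; apply HIk|apply RI_scal, RI_plus; apply HIk]. }
  assert (HB : forall k, Rabs (I k) <= integral (fun y => Rabs (K y)) (- PI) PI).
  { intros k. apply (RI_abs_le (fun y => K y * cos (INR k * y)) (fun y => Rabs (K y)) (- PI) PI).
    - pose proof PI_RGT_0; lra.
    - intros y _. rewrite Rabs_mult. rewrite <- (Rmult_1_r (Rabs (K y))) at 2.
      apply Rmult_le_compat_l; [apply Rabs_pos|]. apply Rabs_le. apply COS_bound.
    - apply HIk.
    - apply RI_continuous. intros y. apply (continuous_comp K Rabs); [apply CK|].
      apply continuous_pt, Rcontinuity_abs. }
  assert (Z : forall k, I k - m k = 0).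
  { apply (poisson_recursion (fun k => I k - m k) x (integral (fun y => Rabs (K y)) (- PI) PI + B) Hx).
    - intros k. specialize (RS k). lra.
    - lra.
    - intros k. unfold Rminus. eapply Rle_trans; [apply Rabs_triang|]. rewrite Rabs_Ropp.
      apply Rplus_le_compat; auto. }
  intros k. replace (m k) with (I k) by (specialize (Z k); lra). apply HIk.
Qed.

Lemma exp_neg_le1 x : 0 <= x -> exp (- x) <= 1.
Proof.
  intros Hx. rewrite <- exp_0. destruct (Req_dec x 0) as [->|N].
  - rewrite Ropp_0. lra.
  - left. apply exp_increasing. lra.
Qed.

Lemma exp_S k x : exp (- (INR (S k) * x)) = exp (- x) * exp (- (INR k * x)).
Proof. rewrite S_INR, <- exp_plus. f_equal. ring. Qed.

(** The kernel times its denominator is the constant [sinh x], whose only nonzero cosine coefficient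
    is at [k = 0]. *)
Lemma poisson_cos x k : 0 < x ->
  RI (fun y => poisson x y * cos (INR k * y)) (- PI) PI (2 * PI * exp (- (INR k * x))).
Proof.
  intros Hx. revert k.
  apply (cos_coef_unique x (poisson x) (fun _ => sinh x) (fun k => 2 * PI * exp (- (INR k * x))) (2 * PI) Hx).
  - intros y; apply poisson_cont; exact Hx.
  - intros y. unfold poisson, pker. pose proof (pker_den x y Hx). field. lra.
  - intros k. pose proof (RI_scal (sinh x) _ _ _ _ (RI_cos k)) as H.
    assert (P : exp x * exp (- x) = 1) by apply exp_mult_opp.
    destruct k as [|j]; simpl Nat.eq_dec in H; cbv iota in H.
    + rewrite exp_S. simpl INR. rewrite Rmult_0_l, Ropp_0, exp_0.
      replace (cosh x * (2 * PI * 1) - 2 * PI * (exp (- x) * 1)) with (sinh x * (2 * PI)); [exact H|].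
      rewrite <- cosh_minus_sinh. ring.
    + rewrite !exp_S. replace (_ - _) with (sinh x * 0); [exact H|].
      set (e := exp (- (INR j * x))). unfold cosh.
      transitivity (PI * (e * (exp x * exp (- x)) - e)); [rewrite P; ring|field].
  - intros k. pose proof PI_RGT_0. pose proof (exp_pos (- (INR k * x))).
    pose proof (exp_neg_le1 (INR k * x) ltac:(apply Rmult_le_pos; [apply pos_INR|lra])).
    rewrite Rabs_right by nra. nra.
Qed.

Lemma exp_ineq x : 1 + x <= exp x.
Proof. destruct (Req_dec x 0) as [->|N]; [rewrite exp_0; lra|]. left; apply exp_ineq1; exact N. Qed.

Lemma linear_exp_le k x : 0 < x -> 0 <= INR k * exp (- (INR k * x)) <= / x.
Proof.
  intros Hx. pose proof (pos_INR k). pose proof (exp_pos (- (INR k * x))). split; [nra|].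
  apply Rmult_le_reg_r with x; [exact Hx|]. rewrite Rinv_l by lra.
  pose proof (exp_ineq (INR k * x)).
  assert (P : exp (INR k * x) * exp (- (INR k * x)) = 1) by apply exp_mult_opp.
  nra.
Qed.

(** The kernel times [cosh x - cos y] equals [- cosh x + sinh x * poisson x y], whose coefficients
    are already known. *)
Lemma poisson_t_cos x k : 0 < x ->
  RI (fun y => poisson_t x y * cos (INR k * y)) (- PI) PI (2 * PI * (INR k * exp (- (INR k * x)))).
Proof.
  intros Hx. revert k.
  apply (cos_coef_unique x (poisson_t x) (fun y => - cosh x + sinh x * poisson x y)
     (fun k => 2 * PI * (INR k * exp (- (INR k * x)))) (2 * PI * / x) Hx).
  - intros y; apply poisson_t_cont; exact Hx.
  - intros y. unfold poisson_t, poisson, pker. pose proof (pker_den x y Hx).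
    apply Rminus_diag_uniq.
    replace (sinh x * (sinh x * / (cosh x - cos y))) with ((cosh x * cosh x - 1) * / (cosh x - cos y))
      by (rewrite cosh_sinh_sqr; ring).
    field. lra.
  - intros k.
    assert (H : RI (fun y => (- cosh x + sinh x * poisson x y) * cos (INR k * y)) (- PI) PI
       (- cosh x * (if Nat.eq_dec k 0 then 2 * PI else 0) + sinh x * (2 * PI * exp (- (INR k * x))))).
    { apply (RI_ext (fun y => - cosh x * cos (INR k * y) + sinh x * (poisson x y * cos (INR k * y)))).
      - intros y; ring.
      - apply RI_plus; apply RI_scal; [apply RI_cos|apply poisson_cos; exact Hx]. }
    destruct k as [|j]; simpl Nat.eq_dec in H; cbv iota in H.
    + replace (_ - _) with (- cosh x * (2 * PI) + sinh x * (2 * PI * exp (- (INR 0 * x)))); [exact H|].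
      rewrite exp_S. simpl INR. rewrite Rmult_0_l, Ropp_0, exp_0.
      rewrite <- cosh_minus_sinh. ring.
    + replace (_ - _) with (- cosh x * 0 + sinh x * (2 * PI * exp (- (INR (S j) * x)))); [exact H|].
      rewrite !exp_S, !S_INR. set (e := exp (- (INR j * x))).
      assert (P : exp x * exp (- x) = 1) by apply exp_mult_opp.
      unfold cosh, sinh.
      replace (exp (- x) * (exp (- x) * e)) with (exp (- x) * exp (- x) * e) by ring.
      apply Rminus_diag_uniq.
      transitivity (PI * e * INR j * (1 - exp x * exp (- x))); [|rewrite P; ring].
      field.
  - intros k. pose proof PI_RGT_0. pose proof (linear_exp_le k x Hx).
    rewrite Rabs_right by (apply Rle_ge; apply Rmult_le_pos; lra).
    apply Rmult_le_compat_l; lra.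
Qed.

(** * Sup and Hoelder bounds under Poisson smoothing *)

Definition bnd (n : nat) (c : coef) (B : R) : Prop := forall q, Rabs (trig n c q) <= B.
Definition hol (n : nat) (c : coef) (b M : R) : Prop :=
  forall q h, Rabs (trig n c (q + h) - trig n c q) <= M * pw b (Rabs h).

Lemma RI_even f a l : (forall x, f (- x) = f x) -> RI f 0 a l -> RI f (- a) a (2 * l).
Proof.
  intros He H.
  assert (H1 : RI (fun y => - f (- y)) 0 (- a) l).
  { apply (@is_RInt_comp_opp R_NormedModule f 0 (- a) l). rewrite Ropp_0, Ropp_involutive. exact H. }
  assert (H2 : RI (fun y => - f (- y)) (- a) 0 (- l)) by exact (@is_RInt_swap R_NormedModule _ _ _ _ H1).
  assert (H3 : RI f (- a) 0 l).
  { replace l with (-1 * - l) by ring. apply (RI_ext (fun y => -1 * - f (- y))); [|apply RI_scal, H2].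
    intros y. rewrite He. ring. }
  replace (2 * l) with (l + l) by ring. apply (RI_chasles f (- a) 0 a); assumption.
Qed.

Lemma pker_even x y : pker x (- y) = pker x y.
Proof. unfold pker. rewrite cos_neg. reflexivity. Qed.

Lemma RI_odd_0 f a : (forall x, f (- x) = - f x) -> (forall x, continuous f x) -> RI f (- a) a 0.
Proof.
  intros Ho Hc. pose proof (RI_continuous f (- a) a Hc) as H.
  pose proof (RI_odd f a _ Ho H) as E. rewrite E in H. exact H.
Qed.

Lemma poisson_sin x k : 0 < x -> RI (fun y => poisson x y * sin (INR k * y)) (- PI) PI 0.
Proof.
  intros Hx. apply RI_odd_0.
  - intros y. unfold poisson. rewrite pker_even. replace (INR k * - y) with (- (INR k * y)) by ring.
    rewrite sin_neg. ring.
  - intros y. apply cont_mult; [apply poisson_cont; exact Hx|apply sink_cont].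
Qed.

Lemma poisson_t_sin x k : 0 < x -> RI (fun y => poisson_t x y * sin (INR k * y)) (- PI) PI 0.
Proof.
  intros Hx. apply RI_odd_0.
  - intros y. unfold poisson_t. rewrite pker_even, cos_neg.
    replace (INR k * - y) with (- (INR k * y)) by ring. rewrite sin_neg. ring.
  - intros y. apply cont_mult; [apply poisson_t_cont; exact Hx|apply sink_cont].
Qed.

Lemma poisson_y_cos x k : 0 < x -> RI (fun y => poisson_y x y * cos (INR k * y)) (- PI) PI 0.
Proof.
  intros Hx. apply RI_odd_0.
  - intros y. unfold poisson_y. rewrite pker_even, sin_neg.
    replace (INR k * - y) with (- (INR k * y)) by ring. rewrite cos_neg. ring.
  - intros y. apply cont_mult; [apply poisson_y_cont; exact Hx|apply cosk_cont].
Qed.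

(** Integration by parts: [poisson_y] is minus the [y]-derivative of [poisson], and the boundary
    terms vanish with [sin (k PI)]. *)
Lemma poisson_y_sin x k : 0 < x ->
  RI (fun y => poisson_y x y * sin (INR k * y)) (- PI) PI (2 * PI * (INR k * exp (- (INR k * x)))).
Proof.
  intros Hx. pose proof PI_RGT_0.
  assert (H0 : RI (fun y => INR k * (poisson x y * cos (INR k * y)) - poisson_y x y * sin (INR k * y))
     (- PI) PI 0).
  { replace 0 with (poisson x PI * sin (INR k * PI) - poisson x (- PI) * sin (INR k * - PI)).
    - apply (RI_derive (fun y => poisson x y * sin (INR k * y))); [lra| |].
      + intros y _.
        replace (INR k * (poisson x y * cos (INR k * y)) - poisson_y x y * sin (INR k * y))
          with (- poisson_y x y * sin (INR k * y) + poisson x y * (INR k * cos (INR k * y))) by ring.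
        apply (is_derive_mult (poisson x) (fun y => sin (INR k * y))).
        * unfold poisson, poisson_y. replace (- (sinh x * sin y * (pker x y * pker x y)))
            with (sinh x * - (sin y * (pker x y * pker x y))) by ring.
          apply is_derive_scal. apply ex_derive_pker; exact Hx.
        * auto_derive; [exact I|ring].
        * intros; apply Rmult_comm.
      + intros y _. apply cont_minus; apply cont_mult.
        * apply continuous_const.
        * apply cont_mult; [apply poisson_cont; exact Hx|apply cosk_cont].
        * apply poisson_y_cont; exact Hx.
        * apply sink_cont.
    - replace (INR k * - PI) with (- (INR k * PI)) by ring. rewrite sin_neg, sin_INR_PI. ring. }
  pose proof (RI_minus _ _ _ _ _ _ (RI_scal (INR k) _ _ _ _ (poisson_cos x k Hx)) H0) as H1.
  rewrite Rminus_0_r in H1.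
  replace (2 * PI * (INR k * exp (- (INR k * x)))) with (INR k * (2 * PI * exp (- (INR k * x)))) by ring.
  eapply RI_ext; [|exact H1]. intros y. simpl. ring.
Qed.

(** Convolution is diagonal in frequency: the even part of [K] acts as the multiplier [m], the odd
    part as [l] composed with [conj]. *)
Lemma trig_conv n c q (K : R -> R) (m l : nat -> R) :
  (forall k, RI (fun y => K y * cos (INR k * y)) (- PI) PI (2 * PI * m k)) ->
  (forall k, RI (fun y => K y * sin (INR k * y)) (- PI) PI (2 * PI * l k)) ->
  RI (fun y => K y * trig n c (q - y)) (- PI) PI
    (2 * PI * (trig n (mul m c) q - trig n (mul l (conj c)) q)).
Proof.
  intros Hc Hs. unfold trig.
  apply (RI_ext (fun y => rsum n (fun k =>
     (c true k * cos (INR k * q) + c false k * sin (INR k * q)) * (K y * cos (INR k * y))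
     + (c true k * sin (INR k * q) - c false k * cos (INR k * q)) * (K y * sin (INR k * y))))).
  - intros y. rewrite <- rsum_scal. apply rsum_ext. intros k _.
    replace (INR k * (q - y)) with (INR k * q - INR k * y) by ring. rewrite cos_minus, sin_minus. ring.
  - replace (2 * PI * (_ - _)) with (rsum n (fun k =>
     (c true k * cos (INR k * q) + c false k * sin (INR k * q)) * (2 * PI * m k)
     + (c true k * sin (INR k * q) - c false k * cos (INR k * q)) * (2 * PI * l k))).
    + apply RI_rsum. intros k _. apply RI_plus; apply RI_scal; auto.
    + unfold Rminus. rewrite Rmult_plus_distr_l, <- Ropp_mult_distr_r, Ropp_mult_distr_l, <- !rsum_scal,
        <- rsum_plus. apply rsum_ext. intros k _. unfold mul, conj. ring.
Qed.

Lemma trig_minus_cont n c q y : continuous (fun y => trig n c (q - y)) y.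
Proof.
  apply (continuous_comp (fun y => q - y) (trig n c)).
  - apply cont_minus; [apply continuous_const|apply continuous_id].
  - apply trig_continuous.
Qed.

Lemma trig_zero_mul n c q : trig n (mul (fun _ => 0) c) q = 0.
Proof. rewrite trig_scal. ring. Qed.

Lemma poisson_conv n c q x : 0 < x ->
  RI (fun y => poisson x y * trig n c (q - y)) (- PI) PI
     (2 * PI * trig n (mul (fun k => exp (- (INR k * x))) c) q).
Proof.
  intros Hx.
  pose proof (trig_conv n c q (poisson x) (fun k => exp (- (INR k * x))) (fun _ => 0)
    (fun k => poisson_cos x k Hx)) as H.
  rewrite trig_zero_mul, Rminus_0_r in H. apply H.
  intros k. rewrite Rmult_0_r. apply poisson_sin; exact Hx.
Qed.

(** Symbol of minus the derivative of the Poisson extension in its height [x]. *)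
Definition kexp (x : R) (k : nat) : R := INR k * exp (- (INR k * x)).

Lemma poisson_t_conv n c q x : 0 < x ->
  RI (fun y => poisson_t x y * trig n c (q - y)) (- PI) PI (2 * PI * trig n (mul (kexp x) c) q).
Proof.
  intros Hx.
  pose proof (trig_conv n c q (poisson_t x) (kexp x) (fun _ => 0) (fun k => poisson_t_cos x k Hx)) as H.
  rewrite trig_zero_mul, Rminus_0_r in H. apply H.
  intros k. rewrite Rmult_0_r. apply poisson_t_sin; exact Hx.
Qed.

Lemma poisson_y_conv n c q x : 0 < x ->
  RI (fun y => poisson_y x y * trig n c (q - y)) (- PI) PI (- (2 * PI * trig n (mul (kexp x) (conj c)) q)).
Proof.
  intros Hx.
  assert (Hc : forall k, RI (fun y => poisson_y x y * cos (INR k * y)) (- PI) PI (2 * PI * 0)).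
  { intros k. rewrite Rmult_0_r. apply poisson_y_cos; exact Hx. }
  pose proof (trig_conv n c q (poisson_y x) (fun _ => 0) (kexp x) Hc (fun k => poisson_y_sin x k Hx)) as H.
  rewrite trig_zero_mul in H.
  replace (- (2 * PI * trig n (mul (kexp x) (conj c)) q))
    with (2 * PI * (0 - trig n (mul (kexp x) (conj c)) q)) by ring. exact H.
Qed.

Lemma RI_poisson x : 0 < x -> RI (poisson x) (- PI) PI (2 * PI).
Proof.
  intros Hx. pose proof (poisson_cos x 0 Hx) as H. simpl INR in H.
  rewrite Rmult_0_l, Ropp_0, exp_0, Rmult_1_r in H.
  eapply RI_ext; [|exact H]. intros y; simpl. rewrite Rmult_0_l, cos_0. ring.
Qed.

Lemma RI_pker x : 0 < x -> RI (pker x) (- PI) PI (2 * PI / sinh x).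
Proof.
  intros Hx. pose proof (sinh_ge x ltac:(lra)).
  replace (2 * PI / sinh x) with (/ sinh x * (2 * PI)) by (field; lra).
  apply (RI_ext (fun y => / sinh x * poisson x y)); [|apply RI_scal, RI_poisson, Hx].
  intros y. unfold poisson. field. lra.
Qed.

Lemma div_2PI_le v B : Rabs (2 * PI * v) <= 2 * PI * B -> Rabs v <= B.
Proof.
  pose proof PI_RGT_0. rewrite Rabs_mult, Rabs_right by lra. intros H1.
  apply Rmult_le_reg_l with (2 * PI); lra.
Qed.

(** The kernel is positive with mean one; height 0 is the identity and is treated apart. *)
Lemma poisson_contraction n c B x : 0 <= x -> bnd n c B ->
  bnd n (mul (fun k => exp (- (INR k * x))) c) B.
Proof.
  intros Hx HB q. destruct (Req_dec x 0) as [->|N].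
  - rewrite (trig_ext n _ c); [apply HB|]. intros i k _. unfold mul. rewrite Rmult_0_r, Ropp_0, exp_0. ring.
  - assert (0 < x) by lra. apply div_2PI_le. pose proof PI_RGT_0. rewrite (Rmult_comm _ B).
    apply (RI_abs_le (fun y => poisson x y * trig n c (q - y)) (fun y => B * poisson x y) (- PI) PI).
    + lra.
    + intros y _. rewrite Rabs_mult, (Rmult_comm B).
      assert (0 <= poisson x y). { unfold poisson. pose proof (sinh_ge x Hx). pose proof (pker_pos x y H). nra. }
      rewrite Rabs_right by lra. apply Rmult_le_compat_l; auto.
    + apply poisson_conv; lra.
    + apply RI_scal, RI_poisson; lra.
Qed.

(** Both derivative kernels are dominated by [pker], of total mass [2 PI / sinh x], and
    [sinh x >= x]. Conjugation alone is not bounded on sup norms uniformly in the degree; combined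
    with a derivative and smoothing it costs the same [1 / x]. *)
Lemma poisson_grad n c B x : 0 < x -> bnd n c B ->
  bnd n (mul (kexp x) c) (B / x) /\ bnd n (mul (kexp x) (conj c)) (B / x).
Proof.
  intros Hx HB. pose proof PI_RGT_0. pose proof (sinh_ge x ltac:(lra)).
  assert (HB0 : 0 <= B) by (eapply Rle_trans; [apply Rabs_pos|apply (HB 0)]).
  assert (L : B * (2 * PI / sinh x) <= 2 * PI * (B / x)).
  { unfold Rdiv. replace (B * (2 * PI * / sinh x)) with (2 * PI * (B * / sinh x)) by ring.
    apply Rmult_le_compat_l; [lra|]. apply Rmult_le_compat_l; [exact HB0|].
    apply Rinv_le_contravar; lra. }
  split; intros q; apply div_2PI_le; eapply Rle_trans; [|exact L| |exact L].
  - apply (RI_abs_le (fun y => poisson_t x y * trig n c (q - y)) (fun y => B * pker x y) (- PI) PI).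
    + lra.
    + intros y _. rewrite Rabs_mult, (Rmult_comm B). apply Rmult_le_compat; try apply Rabs_pos; auto.
      apply poisson_t_le; exact Hx.
    + apply poisson_t_conv; exact Hx.
    + apply RI_scal, RI_pker; exact Hx.
  - rewrite <- Rabs_Ropp.
    apply (RI_abs_le (fun y => poisson_y x y * trig n c (q - y)) (fun y => B * pker x y) (- PI) PI).
    + lra.
    + intros y _. rewrite Rabs_mult, (Rmult_comm B). apply Rmult_le_compat; try apply Rabs_pos; auto.
      apply poisson_y_le; exact Hx.
    + apply poisson_y_conv; exact Hx.
    + apply RI_scal, RI_pker; exact Hx.
Qed.

(** Since [1 - cos z = 2 sin^2 (z/2)], it suffices that [sin (z/2) >= z/6], which the cubic Taylor
    bound gives for [z <= PI <= 4]. *)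
Lemma one_minus_cos_ge y : Rabs y <= PI -> y * y / 18 <= 1 - cos y.
Proof.
  intros Hy. pose proof PI_4.
  assert (W : forall z, 0 <= z <= PI -> z * z / 18 <= 1 - cos z).
  { intros z Hz. destruct (pre_sin_bound (z / 2) 0 ltac:(lra) ltac:(lra)) as [L _].
    assert (E : sin_approx (z / 2) (2 * 0 + 1) = z / 2 - (z / 2) * (z / 2) * (z / 2) / 6).
    { unfold sin_approx, sin_term. simpl. field. }
    rewrite E in L.
    replace (cos z) with (cos (2 * (z / 2))) by (f_equal; field).
    rewrite cos_2a_sin.
    assert (z / 2 / 3 <= sin (z / 2)).
    { assert (z / 2 * (z / 2) * (z / 2) <= 4 * (z / 2)); [|lra].
      apply Rmult_le_compat_r; nra. }
    nra. }
  destruct (Rle_dec 0 y).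
  - apply W. rewrite Rabs_right in Hy; lra.
  - rewrite Rabs_left in Hy by lra. rewrite <- cos_neg.
    replace (y * y) with (- y * - y) by ring. apply W; lra.
Qed.

(** The denominator is at least [x^2/2 + y^2/18], hence at least [(|y| + x)^2 / 36]. *)
Lemma pker_le x y : 0 < x -> Rabs y <= PI -> pker x y <= 36 * Rpower (Rabs y + x) (- (2)).
Proof.
  intros Hx Hy. pose proof (one_minus_cos_ge y Hy). pose proof (cosh_ge x ltac:(lra)).
  pose proof (Rabs_pos y).
  rewrite Rpower_Ropp. replace 2 with (INR 2) by (simpl; ring). rewrite Rpower_pow by lra.
  replace (36 * / (Rabs y + x) ^ 2) with (/ ((Rabs y + x) ^ 2 / 36)) by (field; lra).
  unfold pker. assert (y * y = Rabs y * Rabs y) by (rewrite <- Rabs_mult, Rabs_right; nra).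
  apply Rinv_le_contravar; nra.
Qed.

Lemma RI_abs_shift_power b x : b < 1 -> 0 < x ->
  exists l, RI (fun y => Rpower (Rabs y + x) (b - 2)) (- PI) PI l /\
            0 <= l <= 2 * (Rpower x (b - 1) / (1 - b)).
Proof.
  intros Hb Hx. pose proof PI_RGT_0.
  destruct (RI_shift_power b x PI Hb Hx ltac:(lra)) as [l [Hl Bl]].
  exists (2 * l). split; [|lra]. apply RI_even; [intros; rewrite Rabs_Ropp; reflexivity|].
  apply (RI_ext_in (fun t => Rpower (t + x) (b - 2))); [lra| |exact Hl].
  intros y Hy. rewrite Rabs_right by lra. reflexivity.
Qed.

(** [K] has mean zero, so the polynomial may be replaced by its increment, of size [|y|^b]. Against
    the kernel bound [(|y| + x)^(-2)] this integrates to [x^(b-1)]. *)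
Lemma poisson_kernel_hol n c b M x q K v : 0 < b < 1 -> 0 <= M -> 0 < x -> hol n c b M ->
  (forall y, Rabs (K y) <= pker x y) -> RI K (- PI) PI 0 ->
  RI (fun y => K y * trig n c (q - y)) (- PI) PI (2 * PI * v) ->
  Rabs v <= 12 / (1 - b) * M * Rpower x (b - 1).
Proof.
  intros Hb HM Hx Hh HK HK0 HI. apply div_2PI_le. pose proof PI_RGT_0.
  destruct (RI_abs_shift_power b x ltac:(lra) Hx) as [l [Hl Bl]].
  assert (H1 : RI (fun y => K y * (trig n c (q - y) - trig n c q)) (- PI) PI (2 * PI * v)).
  { replace (2 * PI * v) with (2 * PI * v - trig n c q * 0) by ring.
    apply (RI_ext (fun y => K y * trig n c (q - y) - trig n c q * K y)); [intros; ring|].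
    apply RI_minus; [exact HI|apply RI_scal; exact HK0]. }
  apply Rle_trans with (36 * M * l).
  - apply (RI_abs_le (fun y => K y * (trig n c (q - y) - trig n c q))
      (fun y => 36 * M * Rpower (Rabs y + x) (b - 2)) (- PI) PI); [lra| |exact H1|apply RI_scal, Hl].
    intros y Hy. assert (Hy' : Rabs y <= PI) by (apply Rabs_le; lra).
    pose proof (Rabs_pos y).
    assert (H2 : Rabs (trig n c (q - y) - trig n c q) <= M * Rpower (Rabs y + x) b).
    { pose proof (Hh q (- y)) as H2. rewrite Rabs_Ropp in H2. unfold Rminus at 2.
      eapply Rle_trans; [exact H2|]. apply Rmult_le_compat_l; [exact HM|].
      rewrite <- pw_Rpower by lra. apply pw_le; lra. }
    rewrite Rabs_mult. replace (b - 2) with (b + - (2)) by ring. rewrite Rpower_plus.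
    apply Rle_trans with (36 * Rpower (Rabs y + x) (- (2)) * (M * Rpower (Rabs y + x) b)); [|right; ring].
    apply Rmult_le_compat; try apply Rabs_pos; [|exact H2].
    eapply Rle_trans; [apply HK|]. apply pker_le; assumption.
  (* The kernel contributes 36 and the two half-lines a factor 2; the constant 12 absorbs them
     because [72 <= 24 PI]. *)
  - pose proof PI2_3_2. assert (3 <= PI) by lra.
    assert (0 < Rpower x (b - 1)) by apply Rpower_pos.
    assert (0 < / (1 - b)) by (apply Rinv_0_lt_compat; lra).
    apply Rle_trans with (36 * M * (2 * (Rpower x (b - 1) / (1 - b)))).
    + apply Rmult_le_compat_l; [nra|lra].
    + unfold Rdiv. replace (2 * PI * (12 * / (1 - b) * M * Rpower x (b - 1)))
        with (24 * PI * (M * (Rpower x (b - 1) * / (1 - b)))) by ring.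
      replace (36 * M * (2 * (Rpower x (b - 1) * / (1 - b))))
        with (72 * (M * (Rpower x (b - 1) * / (1 - b)))) by ring.
      apply Rmult_le_compat_r; [|lra]. apply Rmult_le_pos; [exact HM|]. apply Rmult_le_pos; lra.
Qed.

Lemma poisson_grad_hol n c b M x : 0 < b < 1 -> 0 <= M -> 0 < x -> hol n c b M ->
  bnd n (mul (kexp x) c) (12 / (1 - b) * M * Rpower x (b - 1)) /\
  bnd n (mul (kexp x) (conj c)) (12 / (1 - b) * M * Rpower x (b - 1)).
Proof.
  intros Hb HM Hx Hh. split; intros q.
  - apply (poisson_kernel_hol n c b M x q (poisson_t x)); auto.
    + intros; apply poisson_t_le; exact Hx.
    + pose proof (poisson_t_cos x 0 Hx) as H. simpl INR in H. rewrite Rmult_0_l, Rmult_0_r in H.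
      eapply RI_ext; [|exact H]. intros y; simpl. rewrite Rmult_0_l, cos_0. ring.
    + apply poisson_t_conv; exact Hx.
  - rewrite <- Rabs_Ropp. apply (poisson_kernel_hol n c b M x q (poisson_y x)); auto.
    + intros; apply poisson_y_le; exact Hx.
    + pose proof (poisson_y_cos x 0 Hx) as H. simpl INR in H.
      eapply RI_ext; [|exact H]. intros y; simpl. rewrite Rmult_0_l, cos_0. ring.
    + rewrite <- Ropp_mult_distr_r. apply poisson_y_conv; exact Hx.
Qed.

Definition k2exp (x : R) (k : nat) : R := INR k * INR k * exp (- (INR k * x)).

Lemma bnd_ext n c d B : (forall i k, (k < n)%nat -> c i k = d i k) -> bnd n c B -> bnd n d B.
Proof. intros E H q. rewrite <- (trig_ext n c d q E). apply H. Qed.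

Lemma exp_half k x : exp (- (INR k * x)) = exp (- (INR k * (x / 2))) * exp (- (INR k * (x / 2))).
Proof. rewrite <- exp_plus. f_equal. field. Qed.

Lemma Rpower_half b x : 0 < x -> b <= 1 -> Rpower (x / 2) (b - 1) / (x / 2) = Rpower (/ 2) (b - 2) * Rpower x (b - 2).
Proof.
  intros Hx Hb. unfold Rdiv. rewrite Rpower_mult_distr by lra. rewrite (Rmult_comm (/ 2) x).
  replace (b - 2) with (b - 1 + - (1)) by ring.
  rewrite Rpower_plus, Rpower_Ropp, Rpower_1 by lra. reflexivity.
Qed.

(** The height is split in two: the first half uses the Hoelder bound, the second the plain gradient
    bound. The constant 48 is [12 * 4], where 4 bounds [(1/2)^(b-2)]. *)
Lemma poisson_grad2_hol n c b M x : 0 < b < 1 -> 0 <= M -> 0 < x -> hol n c b M ->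
  bnd n (mul (k2exp x) c) (48 / (1 - b) * M * Rpower x (b - 2)) /\
  bnd n (mul (k2exp x) (conj c)) (48 / (1 - b) * M * Rpower x (b - 2)).
Proof.
  intros Hb HM Hx Hh.
  destruct (poisson_grad_hol n c b M (x / 2) Hb HM ltac:(lra) Hh) as [H1 H2].
  assert (L : 12 / (1 - b) * M * Rpower (x / 2) (b - 1) / (x / 2) <= 48 / (1 - b) * M * Rpower x (b - 2)).
  { replace (12 / (1 - b) * M * Rpower (x / 2) (b - 1) / (x / 2))
      with (12 / (1 - b) * M * (Rpower (x / 2) (b - 1) / (x / 2))) by (unfold Rdiv; ring).
    rewrite Rpower_half by lra.
    assert (Rpower (/ 2) (b - 2) <= 4).
    { replace 4 with (Rpower (/ 2) (- (2))).
      - unfold Rpower. assert (ln (/ 2) < 0) by (rewrite <- ln_1; apply ln_increasing; lra).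
        left. apply exp_increasing. nra.
      - rewrite Rpower_Ropp. replace 2 with (INR 2) at 2 by (simpl; ring).
        rewrite Rpower_pow by lra. field. }
    pose proof (Rpower_pos x (b - 2)). assert (0 < / (1 - b)) by (apply Rinv_0_lt_compat; lra).
    unfold Rdiv. replace (48 * / (1 - b) * M * Rpower x (b - 2))
      with (12 * / (1 - b) * M * (4 * Rpower x (b - 2))) by ring.
    apply Rmult_le_compat_l; [apply Rmult_le_pos; nra|]. apply Rmult_le_compat_r; lra. }
  assert (E : forall d i k, mul (kexp (x / 2)) (mul (kexp (x / 2)) d) i k = mul (k2exp x) d i k).
  { intros d i k. unfold mul, kexp, k2exp. rewrite (exp_half k x). ring. }
  destruct (poisson_grad n _ _ (x / 2) ltac:(lra) H1) as [H3 _].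
  destruct (poisson_grad n _ _ (x / 2) ltac:(lra) H2) as [H4 _].
  split; intros q; (eapply Rle_trans; [|exact L]).
  - eapply bnd_ext in H3; [apply H3|]. intros; apply E.
  - eapply bnd_ext in H4; [apply H4|]. intros; apply E.
Qed.

(** * Orthogonality of the trigonometric basis *)

Definition ebas (i : bool) (k : nat) (y : R) : R := if i then cos (INR k * y) else sin (INR k * y).
(** Squared norm of [ebas i k] over one period; the sine of frequency 0 is the zero function. *)
Definition nrm (i : bool) (k : nat) : R := if Nat.eq_dec k 0 then (if i then 2 * PI else 0) else PI.

Lemma ebas_cont i k y : continuous (ebas i k) y.
Proof. destruct i; [apply cosk_cont|apply sink_cont]. Qed.

Lemma ebas_le1 i k y : Rabs (ebas i k y) <= 1.
Proof. destruct i; unfold ebas; apply Rabs_le; [apply COS_bound|apply SIN_bound]. Qed.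

(** With truncated subtraction, [(j - k) + (k - j)] is the absolute difference. *)
Lemma cos_absdiff j k y : cos (INR ((j - k) + (k - j)) * y) = cos (INR j * y - INR k * y).
Proof.
  destruct (Nat.le_ge_cases j k) as [H|H].
  - replace (j - k + (k - j))%nat with (k - j)%nat by lia. rewrite minus_INR by exact H.
    rewrite <- cos_neg. f_equal. ring.
  - replace (j - k + (k - j))%nat with (j - k)%nat by lia. rewrite minus_INR by exact H. f_equal. ring.
Qed.

Lemma RI_ebas_ebas i i' j k : RI (fun y => ebas i j y * ebas i' k y) (- PI) PI
  (if Bool.eqb i i' then (if Nat.eq_dec j k then nrm i k else 0) else 0).
Proof.
  assert (Hodd : RI (fun y => cos (INR j * y) * sin (INR k * y)) (- PI) PI 0 /\
                 RI (fun y => sin (INR j * y) * cos (INR k * y)) (- PI) PI 0).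
  { split; (apply RI_odd_0; [intros y|intros y; solve_cont]);
    replace (INR k * - y) with (- (INR k * y)) by ring; replace (INR j * - y) with (- (INR j * y)) by ring;
    rewrite sin_neg, cos_neg; ring. }
  destruct i, i'; simpl Bool.eqb; cbv iota; unfold ebas; try apply Hodd.
  - pose proof (RI_plus _ _ _ _ _ _ (RI_scal (/ 2) _ _ _ _ (RI_cos ((j - k) + (k - j))))
      (RI_scal (/ 2) _ _ _ _ (RI_cos (j + k)))) as H.
    apply (RI_ext _ (fun y => cos (INR j * y) * cos (INR k * y))) in H.
    + replace (if Nat.eq_dec j k then nrm true k else 0)
        with (/ 2 * (if Nat.eq_dec (j - k + (k - j)) 0 then 2 * PI else 0)
              + / 2 * (if Nat.eq_dec (j + k) 0 then 2 * PI else 0)); [exact H|].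
      unfold nrm. destruct (Nat.eq_dec j k), (Nat.eq_dec (j - k + (k - j)) 0), (Nat.eq_dec (j + k) 0),
        (Nat.eq_dec k 0); try lia; field.
    + intros y. rewrite cos_absdiff, plus_INR, Rmult_plus_distr_r, cos_plus, cos_minus. field.
  - pose proof (RI_minus _ _ _ _ _ _ (RI_scal (/ 2) _ _ _ _ (RI_cos ((j - k) + (k - j))))
      (RI_scal (/ 2) _ _ _ _ (RI_cos (j + k)))) as H.
    apply (RI_ext _ (fun y => sin (INR j * y) * sin (INR k * y))) in H.
    + replace (if Nat.eq_dec j k then nrm false k else 0)
        with (/ 2 * (if Nat.eq_dec (j - k + (k - j)) 0 then 2 * PI else 0)
              - / 2 * (if Nat.eq_dec (j + k) 0 then 2 * PI else 0)); [exact H|].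
      unfold nrm. destruct (Nat.eq_dec j k), (Nat.eq_dec (j - k + (k - j)) 0), (Nat.eq_dec (j + k) 0),
        (Nat.eq_dec k 0); try lia; field.
    + intros y. rewrite cos_absdiff, plus_INR, Rmult_plus_distr_r, cos_plus, cos_minus. field.
Qed.

Lemma trig_ebas n c y : trig n c y = rsum n (fun k => c true k * ebas true k y + c false k * ebas false k y).
Proof. reflexivity. Qed.

Lemma RI_trig_ebas n c i k : (k < n)%nat ->
  RI (fun y => trig n c y * ebas i k y) (- PI) PI (nrm i k * c i k).
Proof.
  intros Hk.
  pose (l j := c true j * (if Bool.eqb true i then (if Nat.eq_dec j k then nrm true k else 0) else 0)
      + c false j * (if Bool.eqb false i then (if Nat.eq_dec j k then nrm false k else 0) else 0)).
  assert (E : rsum n l = nrm i k * c i k).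
  { rewrite (rsum_single n k l Hk).
    - unfold l. destruct (Nat.eq_dec k k); [|lia]. destruct i; simpl; ring.
    - intros j _ Hj. unfold l. destruct (Nat.eq_dec j k); [lia|]. destruct i; simpl; ring. }
  rewrite <- E.
  apply (RI_ext (fun y => rsum n (fun j => c true j * (ebas true j y * ebas i k y)
       + c false j * (ebas false j y * ebas i k y)))).
  - intros y. rewrite trig_ebas, (Rmult_comm _ (ebas i k y)), <- rsum_scal. apply rsum_ext. intros; ring.
  - apply RI_rsum. intros j _. apply RI_plus; apply RI_scal; apply RI_ebas_ebas.
Qed.

Lemma coef_le n c B i k : bnd n c B -> (0 < k < n)%nat -> Rabs (c i k) <= 2 * B.
Proof.
  intros HB Hk. pose proof PI_RGT_0.
  assert (Rabs (nrm i k * c i k) <= (PI - - PI) * B).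
  { apply (RI_abs_le (fun y => trig n c y * ebas i k y) (fun _ => B) (- PI) PI).
    - lra.
    - intros y _. rewrite Rabs_mult. pose proof (HB y). pose proof (ebas_le1 i k y).
      pose proof (Rabs_pos (trig n c y)). pose proof (Rabs_pos (ebas i k y)). nra.
    - apply RI_trig_ebas; lia.
    - apply RI_const. }
  unfold nrm in H0. destruct (Nat.eq_dec k 0); [lia|]. rewrite Rabs_mult, Rabs_right in H0 by lra.
  apply Rmult_le_reg_l with PI; lra.
Qed.

(** * Multipliers on high-frequency polynomials *)

Definition highfreq (K : nat) (c : coef) : Prop := forall i k, (k < K)%nat -> c i k = 0.

(** Bounds by [e] the sup-norm operator norm of the multiplier [m] on frequencies at least [K],
    uniformly in the degree. Raising [K] is what makes the norms below small. *)
Definition opn (K : nat) (m : nat -> R) (e : R) : Prop :=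
  forall n c B, highfreq K c -> bnd n c B -> bnd n (mul m c) (e * B).

Lemma highfreq_mul K m c : highfreq K c -> highfreq K (mul m c).
Proof. intros H i k Hk. unfold mul. rewrite H by exact Hk. ring. Qed.

Lemma opn_comp K m1 m2 e1 e2 : opn K m1 e1 -> opn K m2 e2 -> opn K (fun k => m1 k * m2 k) (e1 * e2).
Proof.
  intros H1 H2 n c B HK HB. rewrite Rmult_assoc.
  apply (bnd_ext n (mul m1 (mul m2 c))); [intros; unfold mul; ring|].
  apply H1; [apply highfreq_mul|apply H2]; assumption.
Qed.

Lemma opn_plus K m1 m2 e1 e2 : opn K m1 e1 -> opn K m2 e2 -> opn K (fun k => m1 k + m2 k) (e1 + e2).
Proof.
  intros H1 H2 n c B HK HB q. specialize (H1 n c B HK HB q). specialize (H2 n c B HK HB q).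
  rewrite (trig_ext n _ (cadd (mul m1 c) (mul m2 c))) by (intros; unfold mul, cadd; ring).
  rewrite trig_add. eapply Rle_trans; [apply Rabs_triang|]. lra.
Qed.

Lemma opn_scal K r m e : opn K m e -> opn K (fun k => r * m k) (Rabs r * e).
Proof.
  intros H n c B HK HB q. specialize (H n c B HK HB q).
  rewrite (trig_ext n _ (mul (fun _ => r) (mul m c))) by (intros; unfold mul; ring).
  rewrite trig_scal, Rabs_mult, Rmult_assoc. apply Rmult_le_compat_l; [apply Rabs_pos|exact H].
Qed.

Lemma opn_weaken K K' m e e' : (K <= K')%nat -> e <= e' -> opn K m e -> opn K' m e'.
Proof.
  intros HK He H n c B Hc HB q.
  assert (0 <= B) by (eapply Rle_trans; [apply Rabs_pos|apply (HB 0)]).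
  apply Rle_trans with (e * B); [|nra]. apply H; [|exact HB]. intros i k Hk. apply Hc. lia.
Qed.

(** The bound is tested on the single mode [cos (k q)] at [q = 0]. *)
Lemma opn_pointwise K m e k : (K <= k)%nat -> opn K m e -> Rabs (m k) <= e.
Proof.
  intros Hk H.
  pose (c := fun (i : bool) (j : nat) => if i then (if Nat.eq_dec j k then 1 else 0) else 0).
  assert (Ht : forall m' q, trig (S k) (mul m' c) q = m' k * cos (INR k * q)).
  { intros m' q. unfold trig. rewrite (rsum_single (S k) k); [| lia |].
    - unfold mul, c. destruct (Nat.eq_dec k k); [|lia]. ring.
    - intros j _ Hj. unfold mul, c. destruct (Nat.eq_dec j k); [lia|]. ring. }
  assert (HB : bnd (S k) c 1).
  { intros q. rewrite (trig_ext _ c (mul (fun _ => 1) c)) by (intros; unfold mul; ring).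
    rewrite Ht, Rmult_1_l. apply Rabs_le, COS_bound. }
  assert (HH : highfreq K c).
  { intros i j Hj. unfold c. destruct (Nat.eq_dec j k); [lia|]. destruct i; reflexivity. }
  specialize (H (S k) c 1 HH HB 0). rewrite Ht, !Rmult_0_r, cos_0 in H. rewrite !Rmult_1_r in H. exact H.
Qed.

Lemma opn_exp_1 K h : 0 <= h -> opn K (fun k => exp (- (INR k * h))) 1.
Proof. intros Hh n c B _ HB. rewrite Rmult_1_l. apply poisson_contraction; assumption. Qed.

(** Telescoping, from [1/k^2 <= 1/(k-1) - 1/k]. *)
Lemma sum_inv_sqr K n : (2 <= K)%nat ->
  rsum n (fun k => if le_dec K k then / (INR k * INR k) else 0) <= / INR (K - 1).
Proof.
  intros HK.
  assert (H : rsum n (fun k => if le_dec K k then / (INR k * INR k) else 0)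
              <= if le_dec K n then / INR (K - 1) - / INR (n - 1) else 0).
  { induction n as [|n IH]; [simpl; destruct (le_dec K 0); [lia|lra]|].
    simpl rsum. destruct (le_dec K n) as [H1|H1].
    - destruct (le_dec K (S n)); [|lia].
      replace (S n - 1)%nat with n by lia.
      assert (2 <= INR n). { replace 2 with (INR 2) by reflexivity. apply le_INR. lia. }
      assert (E : INR (n - 1) = INR n - 1) by (rewrite minus_INR by lia; reflexivity).
      rewrite E in IH.
      assert (/ (INR n * INR n) <= / (INR n - 1) - / INR n).
      { replace (/ (INR n - 1) - / INR n) with (/ ((INR n - 1) * INR n)) by (field; lra).
        apply Rinv_le_contravar; nra. }
      lra.
    - destruct (le_dec K (S n)) as [H2|H2]; [|lra].
      assert (S n = K) by lia. subst K. lra. }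
  assert (0 < / INR (K - 1)) by (apply Rinv_0_lt_compat, lt_0_INR; lia).
  eapply Rle_trans; [exact H|]. destruct (le_dec K n); [|lra].
  assert (0 < / INR (n - 1)) by (apply Rinv_0_lt_compat, lt_0_INR; lia). lra.
Qed.

Lemma opn_inv_sqr K : (2 <= K)%nat -> opn K (fun k => / (INR k * INR k)) (4 / INR (K - 1)).
Proof.
  intros HK n c B Hc HB q.
  assert (B0 : 0 <= B) by (eapply Rle_trans; [apply Rabs_pos|apply (HB 0)]).
  unfold trig. eapply Rle_trans; [apply rsum_abs|].
  apply Rle_trans with (rsum n (fun k => (4 * B) * (if le_dec K k then / (INR k * INR k) else 0))).
  - apply rsum_le. intros k Hk. unfold mul. destruct (le_dec K k) as [H|H].
    + assert (0 < INR k) by (apply lt_0_INR; lia).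
      assert (0 < / (INR k * INR k)) by (apply Rinv_0_lt_compat; nra).
      pose proof (coef_le n c B true k HB ltac:(lia)). pose proof (coef_le n c B false k HB ltac:(lia)).
      rewrite !Rmult_assoc, <- Rmult_plus_distr_l, Rabs_mult, (Rabs_right (/ _)) by lra.
      rewrite (Rmult_comm (/ _)), <- !Rmult_assoc. apply Rmult_le_compat_r; [lra|].
      eapply Rle_trans; [apply Rabs_triang|]. rewrite !Rabs_mult.
      pose proof (ebas_le1 true k q) as E1. pose proof (ebas_le1 false k q) as E2. unfold ebas in E1, E2.
      pose proof (Rabs_pos (c true k)). pose proof (Rabs_pos (c false k)).
      pose proof (Rabs_pos (cos (INR k * q))). pose proof (Rabs_pos (sin (INR k * q))).
      assert (Rabs (c true k) * Rabs (cos (INR k * q)) <= 2 * B) by nra.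
      assert (Rabs (c false k) * Rabs (sin (INR k * q)) <= 2 * B) by nra. lra.
    + rewrite !Hc by lia. rewrite !Rmult_0_r, !Rmult_0_l, Rplus_0_l, Rabs_R0. lra.
  - rewrite rsum_scal. unfold Rdiv. rewrite (Rmult_comm (4 * / _)), <- Rmult_assoc, (Rmult_comm B 4).
    apply Rmult_le_compat_l; [lra|]. apply sum_inv_sqr; exact HK.
Qed.

Lemma is_derive_trig_mul n c (m dm : nat -> R -> R) (q x : R) :
  (forall k, is_derive (m k) x (dm k x)) ->
  is_derive (fun x => trig n (mul (fun k => m k x) c) q) x (trig n (mul (fun k => dm k x) c) q).
Proof.
  intros H. unfold trig. apply is_derive_rsum. intros k _. unfold mul.
  set (A := cos (INR k * q)). set (B := sin (INR k * q)).
  apply (D_ext (fun y => m k y * (c true k * A + c false k * B))); [intros t; ring|].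
  apply (D_eq _ _ (dm k x * (c true k * A + c false k * B))); [ring|].
  apply D_scal_r. apply H.
Qed.

(** Since [1/k] is not summable, it is split as [(1 - exp (-k t))/k + exp (-k t)/k]. The first part
    integrates the Poisson semigroup over heights in [[0, t]] and costs [t]; the second is
    [k exp (-k t)] applied to the summable [1/k^2]. *)
Lemma opn_inv_tau K t : (2 <= K)%nat -> 0 < t -> opn K (fun k => / INR k) (t + 4 / INR (K - 1) / t).
Proof.
  intros HK Ht n c B Hc HB q.
  assert (B0 : 0 <= B) by (eapply Rle_trans; [apply Rabs_pos|apply (HB 0)]).
  assert (H1 : Rabs (trig n (mul (fun k => / INR k * exp (- (INR k * t))) c) q) <= 4 / INR (K - 1) * B / t).
  { destruct (poisson_grad n _ _ t Ht (opn_inv_sqr K HK n c B Hc HB)) as [H _].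
    eapply bnd_ext in H; [apply H|]. intros i k _. unfold mul, kexp.
    destruct (Nat.eq_dec k 0) as [->|N]; [rewrite Hc by lia; ring|].
    assert (INR k <> 0) by (apply not_0_INR; exact N). field. assumption. }
  assert (H2 : Rabs (trig n (mul (fun k => - / INR k * exp (- (INR k * t))) c) q
                     - trig n (mul (fun k => - / INR k * exp (- (INR k * 0))) c) q) <= B * (t - 0)).
  { apply (lipschitz_derive (fun x => trig n (mul (fun k => - / INR k * exp (- (INR k * x))) c) q)
      (fun x => trig n (mul (fun k => INR k * / INR k * exp (- (INR k * x))) c) q)); [lra| | |].
    - intros x _. apply (is_derive_trig_mul n c (fun k x => - / INR k * exp (- (INR k * x)))
        (fun k x => INR k * / INR k * exp (- (INR k * x)))). intros k. auto_derive; [auto|ring].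
    - intros x _. eapply derive_cont.
      apply (is_derive_trig_mul n c (fun k x => - / INR k * exp (- (INR k * x)))
        (fun k x => INR k * / INR k * exp (- (INR k * x)))). intros k. auto_derive; [auto|ring].
    - intros x Hx. rewrite (trig_ext n _ (mul (fun k => exp (- (INR k * x))) c)).
      + apply poisson_contraction; [lra|exact HB].
      + intros i k _. unfold mul. destruct (Nat.eq_dec k 0) as [->|N]; [rewrite Hc by lia; ring|].
        rewrite Rinv_r by (apply not_0_INR; exact N). ring. }
  replace (trig n (mul (fun k => / INR k) c) q) with
    ((trig n (mul (fun k => - / INR k * exp (- (INR k * t))) c) q
      - trig n (mul (fun k => - / INR k * exp (- (INR k * 0))) c) q)
     + trig n (mul (fun k => / INR k * exp (- (INR k * t))) c) q).
  - eapply Rle_trans; [apply Rabs_triang|]. unfold Rdiv in *. lra.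
  - assert (E : forall m, trig n (mul (fun k => - / INR k * m k) c) q
                          = -1 * trig n (mul (fun k => / INR k * m k) c) q).
    { intros m. rewrite <- trig_scal. apply trig_ext. intros; unfold mul; ring. }
    rewrite !E. rewrite (trig_ext n (mul (fun k => / INR k * exp (- (INR k * 0))) c) (mul (fun k => / INR k) c)).
    + ring.
    + intros i k _. unfold mul. rewrite Rmult_0_r, Ropp_0, exp_0. ring.
Qed.

Lemma opn_inv eps : 0 < eps -> exists K0, (2 <= K0)%nat /\ forall K, (K0 <= K)%nat -> opn K (fun k => / INR k) eps.
Proof.
  (* With [t = eps / 2], the remainder [4 / (K - 1) / t] is at most [eps / 2] as soon as
     [K - 1 >= 16 / eps^2]. *)
  intros He. destruct (INR_unbounded (16 / (eps * eps) + 2)) as [N HN].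
  assert (0 < / (eps * eps)) by (apply Rinv_0_lt_compat; nra).
  exists (N + 2)%nat. split; [lia|]. intros K HK.
  apply (opn_weaken K K _ (eps / 2 + 4 / INR (K - 1) / (eps / 2))); [lia| |apply opn_inv_tau; [lia|lra]].
  assert (HI : 16 / (eps * eps) <= INR (K - 1)).
  { assert (INR N <= INR (K - 1)) by (apply le_INR; lia). lra. }
  assert (0 < INR (K - 1)) by (unfold Rdiv in HI; lra).
  assert (/ INR (K - 1) <= eps * eps / 16).
  { replace (eps * eps / 16) with (/ (16 / (eps * eps))) by (field; lra).
    apply Rinv_le_contravar; [|exact HI]. unfold Rdiv; lra. }
  assert (4 / INR (K - 1) / (eps / 2) <= eps / 2); [|lra].
  apply Rmult_le_reg_r with (eps / 2); [lra|].
  replace (4 / INR (K - 1) / (eps / 2) * (eps / 2)) with (4 * / INR (K - 1)) by (field; lra). nra.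
Qed.

(** [exp (-k h)] is [k exp (-k h)], of norm at most [1 / h], composed with [1 / k], which is small
    at high frequency. *)
Lemma opn_exp h eps : 0 < h -> 0 < eps ->
  exists K0, forall K, (K0 <= K)%nat -> opn K (fun k => exp (- (INR k * h))) eps.
Proof.
  intros Hh He. destruct (opn_inv (eps * h) ltac:(nra)) as [K0 [H2 H]].
  exists K0. intros K HK n c B Hc HB q.
  destruct (poisson_grad n _ _ h Hh (H K HK n c B Hc HB)) as [H1 _].
  replace (eps * B) with (eps * h * B / h) by (field; lra).
  eapply bnd_ext in H1; [apply H1|]. intros i k _. unfold mul, kexp.
  destruct (Nat.eq_dec k 0) as [->|N]; [rewrite Hc by lia; ring|].
  field. apply not_0_INR; exact N.
Qed.

(** * Fourier coefficients and Fejer means *)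

Definition per1 (f : R -> R) : Prop := forall q, f (q + 2 * PI) = f q.
Definition hol1 (b M : R) (f : R -> R) : Prop := forall q q', Rabs (f q - f q') <= M * pw b (Rabs (q - q')).

Lemma hol_cont b M (f : R -> R) x : 0 < b ->
  (forall y, Rabs (f y - f x) <= M * pw b (Rabs (y - x))) -> continuous f x.
Proof.
  intros Hb H. apply continuous_pt. intros eps He.
  assert (HM : 0 < Rabs M + 1) by (pose proof (Rabs_pos M); lra).
  destruct (pw_small b (eps / (Rabs M + 1)) Hb) as [d [Hd Hs]].
  { apply Rdiv_lt_0_compat; lra. }
  exists d. split; [exact Hd|]. intros y [_ Hy]. change (Rabs (f y - f x) < eps).
  change (Rabs (y - x) < d) in Hy. eapply Rle_lt_trans; [apply H|].
  specialize (Hs _ Hy). pose proof (pw_nonneg b (Rabs (y - x))). pose proof (Rle_abs M).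
  apply Rle_lt_trans with ((Rabs M + 1) * pw b (Rabs (y - x))); [nra|].
  replace eps with ((Rabs M + 1) * (eps / (Rabs M + 1))) by (field; lra).
  apply Rmult_lt_compat_l; lra.
Qed.

Lemma hol1_cont b M f x : 0 < b -> hol1 b M f -> continuous f x.
Proof. intros Hb H. apply (hol_cont b M f x Hb). intros y. apply H. Qed.

Lemma RI_shift f h a b l : RI f (a + h) (b + h) l -> RI (fun y => f (y + h)) a b l.
Proof.
  intros H. apply (RI_ext (fun y => 1 * f (1 * y + h))).
  - intros y. rewrite !Rmult_1_l. reflexivity.
  - apply (@is_RInt_comp_lin R_NormedModule f 1 h a b l). rewrite !Rmult_1_l. exact H.
Qed.

Lemma RI_periodic g h l : (forall y : R, continuous g y) -> per1 g -> RI g (- PI) PI l ->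
  RI (fun y => g (y + h)) (- PI) PI l.
Proof.
  intros Hc Hp H. apply RI_shift.
  assert (A : RI g (- PI + h) (- PI) (integral g (- PI + h) (- PI))) by (apply RI_continuous; exact Hc).
  assert (B : RI g PI (PI + h) (- integral g (- PI + h) (- PI))).
  { assert (B1 : RI g PI (PI + h) (integral g PI (PI + h))) by (apply RI_continuous; exact Hc).
    replace (- integral g (- PI + h) (- PI)) with (integral g PI (PI + h)); [exact B1|].
    assert (B2 : RI g (- PI) (- PI + h) (integral g PI (PI + h))).
    { apply (RI_ext (fun y => g (y + 2 * PI))); [exact Hp|]. apply RI_shift.
      replace (- PI + 2 * PI) with PI by ring. replace (- PI + h + 2 * PI) with (PI + h) by ring. exact B1. }
    pose proof (RI_chasles _ _ _ _ _ _ A B2) as C.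
    assert (Z : RI g (- PI + h) (- PI + h) 0) by exact (@is_RInt_point R_NormedModule g (- PI + h)).
    pose proof (RI_unique _ _ _ _ _ C Z). lra. }
  pose proof (RI_chasles _ _ _ _ _ _ A (RI_chasles _ _ _ _ _ _ H B)) as C.
  replace l with (integral g (- PI + h) (- PI) + (l + - integral g (- PI + h) (- PI))) by ring. exact C.
Qed.

Definition cnst (k : nat) : R := if Nat.eq_dec k 0 then / (2 * PI) else / PI.
Definition fc (f : R -> R) : coef := fun i k => cnst k * integral (fun y => f y * ebas i k y) (- PI) PI.

Lemma fc_RI (f : R -> R) i k : (forall y : R, continuous f y) ->
  RI (fun y => f y * ebas i k y) (- PI) PI ((if Nat.eq_dec k 0 then 2 * PI else PI) * fc f i k).
Proof.
  intros Hc. pose proof PI_RGT_0. unfold fc, cnst.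
  replace (_ * _) with (integral (fun y => f y * ebas i k y) (- PI) PI).
  - apply RI_continuous. intros y. apply cont_mult; [apply Hc|apply ebas_cont].
  - destruct (Nat.eq_dec k 0); field; lra.
Qed.

Lemma fc_unique f i k l : RI (fun y => f y * ebas i k y) (- PI) PI l -> fc f i k = cnst k * l.
Proof. intros H. unfold fc. f_equal. exact (integral_unique _ _ _ _ H). Qed.

Lemma fc_lin (f g : R -> R) (r : R) i k : (forall y : R, continuous f y) -> (forall y : R, continuous g y) ->
  fc (fun y => f y + r * g y) i k = fc f i k + r * fc g i k.
Proof.
  intros Hf Hg. rewrite (fc_unique _ i k (integral (fun y => f y * ebas i k y) (- PI) PI
     + r * integral (fun y => g y * ebas i k y) (- PI) PI)).
  - unfold fc. ring.
  - apply (RI_ext (fun y => f y * ebas i k y + r * (g y * ebas i k y))); [intros; ring|].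
    apply RI_plus; [|apply RI_scal]; apply RI_continuous; intros y;
    (apply cont_mult; [auto|apply ebas_cont]).
Qed.

Lemma fc_le (f : R -> R) i k (B : R) : (forall y : R, continuous f y) -> (forall y, Rabs (f y) <= B) -> Rabs (fc f i k) <= 2 * B.
Proof.
  intros Hc HB. pose proof PI_RGT_0. assert (B0 : 0 <= B) by (eapply Rle_trans; [apply Rabs_pos|apply (HB 0)]).
  assert (L : Rabs (integral (fun y => f y * ebas i k y) (- PI) PI) <= (PI - - PI) * B).
  { apply (RI_abs_le (fun y => f y * ebas i k y) (fun _ => B) (- PI) PI).
    - lra.
    - intros y _. rewrite Rabs_mult. pose proof (HB y). pose proof (ebas_le1 i k y).
      pose proof (Rabs_pos (f y)). pose proof (Rabs_pos (ebas i k y)). nra.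
    - apply RI_continuous. intros y. apply cont_mult; [apply Hc|apply ebas_cont].
    - apply RI_const. }
  unfold fc. rewrite Rabs_mult.
  assert (C : 0 < cnst k <= / PI).
  { unfold cnst. assert (0 < / PI) by (apply Rinv_0_lt_compat; lra).
    destruct (Nat.eq_dec k 0); [|lra]. rewrite Rinv_mult. lra. }
  rewrite (Rabs_right (cnst k)) by lra.
  apply Rle_trans with (/ PI * ((PI - - PI) * B)).
  - apply Rmult_le_compat; try apply Rabs_pos; lra.
  - right. field. lra.
Qed.

Lemma fc_trig n c i k : (k < n)%nat -> (i = false -> k <> 0%nat) -> fc (trig n c) i k = c i k.
Proof.
  intros Hk Hi. rewrite (fc_unique _ _ _ _ (RI_trig_ebas n c i k Hk)).
  pose proof PI_RGT_0. unfold cnst, nrm. destruct (Nat.eq_dec k 0) as [E|E]; [|field; lra].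
  destruct i; [field; lra|]. exfalso. apply Hi; auto.
Qed.

Lemma fc_sin0 f : fc f false 0%nat = 0.
Proof.
  rewrite (fc_unique f false 0%nat 0); [ring|].
  apply (RI_ext (fun _ => 0)).
  - intros y. unfold ebas. simpl INR. rewrite Rmult_0_l, sin_0. ring.
  - pose proof (RI_const 0 (- PI) PI) as H. rewrite Rmult_0_r in H. exact H.
Qed.

Lemma rsum_first n f : rsum (S n) f = f 0%nat + rsum n (fun k => f (S k)).
Proof. induction n as [|n IH]; [simpl; ring|]. cbn [rsum] in *. rewrite IH. ring. Qed.

Lemma rsum_rev n f : rsum n (fun j => f (n - j)%nat) = rsum n (fun j => f (S j)).
Proof.
  revert f. induction n as [|n IH]; intros f; [reflexivity|].
  rewrite rsum_first. simpl Nat.sub. rewrite IH. simpl. ring.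
Qed.

Definition fejker (n : nat) : coef := fun i k =>
  if i then (if Nat.eq_dec k 0 then 1 else 2) * (1 - INR k / INR n) else 0.

(** The right-hand side is [n] times the Fejer kernel, the left-hand side the squared modulus of
    [1 + e^(iy) + ... + e^(i(n-1)y)]; this is the source of positivity. In the induction the cross
    terms combine to [cos ((n - j) y)]. *)
Lemma sum_cos_sqr n y :
  Rsqr (rsum n (fun j => cos (INR j * y))) + Rsqr (rsum n (fun j => sin (INR j * y)))
  = rsum n (fun k => (if Nat.eq_dec k 0 then 1 else 2) * (INR n - INR k) * cos (INR k * y)).
Proof.
  induction n as [|n IH]; [simpl; unfold Rsqr; ring|].
  transitivity ((Rsqr (rsum n (fun j => cos (INR j * y))) + Rsqr (rsum n (fun j => sin (INR j * y))))
     + 2 * rsum n (fun j => cos (INR (n - j) * y)) + 1).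
  - cbn [rsum]. rewrite !Rsqr_plus. pose proof (sin2_cos2 (INR n * y)) as H.
    replace (rsum n (fun j => cos (INR (n - j) * y)))
      with (rsum n (fun j => cos (INR n * y) * cos (INR j * y)) + rsum n (fun j => sin (INR n * y) * sin (INR j * y))).
    + rewrite !rsum_scal. lra.
    + rewrite <- rsum_plus. apply rsum_ext. intros j Hj. rewrite minus_INR by lia.
      rewrite Rmult_minus_distr_r, cos_minus. ring.
  - rewrite IH, (rsum_rev n (fun j => cos (INR j * y))). cbn [rsum].
    rewrite (rsum_ext n (fun k => (if Nat.eq_dec k 0 then 1 else 2) * (INR (S n) - INR k) * cos (INR k * y))
      (fun k => (if Nat.eq_dec k 0 then 1 else 2) * (INR n - INR k) * cos (INR k * y)
               + (if Nat.eq_dec k 0 then 1 else 2) * cos (INR k * y))).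
    2:{ intros k _. rewrite S_INR. ring. }
    rewrite rsum_plus.
    assert (E : rsum (S n) (fun k => (if Nat.eq_dec k 0 then 1 else 2) * cos (INR k * y))
                = 1 + 2 * rsum n (fun j => cos (INR (S j) * y))).
    { rewrite rsum_first, <- rsum_scal. simpl Nat.eq_dec. cbv iota. simpl (INR 0).
      rewrite Rmult_0_l, cos_0, Rmult_1_l. reflexivity. }
    cbn [rsum] in E.
    set (u := (if Nat.eq_dec n 0 then 1 else 2)) in *.
    replace (u * (INR (S n) - INR n) * cos (INR n * y)) with (u * cos (INR n * y)) by (rewrite S_INR; ring).
    lra.
Qed.

Lemma fejker_nonneg n y : (0 < n)%nat -> 0 <= trig n (fejker n) y.
Proof.
  intros Hn. assert (0 < INR n) by (apply lt_0_INR; exact Hn).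
  replace (trig n (fejker n) y) with (/ INR n * (Rsqr (rsum n (fun j => cos (INR j * y)))
     + Rsqr (rsum n (fun j => sin (INR j * y))))).
  - apply Rmult_le_pos; [left; apply Rinv_0_lt_compat; assumption|].
    apply Rplus_le_le_0_compat; apply Rle_0_sqr.
  - rewrite sum_cos_sqr, <- rsum_scal. apply rsum_ext. intros k _. unfold fejker. field. lra.
Qed.

Definition fmul (n : nat) (k : nat) : R := 1 - INR k / INR n.
Definition fejer (n : nat) (f : R -> R) : R -> R := trig n (mul (fmul n) (fc f)).

Lemma fejer_conv n (f : R -> R) (q : R) : (forall y : R, continuous f y) ->
  RI (fun y => trig n (fejker n) (q - y) * f y) (- PI) PI (2 * PI * fejer n f q).
Proof.
  intros Hf. unfold fejer, trig. rewrite <- rsum_scal.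
  apply (RI_ext (fun y => rsum n (fun k => (fejker n true k * cos (INR k * q)) * (f y * ebas true k y)
      + (fejker n true k * sin (INR k * q)) * (f y * ebas false k y)))).
  - intros y. rewrite (Rmult_comm _ (f y)), <- rsum_scal. apply rsum_ext. intros k _.
    unfold ebas. rewrite Rmult_minus_distr_l, cos_minus.
    replace (fejker n false k) with 0 by reflexivity. ring.
  - apply RI_rsum. intros k _.
    replace (2 * PI * _) with (fejker n true k * cos (INR k * q) * ((if Nat.eq_dec k 0 then 2 * PI else PI) * fc f true k)
       + fejker n true k * sin (INR k * q) * ((if Nat.eq_dec k 0 then 2 * PI else PI) * fc f false k)).
    + apply RI_plus; apply RI_scal; apply fc_RI; exact Hf.
    + unfold fejker, mul, fmul. destruct (Nat.eq_dec k 0); ring.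
Qed.

Lemma fejker_even n y : trig n (fejker n) (- y) = trig n (fejker n) y.
Proof.
  unfold trig. apply rsum_ext. intros k _. replace (INR k * - y) with (- (INR k * y)) by ring.
  rewrite cos_neg. replace (fejker n false k) with 0 by reflexivity. ring.
Qed.

Lemma fejer_conv0 n (f : R -> R) (q : R) : (forall y : R, continuous f y) -> per1 f ->
  RI (fun y => trig n (fejker n) y * f (y + q)) (- PI) PI (2 * PI * fejer n f q).
Proof.
  intros Hf Hp.
  pose proof (RI_periodic _ q _ (fun y => cont_mult _ _ y (trig_minus_cont n (fejker n) q y) (Hf y))
    (fun y => ltac:(cbv beta; rewrite Hp; f_equal;
       replace (q - y) with (q - (y + 2 * PI) + 2 * PI) by ring; symmetry; apply trig_periodic))
    (fejer_conv n f q Hf)) as H.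
  cbv beta in H. eapply RI_ext; [|exact H]. intros y. cbv beta.
  replace (q - (y + q)) with (- y) by ring. rewrite fejker_even. reflexivity.
Qed.

Lemma RI_fejker n : (0 < n)%nat -> RI (trig n (fejker n)) (- PI) PI (2 * PI).
Proof.
  intros Hn. pose proof (RI_trig_ebas n (fejker n) true 0 Hn) as H.
  replace (nrm true 0%nat * fejker n true 0%nat) with (2 * PI) in H.
  - eapply RI_ext; [|exact H]. intros y. unfold ebas. simpl INR. rewrite Rmult_0_l, cos_0. ring.
  - unfold nrm, fejker. simpl. assert (0 < INR n) by (apply lt_0_INR; exact Hn). field. lra.
Qed.

(** The second moment of the kernel, with [1 - cos y] in the role of [y^2]: only the frequencies 0
    and 1 contribute, so the value is exact. *)
Lemma RI_fejker_var n : (2 <= n)%nat ->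
  RI (fun y => trig n (fejker n) y * (1 - cos y)) (- PI) PI (2 * PI / INR n).
Proof.
  intros Hn. assert (0 < INR n) by (apply lt_0_INR; lia).
  pose proof (RI_minus _ _ _ _ _ _ (RI_fejker n ltac:(lia)) (RI_trig_ebas n (fejker n) true 1 ltac:(lia))) as H1.
  replace (2 * PI - nrm true 1%nat * fejker n true 1%nat) with (2 * PI / INR n) in H1.
  - eapply RI_ext; [|exact H1]. intros y. unfold ebas. simpl INR. rewrite Rmult_1_l. ring.
  - unfold nrm, fejker. simpl. field. lra.
Qed.

(* The Fejer kernel is positive with mean one, so averaging against it preserves bounds. *)
Lemma fejer_diff_le n (f f' : R -> R) (r B : R) : (0 < n)%nat -> (forall y : R, continuous f y) -> per1 f ->
  (forall y, continuous f' y) -> per1 f' ->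
  forall q q', (forall y, Rabs (f (y + q) - r * f' (y + q')) <= B) ->
  Rabs (fejer n f q - r * fejer n f' q') <= B.
Proof.
  intros Hn Hf Hp Hf' Hp' q q' HB. apply div_2PI_le. rewrite (Rmult_comm _ B). pose proof PI_RGT_0.
  replace (2 * PI * (fejer n f q - r * fejer n f' q')) with
    (2 * PI * fejer n f q - r * (2 * PI * fejer n f' q')) by ring.
  apply (RI_abs_le (fun y => trig n (fejker n) y * f (y + q) - r * (trig n (fejker n) y * f' (y + q')))
    (fun y => B * trig n (fejker n) y) (- PI) PI); [lra| | |apply RI_scal, RI_fejker; exact Hn].
  - intros y _. replace (_ - _) with (trig n (fejker n) y * (f (y + q) - r * f' (y + q'))) by ring.
    pose proof (fejker_nonneg n y Hn). rewrite Rabs_mult, Rabs_right by lra.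
    rewrite (Rmult_comm B). apply Rmult_le_compat_l; [lra|apply HB].
  - apply RI_minus; [|apply RI_scal]; apply fejer_conv0; assumption.
Qed.

Lemma fejer_hol n b M f : (0 < n)%nat -> 0 < b -> per1 f -> hol1 b M f -> hol1 b M (fejer n f).
Proof.
  intros Hn Hb Hp Hh q q'. replace (fejer n f q - fejer n f q') with (fejer n f q - 1 * fejer n f q') by ring.
  assert (forall y : R, continuous f y) by (intros; apply (hol1_cont b M); assumption).
  apply fejer_diff_le; auto. intros y. rewrite Rmult_1_l.
  replace (q - q') with (y + q - (y + q')) by ring. apply Hh.
Qed.

Lemma fejer_bound n (f : R -> R) (B : R) : (0 < n)%nat -> (forall y : R, continuous f y) -> per1 f ->
  (forall y, Rabs (f y) <= B) -> forall q, Rabs (fejer n f q) <= B.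
Proof.
  intros Hn Hc Hp HB q. replace (fejer n f q) with (fejer n f q - 0 * fejer n f q) by ring.
  apply fejer_diff_le; auto. intros y. rewrite Rmult_0_l, Rminus_0_r. apply HB.
Qed.

(** Near 0 the power is below [eps]; away from 0, [1 - cos y] is bounded below. Convergence of Fejer
    means is thereby reduced to one test function. *)
Lemma pw_quadratic b eps : 0 < b -> 0 < eps ->
  exists C, 0 <= C /\ forall y, Rabs y <= PI -> pw b (Rabs y) <= eps + C * (1 - cos y).
Proof.
  intros Hb He. destruct (pw_small b eps Hb He) as [d [Hd H]].
  pose proof (pw_nonneg b PI).
  assert (0 < / (d * d)) by (apply Rinv_0_lt_compat; nra).
  assert (C0 : 0 <= 18 * pw b PI * / (d * d)) by (apply Rmult_le_pos; lra).
  exists (18 * pw b PI * / (d * d)). split; [exact C0|].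
  intros y Hy. pose proof (one_minus_cos_ge y Hy). pose proof (Rabs_pos y).
  destruct (Rlt_dec (Rabs y) d) as [L|L].
  - specialize (H _ L). assert (0 <= 1 - cos y) by nra. nra.
  - assert (pw b (Rabs y) <= pw b PI) by (apply pw_le; lra).
    assert (d * d <= y * y) by (rewrite <- (Rabs_right (y * y)), Rabs_mult by nra; nra).
    assert (E : pw b PI = 18 * pw b PI * / (d * d) * (d * d / 18)) by (field; lra).
    assert (18 * pw b PI * / (d * d) * (d * d / 18) <= 18 * pw b PI * / (d * d) * (1 - cos y))
      by (apply Rmult_le_compat_l; lra).
    lra.
Qed.

(** A Korovkin argument. The rank [n0] depends on [f] only through [b] and [M], so one rank serves
    all horizontal slices of the data at once. *)
Lemma fejer_cvg b M eps : 0 < b -> 0 <= M -> 0 < eps ->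
  exists n0, (2 <= n0)%nat /\ forall n, (n0 <= n)%nat -> forall f, per1 f -> hol1 b M f ->
    forall q, Rabs (fejer n f q - f q) <= eps.
Proof.
  intros Hb HM He.
  destruct (pw_quadratic b (eps / (2 * (M + 1))) Hb) as [C [C0 HC]].
  { apply Rdiv_lt_0_compat; lra. }
  destruct (INR_unbounded (2 * M * C / eps)) as [N HN].
  exists (N + 2)%nat. split; [lia|]. intros n Hn f Hp Hh q.
  assert (0 < INR n) by (apply lt_0_INR; lia).
  assert (Hc : forall y, continuous f y) by (intros; apply (hol1_cont b M); assumption).
  apply div_2PI_le. pose proof PI_RGT_0.
  assert (HI : RI (fun y => trig n (fejker n) y * (f (y + q) - f q)) (- PI) PI
     (2 * PI * (fejer n f q - f q))).
  { replace (2 * PI * (fejer n f q - f q)) with (2 * PI * fejer n f q - f q * (2 * PI)) by ring.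
    apply (RI_ext (fun y => trig n (fejker n) y * f (y + q) - f q * trig n (fejker n) y)); [intros; ring|].
    apply RI_minus; [apply fejer_conv0; assumption|apply RI_scal, RI_fejker; lia]. }
  apply Rle_trans with ((M * (eps / (2 * (M + 1)))) * (2 * PI) + (M * C) * (2 * PI / INR n)).
  - apply (RI_abs_le (fun y => trig n (fejker n) y * (f (y + q) - f q))
      (fun y => (M * (eps / (2 * (M + 1)))) * trig n (fejker n) y
              + (M * C) * (trig n (fejker n) y * (1 - cos y))) (- PI) PI); [lra| |exact HI|].
    + intros y Hy. pose proof (fejker_nonneg n y ltac:(lia)). rewrite Rabs_mult, Rabs_right by lra.
      assert (Rabs (f (y + q) - f q) <= M * (eps / (2 * (M + 1)) + C * (1 - cos y))).
      { eapply Rle_trans; [apply Hh|]. replace (y + q - q) with y by ring.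
        apply Rmult_le_compat_l; [exact HM|]. apply HC. apply Rabs_le; lra. }
      apply Rle_trans with (trig n (fejker n) y * (M * (eps / (2 * (M + 1)) + C * (1 - cos y))));
        [apply Rmult_le_compat_l; lra|right; ring].
    + apply RI_plus; apply RI_scal; [apply RI_fejker|apply RI_fejker_var]; lia.
  - assert (L1 : M * (eps / (2 * (M + 1))) <= eps / 2).
    { apply Rmult_le_reg_r with (2 * (M + 1)); [lra|].
      replace (M * (eps / (2 * (M + 1))) * (2 * (M + 1))) with (M * eps) by (field; lra).
      nra. }
    assert (L2 : M * C / INR n <= eps / 2).
    { apply Rmult_le_reg_r with (INR n); [assumption|].
      replace (M * C / INR n * INR n) with (M * C) by (field; lra).
      assert (2 * M * C / eps <= INR n).
      { assert (INR N <= INR n) by (apply le_INR; lia). lra. }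
      assert (2 * M * C / eps * eps <= INR n * eps) by (apply Rmult_le_compat_r; lra).
      replace (2 * M * C / eps * eps) with (2 * M * C) in H2 by (field; lra). lra. }
    replace (M * C * (2 * PI / INR n)) with (2 * PI * (M * C / INR n)) by (field; lra).
    nra.
Qed.

Lemma fourier_unique b M f : 0 < b -> 0 <= M -> per1 f -> hol1 b M f ->
  (forall i k, fc f i k = 0) -> forall q, f q = 0.
Proof.
  intros Hb HM Hp Hh Hz q. destruct (Req_dec (f q) 0) as [E|N]; [exact E|exfalso].
  assert (P : 0 < Rabs (f q)) by (apply Rabs_pos_lt; exact N).
  destruct (fejer_cvg b M (Rabs (f q) / 2) Hb HM ltac:(lra)) as [n [_ H]].
  specialize (H n (le_n n) f Hp Hh q).
  replace (fejer n f q) with 0 in H.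
  - rewrite Rminus_0_l, Rabs_Ropp in H. lra.
  - unfold fejer. rewrite (trig_ext n _ (mul (fun _ => 0) (fc f))).
    + rewrite trig_zero_mul. reflexivity.
    + intros i k _. unfold mul. rewrite Hz. ring.
Qed.

(** * Hoelder estimates by Poisson regularisation *)

Definition fam : Type := bool -> nat -> R -> R.
Definition at_ (G : fam) (s : R) : coef := fun i k => G i k s.
(** Differentiation in [q] exchanges a function and its conjugate, so bounds are stated for both,
    indexed by [j]. *)
Definition cj (j : bool) (c : coef) : coef := if j then conj c else c.
Definition pexp (x : R) (k : nat) : R := exp (- (INR k * x)).

Lemma conj_cj j c : exists e, (e = 1 \/ e = -1) /\
  forall i k, conj (cj j c) i k = e * cj (negb j) c i k.
Proof.
  destruct j; [exists (-1)|exists 1]; (split; [auto|]); intros i k; unfold cj, conj, negb; destruct i; ring.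
Qed.

(* [G] takes values in trigonometric polynomials of degree [< n].  After smoothing with the
   Poisson kernel at scale [d], its gradient blows up at most like [d^(b-1)]. *)
Definition block (n : nat) (b M l r : R) (G : fam) : Prop :=
  exists G' : fam,
    (forall i k s, l < s < r -> is_derive (G i k) s (G' i k s)) /\
    (forall i k s, l <= s <= r -> continuous (G i k) s) /\
    (forall j s d, l <= s <= r -> 0 < d <= 1 ->
       bnd n (mul (kexp d) (cj j (at_ G s))) (M * Rpower d (b - 1))) /\
    (forall j s, l <= s <= r -> bnd n (mul (pexp 1) (cj j (at_ G s))) M) /\
    (forall j s d, l < s < r -> 0 < d <= 1 ->
       bnd n (mul (pexp d) (cj j (at_ G' s))) (M * Rpower d (b - 1))).

Lemma bnd_scal n c B r : bnd n c B -> bnd n (mul (fun _ => r) c) (Rabs r * B).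
Proof. intros H q. rewrite trig_scal, Rabs_mult. apply Rmult_le_compat_l; [apply Rabs_pos|apply H]. Qed.

Lemma bnd_add n c d B1 B2 : bnd n c B1 -> bnd n d B2 -> bnd n (cadd c d) (B1 + B2).
Proof.
  intros H1 H2 q. rewrite trig_add. eapply Rle_trans; [apply Rabs_triang|].
  apply Rplus_le_compat; auto.
Qed.

Lemma bnd_weaken n c B B' : B <= B' -> bnd n c B -> bnd n c B'.
Proof. intros H1 H2 q. eapply Rle_trans; [apply H2|exact H1]. Qed.

Lemma block_weaken n b M M' l r G : M <= M' -> block n b M l r G -> block n b M' l r G.
Proof.
  intros HM [G' [H1 [H2 [H3 [H4 H5]]]]]. exists G'. split; [exact H1|]. split; [exact H2|].
  split; [|split].
  - intros j s d Hs Hd. eapply bnd_weaken; [|apply H3; assumption].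
    apply Rmult_le_compat_r; [left; apply Rpower_pos|exact HM].
  - intros j s Hs. eapply bnd_weaken; [exact HM|]. apply H4; assumption.
  - intros j s d Hs Hd. eapply bnd_weaken; [|apply H5; assumption].
    apply Rmult_le_compat_r; [left; apply Rpower_pos|exact HM].
Qed.

Lemma block_comb n b M1 M2 l r G1 G2 e1 e2 : block n b M1 l r G1 -> block n b M2 l r G2 ->
  block n b (Rabs e1 * M1 + Rabs e2 * M2) l r (fun i k s => e1 * G1 i k s + e2 * G2 i k s).
Proof.
  intros [G1' [A1 [A2 [A3 [A4 A5]]]]] [G2' [C1 [C2 [C3 [C4 C5]]]]].
  assert (E : forall m j s (H1 H2 : fam) B1 B2, bnd n (mul m (cj j (at_ H1 s))) B1 ->
     bnd n (mul m (cj j (at_ H2 s))) B2 ->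
     bnd n (mul m (cj j (at_ (fun i k s => e1 * H1 i k s + e2 * H2 i k s) s))) (Rabs e1 * B1 + Rabs e2 * B2)).
  { intros m j s H1 H2 B1 B2 HB1 HB2.
    apply (bnd_ext n (cadd (mul (fun _ => e1) (mul m (cj j (at_ H1 s))))
                           (mul (fun _ => e2) (mul m (cj j (at_ H2 s)))))).
    - intros i k _. destruct j, i; unfold cadd, mul, cj, conj, at_; ring.
    - apply bnd_add; apply bnd_scal; assumption. }
  exists (fun i k s => e1 * G1' i k s + e2 * G2' i k s).
  split; [|split; [|split; [|split]]].
  - intros i k s Hs. apply D_plus; apply D_scal; auto.
  - intros i k s Hs. apply cont_plus; (apply cont_mult; [apply continuous_const|auto]).
  - intros j s d Hs Hd. rewrite Rmult_plus_distr_r, !Rmult_assoc. apply E; auto.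
  - intros j s Hs. apply E; auto.
  - intros j s d Hs Hd. rewrite Rmult_plus_distr_r, !Rmult_assoc. apply E; auto.
Qed.

Lemma pexp_0 k : pexp 0 k = 1.
Proof. unfold pexp. rewrite Rmult_0_r, Ropp_0. apply exp_0. Qed.

Lemma is_derive_pexp n c q d : is_derive (fun d => trig n (mul (pexp d) c) q) d
   (trig n (mul (fun k => - kexp d k) c) q).
Proof.
  apply (is_derive_trig_mul n c (fun k x => pexp x k) (fun k x => - kexp x k)).
  intros k. unfold pexp, kexp. auto_derive; [exact I|ring].
Qed.

Lemma trig_mul_opp n m c q : trig n (mul (fun k => - m k) c) q = - trig n (mul m c) q.
Proof.
  replace (- trig n (mul m c) q) with (-1 * trig n (mul m c) q) by ring.
  rewrite <- trig_scal. apply trig_ext. intros; unfold mul; ring.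
Qed.

(** The gradient bound is integrated in the height from 0 to [d]; [d^(b-1)] is integrable because
    [b > 0]. *)
Lemma poisson_step n b M c q : 0 < b -> (forall d, 0 < d <= 1 -> bnd n (mul (kexp d) c) (M * Rpower d (b - 1))) ->
  forall d, 0 <= d <= 1 -> Rabs (trig n (mul (pexp d) c) q - trig n c q) <= M / b * pw b d.
Proof.
  intros Hb H d Hd.
  replace (trig n c q) with (trig n (mul (pexp 0) c) q).
  2:{ apply trig_ext. intros i k _. unfold mul. rewrite pexp_0. ring. }
  replace (M / b * pw b d) with (M / b * pw b d - M / b * pw b 0) by (rewrite (pw_0 b 0) by lra; ring).
  apply (compare_derive (fun d => trig n (mul (pexp d) c) q) (fun d => M / b * pw b d)
    (fun d => trig n (mul (fun k => - kexp d k) c) q) (fun d => M / b * (b * Rpower d (b - 1)))).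
  - lra.
  - intros x _. apply is_derive_pexp.
  - intros x Hx. apply D_scal. apply is_derive_pw. lra.
  - intros x _. exact (derive_cont _ _ _ (is_derive_pexp n c q x)).
  - intros x _. apply cont_mult; [apply continuous_const|apply pw_continuous; exact Hb].
  - intros x Hx. rewrite trig_mul_opp, Rabs_Ropp.
    replace (M / b * (b * Rpower x (b - 1))) with (M * Rpower x (b - 1)) by (field; lra).
    apply H. lra.
Qed.

Lemma block_sup n b M l r G j s q : 0 < b -> block n b M l r G -> l <= s <= r ->
  Rabs (trig n (cj j (at_ G s)) q) <= (1 + / b) * M.
Proof.
  intros Hb [G' [H1 [H2 [H3 [H4 H5]]]]] Hs.
  pose proof (poisson_step n b M (cj j (at_ G s)) q Hb (fun d Hd => H3 j s d Hs Hd) 1 ltac:(lra)) as S.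
  pose proof (H4 j s Hs q) as T.
  assert (E : pw b 1 = 1).
  { rewrite pw_Rpower by lra. unfold Rpower. rewrite ln_1, Rmult_0_r. apply exp_0. }
  rewrite E in S. rewrite Rabs_minus_sym in S.
  replace (trig n (cj j (at_ G s)) q) with
    ((trig n (cj j (at_ G s)) q - trig n (mul (pexp 1) (cj j (at_ G s))) q)
     + trig n (mul (pexp 1) (cj j (at_ G s))) q) by ring.
  eapply Rle_trans; [apply Rabs_triang|]. unfold Rdiv in S. lra.
Qed.

(** For [d <= 1] the hypothesis combines two smoothing errors and one Lipschitz bound, all of order
    [d^b]. For [d > 1] twice the sup bound suffices. *)
Lemma hol_of_small b M D B d : 0 < b -> 0 <= M -> 0 <= d -> D <= 2 * ((1 + / b) * M) -> B = (2 + 2 * / b) * M ->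
  (0 < d <= 1 -> D <= 2 * (M / b * pw b d) + M * Rpower d (b - 1) * d) -> (d = 0 -> D <= 0) -> D <= B * pw b d.
Proof.
  intros Hb HM Hd HD -> H H0.
  assert (0 < / b) by (apply Rinv_0_lt_compat; exact Hb).
  destruct (Req_dec d 0) as [E|N].
  - rewrite pw_0 by lra. rewrite Rmult_0_r. auto.
  - destruct (Rle_dec d 1).
    + specialize (H ltac:(lra)). pose proof (pw_nonneg b d).
      assert (E : Rpower d (b - 1) * d = pw b d).
      { rewrite pw_Rpower by lra. rewrite <- (Rpower_1 d) at 2 by lra. rewrite <- Rpower_plus. f_equal; ring. }
      rewrite Rmult_assoc, E in H. unfold Rdiv in H. nra.
    + pose proof (pw_ge_1 b d ltac:(lra) ltac:(lra)).
      assert (0 <= (2 + 2 * / b) * M) by (apply Rmult_le_pos; lra). nra.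
Qed.

(** Both values are smoothed at height [d = |q - q'|]: each smoothing error is at most [M/b d^b],
    and the smoothed function has slope at most [M d^(b-1)]. The slope in [q] involves [conj], which
    is why [block] quantifies over [j]. *)
Lemma block_hol_q n b M l r G j s q q' : 0 < b -> 0 <= M -> block n b M l r G -> l <= s <= r ->
  Rabs (trig n (cj j (at_ G s)) q - trig n (cj j (at_ G s)) q') <= (2 + 2 * / b) * M * pw b (Rabs (q - q')).
Proof.
  intros Hb HM HG Hs.
  pose proof (block_sup n b M l r G j s q Hb HG Hs) as S1.
  pose proof (block_sup n b M l r G j s q' Hb HG Hs) as S2.
  destruct HG as [G' [H1 [H2 [H3 [H4 H5]]]]].
  set (c := cj j (at_ G s)) in *.
  apply (hol_of_small b M); auto using Rabs_pos.
  - unfold Rminus. eapply Rle_trans; [apply Rabs_triang|]. rewrite Rabs_Ropp. lra.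
  - set (d := Rabs (q - q')). intros Hd.
    pose proof (poisson_step n b M c q Hb (fun d Hd => H3 j s d Hs Hd) d ltac:(lra)) as P1.
    pose proof (poisson_step n b M c q' Hb (fun d Hd => H3 j s d Hs Hd) d ltac:(lra)) as P2.
    assert (P3 : Rabs (trig n (mul (pexp d) c) q - trig n (mul (pexp d) c) q') <= M * Rpower d (b - 1) * d).
    { unfold d at 4. apply (lipschitz_derive_R (trig n (mul (pexp d) c))
        (fun q => trig n (mul INR (conj (mul (pexp d) c))) q)).
      - intros x. apply is_derive_trig.
      - intros x. destruct (conj_cj j (at_ G s)) as [e [He E]].
        rewrite (trig_ext n _ (mul (fun _ => e) (mul (kexp d) (cj (negb j) (at_ G s))))).
        + rewrite trig_scal, Rabs_mult. pose proof (H3 (negb j) s d Hs Hd x).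
          destruct He as [->| ->]; [rewrite Rabs_R1|rewrite Rabs_m1]; lra.
        + intros i k _. fold c in E. transitivity (kexp d k * conj c i k).
          * unfold mul, conj, kexp, pexp. destruct i; ring.
          * rewrite E. unfold mul. ring. }
    apply Rabs_le_between in P1, P2, P3. apply Rabs_le. lra.
  - intros E. assert (q = q') as ->.
    { destruct (Req_dec q q'); [assumption|]. exfalso. apply (Rabs_no_R0 (q - q')); lra. }
    rewrite Rminus_diag, Rabs_R0. lra.
Qed.

(** As in [q], with smoothing still in [q] at height [d = s' - s]; the slope in [s] is controlled by
    the bound on [G']. *)
Lemma block_hol_s_aux n b M l r G j s s' q : 0 < b -> 0 <= M -> block n b M l r G -> l <= s -> s <= s' -> s' <= r ->
  Rabs (trig n (cj j (at_ G s')) q - trig n (cj j (at_ G s)) q) <= (2 + 2 * / b) * M * pw b (s' - s).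
Proof.
  intros Hb HM HG Hl Hs Hr.
  pose proof (block_sup n b M l r G j s q Hb HG ltac:(lra)) as S1.
  pose proof (block_sup n b M l r G j s' q Hb HG ltac:(lra)) as S2.
  destruct HG as [G' [H1 [H2 [H3 [H4 H5]]]]].
  apply (hol_of_small b M); auto; [lra| | |].
  - unfold Rminus. eapply Rle_trans; [apply Rabs_triang|]. rewrite Rabs_Ropp. lra.
  - set (d := s' - s). intros Hd.
    pose proof (poisson_step n b M (cj j (at_ G s)) q Hb (fun d Hd => H3 j s d ltac:(lra) Hd) d ltac:(lra)) as P1.
    pose proof (poisson_step n b M (cj j (at_ G s')) q Hb (fun d Hd => H3 j s' d ltac:(lra) Hd) d ltac:(lra)) as P2.
    assert (P3 : Rabs (trig n (mul (pexp d) (cj j (at_ G s'))) q - trig n (mul (pexp d) (cj j (at_ G s))) q)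
                 <= M * Rpower d (b - 1) * d).
    { unfold d at 4. apply (lipschitz_derive (fun s => trig n (mul (pexp d) (cj j (at_ G s))) q)
        (fun s => trig n (mul (pexp d) (cj j (at_ G' s))) q)); [lra| | |].
      - intros x Hx. unfold trig. apply is_derive_rsum. intros k _.
        unfold mul, cj, conj, at_. destruct j; apply D_plus; apply D_scal_r; apply D_scal; try apply H1; try lra.
        apply (D_ext (fun y => -1 * G true k y)); [intros; ring|].
        apply (D_eq _ _ (-1 * G' true k x)); [ring|]. apply D_scal. apply H1; lra.
      - intros x Hx. unfold trig. apply continuous_rsum. intros k _.
        unfold mul, cj, conj, at_. destruct j; apply cont_plus;
          (apply cont_mult; [apply cont_mult; [apply continuous_const|]|apply continuous_const]);
          try (apply H2; lra).
        apply (continuous_opp (G true k)). apply H2; lra.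
      - intros x Hx. apply H5; lra. }
    apply Rabs_le_between in P1, P2, P3. apply Rabs_le. lra.
  - intros E. assert (s = s') as -> by lra. rewrite Rminus_diag, Rabs_R0. lra.
Qed.

Lemma block_hol_s n b M l r G j s s' q : 0 < b -> 0 <= M -> block n b M l r G -> l <= s <= r -> l <= s' <= r ->
  Rabs (trig n (cj j (at_ G s)) q - trig n (cj j (at_ G s')) q) <= (2 + 2 * / b) * M * pw b (Rabs (s - s')).
Proof.
  intros Hb HM HG Hs Hs'. destruct (Rle_dec s s').
  - rewrite Rabs_minus_sym, (Rabs_minus_sym s), (Rabs_right (s' - s)) by lra.
    apply (block_hol_s_aux n b M l r); auto; lra.
  - rewrite (Rabs_right (s - s')) by lra. apply (block_hol_s_aux n b M l r); auto; lra.
Qed.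

Lemma hol_cj_grad n c b M x j : 0 < b < 1 -> 0 <= M -> 0 < x -> hol n c b M ->
  bnd n (mul (kexp x) (cj j c)) (12 / (1 - b) * M * Rpower x (b - 1)).
Proof. intros. destruct (poisson_grad_hol n c b M x) as [A B]; auto. destruct j; assumption. Qed.

Lemma hol_cj_grad2 n c b M x j : 0 < b < 1 -> 0 <= M -> 0 < x -> hol n c b M ->
  bnd n (mul (k2exp x) (cj j c)) (48 / (1 - b) * M * Rpower x (b - 2)).
Proof. intros. destruct (poisson_grad2_hol n c b M x) as [A B]; auto. destruct j; assumption. Qed.

Lemma Rpower_le_1 x e : 1 <= x -> e <= 0 -> Rpower x e <= 1.
Proof.
  intros Hx He. unfold Rpower. rewrite <- exp_0.
  assert (0 <= ln x) by (rewrite <- ln_1; apply ln_le; lra).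
  destruct (Req_dec (e * ln x) 0) as [->|N]; [lra|]. left. apply exp_increasing. nra.
Qed.

(* Solutions [exp (-k d)] of the homogeneous equation, [d] being the distance to a line. *)
Lemma block_exp n K b M B l r c u v : 0 < b < 1 -> 0 <= M -> 0 <= B ->
  (u = 1 \/ u = -1) -> (forall s, l <= s <= r -> 0 <= u * s + v) ->
  highfreq K c -> opn K (fun k => / INR k) 1 -> (1 <= K)%nat ->
  hol n c b M -> bnd n c B ->
  block n b (12 / (1 - b) * M + B) l r (fun i k s => pexp (u * s + v) k * c i k).
Proof.
  intros Hb HM HB Hu Hv Hc HK HK1 Hh Hbd.
  assert (C0 : 0 <= 12 / (1 - b) * M).
  { apply Rmult_le_pos; [|exact HM]. apply Rlt_le, Rdiv_lt_0_compat; lra. }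
  assert (L : forall j s d, l <= s <= r -> 0 < d ->
     bnd n (mul (kexp (d + (u * s + v))) (cj j c)) ((12 / (1 - b) * M + B) * Rpower d (b - 1))).
  { intros j s d Hs Hd. specialize (Hv s Hs).
    eapply bnd_weaken; [|apply (hol_cj_grad n c b M); auto; lra].
    apply Rmult_le_compat; [exact C0|left; apply Rpower_pos|lra|apply Rpower_decr; lra]. }
  assert (E : forall j s m m', (forall k, m k * pexp (u * s + v) k = m' k) ->
     forall i k, mul m (cj j (at_ (fun i k s => pexp (u * s + v) k * c i k) s)) i k = mul m' (cj j c) i k).
  { intros j s m m' Hm i k. unfold mul. rewrite <- Hm. destruct j, i; unfold cj, conj, at_; ring. }
  assert (Eexp : forall d s k, kexp d k * pexp (u * s + v) k = kexp (d + (u * s + v)) k).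
  { intros d s k. unfold kexp, pexp. rewrite Rmult_assoc, <- exp_plus. do 2 f_equal. ring. }
  exists (fun i k s => - u * kexp (u * s + v) k * c i k).
  split; [|split; [|split; [|split]]].
  - intros i k s Hs. unfold pexp, kexp. auto_derive; [exact I|ring].
  - intros i k s Hs. apply (derive_cont _ _ (- u * kexp (u * s + v) k * c i k)).
    unfold pexp, kexp. auto_derive; [exact I|ring].
  - intros j s d Hs Hd. eapply bnd_ext; [|apply (L j s d Hs); lra].
    intros i k _. symmetry. apply (E j s). intros k'. apply Eexp.
  - intros j s Hs. specialize (Hv s Hs).
    (* [exp (-k h) c] is read as [k exp (-k h)] applied to [c / k], so that the bound also covers
       [conj c], which the sup norm of [c] does not control. *)
    destruct (poisson_grad n (mul (fun k => / INR k) c) (1 * B) (1 + (u * s + v)) ltac:(lra)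
       (HK n c B Hc Hbd)) as [P Q].
    assert (W : 1 * B / (1 + (u * s + v)) <= 12 / (1 - b) * M + B).
    { apply Rle_trans with B; [|lra]. rewrite Rmult_1_l.
      apply Rmult_le_reg_r with (1 + (u * s + v)); [lra|].
      replace (B / (1 + (u * s + v)) * (1 + (u * s + v))) with B by (field; lra). nra. }
    eapply bnd_weaken; [exact W|].
    assert (F : forall i k, mul (kexp (1 + (u * s + v))) (cj j (mul (fun k => / INR k) c)) i k
       = mul (pexp 1) (cj j (at_ (fun i k s => pexp (u * s + v) k * c i k) s)) i k).
    { intros i k. rewrite (E j s (pexp 1) (pexp (1 + (u * s + v)))).
      2:{ intros k'. unfold pexp. rewrite <- exp_plus. f_equal. ring. }
      unfold mul, kexp, pexp. destruct (Nat.eq_dec k 0) as [->|N].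
      - destruct j, i; unfold cj, conj; rewrite !Hc by lia; ring.
      - assert (INR k <> 0) by (apply not_0_INR; exact N).
        destruct j, i; unfold cj, conj; field; assumption. }
    destruct j; (eapply bnd_ext; [intros i k _; apply F|]); assumption.
  - intros j s d Hs Hd.
    assert (S : bnd n (mul (fun _ => - u) (mul (kexp (d + (u * s + v))) (cj j c)))
       (Rabs (- u) * ((12 / (1 - b) * M + B) * Rpower d (b - 1)))).
    { apply bnd_scal, L; lra. }
    assert (Rabs (- u) = 1) as EU.
    { rewrite Rabs_Ropp. destruct Hu as [->| ->]; [apply Rabs_R1|apply Rabs_m1]. }
    rewrite EU, Rmult_1_l in S. eapply bnd_ext; [|exact S].
    intros i k _. unfold mul. rewrite <- Eexp. unfold kexp, pexp.
    destruct j, i; unfold cj, conj, at_; ring.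
Qed.

(** * Duhamel integrals *)

(** Integrability against every continuous weight, the property kept when the data of the two layers
    are glued with a possible jump at 0. *)
Definition pint (f : R -> R) : Prop := forall g a b, (forall x, continuous g x) ->
  RI (fun t => g t * f t) a b (integral (fun t => g t * f t) a b).

Definition glue (f1 f2 : R -> R) (t : R) : R := if Rle_dec t 0 then f1 t else f2 t.

Lemma pint_glue f1 f2 : (forall x, continuous f1 x) -> (forall x, continuous f2 x) -> pint (glue f1 f2).
Proof.
  intros C1 C2 g a b Cg.
  apply (@RInt_correct R_CompleteNormedModule).
  assert (H : forall c, @ex_RInt R_NormedModule (fun t => g t * glue f1 f2 t) 0 c).
  { intros c. destruct (Rle_dec c 0).
    - apply (@ex_RInt_ext R_NormedModule (fun t => g t * f1 t)).
      + rewrite Rmin_right, Rmax_left by lra. intros x Hx. unfold glue. destruct (Rle_dec x 0); [reflexivity|lra].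
      + apply (@ex_RInt_continuous R_CompleteNormedModule). intros; apply cont_mult; auto.
    - apply (@ex_RInt_ext R_NormedModule (fun t => g t * f2 t)).
      + rewrite Rmin_left, Rmax_right by lra. intros x Hx. unfold glue. destruct (Rle_dec x 0); [lra|reflexivity].
      + apply (@ex_RInt_continuous R_CompleteNormedModule). intros; apply cont_mult; auto. }
  apply (@ex_RInt_Chasles R_NormedModule _ a 0 b); [apply ex_RInt_swap|]; apply H.
Qed.

Lemma glue_cont_neg f1 f2 s : s < 0 -> continuous f1 s -> continuous (glue f1 f2) s.
Proof.
  intros Hs C. apply (continuous_ext_loc _ f1); [|exact C].
  exists (mkposreal (- s) ltac:(lra)). intros y Hy. change (Rabs (y - s) < - s) in Hy.
  apply Rabs_lt_between in Hy. unfold glue. destruct (Rle_dec y 0); [reflexivity|lra].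
Qed.

Lemma glue_cont_pos f1 f2 s : 0 < s -> continuous f2 s -> continuous (glue f1 f2) s.
Proof.
  intros Hs C. apply (continuous_ext_loc _ f2); [|exact C].
  exists (mkposreal s Hs). intros y Hy. change (Rabs (y - s) < s) in Hy.
  apply Rabs_lt_between in Hy. unfold glue. destruct (Rle_dec y 0); [lra|reflexivity].
Qed.

(* One-sided Duhamel integrals [int_lo^s exp (-k (s-t)) f t dt] and [int_s^hi exp (-k (t-s)) f t dt]. *)
Definition Dp (lo : R) (f : R -> R) (k : nat) (s : R) : R :=
  exp (- (INR k * s)) * integral (fun t => exp (INR k * t) * f t) lo s.
Definition Dm (hi : R) (f : R -> R) (k : nat) (s : R) : R :=
  exp (INR k * s) * integral (fun t => exp (- (INR k * t)) * f t) s hi.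

Lemma expk_cont a x : continuous (fun t => exp (a * t)) x.
Proof. apply @ex_derive_continuous. auto_derive. exact I. Qed.
Lemma expmk_cont a x : continuous (fun t => exp (- (a * t))) x.
Proof. apply @ex_derive_continuous. auto_derive. exact I. Qed.

Lemma integral_cont_r f g lo s : pint f -> (forall x, continuous g x) ->
  continuous (fun s => integral (fun t => g t * f t) lo s) s.
Proof.
  intros Hf Hg. apply (@continuous_RInt_1 R_CompleteNormedModule (fun t => g t * f t) lo s).
  exists (mkposreal 1 Rlt_0_1). intros z _. apply Hf. exact Hg.
Qed.

Lemma integral_swap f g a b : pint f -> (forall x, continuous g x) ->
  integral (fun t => g t * f t) a b = - integral (fun t => g t * f t) b a.
Proof.
  intros Hf Hg. apply integral_unique. apply (@is_RInt_swap R_NormedModule). apply Hf. exact Hg.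
Qed.

Lemma integral_derive_r f g lo (s : R) : pint f -> (forall x, continuous g x) -> continuous f s ->
  is_derive (fun s => integral (fun t => g t * f t) lo s) s (g s * f s).
Proof.
  intros Hf Hg Hc. apply (@is_derive_RInt R_NormedModule (fun t => g t * f t) _ lo s).
  - exists (mkposreal 1 Rlt_0_1). intros z _. apply Hf. exact Hg.
  - apply cont_mult; auto.
Qed.

Lemma Dp_cont lo f k s : pint f -> continuous (Dp lo f k) s.
Proof.
  intros Hf. apply cont_mult; [apply expmk_cont|]. apply integral_cont_r; [exact Hf|].
  intros; apply expk_cont.
Qed.

Lemma Dp_derive lo f k (s : R) : pint f -> continuous f s ->
  is_derive (Dp lo f k) s (f s - INR k * Dp lo f k s).
Proof.
  intros Hf Hc.
  apply (D_eq _ _ (- INR k * exp (- (INR k * s)) * integral (fun t => exp (INR k * t) * f t) lo s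
    + exp (- (INR k * s)) * (exp (INR k * s) * f s))).
  - unfold Dp. pose proof (exp_mult_opp (INR k * s)) as E.
    replace (exp (- (INR k * s)) * (exp (INR k * s) * f s)) with (exp (INR k * s) * exp (- (INR k * s)) * f s) by ring.
    rewrite E. ring.
  - apply (D_mult (fun s => exp (- (INR k * s))) (fun s => integral (fun t => exp (INR k * t) * f t) lo s) s
      (- INR k * exp (- (INR k * s))) (exp (INR k * s) * f s)).
    + auto_derive; [exact I|simpl; ring].
    + apply (integral_derive_r f (fun t => exp (INR k * t))); auto. intros; apply expk_cont.
Qed.

Lemma Dm_alt hi f k s : pint f -> Dm hi f k s = - exp (INR k * s) * integral (fun t => exp (- (INR k * t)) * f t) hi s.
Proof.
  intros Hf. unfold Dm. rewrite integral_swap; [ring|exact Hf|]. intros; apply expmk_cont.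
Qed.

Lemma Dm_cont hi f k s : pint f -> continuous (Dm hi f k) s.
Proof.
  intros Hf. apply (continuous_ext (fun s => - exp (INR k * s) * integral (fun t => exp (- (INR k * t)) * f t) hi s)).
  - intros x. symmetry. apply Dm_alt. exact Hf.
  - apply cont_mult; [|apply integral_cont_r; [exact Hf|intros; apply expmk_cont]].
    apply @ex_derive_continuous. auto_derive. exact I.
Qed.

Lemma Dm_derive hi f k (s : R) : pint f -> continuous f s ->
  is_derive (Dm hi f k) s (INR k * Dm hi f k s - f s).
Proof.
  intros Hf Hc.
  apply (D_ext (fun s => - exp (INR k * s) * integral (fun t => exp (- (INR k * t)) * f t) hi s)).
  { intros x. symmetry. apply Dm_alt. exact Hf. }
  apply (D_eq _ _ (- INR k * exp (INR k * s) * integral (fun t => exp (- (INR k * t)) * f t) hi s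
    + - exp (INR k * s) * (exp (- (INR k * s)) * f s))).
  - rewrite Dm_alt by exact Hf. pose proof (exp_mult_opp (INR k * s)) as E.
    replace (- exp (INR k * s) * (exp (- (INR k * s)) * f s)) with (- (exp (INR k * s) * exp (- (INR k * s)) * f s)) by ring.
    rewrite E. ring.
  - apply (D_mult (fun s => - exp (INR k * s)) (fun s => integral (fun t => exp (- (INR k * t)) * f t) hi s) s
      (- INR k * exp (INR k * s)) (exp (- (INR k * s)) * f s)).
    + auto_derive; [exact I|simpl; ring].
    + apply (integral_derive_r f (fun t => exp (- (INR k * t)))); auto. intros; apply expmk_cont.
Qed.

(** Exchanges the finite Fourier sum with the integral in [t]. The exponential is factored so that
    only [exp (w2 k * t)] remains under the integral; [G] holds the resulting constants and is read
    at 0 merely to have the type of a family. *)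
Lemma RI_trig_duhamel n (c : fam) m j q a b (G : fam) (w1 w2 : nat -> R) :
  (forall i k, RI (fun t => exp (w2 k * t) * c i k t) a b (G i k 0)) ->
  RI (fun t => trig n (mul (fun k => m k * (w1 k * exp (w2 k * t))) (cj j (at_ c t))) q) a b
     (trig n (mul (fun k => m k * w1 k) (cj j (at_ G 0))) q).
Proof.
  intros HG. unfold trig. apply RI_rsum. intros k _. unfold mul, cj, conj, at_.
  destruct j.
  - replace (_ + _) with (m k * w1 k * cos (INR k * q) * G false k 0 - m k * w1 k * sin (INR k * q) * G true k 0) by ring.
    apply (RI_ext (fun t => (m k * w1 k * cos (INR k * q)) * (exp (w2 k * t) * c false k t)
       - (m k * w1 k * sin (INR k * q)) * (exp (w2 k * t) * c true k t))); [intros; ring|].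
    apply RI_minus; apply RI_scal; apply HG.
  - replace (_ + _) with (m k * w1 k * cos (INR k * q) * G true k 0 + m k * w1 k * sin (INR k * q) * G false k 0) by ring.
    apply (RI_ext (fun t => (m k * w1 k * cos (INR k * q)) * (exp (w2 k * t) * c true k t)
       + (m k * w1 k * sin (INR k * q)) * (exp (w2 k * t) * c false k t))); [intros; ring|].
    apply RI_plus; apply RI_scal; apply HG.
Qed.

Lemma RI_trig_Dp n (c : fam) m j q lo s : (forall i k, pint (c i k)) ->
  RI (fun t => trig n (mul (fun k => m k * (INR k * pexp (s - t) k)) (cj j (at_ c t))) q) lo s
     (trig n (mul m (cj j (at_ (fun i k s => INR k * Dp lo (c i k) k s) s))) q).
Proof.
  intros Hc.
  pose proof (RI_trig_duhamel n c m j q lo s (fun i k _ => integral (fun t => exp (INR k * t) * c i k t) lo s)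
    (fun k => INR k * exp (- (INR k * s))) INR
    (fun i k => Hc i k _ _ _ (fun x => expk_cont (INR k) x))) as H.
  match goal with |- RI _ _ _ ?v => match type of H with RI _ _ _ ?w => replace v with w end end.
  - eapply RI_ext; [|exact H]. intros t. apply trig_ext. intros i k _. unfold mul, pexp.
    rewrite (Rmult_assoc (INR k)), <- exp_plus. do 4 f_equal. ring.
  - apply trig_ext. intros i k _. unfold mul, Dp. destruct j, i; unfold cj, conj, at_; ring.
Qed.

Lemma RI_trig_Dm n (c : fam) m j q hi s : (forall i k, pint (c i k)) ->
  RI (fun t => trig n (mul (fun k => m k * (INR k * pexp (t - s) k)) (cj j (at_ c t))) q) s hi
     (trig n (mul m (cj j (at_ (fun i k s => INR k * Dm hi (c i k) k s) s))) q).
Proof.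
  intros Hc.
  assert (H0 : forall i k, RI (fun t => exp (- INR k * t) * c i k t) s hi
      (integral (fun t => exp (- (INR k * t)) * c i k t) s hi)).
  { intros i k. apply (RI_ext (fun t => exp (- (INR k * t)) * c i k t)).
    - intros t. rewrite Ropp_mult_distr_l. reflexivity.
    - apply Hc. intros x; apply expmk_cont. }
  pose proof (RI_trig_duhamel n c m j q s hi (fun i k _ => integral (fun t => exp (- (INR k * t)) * c i k t) s hi)
    (fun k => INR k * exp (INR k * s)) (fun k => - INR k) H0) as H.
  match goal with |- RI _ _ _ ?v => match type of H with RI _ _ _ ?w => replace v with w end end.
  - eapply RI_ext; [|exact H]. intros t. apply trig_ext. intros i k _. unfold mul, pexp.
    rewrite (Rmult_assoc (INR k)), <- exp_plus. do 4 f_equal. ring.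
  - apply trig_ext. intros i k _. unfold mul, Dm. destruct j, i; unfold cj, conj, at_; ring.
Qed.

Lemma RI_reflect f a s l : RI f 0 (s - a) l -> RI (fun t => f (s - t)) a s l.
Proof.
  intros H.
  assert (H1 : RI (fun t => -1 * f (-1 * t + s)) a s (- l)).
  { apply (@is_RInt_comp_lin R_NormedModule f (-1) s a s (- l)).
    replace (-1 * a + s) with (s - a) by ring. replace (-1 * s + s) with 0 by ring.
    exact (@is_RInt_swap R_NormedModule f _ _ _ H). }
  replace l with (-1 * - l) by ring.
  apply (RI_ext (fun t => -1 * (-1 * f (-1 * t + s)))); [|apply RI_scal, H1].
  intros t. replace (-1 * t + s) with (s - t) by ring. ring.
Qed.

(* The two Duhamel blocks share their estimates: [D] is either [Dp] or [Dm], the kernel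
   distance [w s t] being [s - t] or [t - s]. *)
Section Duhamel.
Variables (n : nat) (b M lo hi l r : R) (c : fam) (D : (R -> R) -> nat -> R -> R)
  (w : R -> R -> R) (x0 x1 : R -> R) (e : R).
Hypotheses (Hb : 0 < b < 1) (HM : 0 <= M) (Hlo : lo <= l) (Hhi : r <= hi) (He : e = 1 \/ e = -1).
Hypothesis (Hcc : forall i k s, l < s < r -> continuous (c i k) s).
Hypothesis (Hhol : forall t, lo <= t <= hi -> hol n (at_ c t) b M).
Hypothesis (Hx : forall s, l <= s <= r -> lo <= x0 s /\ x0 s <= x1 s /\ x1 s <= hi).
Hypothesis (Hw : forall s t, l <= s <= r -> x0 s <= t <= x1 s -> 0 <= w s t).
Hypothesis (HwI : forall s d, l <= s <= r -> 0 < d ->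
  exists v, RI (fun t => Rpower (w s t + d) (b - 2)) (x0 s) (x1 s) v /\ 0 <= v <= Rpower d (b - 1) / (1 - b)).
Hypothesis (HD : forall m j q s, l <= s <= r ->
  RI (fun t => trig n (mul (fun k => m k * (INR k * pexp (w s t) k)) (cj j (at_ c t))) q) (x0 s) (x1 s)
     (trig n (mul m (cj j (at_ (fun i k s => INR k * D (c i k) k s) s))) q)).
Hypothesis (HDc : forall i k s, continuous (D (c i k) k) s).
Hypothesis (HDd : forall i k s, continuous (c i k) s ->
  is_derive (D (c i k) k) s (e * (c i k s - INR k * D (c i k) k s))).

(** Under the integral stands [k^2 exp (-k (w + d))] applied to the data, of size [(w + d)^(b-2)];
    integration in [t] brings this back to [d^(b-1)] up to the end points of the layer. *)
Lemma duhamel_grad j s d : l <= s <= r -> 0 < d ->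
  bnd n (mul (kexp d) (cj j (at_ (fun i k s => INR k * D (c i k) k s) s)))
    (48 / (1 - b) / (1 - b) * M * Rpower d (b - 1)).
Proof.
  intros Hs Hd q. destruct (HwI s d Hs Hd) as [v [Hv Bv]]. destruct (Hx s Hs) as [X0 [X1 X2]].
  assert (0 < / (1 - b)) by (apply Rinv_0_lt_compat; lra).
  apply Rle_trans with (48 / (1 - b) * M * v).
  - eapply (RI_abs_le _ (fun t => 48 / (1 - b) * M * Rpower (w s t + d) (b - 2)));
      [exact X1| |apply HD; exact Hs|apply RI_scal, Hv].
    intros t Ht. cbv beta. pose proof (Hw s t Hs ltac:(lra)).
    rewrite (trig_ext n _ (mul (k2exp (w s t + d)) (cj j (at_ c t)))).
    + apply hol_cj_grad2; auto; [lra|]. apply Hhol; lra.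
    + intros i k _. unfold mul, kexp, k2exp, pexp.
      replace (- (INR k * (w s t + d))) with (- (INR k * d) + - (INR k * w s t)) by ring.
      rewrite exp_plus. ring.
  - replace (48 / (1 - b) / (1 - b) * M * Rpower d (b - 1))
      with (48 / (1 - b) * M * (Rpower d (b - 1) / (1 - b))) by (unfold Rdiv; ring).
    apply Rmult_le_compat_l; [|lra]. apply Rmult_le_pos; [|exact HM]. unfold Rdiv; nra.
Qed.

Lemma duhamel_block : block n b (60 / (1 - b) / (1 - b) * (1 + hi - lo) * M) l r
  (fun i k s => INR k * D (c i k) k s).
Proof.
  assert (B1 : 1 <= / (1 - b)).
  { rewrite <- Rinv_1 at 1. apply Rinv_le_contravar; lra. }
  assert (B2 : 1 <= / (1 - b) * / (1 - b)) by nra.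
  assert (C0 : l <= r -> 1 <= 1 + hi - lo) by lra.
  assert (L1 : l <= r -> 60 / (1 - b) / (1 - b) * M <= 60 / (1 - b) / (1 - b) * (1 + hi - lo) * M).
  { intros Hlr. specialize (C0 Hlr). apply Rmult_le_compat_r; [exact HM|]. unfold Rdiv. nra. }
  exists (fun i k s => INR k * (e * (c i k s - INR k * D (c i k) k s))).
  split; [|split; [|split; [|split]]].
  - intros i k s Hs. apply D_scal. apply HDd. apply Hcc; exact Hs.
  - intros i k s Hs. apply cont_mult; [apply continuous_const|apply HDc].
  - intros j s d Hs Hd. eapply bnd_weaken; [|apply duhamel_grad; [exact Hs|lra]].
    apply Rmult_le_compat_r; [left; apply Rpower_pos|].
    eapply Rle_trans; [|apply L1; lra]. apply Rmult_le_compat_r; [exact HM|]. unfold Rdiv; nra.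
  - intros j s Hs q. destruct (Hx s Hs) as [X0 [X1 X2]].
    apply Rle_trans with ((x1 s - x0 s) * (12 / (1 - b) * M)).
    + eapply (RI_abs_le _ (fun t => 12 / (1 - b) * M)); [exact X1| |apply HD; exact Hs|apply RI_const].
      intros t Ht. cbv beta. pose proof (Hw s t Hs ltac:(lra)).
      rewrite (trig_ext n _ (mul (kexp (1 + w s t)) (cj j (at_ c t)))).
      * eapply Rle_trans; [apply (hol_cj_grad n (at_ c t) b M); auto; [lra|apply Hhol; lra]|].
        rewrite <- (Rmult_1_r (12 / (1 - b) * M)) at 2. apply Rmult_le_compat_l.
        -- apply Rmult_le_pos; [unfold Rdiv; lra|exact HM].
        -- apply Rpower_le_1; lra.
      * intros i k _. unfold mul, kexp, pexp.
        replace (- (INR k * (1 + w s t))) with (- (INR k * 1) + - (INR k * w s t)) by ring.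
        rewrite exp_plus. ring.
    + replace ((x1 s - x0 s) * (12 / (1 - b) * M)) with ((x1 s - x0 s) * (12 / (1 - b)) * M) by ring.
      apply Rmult_le_compat_r; [exact HM|].
      assert (Y : 0 <= x1 s - x0 s <= 1 + hi - lo) by lra.
      unfold Rdiv. replace (60 * / (1 - b) * / (1 - b) * (1 + hi - lo))
        with ((1 + hi - lo) * (60 * (/ (1 - b) * / (1 - b)))) by ring.
      apply Rmult_le_compat; try lra; nra.
  - intros j s d Hs Hd.
    assert (A1 : bnd n (mul (kexp d) (cj j (at_ c s))) (12 / (1 - b) * M * Rpower d (b - 1))).
    { apply hol_cj_grad; auto; [lra|apply Hhol; lra]. }
    pose proof (duhamel_grad j s d ltac:(lra) ltac:(lra)) as A2.
    (* The [s]-derivative is, up to the sign [e], [k c - k (k D)]: the datum contributes 12, the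
       integral 48, whence the constant 60. *)
    pose proof (bnd_add n _ _ _ _ (bnd_scal n _ _ e A1) (bnd_scal n _ _ (- e) A2)) as A3.
    assert (Ee : Rabs e = 1) by (destruct He as [->| ->]; [apply Rabs_R1|apply Rabs_m1]).
    rewrite Rabs_Ropp, Ee, !Rmult_1_l in A3.
    eapply bnd_weaken; [|eapply bnd_ext; [|exact A3]].
    + rewrite <- Rmult_plus_distr_r. apply Rmult_le_compat_r; [left; apply Rpower_pos|].
      eapply Rle_trans; [|apply L1; lra]. rewrite <- Rmult_plus_distr_r.
      apply Rmult_le_compat_r; [exact HM|]. unfold Rdiv; nra.
    + intros i k _. unfold cadd, mul, kexp, pexp. destruct j, i; unfold cj, conj, at_; ring.
Qed.
End Duhamel.

Lemma Dp_block n b M lo hi l r (c : fam) : 0 < b < 1 -> 0 <= M -> lo <= l -> r <= hi ->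
  (forall i k, pint (c i k)) -> (forall i k s, l < s < r -> continuous (c i k) s) ->
  (forall t, lo <= t <= hi -> hol n (at_ c t) b M) ->
  block n b (60 / (1 - b) / (1 - b) * (1 + hi - lo) * M) l r (fun i k s => INR k * Dp lo (c i k) k s).
Proof.
  intros Hb HM Hlo Hhi Hc Hcc Hh.
  apply (duhamel_block n b M lo hi l r c (Dp lo) (fun s t => s - t) (fun _ => lo) (fun s => s) 1); auto.
  - intros; lra.
  - intros; lra.
  - intros s d Hs Hd. destruct (RI_shift_power b d (s - lo)) as [v [Hv Bv]]; try lra.
    exists v. split; [|exact Bv]. apply (RI_reflect (fun t => Rpower (t + d) (b - 2))). exact Hv.
  - intros m j q s Hs. apply RI_trig_Dp. exact Hc.
  - intros i k s. apply Dp_cont. apply Hc.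
  - intros i k s Hs. rewrite Rmult_1_l. apply Dp_derive; auto.
Qed.

Lemma Dm_block n b M lo hi l r (c : fam) : 0 < b < 1 -> 0 <= M -> lo <= l -> r <= hi ->
  (forall i k, pint (c i k)) -> (forall i k s, l < s < r -> continuous (c i k) s) ->
  (forall t, lo <= t <= hi -> hol n (at_ c t) b M) ->
  block n b (60 / (1 - b) / (1 - b) * (1 + hi - lo) * M) l r (fun i k s => INR k * Dm hi (c i k) k s).
Proof.
  intros Hb HM Hlo Hhi Hc Hcc Hh.
  apply (duhamel_block n b M lo hi l r c (Dm hi) (fun s t => t - s) (fun s => s) (fun _ => hi) (-1)); auto.
  - intros; lra.
  - intros; lra.
  - intros s d Hs Hd. destruct (RI_shift_power b d (hi - s)) as [v [Hv Bv]]; try lra.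
    exists v. split; [|exact Bv]. apply (RI_shift (fun t => Rpower (t + d) (b - 2)) (- s)).
    replace (s + - s) with 0 by ring. exact Hv.
  - intros m j q s Hs. apply RI_trig_Dm. exact Hc.
  - intros i k s. apply Dm_cont. apply Hc.
  - intros i k s Hs. apply (D_eq _ _ (INR k * Dm hi (c i k) k s - c i k s)); [ring|]. apply Dm_derive; auto.
Qed.

(** * The boundary system at high frequency *)

(** Coefficients of an increment. Multipliers commute with it, so every sup bound for a multiplier
    is automatically a Hoelder bound. *)
Definition diffc (h : R) (c : coef) : coef := cadd (shift h c) (mul (fun _ => -1) c).

Lemma trig_diffc n h c q : trig n (diffc h c) q = trig n c (q + h) - trig n c q.
Proof. unfold diffc. rewrite trig_add, trig_shift, trig_scal. ring. Qed.

Lemma hol_diffc n c b M : hol n c b M <-> forall h, bnd n (diffc h c) (M * pw b (Rabs h)).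
Proof.
  split.
  - intros H h q. rewrite trig_diffc. apply H.
  - intros H q h. rewrite <- trig_diffc. apply H.
Qed.

Definition good (n : nat) (b : R) (c : coef) (M : R) : Prop := bnd n c M /\ hol n c b M.

Lemma diffc_mul h m c i k : diffc h (mul m c) i k = mul m (diffc h c) i k.
Proof. unfold diffc, cadd, shift, mul. destruct i; ring. Qed.

Lemma diffc_add h c d i k : diffc h (cadd c d) i k = cadd (diffc h c) (diffc h d) i k.
Proof. unfold diffc, cadd, shift, mul. destruct i; ring. Qed.

Lemma diffc_highfreq K h c : highfreq K c -> highfreq K (diffc h c).
Proof.
  intros H i k Hk. unfold diffc, cadd, shift, mul. destruct i; rewrite !H by exact Hk; ring.
Qed.

Lemma diffc_ext h c d i k : (forall i, c i k = d i k) -> diffc h c i k = diffc h d i k.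
Proof. intros H. unfold diffc, cadd, shift, mul. destruct i; rewrite !H; reflexivity. Qed.

Lemma good_mul n b K m e c M : opn K m e -> highfreq K c -> good n b c M -> good n b (mul m c) (e * M).
Proof.
  intros Ho Hc [H1 H2]. split; [apply Ho; assumption|].
  apply hol_diffc. intros h. rewrite Rmult_assoc.
  apply (bnd_ext n (mul m (diffc h c))); [intros; symmetry; apply diffc_mul|].
  apply Ho; [apply diffc_highfreq; exact Hc|]. apply hol_diffc; exact H2.
Qed.

Lemma good_scal n b r c M : good n b c M -> good n b (mul (fun _ => r) c) (Rabs r * M).
Proof.
  intros [H1 H2]. split; [apply bnd_scal; exact H1|].
  apply hol_diffc. intros h. rewrite Rmult_assoc.
  apply (bnd_ext n (mul (fun _ => r) (diffc h c))); [intros; symmetry; apply diffc_mul|].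
  apply bnd_scal. apply hol_diffc; exact H2.
Qed.

Lemma good_add n b c d M1 M2 : good n b c M1 -> good n b d M2 -> good n b (cadd c d) (M1 + M2).
Proof.
  intros [H1 H2] [H3 H4]. split; [apply bnd_add; assumption|].
  apply hol_diffc. intros h. rewrite Rmult_plus_distr_r.
  apply (bnd_ext n (cadd (diffc h c) (diffc h d))); [intros; symmetry; apply diffc_add|].
  apply bnd_add; apply hol_diffc; assumption.
Qed.

Lemma good_weaken n b c M M' : M <= M' -> good n b c M -> good n b c M'.
Proof.
  intros HM [H1 H2]. split; [exact (bnd_weaken n c M M' HM H1)|].
  intros q h. eapply Rle_trans; [apply H2|]. apply Rmult_le_compat_r; [apply pw_nonneg|exact HM].
Qed.

Lemma trig_bounded n c : exists B, bnd n c B.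
Proof.
  exists (rsum n (fun k => Rabs (c true k) + Rabs (c false k))). intros q. unfold trig.
  eapply Rle_trans; [apply rsum_abs|]. apply rsum_le. intros k _.
  eapply Rle_trans; [apply Rabs_triang|]. rewrite !Rabs_mult.
  pose proof (ebas_le1 true k q) as E1. pose proof (ebas_le1 false k q) as E2. unfold ebas in E1, E2.
  pose proof (Rabs_pos (c true k)). pose proof (Rabs_pos (c false k)). nra.
Qed.

(** * Contractive systems of three multipliers *)

(** Three entries of norm at most [1/6] make a row of norm at most [1/2]. *)
Definition row (K : nat) (m1 m2 m3 : nat -> R) : Prop :=
  opn K m1 (/ 6) /\ opn K m2 (/ 6) /\ opn K m3 (/ 6).
Definition comb3 (m1 m2 m3 : nat -> R) (r x1 x2 x3 : coef) : coef :=
  cadd r (cadd (mul m1 x1) (cadd (mul m2 x2) (mul m3 x3))).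

Lemma row_step n K m1 m2 m3 r x1 x2 x3 R B : row K m1 m2 m3 ->
  highfreq K x1 -> highfreq K x2 -> highfreq K x3 ->
  bnd n r R -> bnd n x1 B -> bnd n x2 B -> bnd n x3 B -> bnd n (comb3 m1 m2 m3 r x1 x2 x3) (R + B / 2).
Proof.
  intros [O1 [O2 O3]] H1 H2 H3 Hr B1 B2 B3.
  eapply bnd_weaken; [|apply bnd_add; [exact Hr|apply bnd_add; [|apply bnd_add]]].
  2: apply O1; eassumption. 2: apply O2; eassumption. 2: apply O3; eassumption. lra.
Qed.

(** The initial bound [B] depends on the solution and on the degree. Each use of the equations
    halves its contribution, so it disappears in the limit and [2 R] remains. *)
Lemma contraction3 n K m11 m12 m13 m21 m22 m23 m31 m32 m33 r1 r2 r3 x1 x2 x3 R :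
  row K m11 m12 m13 -> row K m21 m22 m23 -> row K m31 m32 m33 ->
  highfreq K x1 -> highfreq K x2 -> highfreq K x3 ->
  (forall i k, (k < n)%nat -> x1 i k = comb3 m11 m12 m13 r1 x1 x2 x3 i k) ->
  (forall i k, (k < n)%nat -> x2 i k = comb3 m21 m22 m23 r2 x1 x2 x3 i k) ->
  (forall i k, (k < n)%nat -> x3 i k = comb3 m31 m32 m33 r3 x1 x2 x3 i k) ->
  bnd n r1 R -> bnd n r2 R -> bnd n r3 R ->
  bnd n x1 (2 * R) /\ bnd n x2 (2 * R) /\ bnd n x3 (2 * R).
Proof.
  intros R1 R2 R3 H1 H2 H3 E1 E2 E3 B1 B2 B3.
  destruct (trig_bounded n x1) as [b1 T1], (trig_bounded n x2) as [b2 T2], (trig_bounded n x3) as [b3 T3].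
  pose (B := Rmax b1 (Rmax b2 b3)).
  pose proof (Rmax_l b1 (Rmax b2 b3)). pose proof (Rmax_r b1 (Rmax b2 b3)).
  pose proof (Rmax_l b2 b3). pose proof (Rmax_r b2 b3).
  assert (R0 : 0 <= R) by (eapply Rle_trans; [apply Rabs_pos|apply (B1 0)]).
  assert (I : forall N, let BN := 2 * R + B * (/ 2) ^ N in bnd n x1 BN /\ bnd n x2 BN /\ bnd n x3 BN).
  { induction N as [|N [I1 [I2 I3]]]; cbv zeta.
    - simpl. repeat split; eapply bnd_weaken; try eassumption; unfold B; lra.
    - assert (W : R + (2 * R + B * (/ 2) ^ N) / 2 <= 2 * R + B * (/ 2) ^ S N) by (simpl; lra).
      repeat split; (eapply bnd_weaken; [exact W|]);
      (eapply bnd_ext; [intros i k Hk; symmetry; first [apply E1|apply E2|apply E3]; exact Hk|]);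
      eapply row_step; eassumption. }
  assert (L : forall c, (forall N, bnd n c (2 * R + B * (/ 2) ^ N)) -> bnd n c (2 * R)).
  { intros c Hc q. apply Rnot_lt_le. intros Hlt.
    destruct (pow_lt_1_zero (/ 2) ltac:(rewrite Rabs_right; lra)
      ((Rabs (trig n c q) - 2 * R) / (Rabs B + 1))) as [N HN].
    { pose proof (Rabs_pos B). apply Rdiv_lt_0_compat; lra. }
    specialize (HN N (le_n N)). specialize (Hc N q).
    assert (P : 0 < (/ 2) ^ N) by (apply pow_lt; lra).
    rewrite Rabs_right in HN by lra. pose proof (Rabs_pos B). pose proof (Rle_abs B).
    assert ((/ 2) ^ N * (Rabs B + 1) < Rabs (trig n c q) - 2 * R).
    { replace (Rabs (trig n c q) - 2 * R) with
        ((Rabs (trig n c q) - 2 * R) / (Rabs B + 1) * (Rabs B + 1)) by (field; lra).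
      apply Rmult_lt_compat_r; lra. }
    nra. }
  repeat split; apply L; intros N; apply I.
Qed.

Lemma comb3_diffc h m1 m2 m3 r x1 x2 x3 i k :
  diffc h (comb3 m1 m2 m3 r x1 x2 x3) i k = comb3 m1 m2 m3 (diffc h r) (diffc h x1) (diffc h x2) (diffc h x3) i k.
Proof. unfold comb3, diffc, cadd, shift, mul. destruct i; ring. Qed.

(** The increments satisfy the same system with the increments of the right-hand sides. *)
Lemma contraction3_good n b K m11 m12 m13 m21 m22 m23 m31 m32 m33 r1 r2 r3 x1 x2 x3 R :
  row K m11 m12 m13 -> row K m21 m22 m23 -> row K m31 m32 m33 ->
  highfreq K x1 -> highfreq K x2 -> highfreq K x3 ->
  (forall i k, x1 i k = comb3 m11 m12 m13 r1 x1 x2 x3 i k) ->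
  (forall i k, x2 i k = comb3 m21 m22 m23 r2 x1 x2 x3 i k) ->
  (forall i k, x3 i k = comb3 m31 m32 m33 r3 x1 x2 x3 i k) ->
  good n b r1 R -> good n b r2 R -> good n b r3 R ->
  good n b x1 (2 * R) /\ good n b x2 (2 * R) /\ good n b x3 (2 * R).
Proof.
  intros R1 R2 R3 H1 H2 H3 E1 E2 E3 [B1 L1] [B2 L2] [B3 L3].
  assert (S : bnd n x1 (2 * R) /\ bnd n x2 (2 * R) /\ bnd n x3 (2 * R)).
  { apply (contraction3 n K m11 m12 m13 m21 m22 m23 m31 m32 m33 r1 r2 r3); auto. }
  assert (D : forall h, bnd n (diffc h x1) (2 * (R * pw b (Rabs h))) /\
     bnd n (diffc h x2) (2 * (R * pw b (Rabs h))) /\ bnd n (diffc h x3) (2 * (R * pw b (Rabs h)))).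
  { intros h. apply (contraction3 n K m11 m12 m13 m21 m22 m23 m31 m32 m33 (diffc h r1) (diffc h r2) (diffc h r3));
    auto using diffc_highfreq; try (apply hol_diffc; assumption);
    intros i k _; rewrite <- comb3_diffc; apply diffc_ext; intros; auto. }
  destruct S as [S1 [S2 S3]].
  split; [|split]; (split; [assumption|]); apply hol_diffc; intros h; rewrite Rmult_assoc; apply (D h).
Qed.

(** Elimination by Cramer's rule: [d] is the determinant for [x2, x3] and [D] the one of the whole
    system; the bounds [1/6] keep both positive. *)
Lemma solve3 m11 m12 m13 m21 m22 m23 m31 m32 m33 r1 r2 r3 :
  Rabs m11 <= / 6 -> Rabs m12 <= / 6 -> Rabs m13 <= / 6 ->
  Rabs m21 <= / 6 -> Rabs m22 <= / 6 -> Rabs m23 <= / 6 ->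
  Rabs m31 <= / 6 -> Rabs m32 <= / 6 -> Rabs m33 <= / 6 ->
  exists x1 x2 x3, x1 = r1 + (m11 * x1 + (m12 * x2 + m13 * x3)) /\
    x2 = r2 + (m21 * x1 + (m22 * x2 + m23 * x3)) /\ x3 = r3 + (m31 * x1 + (m32 * x2 + m33 * x3)).
Proof.
  intros A11 A12 A13 A21 A22 A23 A31 A32 A33.
  assert (P : forall u v, Rabs u <= / 6 -> Rabs v <= / 6 -> Rabs (u * v) <= / 36).
  { intros u v Hu Hv. rewrite Rabs_mult. pose proof (Rabs_pos u). pose proof (Rabs_pos v). nra. }
  pose (d := (1 - m22) * (1 - m33) - m23 * m32).
  pose (e2 := m21 * (1 - m33) + m23 * m31).
  pose (e3 := m21 * m32 + (1 - m22) * m31).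
  pose (D := (1 - m11) * d - m12 * e2 - m13 * e3).
  pose proof (P _ _ A22 A33). pose proof (P _ _ A23 A32). pose proof (P _ _ A21 A33).
  pose proof (P _ _ A23 A31). pose proof (P _ _ A21 A32). pose proof (P _ _ A22 A31).
  assert (Hd : 3 / 5 <= d <= 3 / 2).
  { unfold d. apply Rabs_le_between in A22, A33, H, H0. split; lra. }
  assert (He2 : Rabs e2 <= / 4).
  { unfold e2. apply Rabs_le_between in A21, A33, H1, H2. apply Rabs_le. split; lra. }
  assert (He3 : Rabs e3 <= / 4).
  { unfold e3. apply Rabs_le_between in A31, H3, H4. apply Rabs_le. split; lra. }
  assert (HD : 0 < D).
  { unfold D.
    assert (Rabs (m12 * e2) <= / 24) by (rewrite Rabs_mult; pose proof (Rabs_pos m12); pose proof (Rabs_pos e2); nra).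
    assert (Rabs (m13 * e3) <= / 24) by (rewrite Rabs_mult; pose proof (Rabs_pos m13); pose proof (Rabs_pos e3); nra).
    apply Rabs_le_between in H5, H6, A11. nra. }
  pose (x1 := (r1 * d + m12 * (r2 * (1 - m33) + m23 * r3) + m13 * (r2 * m32 + (1 - m22) * r3)) / D).
  pose (f2 := r2 + m21 * x1). pose (f3 := r3 + m31 * x1).
  exists x1, ((f2 * (1 - m33) + m23 * f3) / d), ((f2 * m32 + (1 - m22) * f3) / d).
  assert (Nd : d <> 0) by lra. assert (ND : D <> 0) by lra.
  split; [|split].
  - apply (Rmult_eq_reg_r d); [|exact Nd].
    replace ((r1 + (m11 * x1 + (m12 * ((f2 * (1 - m33) + m23 * f3) / d) + m13 * ((f2 * m32 + (1 - m22) * f3) / d)))) * d)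
      with ((r1 + m11 * x1) * d + m12 * (f2 * (1 - m33) + m23 * f3) + m13 * (f2 * m32 + (1 - m22) * f3)) by (field; exact Nd).
    assert (X : x1 * D = r1 * d + m12 * (r2 * (1 - m33) + m23 * r3) + m13 * (r2 * m32 + (1 - m22) * r3)).
    { unfold x1. field. exact ND. }
    unfold f2, f3. unfold D, e2, e3 in X. lra.
  - apply (Rmult_eq_reg_r d); [|exact Nd].
    replace ((r2 + (m21 * x1 + (m22 * ((f2 * (1 - m33) + m23 * f3) / d) + m23 * ((f2 * m32 + (1 - m22) * f3) / d)))) * d)
      with (f2 * d + m22 * (f2 * (1 - m33) + m23 * f3) + m23 * (f2 * m32 + (1 - m22) * f3)) by (unfold f2; field; exact Nd).
    replace ((f2 * (1 - m33) + m23 * f3) / d * d) with (f2 * (1 - m33) + m23 * f3) by (field; exact Nd).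
    unfold d. ring.
  - apply (Rmult_eq_reg_r d); [|exact Nd].
    replace ((r3 + (m31 * x1 + (m32 * ((f2 * (1 - m33) + m23 * f3) / d) + m33 * ((f2 * m32 + (1 - m22) * f3) / d)))) * d)
      with (f3 * d + m32 * (f2 * (1 - m33) + m23 * f3) + m33 * (f2 * m32 + (1 - m22) * f3)) by (unfold f3; field; exact Nd).
    replace ((f2 * m32 + (1 - m22) * f3) / d * d) with (f2 * m32 + (1 - m22) * f3) by (field; exact Nd).
    unfold d. ring.
Qed.

Lemma block_ext n b M l r (G H : fam) : (forall i k s, G i k s = H i k s) -> block n b M l r G -> block n b M l r H.
Proof.
  intros E [G' [H1 [H2 [H3 [H4 H5]]]]]. exists G'.
  assert (EE : forall m j s i k, mul m (cj j (at_ G s)) i k = mul m (cj j (at_ H s)) i k).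
  { intros m j s i k. destruct j, i; unfold mul, cj, conj, at_; rewrite E; reflexivity. }
  split; [|split; [|split; [|split]]].
  - intros i k s Hs. apply (D_ext (G i k)); auto.
  - intros i k s Hs. apply (continuous_ext (G i k)); auto.
  - intros j s d Hs Hd. eapply bnd_ext; [|apply H3; eassumption]. intros; apply EE.
  - intros j s Hs. eapply bnd_ext; [|apply H4; eassumption]. intros; apply EE.
  - exact H5.
Qed.

Lemma block_add n b M1 M2 l r (G1 G2 : fam) : block n b M1 l r G1 -> block n b M2 l r G2 ->
  block n b (M1 + M2) l r (fun i k s => G1 i k s + G2 i k s).
Proof.
  intros H1 H2. pose proof (block_comb n b M1 M2 l r G1 G2 1 1 H1 H2) as H.
  rewrite Rabs_R1, !Rmult_1_l in H. eapply block_ext; [|exact H]. intros; simpl; ring.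
Qed.

Lemma block_opp n b M l r (G : fam) : block n b M l r G -> block n b M l r (fun i k s => - G i k s).
Proof.
  intros H1. pose proof (block_comb n b M M l r G G (-1) 0 H1 H1) as H.
  rewrite Rabs_m1, Rabs_R0, Rmult_1_l, Rmult_0_l, Rplus_0_r in H. eapply block_ext; [|exact H]. intros; simpl; ring.
Qed.

(** * The high-frequency modes and their a priori bounds *)

Section HighFrequency.
Variables (h1 h2 kap sig bt ct : R).
Hypotheses (Hh1 : 0 < h1) (Hh2 : 0 < h2) (Hsig : sig <> 0).

Definition invk (k : nat) : R := / INR k.

(* With [k^2 w] written as Duhamel part [+ x1 exp (-k (s + h1)) + x2 exp (-k (h2 - s)) + x3 exp (-k |s|)],
   the conditions at the bottom, at the top and at the interface become [x = rhs + m x]. *)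
Definition m11 (k : nat) : R := 0 * invk k.
Definition m12 (k : nat) : R := -1 * pexp (h1 + h2) k.
Definition m13 (k : nat) : R := -1 * pexp h1 k.
(** Effect on the top condition of an exponential launched at distance [h] below the top. After
    division by [sig], the leading term [sig k^2 w] leaves [- pexp h], while [bt w] and [ct w_s]
    carry the extra factors [1/k^2] and [1/k]. *)
Definition m2 (h : R) (k : nat) : R :=
  -1 * pexp h k + (- (bt / sig) * (invk k * (invk k * pexp h k)) + - (ct / sig) * (invk k * pexp h k)).
Definition m22 (k : nat) : R := - (bt / sig) * (invk k * invk k) + ct / sig * invk k.
Definition m31 (h : R) (k : nat) : R := kap / 2 * (invk k * pexp h k).
Definition m33 (k : nat) : R := kap / 2 * invk k.

Definition hf (K : nat) : Prop :=
  (2 <= K)%nat /\ opn K invk 1 /\ row K m11 m12 m13 /\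
  row K (m2 (h1 + h2)) m22 (m2 h2) /\ row K (m31 h1) (m31 h2) m33.

Lemma hf_exists : exists K0, forall K, (K0 <= K)%nat -> hf K.
Proof.
  pose (A := 1 + Rabs (kap / 2) + Rabs (bt / sig) + Rabs (ct / sig)).
  pose proof (Rabs_pos (kap / 2)). pose proof (Rabs_pos (bt / sig)). pose proof (Rabs_pos (ct / sig)).
  assert (HA : 1 <= A) by (unfold A; lra).
  (* [A] dominates the sum of the coefficients in each entry, so entries built from factors of norm
     [e] have norm at most [1/6]. *)
  pose (e := / (6 * A)).
  assert (He : 0 < e) by (apply Rinv_0_lt_compat; lra).
  assert (HeA : e * A = / 6) by (unfold e; field; lra).
  assert (He6 : e <= / 6) by nra.
  destruct (opn_inv e He) as [K1 [L1 O1]].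
  destruct (opn_exp h1 e Hh1 He) as [K2 O2]. destruct (opn_exp h2 e Hh2 He) as [K3 O3].
  destruct (opn_exp (h1 + h2) e ltac:(lra) He) as [K4 O4].
  exists (K1 + K2 + K3 + K4)%nat. intros K HK.
  assert (P1 : opn K invk e) by (apply O1; lia).
  assert (P1' : opn K invk 1) by (apply (opn_weaken K K _ e); [lia|lra|exact P1]).
  assert (P2 : opn K (pexp h1) e) by (apply O2; lia).
  assert (P3 : opn K (pexp h2) e) by (apply O3; lia).
  assert (P4 : opn K (pexp (h1 + h2)) e) by (apply O4; lia).
  assert (U : forall h, 0 < h -> opn K (pexp h) 1) by (intros; apply opn_exp_1; lra).
  assert (Q : forall m x, x <= / 6 -> opn K m x -> opn K m (/ 6)).
  { intros m x Hx. apply opn_weaken; [lia|exact Hx]. }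
  assert (M2 : forall h, 0 < h -> opn K (pexp h) e -> opn K (m2 h) (/ 6)).
  { intros h Hh Ph. eapply Q; [|apply opn_plus; [apply opn_scal, Ph|apply opn_plus; apply opn_scal]].
    2: apply opn_comp; [exact P1|apply opn_comp; [exact P1'|exact (U h Hh)]].
    2: apply opn_comp; [exact P1|exact (U h Hh)].
    rewrite Rabs_m1, !Rabs_Ropp. unfold A in HeA. nra. }
  assert (M3 : forall h, 0 < h -> opn K (m31 h) (/ 6)).
  { intros h Hh. eapply Q; [|apply opn_scal, opn_comp; [exact P1|exact (U h Hh)]]. unfold A in HeA. nra. }
  split; [lia|]. split; [exact P1'|]. split; [|split].
  - split; [|split].
    + eapply Q; [|apply opn_scal, P1]. rewrite Rabs_R0. lra.
    + eapply Q; [|apply opn_scal, P4]. rewrite Rabs_m1. lra.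
    + eapply Q; [|apply opn_scal, P2]. rewrite Rabs_m1. lra.
  - split; [|split].
    + apply M2; [lra|exact P4].
    + eapply Q; [|apply opn_plus; apply opn_scal; [apply opn_comp; [exact P1|exact P1']|exact P1]].
      rewrite Rabs_Ropp. unfold A in HeA. nra.
    + apply M2; [lra|exact P3].
  - split; [|split].
    + apply M3; lra.
    + apply M3; lra.
    + eapply Q; [|apply opn_scal, P1]. unfold A in HeA. nra.
Qed.

(** [Uq] and [Us] are [k^2 w] and [k w_s] for the particular solution obtained from the decaying
    Green function [- exp (-k |s - t|) / (2 k)], integrated over both layers. *)
Definition Uq (c : fam) : fam := fun i k s =>
  - / 2 * (INR k * Dp (- h1) (c i k) k s) + - / 2 * (INR k * Dm h2 (c i k) k s).
Definition Us (c : fam) : fam := fun i k s =>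
  / 2 * (INR k * Dp (- h1) (c i k) k s) + - / 2 * (INR k * Dm h2 (c i k) k s).

Definition rhs1 (c : fam) : coef := mul (fun _ => -1) (at_ (Uq c) (- h1)).
Definition rhs2 (c : fam) (z : coef) : coef :=
  cadd (mul (fun _ => / sig) z) (cadd (mul (fun _ => -1) (at_ (Uq c) h2))
    (cadd (mul (fun _ => - (bt / sig)) (mul invk (mul invk (at_ (Uq c) h2))))
          (mul (fun _ => ct / sig) (mul invk (at_ (Us c) h2))))).
Definition rhs3 (c : fam) : coef := mul (fun _ => kap / 2) (mul invk (at_ (Uq c) 0)).

Record Sys (K : nat) (c : fam) (z x1 x2 x3 : coef) : Prop := mkSys {
  sys_c : forall t, highfreq K (at_ c t);
  sys_z : highfreq K z;
  sys_x1 : highfreq K x1; sys_x2 : highfreq K x2; sys_x3 : highfreq K x3;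
  sys_e1 : forall i k, x1 i k = comb3 m11 m12 m13 (rhs1 c) x1 x2 x3 i k;
  sys_e2 : forall i k, x2 i k = comb3 (m2 (h1 + h2)) m22 (m2 h2) (rhs2 c z) x1 x2 x3 i k;
  sys_e3 : forall i k, x3 i k = comb3 (m31 h1) (m31 h2) m33 (rhs3 c) x1 x2 x3 i k }.

Lemma D_highfreq K (c : fam) i k s : (forall t, highfreq K (at_ c t)) -> (k < K)%nat ->
  Dp (- h1) (c i k) k s = 0 /\ Dm h2 (c i k) k s = 0.
Proof.
  intros H Hk. assert (Z : forall a b g, integral (fun t => g t * c i k t) a b = 0).
  { intros a b g. apply integral_unique. pose proof (RI_const 0 a b) as H0. rewrite Rmult_0_r in H0.
    apply (RI_ext (fun _ => 0)); [|exact H0]. intros t. specialize (H t i k Hk). unfold at_ in H. rewrite H. ring. }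
  unfold Dp, Dm. rewrite !Z. split; ring.
Qed.

Lemma U_highfreq K c s : (forall t, highfreq K (at_ c t)) -> highfreq K (at_ (Uq c) s) /\ highfreq K (at_ (Us c) s).
Proof.
  intros H. split; intros i k Hk; destruct (D_highfreq K c i k s H Hk) as [E1 E2];
  unfold at_, Uq, Us; rewrite E1, E2; ring.
Qed.

Lemma Sys_exists K c z : hf K -> (forall t, highfreq K (at_ c t)) -> highfreq K z ->
  exists x1 x2 x3, Sys K c z x1 x2 x3.
Proof.
  intros [HK [_ [[A1 [A2 A3]] [[B1 [B2 B3]] [C1 [C2 C3]]]]]] Hc Hz.
  assert (S : forall p : bool * nat, exists x : R * R * R,
     let i := fst p in let k := snd p in let x1 := fst (fst x) in let x2 := snd (fst x) in let x3 := snd x in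
     ((k < K)%nat -> x1 = 0 /\ x2 = 0 /\ x3 = 0) /\
     x1 = rhs1 c i k + (m11 k * x1 + (m12 k * x2 + m13 k * x3)) /\
     x2 = rhs2 c z i k + (m2 (h1 + h2) k * x1 + (m22 k * x2 + m2 h2 k * x3)) /\
     x3 = rhs3 c i k + (m31 h1 k * x1 + (m31 h2 k * x2 + m33 k * x3))).
  { intros [i k]. cbv zeta. simpl fst; simpl snd. destruct (le_lt_dec K k) as [Hk|Hk].
    - destruct (solve3 (m11 k) (m12 k) (m13 k) (m2 (h1 + h2) k) (m22 k) (m2 h2 k) (m31 h1 k) (m31 h2 k) (m33 k)
        (rhs1 c i k) (rhs2 c z i k) (rhs3 c i k)) as [x1 [x2 [x3 E]]];
        try (eapply opn_pointwise; eassumption).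
      exists (x1, x2, x3). simpl. split; [intros; lia|exact E].
    (* Below [K] the data and their Duhamel integrals vanish, so zero amplitudes solve the equations
       there. *)
    - exists (0, 0, 0). simpl. split; [auto|].
      assert (Q : forall s, Uq c i k s = 0) by (intros s; apply (proj1 (U_highfreq K c s Hc) i k Hk)).
      assert (Q' : forall s, Us c i k s = 0) by (intros s; apply (proj2 (U_highfreq K c s Hc) i k Hk)).
      unfold rhs1, rhs2, rhs3, cadd, mul, at_. rewrite !Q, !Q', (Hz i k Hk).
      repeat split; ring. }
  destruct (functional_choice _ S) as [f Hf]. cbv zeta in Hf.
  exists (fun i k => fst (fst (f (i, k)))), (fun i k => snd (fst (f (i, k)))), (fun i k => snd (f (i, k))).
  split; auto.
  - intros i k Hk. apply (Hf (i, k)); exact Hk.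
  - intros i k Hk. apply (Hf (i, k)); exact Hk.
  - intros i k Hk. apply (Hf (i, k)); exact Hk.
  - intros i k. apply (Hf (i, k)).
  - intros i k. apply (Hf (i, k)).
  - intros i k. apply (Hf (i, k)).
Qed.

(* [k^2 w] and [k w_s] in the lower and upper layer. *)
Definition Wq1 (c : fam) (x1 x2 x3 : coef) : fam := fun i k s =>
  Uq c i k s + (pexp (1 * s + h1) k * x1 i k + (pexp (-1 * s + h2) k * x2 i k + pexp (-1 * s + 0) k * x3 i k)).
Definition Ws1 (c : fam) (x1 x2 x3 : coef) : fam := fun i k s =>
  Us c i k s + (- (pexp (1 * s + h1) k * x1 i k) + (pexp (-1 * s + h2) k * x2 i k + pexp (-1 * s + 0) k * x3 i k)).
Definition Wq2 (c : fam) (x1 x2 x3 : coef) : fam := fun i k s =>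
  Uq c i k s + (pexp (1 * s + h1) k * x1 i k + (pexp (-1 * s + h2) k * x2 i k + pexp (1 * s + 0) k * x3 i k)).
Definition Ws2 (c : fam) (x1 x2 x3 : coef) : fam := fun i k s =>
  Us c i k s + (- (pexp (1 * s + h1) k * x1 i k) + (pexp (-1 * s + h2) k * x2 i k + - (pexp (1 * s + 0) k * x3 i k))).

Lemma U_block n b M l r (c : fam) : 0 < b < 1 -> 0 <= M -> - h1 <= l -> r <= h2 ->
  (forall i k, pint (c i k)) -> (forall i k s, l < s < r -> continuous (c i k) s) ->
  (forall t, - h1 <= t <= h2 -> hol n (at_ c t) b M) ->
  let CD := 60 / (1 - b) / (1 - b) * (1 + h2 - - h1) in
  block n b (CD * M) l r (Uq c) /\ block n b (CD * M) l r (Us c).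
Proof.
  intros Hb HM Hl Hr Hc Hcc Hh CD.
  pose proof (Dp_block n b M (- h1) h2 l r c Hb HM Hl Hr Hc Hcc Hh) as B1.
  pose proof (Dm_block n b M (- h1) h2 l r c Hb HM Hl Hr Hc Hcc Hh) as B2.
  fold CD in B1, B2.
  assert (E1 : Rabs (- / 2) = / 2) by (rewrite Rabs_Ropp, Rabs_right; lra).
  assert (E2 : Rabs (/ 2) = / 2) by (rewrite Rabs_right; lra).
  split.
  - pose proof (block_comb n b _ _ l r _ _ (- / 2) (- / 2) B1 B2) as H. rewrite E1 in H.
    replace (CD * M) with (/ 2 * (CD * M) + / 2 * (CD * M)) by field. exact H.
  - pose proof (block_comb n b _ _ l r _ _ (/ 2) (- / 2) B1 B2) as H. rewrite E1, E2 in H.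
    replace (CD * M) with (/ 2 * (CD * M) + / 2 * (CD * M)) by field. exact H.
Qed.

Lemma block_good n b M G s : 0 < b -> 0 <= M -> block n b M s s G -> good n b (at_ G s) ((2 + 2 * / b) * M).
Proof.
  intros Hb HM HG. assert (0 < / b) by (apply Rinv_0_lt_compat; lra). split.
  - intros q. eapply Rle_trans; [apply (block_sup n b M s s G false s q); auto; lra|].
    apply Rmult_le_compat_r; lra.
  - intros q h. pose proof (block_hol_q n b M s s G false s (q + h) q Hb HM HG ltac:(lra)) as H1.
    replace (q + h - q) with h in H1 by ring. exact H1.
Qed.

(** Traces of the Duhamel part are the right-hand sides of the boundary system, whose solution
    bounds the amplitudes. [C] is independent of the degree [n] and of the data. *)
Lemma apriori b K : 0 < b < 1 -> hf K -> exists C, 0 <= C /\ forall n c z x1 x2 x3 M, 0 <= M ->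
  Sys K c z x1 x2 x3 -> (forall i k, pint (c i k)) ->
  (forall i k s, - h1 < s < 0 \/ 0 < s < h2 -> continuous (c i k) s) ->
  (forall t, - h1 <= t <= h2 -> hol n (at_ c t) b M) -> good n b z M ->
  block n b (C * M) (- h1) 0 (Wq1 c x1 x2 x3) /\ block n b (C * M) (- h1) 0 (Ws1 c x1 x2 x3) /\
  block n b (C * M) 0 h2 (Wq2 c x1 x2 x3) /\ block n b (C * M) 0 h2 (Ws2 c x1 x2 x3).
Proof.
  intros Hb [HK [O1 [Row1 [Row2 Row3]]]].
  assert (Ib : 0 < / b) by (apply Rinv_0_lt_compat; lra).
  assert (I1b : 0 < / (1 - b)) by (apply Rinv_0_lt_compat; lra).
  pose (CD := 60 / (1 - b) / (1 - b) * (1 + h2 - - h1)).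
  assert (CD0 : 0 <= CD). { unfold CD, Rdiv. apply Rmult_le_pos; [|lra]. apply Rmult_le_pos; [|lra]. nra. }
  pose (CU := (2 + 2 * / b) * CD).
  assert (CU0 : 0 <= CU) by (unfold CU; apply Rmult_le_pos; lra).
  pose (CR := Rabs (/ sig) + CU + Rabs (kap / 2) * CU + Rabs (bt / sig) * CU + Rabs (ct / sig) * CU).
  pose proof (Rabs_pos (/ sig)). pose proof (Rabs_pos (kap / 2)). pose proof (Rabs_pos (bt / sig)).
  pose proof (Rabs_pos (ct / sig)).
  assert (CR0 : 0 <= CR) by (unfold CR; nra).
  pose (CX := 12 / (1 - b) * (2 * CR) + 2 * CR).
  assert (CX0 : 0 <= CX) by (unfold CX, Rdiv; nra).
  exists (CD + 3 * CX). split; [lra|].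
  intros n c z x1 x2 x3 M HM [Sc Sz S1 S2 S3 E1 E2 E3] Hc Hcc Hh Hz.
  assert (GU : forall s, - h1 <= s <= h2 -> good n b (at_ (Uq c) s) (CU * M) /\ good n b (at_ (Us c) s) (CU * M)).
  (* On the degenerate interval [[s, s]] the continuity of the data in the interior is vacuous, so
     the slice at the jump [s = 0] is covered as well. *)
  { intros s Hs. destruct (U_block n b M s s c Hb HM ltac:(lra) ltac:(lra) Hc ltac:(intros; lra) Hh) as [B1 B2].
    fold CD in B1, B2. unfold CU. rewrite Rmult_assoc. assert (0 <= CD * M) by (apply Rmult_le_pos; lra).
    split; apply block_good; auto; lra. }
  assert (HU : forall s, highfreq K (at_ (Uq c) s) /\ highfreq K (at_ (Us c) s)) by (intros; apply U_highfreq; exact Sc).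
  assert (CUM : 0 <= CU * M) by (apply Rmult_le_pos; lra).
  assert (G1 : good n b (rhs1 c) (CR * M)).
  { eapply good_weaken; [|apply good_scal, (GU (- h1)); lra]. rewrite Rabs_m1. unfold CR. nra. }
  assert (G3 : good n b (rhs3 c) (CR * M)).
  { eapply good_weaken; [|apply good_scal, (good_mul n b K invk 1); [exact O1|apply HU|apply (GU 0); lra]].
    unfold CR. nra. }
  assert (G2 : good n b (rhs2 c z) (CR * M)).
  { destruct (GU h2 ltac:(lra)) as [GQ GS]. destruct (HU h2) as [HQ HS].
    eapply good_weaken; [|apply good_add; [apply good_scal, Hz|apply good_add; [apply good_scal, GQ|
      apply good_add; apply good_scal]]].
    2: apply (good_mul n b K invk 1); [exact O1|apply highfreq_mul; exact HQ|
       apply (good_mul n b K invk 1); [exact O1|exact HQ|exact GQ]].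
    2: apply (good_mul n b K invk 1); [exact O1|exact HS|exact GS].
    rewrite Rabs_m1, Rabs_Ropp. unfold CR. nra. }
  destruct (contraction3_good n b K _ _ _ _ _ _ _ _ _ _ _ _ x1 x2 x3 _ Row1 Row2 Row3 S1 S2 S3 E1 E2 E3 G1 G2 G3)
    as [X1 [X2 X3]].
  assert (CRM : 0 <= CR * M) by (apply Rmult_le_pos; lra).
  assert (BX : forall x l r u v, highfreq K x -> good n b x (2 * (CR * M)) -> (u = 1 \/ u = -1) ->
     (forall s, l <= s <= r -> 0 <= u * s + v) -> block n b (CX * M) l r (fun i k s => pexp (u * s + v) k * x i k)).
  { intros x l r u v Hx [Gb Gh] Hu Hv.
    pose proof (block_exp n K b (2 * (CR * M)) (2 * (CR * M)) l r x u v Hb ltac:(lra) ltac:(lra) Hu Hv Hx O1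
      ltac:(lia) Gh Gb) as Q.
    replace (CX * M) with (12 / (1 - b) * (2 * (CR * M)) + 2 * (CR * M)) by (unfold CX; ring). exact Q. }
  destruct (U_block n b M (- h1) 0 c Hb HM ltac:(lra) ltac:(lra) Hc ltac:(intros; apply Hcc; lra) Hh) as [A1 A2].
  destruct (U_block n b M 0 h2 c Hb HM ltac:(lra) ltac:(lra) Hc ltac:(intros; apply Hcc; lra) Hh) as [A3 A4].
  fold CD in A1, A2, A3, A4.
  replace ((CD + 3 * CX) * M) with (CD * M + (CX * M + (CX * M + CX * M))) by ring.
  unfold Wq1, Wq2, Ws1, Ws2.
  assert (Y1 : forall l r, - h1 <= l -> block n b (CX * M) l r (fun i k s => pexp (1 * s + h1) k * x1 i k)).
  { intros l r Hl. apply (BX x1 l r 1 h1); auto. intros; lra. }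
  assert (Y2 : forall l r, r <= h2 -> block n b (CX * M) l r (fun i k s => pexp (-1 * s + h2) k * x2 i k)).
  { intros l r Hr. apply (BX x2 l r (-1) h2); auto. intros; lra. }
  assert (Y3 : block n b (CX * M) (- h1) 0 (fun i k s => pexp (-1 * s + 0) k * x3 i k)).
  { apply (BX x3 (- h1) 0 (-1) 0); auto. intros; lra. }
  assert (Y4 : block n b (CX * M) 0 h2 (fun i k s => pexp (1 * s + 0) k * x3 i k)).
  { apply (BX x3 0 h2 1 0); auto. intros; lra. }
  split; [|split; [|split]].
  - exact (block_add _ _ _ _ _ _ _ _ A1 (block_add _ _ _ _ _ _ _ _ (Y1 (- h1) 0 ltac:(lra))
      (block_add _ _ _ _ _ _ _ _ (Y2 (- h1) 0 ltac:(lra)) Y3))).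
  - exact (block_add _ _ _ _ _ _ _ _ A2 (block_add _ _ _ _ _ _ _ _ (block_opp _ _ _ _ _ _ (Y1 (- h1) 0 ltac:(lra)))
      (block_add _ _ _ _ _ _ _ _ (Y2 (- h1) 0 ltac:(lra)) Y3))).
  - exact (block_add _ _ _ _ _ _ _ _ A3 (block_add _ _ _ _ _ _ _ _ (Y1 0 h2 ltac:(lra))
      (block_add _ _ _ _ _ _ _ _ (Y2 0 h2 ltac:(lra)) Y4))).
  - exact (block_add _ _ _ _ _ _ _ _ A4 (block_add _ _ _ _ _ _ _ _ (block_opp _ _ _ _ _ _ (Y1 0 h2 ltac:(lra)))
      (block_add _ _ _ _ _ _ _ _ (Y2 0 h2 ltac:(lra)) (block_opp _ _ _ _ _ _ Y4)))).
Qed.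

Lemma U_derive (c : fam) i k s : pint (c i k) -> continuous (c i k) s ->
  is_derive (Uq c i k) s (INR k * Us c i k s) /\ is_derive (Us c i k) s (INR k * (Uq c i k s + c i k s)).
Proof.
  intros Hc Hs. pose proof (Dp_derive (- h1) _ k s Hc Hs) as D1. pose proof (Dm_derive h2 _ k s Hc Hs) as D2.
  pose proof (D_scal _ (INR k) _ _ D1) as F1. pose proof (D_scal _ (INR k) _ _ D2) as F2.
  split.
  - pose proof (D_plus _ _ _ _ _ (D_scal _ (- / 2) _ _ F1) (D_scal _ (- / 2) _ _ F2)) as G.
    eapply D_eq; [|exact G]. unfold Us. field.
  - pose proof (D_plus _ _ _ _ _ (D_scal _ (/ 2) _ _ F1) (D_scal _ (- / 2) _ _ F2)) as G.
    eapply D_eq; [|exact G]. unfold Uq. field.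
Qed.

Lemma W_derive (c : fam) x1 x2 x3 i k s : pint (c i k) -> continuous (c i k) s ->
  is_derive (Wq1 c x1 x2 x3 i k) s (INR k * Ws1 c x1 x2 x3 i k s) /\
  is_derive (Ws1 c x1 x2 x3 i k) s (INR k * (Wq1 c x1 x2 x3 i k s + c i k s)) /\
  is_derive (Wq2 c x1 x2 x3 i k) s (INR k * Ws2 c x1 x2 x3 i k s) /\
  is_derive (Ws2 c x1 x2 x3 i k) s (INR k * (Wq2 c x1 x2 x3 i k s + c i k s)).
Proof.
  intros Hc Hs. destruct (U_derive c i k s Hc Hs) as [D1 D2].
  assert (P : forall u v x, is_derive (fun s => pexp (u * s + v) k * x) s (- u * INR k * (pexp (u * s + v) k * x))).
  { intros u v x. unfold pexp. auto_derive; [exact I|ring]. }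
  assert (N : forall u v x, is_derive (fun s => - (pexp (u * s + v) k * x)) s (u * INR k * (pexp (u * s + v) k * x))).
  { intros u v x. unfold pexp. auto_derive; [exact I|ring]. }
  split; [|split; [|split]].
  - eapply D_eq; [|apply D_plus; [exact D1|apply D_plus; [apply P|apply D_plus; apply P]]]. unfold Ws1. ring.
  - eapply D_eq; [|apply D_plus; [exact D2|apply D_plus; [apply N|apply D_plus; apply P]]]. unfold Wq1. ring.
  - eapply D_eq; [|apply D_plus; [exact D1|apply D_plus; [apply P|apply D_plus; apply P]]]. unfold Ws2. ring.
  - eapply D_eq; [|apply D_plus; [exact D2|apply D_plus; [apply N|apply D_plus; [apply P|apply N]]]]. unfold Wq2. ring.
Qed.

Lemma W_boundary K c z x1 x2 x3 i k : Sys K c z x1 x2 x3 -> (K <= k)%nat -> (0 < k)%nat ->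
  Wq1 c x1 x2 x3 i k (- h1) = 0 /\
  Wq1 c x1 x2 x3 i k 0 = Wq2 c x1 x2 x3 i k 0 /\
  Ws1 c x1 x2 x3 i k 0 - Ws2 c x1 x2 x3 i k 0 = kap * (/ INR k * Wq1 c x1 x2 x3 i k 0) /\
  sig * Wq2 c x1 x2 x3 i k h2 + bt * (/ INR k * (/ INR k * Wq2 c x1 x2 x3 i k h2))
    - ct * (/ INR k * Ws2 c x1 x2 x3 i k h2) = z i k.
Proof.
  intros [Sc Sz S1 S2 S3 E1 E2 E3] HK Hk. specialize (E1 i k). specialize (E2 i k). specialize (E3 i k).
  unfold comb3, cadd, mul, rhs1, rhs2, rhs3, m11, m12, m13, m2, m22, m31, m33, invk, at_, mul, cadd in E1, E2, E3.
  unfold Wq1, Wq2, Ws1, Ws2. set (I := / INR k) in *.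
  assert (Hp0 : pexp (1 * - h1 + h1) k = 1) by (replace (1 * - h1 + h1) with 0 by ring; apply pexp_0).
  assert (Hp1 : pexp (-1 * h2 + h2) k = 1) by (replace (-1 * h2 + h2) with 0 by ring; apply pexp_0).
  assert (Hp2 : pexp (-1 * 0 + 0) k = 1) by (replace (-1 * 0 + 0) with 0 by ring; apply pexp_0).
  assert (Hp3 : pexp (1 * 0 + 0) k = 1) by (replace (1 * 0 + 0) with 0 by ring; apply pexp_0).
  replace (-1 * - h1 + h2) with (h1 + h2) by ring. replace (-1 * - h1 + 0) with h1 by ring.
  replace (1 * 0 + h1) with h1 by ring. replace (-1 * 0 + h2) with h2 by ring.
  replace (1 * h2 + h1) with (h1 + h2) by ring. replace (1 * h2 + 0) with h2 by ring.
  rewrite Hp0, Hp1, Hp2, Hp3.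
  (* The third exponential depends on [|s|]: continuity across the interface is automatic, and its
     kink produces the jump [2 x3] of [k w_s]. *)
  split; [lra|]. split; [ring|]. split.
  - replace (Us c i k 0 + _ - _) with (2 * x3 i k) by ring. rewrite E3 at 1. field.
  - apply (Rmult_eq_reg_l (/ sig)); [|apply Rinv_neq_0_compat; exact Hsig].
    unfold Rdiv in E2. set (J := / sig) in *.
    assert (HJ : J * sig = 1) by (unfold J; field; exact Hsig).
    transitivity ((J * sig) * (Uq c i k h2 + (pexp (h1 + h2) k * x1 i k + (1 * x2 i k + pexp h2 k * x3 i k)))
      + (bt * J) * (I * (I * (Uq c i k h2 + (pexp (h1 + h2) k * x1 i k + (1 * x2 i k + pexp h2 k * x3 i k)))))
      - (ct * J) * (I * (Us c i k h2 + (- (pexp (h1 + h2) k * x1 i k) + (1 * x2 i k + - (pexp h2 k * x3 i k)))))); [ring|].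
    rewrite HJ. rewrite E2 at 1. ring.
Qed.
End HighFrequency.

(** * Passage to the limit *)

Definition seqlim (u : nat -> R) (l : R) : Prop :=
  forall eps, 0 < eps -> exists N, forall n, (N <= n)%nat -> Rabs (u n - l) <= eps.

Lemma seqlim_abs_le u l B N0 : (forall n, (N0 <= n)%nat -> Rabs (u n) <= B) -> seqlim u l -> Rabs l <= B.
Proof.
  intros HB Hl. apply Rnot_lt_le. intros Hlt.
  destruct (Hl ((Rabs l - B) / 2) ltac:(lra)) as [N HN].
  specialize (HN (N + N0)%nat ltac:(lia)). specialize (HB (N + N0)%nat ltac:(lia)).
  assert (Rabs l <= Rabs (u (N + N0)%nat) + Rabs (u (N + N0)%nat - l)); [|lra].
  replace l with (u (N + N0)%nat + - (u (N + N0)%nat - l)) at 1 by ring.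
  eapply Rle_trans; [apply Rabs_triang|]. rewrite Rabs_Ropp. lra.
Qed.

Lemma seqlim_lin u v l m a b : seqlim u l -> seqlim v m -> seqlim (fun n => a * u n + b * v n) (a * l + b * m).
Proof.
  intros Hu Hv eps He. pose proof (Rabs_pos a). pose proof (Rabs_pos b).
  pose (d := eps / (Rabs a + Rabs b + 1)).
  assert (Hd : 0 < d) by (apply Rdiv_lt_0_compat; lra).
  assert (Ed : d * (Rabs a + Rabs b + 1) = eps) by (unfold d; field; lra).
  destruct (Hu d Hd) as [N1 H1]. destruct (Hv d Hd) as [N2 H2].
  exists (N1 + N2)%nat. intros n Hn. specialize (H1 n ltac:(lia)). specialize (H2 n ltac:(lia)).
  replace (a * u n + b * v n - (a * l + b * m)) with (a * (u n - l) + b * (v n - m)) by ring.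
  eapply Rle_trans; [apply Rabs_triang|]. rewrite !Rabs_mult. nra.
Qed.

Lemma seqlim_unique u l m : seqlim u l -> seqlim u m -> l = m.
Proof.
  intros H1 H2. pose proof (seqlim_lin u u l m 1 (-1) H1 H2) as H.
  assert (Rabs (1 * l + -1 * m) <= 0).
  { apply (seqlim_abs_le (fun n => 1 * u n + -1 * u n) _ 0 0); [|exact H].
    intros n _. replace (1 * u n + -1 * u n) with 0 by ring. rewrite Rabs_R0. lra. }
  pose proof (Rabs_pos (1 * l + -1 * m)). apply Rabs_le_between in H0. lra.
Qed.

Lemma seqlim_ext u v l : (forall n, (1 <= n)%nat -> u n = v n) -> seqlim u l -> seqlim v l.
Proof.
  intros E H eps He. destruct (H eps He) as [N HN]. exists (N + 1)%nat. intros n Hn.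
  rewrite <- E by lia. apply HN. lia.
Qed.

Lemma seqlim_const l : seqlim (fun _ => l) l.
Proof. intros eps He. exists 0%nat. intros n _. rewrite Rminus_diag, Rabs_R0. lra. Qed.

Definition ucauchy (D : R -> Prop) (u : nat -> R -> R -> R) : Prop := forall eps, 0 < eps ->
  exists N, forall n m, (N <= n)%nat -> (N <= m)%nat -> forall q s, D s -> Rabs (u n q s - u m q s) <= eps.
Definition ulim (D : R -> Prop) (u : nat -> R -> R -> R) (U : R -> R -> R) : Prop := forall eps, 0 < eps ->
  exists N, forall n, (N <= n)%nat -> forall q s, D s -> Rabs (u n q s - U q s) <= eps.

Lemma ucauchy_ulim D u : ucauchy D u -> exists U, ulim D u U.
Proof.
  intros H.
  exists (fun q s => real (Lim_seq (fun n => u n q s))).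
  assert (P : forall q s, D s -> seqlim (fun n => u n q s) (real (Lim_seq (fun n => u n q s)))).
  { intros q s Hs.
    assert (E : ex_finite_lim_seq (fun n => u n q s)).
    { apply ex_lim_seq_cauchy_corr. intros eps. destruct (H (eps / 2)) as [N HN].
      { pose proof (cond_pos eps). lra. }
      exists N. intros n m Hn Hm. specialize (HN n m Hn Hm q s Hs). pose proof (cond_pos eps). lra. }
    apply Lim_seq_correct' in E. intros eps He.
    apply is_lim_seq_spec in E. destruct (E (mkposreal eps He)) as [N HN]. exists N. intros n Hn.
    specialize (HN n Hn). simpl in HN. lra. }
  intros eps He. destruct (H (eps / 2) ltac:(lra)) as [N HN]. exists N. intros n Hn q s Hs.
  destruct (P q s Hs (eps / 2) ltac:(lra)) as [N' HN'].
  specialize (HN n (N + N')%nat Hn ltac:(lia) q s Hs). specialize (HN' (N + N')%nat ltac:(lia)).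
  apply Rabs_le_between in HN, HN'. apply Rabs_le. lra.
Qed.

Lemma ulim_seqlim D u U q s : ulim D u U -> D s -> seqlim (fun n => u n q s) (U q s).
Proof. intros H Hs eps He. destruct (H eps He) as [N HN]. exists N. intros n Hn. apply HN; assumption. Qed.

(** The mean value inequality is applied to [u n y - V x * y]. Near [x], [v n] stays within [eps/2]
    of [V x]: three errors [eps/8] from uniform convergence and one from the continuity of the
    single function [v (N + 1)]. *)
Lemma limit_derive (u v : nat -> R -> R) (U V : R -> R) l r x : l < x < r ->
  (forall n y, (1 <= n)%nat -> l < y < r -> is_derive (u n) y (v n y)) ->
  (forall n, (1 <= n)%nat -> continuous (v n) x) ->
  (forall y, l < y < r -> seqlim (fun n => u n y) (U y)) ->
  (forall eps, 0 < eps -> exists N, forall n, (N <= n)%nat -> forall y, l < y < r -> Rabs (v n y - V y) <= eps) ->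
  derivable_pt_lim U x (V x).
Proof.
  intros Hx Hd Hc Hu Hv eps He.
  destruct (Hv (eps / 8) ltac:(lra)) as [N HN].
  pose proof (Hc (N + 1)%nat ltac:(lia)) as C. apply continuous_pt in C.
  destruct (C (eps / 8) ltac:(lra)) as [d [Hd0 HdC]].
  assert (Hm : 0 < Rmin d (Rmin (x - l) (r - x))) by (repeat apply Rmin_glb_lt; lra).
  exists (mkposreal _ Hm). intros h Hh0 Hh. simpl in Hh.
  pose proof (Rmin_l d (Rmin (x - l) (r - x))). pose proof (Rmin_r d (Rmin (x - l) (r - x))).
  pose proof (Rmin_l (x - l) (r - x)). pose proof (Rmin_r (x - l) (r - x)).
  assert (Hint : forall y, Rabs (y - x) <= Rabs h -> l < y < r).
  { intros y Hy. assert (Hy2 : Rabs (y - x) < Rmin (x - l) (r - x)) by lra.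
    apply Rabs_lt_between in Hy2. lra. }
  assert (Hv2 : forall n y, (N <= n)%nat -> Rabs (y - x) <= Rabs h -> Rabs (v n y - V x) <= eps / 2).
  { intros n y Hn Hy. pose proof (HN n Hn y (Hint y Hy)) as A1.
    pose proof (HN (N + 1)%nat ltac:(lia) y (Hint y Hy)) as A2.
    pose proof (HN (N + 1)%nat ltac:(lia) x ltac:(lra)) as A3.
    assert (A4 : Rabs (v (N + 1)%nat y - v (N + 1)%nat x) <= eps / 8).
    { destruct (Req_dec y x) as [->|Ny]; [rewrite Rminus_diag, Rabs_R0; lra|].
      left. apply (HdC y). split; [split; [exact I|auto]|]. change (Rabs (y - x) < d). lra. }
    apply Rabs_le_between in A1, A2, A3, A4. apply Rabs_le. lra. }
  assert (L : forall n, (N + 1 <= n)%nat -> Rabs (u n (x + h) - u n x - V x * h) <= eps / 2 * Rabs h).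
  { intros n Hn.
    assert (Hder : forall y, l < y < r -> is_derive (fun y => u n y - V x * y) y (v n y - V x)).
    { intros y Hy. apply D_minus; [apply Hd; [lia|exact Hy]|apply is_derive_linear]. }
    assert (Gen : forall a b, a <= b -> (forall y, a <= y <= b -> Rabs (y - x) <= Rabs h) ->
      Rabs ((u n b - V x * b) - (u n a - V x * a)) <= eps / 2 * (b - a)).
    { intros a b Hab Hy. apply (lipschitz_derive (fun y => u n y - V x * y) (fun y => v n y - V x)); auto.
      - intros y Hy'. apply Hder. apply Hint, Hy. lra.
      - intros y Hy'. apply (derive_cont _ _ _ (Hder y (Hint y (Hy y Hy')))).
      - intros y Hy'. apply Hv2; [lia|apply Hy; lra]. }
    destruct (Rle_dec 0 h).
    - rewrite (Rabs_right h) by lra.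
      replace (u n (x + h) - u n x - V x * h) with ((u n (x + h) - V x * (x + h)) - (u n x - V x * x)) by ring.
      replace (eps / 2 * h) with (eps / 2 * (x + h - x)) by ring. apply Gen; [lra|].
      intros y Hy. rewrite !Rabs_right; lra.
    - rewrite (Rabs_left h) by lra. rewrite <- Rabs_Ropp.
      replace (- (u n (x + h) - u n x - V x * h)) with ((u n x - V x * x) - (u n (x + h) - V x * (x + h))) by ring.
      replace (eps / 2 * - h) with (eps / 2 * (x - (x + h))) by ring. apply Gen; [lra|].
      intros y Hy. rewrite !Rabs_left1; lra. }
  assert (S : seqlim (fun n => u n (x + h) - u n x - V x * h) (U (x + h) - U x - V x * h)).
  { pose proof (seqlim_lin _ _ _ _ 1 (-1) (Hu (x + h) (Hint (x + h) ltac:(replace (x + h - x) with h by ring; lra)))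
      (Hu x Hx)) as S1.
    pose proof (seqlim_lin _ _ _ _ 1 1 S1 (seqlim_const (- (V x * h)))) as S2.
    replace (U (x + h) - U x - V x * h) with (1 * (1 * U (x + h) + -1 * U x) + 1 * - (V x * h)) by ring.
    eapply seqlim_ext; [|exact S2]. intros n _. simpl. ring. }
  pose proof (seqlim_abs_le _ _ _ (N + 1) L S) as F.
  assert (Hh' : 0 < Rabs h) by (apply Rabs_pos_lt; exact Hh0).
  apply Rle_lt_trans with (eps / 2); [|lra].
  replace ((U (x + h) - U x) / h - V x) with ((U (x + h) - U x - V x * h) * / h) by (field; exact Hh0).
  rewrite Rabs_mult, Rabs_inv. apply Rmult_le_reg_r with (Rabs h); [exact Hh'|].
  rewrite Rmult_assoc, Rinv_l, Rmult_1_r by lra. exact F.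
Qed.

Lemma dist2_same_p q1 q2 p : dist2 q1 p q2 p = Rabs (q1 - q2).
Proof.
  unfold dist2. replace ((q1 - q2) ^ 2 + (p - p) ^ 2) with (Rsqr (q1 - q2)) by (unfold Rsqr; ring).
  apply sqrt_Rsqr_abs.
Qed.

Lemma dist2_same_q q p1 p2 : dist2 q p1 q p2 = Rabs (p1 - p2).
Proof.
  unfold dist2. replace ((q - q) ^ 2 + (p1 - p2) ^ 2) with (Rsqr (p1 - p2)) by (unfold Rsqr; ring).
  apply sqrt_Rsqr_abs.
Qed.

Lemma dist2_ge q1 p1 q2 p2 : Rabs (q1 - q2) <= dist2 q1 p1 q2 p2 /\ Rabs (p1 - p2) <= dist2 q1 p1 q2 p2.
Proof.
  unfold dist2. rewrite <- !sqrt_Rsqr_abs. unfold Rsqr.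
  pose proof (Rle_0_sqr (q1 - q2)). pose proof (Rle_0_sqr (p1 - p2)). unfold Rsqr in *.
  split; apply sqrt_le_1; nra.
Qed.

(** * Hoelder bounds in separate variables and approximating polynomials *)

(** A form of [holder2] with one explicit constant and one variable moving at a time, which passes
    to pointwise limits with the same constant. *)
Record sepH (al l r M : R) (u : R -> R -> R) : Prop := mkSepH {
  sepH_b : forall q s, l <= s <= r -> Rabs (u q s) <= M;
  sepH_q : forall q q' s, l <= s <= r -> Rabs (u q s - u q' s) <= M * pw al (Rabs (q - q'));
  sepH_s : forall q s s', l <= s <= r -> l <= s' <= r -> Rabs (u q s - u q s') <= M * pw al (Rabs (s - s')) }.

Lemma sepH_holder2 al l r M u : 0 < al -> 0 <= M -> sepH al l r M u -> holder2 al l r u.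
Proof.
  intros Hal HM [H1 H2 H3]. split; [exists M; exact H1|].
  exists (2 * M). intros q1 p1 q2 p2 Hp1 Hp2 Hd.
  destruct (dist2_ge q1 p1 q2 p2) as [D1 D2]. rewrite <- pw_Rpower by exact Hd.
  pose proof (pw_le al _ _ ltac:(lra) D1). pose proof (pw_le al _ _ ltac:(lra) D2).
  specialize (H2 q1 q2 p1 Hp1). specialize (H3 q2 p1 p2 Hp1 Hp2).
  replace (u q1 p1 - u q2 p2) with ((u q1 p1 - u q2 p1) + (u q2 p1 - u q2 p2)) by ring.
  eapply Rle_trans; [apply Rabs_triang|]. nra.
Qed.

Lemma holder2_sepH al l r u : holder2 al l r u -> exists M, 0 <= M /\ sepH al l r M u.
Proof.
  intros [[M HM] [C HC]]. pose proof (Rle_abs M). pose proof (Rle_abs C).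
  pose proof (Rabs_pos M). pose proof (Rabs_pos C).
  exists (Rabs M + Rabs C). split; [lra|]. split.
  - intros q s Hs. specialize (HM q s Hs). lra.
  - intros q q' s Hs. destruct (Req_dec q q') as [->|N].
    + rewrite !Rminus_diag, !Rabs_R0. apply Rmult_le_pos; [lra|apply pw_nonneg].
    + assert (P : 0 < Rabs (q - q')) by (apply Rabs_pos_lt; lra).
      specialize (HC q s q' s Hs Hs). rewrite dist2_same_p in HC. rewrite pw_Rpower by exact P.
      specialize (HC P). pose proof (Rpower_pos (Rabs (q - q')) al). nra.
  - intros q s s' Hs Hs'. destruct (Req_dec s s') as [->|N].
    + rewrite !Rminus_diag, !Rabs_R0. apply Rmult_le_pos; [lra|apply pw_nonneg].
    + assert (P : 0 < Rabs (s - s')) by (apply Rabs_pos_lt; lra).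
      specialize (HC q s q s' Hs Hs'). rewrite dist2_same_q in HC. rewrite pw_Rpower by exact P.
      specialize (HC P). pose proof (Rpower_pos (Rabs (s - s')) al). nra.
Qed.

Lemma sepH_ulim al l r M (u : nat -> R -> R -> R) U : (forall n, (1 <= n)%nat -> sepH al l r M (u n)) ->
  ulim (fun s => l <= s <= r) u U -> sepH al l r M U.
Proof.
  intros H HU. split.
  - intros q s Hs. apply (seqlim_abs_le (fun n => u n q s) _ _ 1).
    + intros n Hn. apply (H n Hn); exact Hs.
    + apply (ulim_seqlim _ u U q s HU Hs).
  - intros q q' s Hs. apply (seqlim_abs_le (fun n => u n q s - u n q' s) _ _ 1).
    + intros n Hn. apply (H n Hn); exact Hs.
    + replace (U q s - U q' s) with (1 * U q s + -1 * U q' s) by ring.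
      eapply seqlim_ext; [|apply seqlim_lin; [exact (ulim_seqlim _ u U q s HU Hs)|exact (ulim_seqlim _ u U q' s HU Hs)]].
      intros n _; simpl; ring.
  - intros q s s' Hs Hs'. apply (seqlim_abs_le (fun n => u n q s - u n q s') _ _ 1).
    + intros n Hn. apply (H n Hn); assumption.
    + replace (U q s - U q s') with (1 * U q s + -1 * U q s') by ring.
      eapply seqlim_ext; [|apply seqlim_lin; [exact (ulim_seqlim _ u U q s HU Hs)|exact (ulim_seqlim _ u U q s' HU Hs')]].
      intros n _; simpl; ring.
Qed.

(** The Fejer multiplier extended by zero, so that means of different orders can be compared as
    polynomials of a common degree. *)
Definition fm (N k : nat) : R := if lt_dec k N then fmul N k else 0.

Lemma trig_fm_ext N n c q : (N <= n)%nat -> trig n (mul (fm N) c) q = trig N (mul (fm N) c) q.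
Proof.
  intros H. unfold trig. apply rsum_le_ext; [exact H|]. intros k Hk. unfold mul, fm.
  destruct (lt_dec k N); [lia|ring].
Qed.

Lemma trig_fm_diff N N' c q : trig N (mul (fm N) c) q - trig N' (mul (fm N') c) q
  = trig (Nat.max N N') (mul (fun k => fm N k - fm N' k) c) q.
Proof.
  rewrite <- (trig_fm_ext N (Nat.max N N')) by lia. rewrite <- (trig_fm_ext N' (Nat.max N N')) by lia.
  replace (trig (Nat.max N N') (mul (fm N) c) q - trig (Nat.max N N') (mul (fm N') c) q) with
    (trig (Nat.max N N') (mul (fm N) c) q + -1 * trig (Nat.max N N') (mul (fm N') c) q) by ring.
  rewrite <- trig_scal, <- trig_add. apply trig_ext. intros; unfold cadd, mul; ring.
Qed.

Lemma fejer_fm N f q : fejer N f q = trig N (mul (fm N) (fc f)) q.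
Proof. apply trig_ext. intros i k Hk. unfold mul, fm. destruct (lt_dec k N); [reflexivity|lia]. Qed.

Fixpoint invs (e : nat) (c : coef) : coef := match e with O => c | S e => mul invk (invs e c) end.

Lemma invs_mul e m c i k : invs e (mul m c) i k = mul m (invs e c) i k.
Proof. induction e as [|e IH]; [reflexivity|]. 
  change (invk k * invs e (mul m c) i k = m k * (invk k * invs e c i k)). rewrite IH. unfold mul. ring. Qed.

Lemma invs_highfreq K e c : highfreq K c -> highfreq K (invs e c).
Proof. intros H. induction e as [|e IH]; [exact H|]. apply highfreq_mul; exact IH. Qed.

Lemma cj_highfreq K j c : highfreq K c -> highfreq K (cj j c).
Proof.
  intros H i k Hk. destruct j, i; unfold cj, conj; rewrite ?H by exact Hk; ring.
Qed.

Lemma invs_bnd K n e c B : opn K invk 1 -> highfreq K c -> bnd n c B -> bnd n (invs e c) B.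
Proof.
  intros HO Hc HB. induction e as [|e IH]; [exact HB|]. simpl.
  rewrite <- (Rmult_1_l B). apply HO; [apply invs_highfreq; exact Hc|exact IH].
Qed.

(** For [X = Wq], which stands for [k^2 w], the exponents [e = 2, 1, 0] give the Fejer means of [w],
    of [w_q] (with [j = true]) and of [- w_qq]. For [X = Ws], standing for [k w_s], one obtains
    [w_s] and, with [j = true], [w_sq]. *)
Definition apx (X : fam) (j : bool) (e N : nat) (q s : R) : R :=
  trig N (mul (fm N) (invs e (cj j (at_ X s)))) q.

Lemma hol_cont_loc b M (f : R -> R) l r x : 0 < b -> l < x < r ->
  (forall y, l < y < r -> Rabs (f y - f x) <= M * pw b (Rabs (y - x))) -> continuous f x.
Proof.
  intros Hb Hx H.
  pose (cl y := if Rlt_dec l y then if Rlt_dec y r then f y else f x else f x).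
  apply (continuous_ext_loc _ cl).
  - assert (Hd : 0 < Rmin (x - l) (r - x)) by (apply Rmin_glb_lt; lra).
    exists (mkposreal _ Hd). intros y Hy. change (Rabs (y - x) < Rmin (x - l) (r - x)) in Hy.
    pose proof (Rmin_l (x - l) (r - x)). pose proof (Rmin_r (x - l) (r - x)).
    apply Rabs_lt_between in Hy. unfold cl. destruct (Rlt_dec l y); [|lra]. destruct (Rlt_dec y r); [reflexivity|lra].
  - apply (hol_cont b (Rabs M) cl x Hb). intros y.
    assert (E : cl x = f x) by (unfold cl; destruct (Rlt_dec l x); [destruct (Rlt_dec x r)|]; reflexivity).
    rewrite E. pose proof (pw_nonneg b (Rabs (y - x))). pose proof (Rabs_pos M). pose proof (Rle_abs M).
    unfold cl. destruct (Rlt_dec l y); [destruct (Rlt_dec y r)|].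
    + specialize (H y ltac:(lra)). nra.
    + rewrite Rminus_diag, Rabs_R0. nra.
    + rewrite Rminus_diag, Rabs_R0. nra.
Qed.

Lemma lim_s (l r : R) (u v : nat -> R -> R -> R) U V :
  ulim (fun s => l <= s <= r) u U -> ulim (fun s => l <= s <= r) v V ->
  (forall n q s, (1 <= n)%nat -> l < s < r -> is_derive (fun s => u n q s) s (v n q s)) ->
  (forall n q s, (1 <= n)%nat -> l < s < r -> continuous (fun s => v n q s) s) ->
  forall q s, l < s < r -> derivable_pt_lim (fun s => U q s) s (V q s).
Proof.
  intros HU HV Hd Hc q s Hs.
  apply (limit_derive (fun n s => u n q s) (fun n s => v n q s) (fun s => U q s) (fun s => V q s) l r); auto.
  - intros y Hy. apply (ulim_seqlim _ u U q y HU). lra.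
  - intros eps He. destruct (HV eps He) as [N HN]. exists N. intros n Hn y Hy. apply HN; [exact Hn|lra].
Qed.

Lemma lim_q (l r : R) (u v : nat -> R -> R -> R) U V :
  ulim (fun s => l <= s <= r) u U -> ulim (fun s => l <= s <= r) v V ->
  (forall n q s, (1 <= n)%nat -> is_derive (fun q => u n q s) q (v n q s)) ->
  (forall n q s, (1 <= n)%nat -> continuous (fun q => v n q s) q) ->
  forall q s, l < s < r -> derivable_pt_lim (fun q => U q s) q (V q s).
Proof.
  intros HU HV Hd Hc q s Hs.
  apply (limit_derive (fun n q => u n q s) (fun n q => v n q s) (fun q => U q s) (fun q => V q s) (q - 1) (q + 1)); auto.
  - lra.
  - intros y Hy. apply (ulim_seqlim _ u U y s HU). lra.
  - intros eps He. destruct (HV eps He) as [N HN]. exists N. intros n Hn y Hy. apply HN; [exact Hn|lra].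
Qed.

Lemma sepH_lip al l r L u uq us : 0 < al < 1 -> 0 <= L ->
  (forall q s, l <= s <= r -> Rabs (u q s) <= L) ->
  (forall q s, is_derive (fun q => u q s) q (uq q s)) ->
  (forall q s, l < s < r -> is_derive (fun s => u q s) s (us q s)) ->
  (forall q s, l <= s <= r -> continuous (fun s => u q s) s) ->
  (forall q s, l <= s <= r -> Rabs (uq q s) <= L) ->
  (forall q s, l < s < r -> Rabs (us q s) <= L) -> sepH al l r (3 * L) u.
Proof.
  intros Hal HL Hu Hq Hs Hc Bq Bs.
  assert (E : forall d D, 0 <= d -> D <= L * d -> D <= 2 * L -> D <= 3 * L * pw al d).
  { intros d D Hd H1 H2. replace (3 * L) with (L + Rabs (2 * L)) by (rewrite Rabs_right; lra).
    apply lip_pw; lra. }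
  assert (T : forall a b, Rabs a <= L -> Rabs b <= L -> Rabs (a - b) <= 2 * L).
  { intros a b Ha Hb. apply Rabs_le_between in Ha, Hb. apply Rabs_le. lra. }
  split.
  - intros q s Hs'. specialize (Hu q s Hs'). lra.
  - intros q q' s Hs'. apply E; [apply Rabs_pos| |apply T; auto].
    apply (lipschitz_derive_R (fun q => u q s) (fun q => uq q s)); auto.
  - intros q s s' Hs1 Hs2. apply E; [apply Rabs_pos| |apply T; auto].
    destruct (Rle_dec s s').
    + rewrite Rabs_minus_sym, (Rabs_minus_sym s), (Rabs_right (s' - s)) by lra.
      apply (lipschitz_derive (fun s => u q s) (fun s => us q s)); auto; intros; [apply Hs|apply Hc|apply Bs]; lra.
    + rewrite (Rabs_right (s - s')) by lra.
      apply (lipschitz_derive (fun s => u q s) (fun s => us q s)); try lra; intros; [apply Hs|apply Hc|apply Bs]; lra.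
Qed.

Definition scalef (m : nat -> R) (G : fam) : fam := fun i k s => m k * G i k s.

(** * Passage to the limit in one layer *)

Section Layer.
Variables (al l r M0 M1 : R) (K : nat) (F : R -> R -> R) (c Wq Ws : fam).
Hypotheses (Hal : 0 < al < 1) (HK : (1 <= K)%nat) (HO : opn K invk 1).
Hypotheses (HM0 : 0 <= M0) (HM1 : 0 <= M1).
Hypothesis (HFp : forall q s, l <= s <= r -> F (q + 2 * PI) s = F q s).
Hypothesis (HF : sepH al l r M0 F).
Hypothesis (HcF : forall i k s, l < s < r -> c i k s = fc (fun q => F q s) i k).
Hypothesis (Hc : forall s, highfreq K (at_ c s)).
Hypothesis (HWq : forall s, highfreq K (at_ Wq s)).
Hypothesis (HWs : forall s, highfreq K (at_ Ws s)).
Hypothesis (HDq : forall i k s, l < s < r -> is_derive (Wq i k) s (INR k * Ws i k s)).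
Hypothesis (HDs : forall i k s, l < s < r -> is_derive (Ws i k) s (INR k * (Wq i k s + c i k s))).
Hypothesis (HCq : forall i k s, l <= s <= r -> continuous (Wq i k) s).
Hypothesis (HCs : forall i k s, l <= s <= r -> continuous (Ws i k) s).
Hypothesis (HBq : forall N, (1 <= N)%nat -> block N al M1 l r (scalef (fm N) Wq)).
Hypothesis (HBs : forall N, (1 <= N)%nat -> block N al M1 l r (scalef (fm N) Ws)).
Hypothesis (HCaq : forall eps, 0 < eps -> exists N0, forall N N', (N0 <= N)%nat -> (N0 <= N')%nat ->
  block (Nat.max N N') (al / 2) eps l r (scalef (fun k => fm N k - fm N' k) Wq)).
Hypothesis (HCas : forall eps, 0 < eps -> exists N0, forall N N', (N0 <= N)%nat -> (N0 <= N')%nat ->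
  block (Nat.max N N') (al / 2) eps l r (scalef (fun k => fm N k - fm N' k) Ws)).

Let CB : R := (2 + 2 * / al) * M1.

Lemma Ial : 0 < / al.
Proof. apply Rinv_0_lt_compat; lra. Qed.

Lemma CB_pos : 0 <= CB.
Proof. unfold CB. pose proof Ial. apply Rmult_le_pos; lra. Qed.

Lemma scalef_at m X s j i k : mul m (cj j (at_ X s)) i k = cj j (at_ (scalef m X) s) i k.
Proof. unfold mul, scalef, at_. destruct j, i; unfold cj, conj; ring. Qed.

Lemma apx_bound (X : fam) j e N q s : (forall s, highfreq K (at_ X s)) ->
  block N al M1 l r (scalef (fm N) X) -> l <= s <= r -> Rabs (apx X j e N q s) <= CB.
Proof.
  intros HX HB Hs. unfold apx.
  rewrite (trig_ext N _ (invs e (mul (fm N) (cj j (at_ X s))))) by (intros; symmetry; apply invs_mul).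
  apply (invs_bnd K); [exact HO|apply highfreq_mul, cj_highfreq, HX|].
  intros q'. rewrite (trig_ext N _ (cj j (at_ (scalef (fm N) X) s))) by (intros; apply scalef_at).
  eapply Rle_trans; [apply (block_sup N al M1 l r); auto; lra|]. unfold CB. pose proof Ial.
  apply Rmult_le_compat_r; lra.
Qed.

Lemma apx_ucauchy (X : fam) j e : (forall s, highfreq K (at_ X s)) ->
  (forall eps, 0 < eps -> exists N0, forall N N', (N0 <= N)%nat -> (N0 <= N')%nat ->
    block (Nat.max N N') (al / 2) eps l r (scalef (fun k => fm N k - fm N' k) X)) ->
  ucauchy (fun s => l <= s <= r) (fun N q s => apx X j e N q s).
Proof.
  intros HX HC eps He. pose proof Ial.
  assert (0 < / (al / 2)) by (apply Rinv_0_lt_compat; lra).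
  destruct (HC (eps / (1 + / (al / 2)))) as [N0 HN0]; [apply Rdiv_lt_0_compat; lra|].
  exists N0. intros N N' HN HN' q s Hs. unfold apx. rewrite trig_fm_diff.
  rewrite (trig_ext _ _ (invs e (mul (fun k => fm N k - fm N' k) (cj j (at_ X s))))) by (intros; symmetry; apply invs_mul).
  apply (invs_bnd K); [exact HO|apply highfreq_mul, cj_highfreq, HX|].
  intros q'. rewrite (trig_ext _ _ (cj j (at_ (scalef (fun k => fm N k - fm N' k) X) s))) by (intros; apply scalef_at).
  eapply Rle_trans; [apply (block_sup _ (al / 2) (eps / (1 + / (al / 2))) l r); auto; lra|].
  right. field. split; lra.
Qed.

Lemma apx_sepH (X : fam) j N : block N al M1 l r (scalef (fm N) X) ->
  sepH al l r CB (apx X j 0 N).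
Proof.
  intros HB. pose proof Ial.
  assert (E : forall q s, apx X j 0 N q s = trig N (cj j (at_ (scalef (fm N) X) s)) q).
  { intros q s. unfold apx. apply trig_ext. intros; apply scalef_at. }
  split.
  - intros q s Hs. rewrite E. eapply Rle_trans; [apply (block_sup N al M1 l r); auto; lra|]. unfold CB.
    apply Rmult_le_compat_r; lra.
  - intros q q' s Hs. rewrite !E. apply (block_hol_q N al M1 l r); auto; lra.
  - intros q s s' Hs Hs'. rewrite !E. apply (block_hol_s N al M1 l r); auto; lra.
Qed.

Lemma apx_cont (X : fam) j e N q s : (forall i k s, l <= s <= r -> continuous (X i k) s) -> l <= s <= r ->
  continuous (fun s => apx X j e N q s) s.
Proof.
  intros HX Hs. unfold apx, trig. apply continuous_rsum. intros k _.
  assert (I : forall i, continuous (fun s => invs e (cj j (at_ X s)) i k) s).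
  { intros i. induction e as [|e IH]; simpl.
    - destruct j, i; unfold cj, conj, at_; try (apply HX; exact Hs).
      apply (continuous_opp (X true k)). apply HX; exact Hs.
    - apply cont_mult; [apply continuous_const|exact IH]. }
  apply cont_plus; (apply cont_mult; [apply cont_mult; [apply continuous_const|apply I]|apply continuous_const]).
Qed.

(** One derivative in [q] removes one division by [k] and toggles [conj]; the sign comes from [conj]
    applied twice being minus the identity. *)
Lemma is_derive_apx_q (X : fam) j e N (q s : R) : (forall s, highfreq K (at_ X s)) ->
  is_derive (fun q => apx X j (S e) N q s) q ((if j then -1 else 1) * apx X (negb j) e N q s).
Proof.
  intros HX.
  apply (D_eq _ _ (trig N (mul INR (conj (mul (fm N) (invs (S e) (cj j (at_ X s)))))) q)); [|apply is_derive_trig].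
  unfold apx. rewrite <- trig_scal. apply trig_ext. intros i k Hk.
  assert (I : forall i, invs e (cj true (at_ X s)) i k = conj (invs e (at_ X s)) i k).
  { clear - k. intros i. revert i. induction e as [|e IH]; intros i; [reflexivity|].
    change (invk k * invs e (cj true (at_ X s)) i k = conj (invs (S e) (at_ X s)) i k). rewrite IH.
    destruct i; unfold conj; simpl; unfold mul; ring. }
  assert (I0 : forall i, (k < K)%nat -> invs e (at_ X s) i k = 0) by (intros; apply (invs_highfreq K); auto).
  (* At frequency 0 multiplication by [k] does not undo [invk]; there all coefficients vanish
     because [K >= 1]. *)
  destruct (Nat.eq_dec k 0) as [->|N0].
  - destruct j; simpl negb.
    + unfold mul. change (cj false (at_ X s)) with (at_ X s). rewrite I0 by lia. simpl INR. ring.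
    + unfold mul. rewrite (I i). destruct i; unfold conj; rewrite !I0 by lia; simpl INR; ring.
  - assert (NN : INR k <> 0) by (apply not_0_INR; exact N0).
    change (invs (S e) (cj j (at_ X s))) with (mul invk (invs e (cj j (at_ X s)))).
    destruct j; simpl negb.
    + change (cj false (at_ X s)) with (at_ X s). unfold mul, invk. destruct i; unfold conj at 1.
      * rewrite (I false). unfold conj. field. exact NN.
      * rewrite (I true). unfold conj. field. exact NN.
    + unfold mul, invk. rewrite (I i). change (cj false (at_ X s)) with (at_ X s).
      destruct i; unfold conj; field; exact NN.
Qed.

Lemma is_derive_apx_s (X X' : fam) j e N (q s : R) : (forall s, highfreq K (at_ X' s)) ->
  (forall i k, is_derive (X i k) s (INR k * X' i k s)) ->
  is_derive (fun s => apx X j (S e) N q s) s (apx X' j e N q s).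
Proof.
  intros HX HD. unfold apx, trig. apply is_derive_rsum. intros k _.
  assert (I : forall i, is_derive (fun s => invs (S e) (cj j (at_ X s)) i k) s (invs e (cj j (at_ X' s)) i k)).
  { induction e as [|e IH]; intros i.
    - simpl. unfold mul. destruct (Nat.eq_dec k 0) as [->|N0].
      + apply (D_eq _ _ (invk 0 * 0)).
        { rewrite (cj_highfreq K j _ (HX s) i 0%nat) by lia. ring. }
        apply D_scal. destruct j, i; unfold cj, conj, at_.
        * eapply D_eq; [|apply HD]. simpl; ring.
        * apply (D_ext (fun y => -1 * X true 0%nat y)); [intros; ring|]. eapply D_eq; [|apply D_scal, HD]. simpl; ring.
        * eapply D_eq; [|apply HD]. simpl; ring.
        * eapply D_eq; [|apply HD]. simpl; ring.
      + assert (NN : INR k <> 0) by (apply not_0_INR; exact N0).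
        apply (D_eq _ _ (invk k * (INR k * cj j (at_ X' s) i k))); [unfold invk; field; exact NN|].
        apply D_scal. destruct j, i; unfold cj, conj, at_; try apply HD.
        apply (D_ext (fun y => -1 * X true k y)); [intros; ring|]. eapply D_eq; [|apply D_scal, HD]. ring.
    - change (is_derive (fun s => invk k * invs (S e) (cj j (at_ X s)) i k) s (invk k * invs e (cj j (at_ X' s)) i k)).
      apply D_scal. apply IH. }
  unfold mul at 1 2. apply D_plus; apply D_scal_r; apply D_scal; apply I.
Qed.

(** Approximation of [w_ss], read off the equation as [F - w_qq]. *)
Definition assN (N : nat) (q s : R) : R := fejer N (fun q => F q s) q + apx Wq false 0 N q s.

Lemma F_slice s : l <= s <= r -> per1 (fun q => F q s) /\ hol1 al M0 (fun q => F q s) /\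
  (forall q, continuous (fun q => F q s) q).
Proof.
  intros Hs. assert (H : hol1 al M0 (fun q => F q s)) by (intros q q'; apply HF; exact Hs).
  split; [intros q; apply HFp; exact Hs|]. split; [exact H|]. intros q. apply (hol1_cont al M0); [lra|exact H].
Qed.

Lemma fejer_s N q s s' : (1 <= N)%nat -> l <= s <= r -> l <= s' <= r ->
  Rabs (fejer N (fun q => F q s) q - fejer N (fun q => F q s') q) <= M0 * pw al (Rabs (s - s')).
Proof.
  intros HN Hs Hs'. destruct (F_slice s Hs) as [P1 [_ C1]]. destruct (F_slice s' Hs') as [P2 [_ C2]].
  rewrite <- (Rmult_1_l (fejer N (fun q => F q s') q)).
  apply fejer_diff_le; auto. intros y. rewrite Rmult_1_l. apply HF; assumption.
Qed.

Lemma assN_ucauchy : ucauchy (fun s => l <= s <= r) assN.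
Proof.
  intros eps He. destruct (fejer_cvg al M0 (eps / 4) ltac:(lra) HM0 ltac:(lra)) as [N1 [_ H1]].
  destruct (apx_ucauchy Wq false 0 HWq HCaq (eps / 2) ltac:(lra)) as [N2 H2].
  exists (N1 + N2)%nat. intros n m Hn Hm q s Hs. destruct (F_slice s Hs) as [P1 [P2 _]].
  pose proof (H1 n ltac:(lia) _ P1 P2 q) as A1. pose proof (H1 m ltac:(lia) _ P1 P2 q) as A2.
  pose proof (H2 n m ltac:(lia) ltac:(lia) q s Hs) as A3. unfold assN.
  apply Rabs_le_between in A1, A2, A3. apply Rabs_le. lra.
Qed.

Lemma assN_derive N q s : l < s < r -> is_derive (fun s => apx Ws false 1 N q s) s (assN N q s).
Proof.
  intros Hs.
  pose (X' := fun i k s => Wq i k s + c i k s).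
  apply (D_eq _ _ (apx X' false 0 N q s)).
  - unfold assN, apx. rewrite fejer_fm, <- trig_add. apply trig_ext. intros i k _.
    unfold cadd, mul. simpl. unfold X', cj, at_. rewrite <- HcF by exact Hs. ring.
  - apply is_derive_apx_s.
    + intros s' i k Hk. unfold X', at_. pose proof (HWq s' i k Hk) as E1. pose proof (Hc s' i k Hk) as E2.
      unfold at_ in E1, E2. rewrite E1, E2. ring.
    + intros i k. apply HDs; exact Hs.
Qed.

(** Existence of the limits rests on the Cauchy property at exponent [al / 2]; their Hoelder bounds
    rest on the uniform bounds at exponent [al]. Lower-order derivatives are Hoelder because their
    approximants are uniformly Lipschitz. *)
Lemma layer_limit : exists (w : R -> R -> R) (d : Der2), IsC2a al l r w d /\
  (forall q s, l <= s <= r -> dpp d q s + dqq d q s = F q s) /\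
  (forall q s, l <= s <= r -> seqlim (fun N => apx Wq false 2 N q s) (w q s) /\
     seqlim (fun N => apx Ws false 1 N q s) (dp d q s) /\
     seqlim (fun N => -1 * apx Wq false 0 N q s) (dqq d q s)).
Proof.
  pose proof CB_pos as HCB. pose proof Ial.
  destruct (ucauchy_ulim _ _ (apx_ucauchy Wq false 2 HWq HCaq)) as [w Lw].
  destruct (ucauchy_ulim _ _ (apx_ucauchy Wq true 1 HWq HCaq)) as [wq Lq].
  destruct (ucauchy_ulim _ _ (apx_ucauchy Ws false 1 HWs HCas)) as [ws Ls].
  destruct (ucauchy_ulim _ _ (apx_ucauchy Wq false 0 HWq HCaq)) as [vqq Lvqq].
  destruct (ucauchy_ulim _ _ (apx_ucauchy Ws true 0 HWs HCas)) as [wsq Lsq].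
  destruct (ucauchy_ulim _ _ assN_ucauchy) as [wss Lss].
  pose (wqq := fun q s => -1 * vqq q s).
  assert (Lqq : ulim (fun s => l <= s <= r) (fun N q s => -1 * apx Wq false 0 N q s) wqq).
  { intros eps He. destruct (Lvqq eps He) as [N HN]. exists N. intros n Hn q s Hs. unfold wqq.
    rewrite <- Rmult_minus_distr_l, Rabs_mult, Rabs_m1, Rmult_1_l. apply HN; assumption. }
  assert (Sqq : sepH al l r CB vqq) by (apply (sepH_ulim al l r CB (apx Wq false 0)); [intros; apply apx_sepH; auto|exact Lvqq]).
  assert (Ssq : sepH al l r CB wsq) by (apply (sepH_ulim al l r CB (apx Ws true 0)); [intros; apply apx_sepH; auto|exact Lsq]).
  assert (Dq0 : forall n q s, is_derive (fun q => apx Wq false 2 n q s) q (apx Wq true 1 n q s)).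
  { intros n q s. eapply D_eq; [|apply is_derive_apx_q; exact HWq]. cbv iota; simpl negb. ring. }
  assert (Dq1 : forall n q s, is_derive (fun q => apx Wq true 1 n q s) q (-1 * apx Wq false 0 n q s)).
  { intros n q s. exact (is_derive_apx_q Wq true 0 n q s HWq). }
  assert (Dq2 : forall n q s, is_derive (fun q => apx Ws false 1 n q s) q (apx Ws true 0 n q s)).
  { intros n q s. eapply D_eq; [|apply is_derive_apx_q; exact HWs]. cbv iota; simpl negb. ring. }
  assert (Ds0 : forall n q s, l < s < r -> is_derive (fun s => apx Wq false 2 n q s) s (apx Ws false 1 n q s)).
  { intros n q s Hs. apply is_derive_apx_s; [exact HWs|]. intros; apply HDq; exact Hs. }
  assert (Ds1 : forall n q s, l < s < r -> is_derive (fun s => apx Wq true 1 n q s) s (apx Ws true 0 n q s)).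
  { intros n q s Hs. apply is_derive_apx_s; [exact HWs|]. intros; apply HDq; exact Hs. }
  assert (BSS : forall n q s, (1 <= n)%nat -> l <= s <= r -> Rabs (assN n q s) <= M0 + CB).
  { intros n q s Hn Hs. unfold assN. eapply Rle_trans; [apply Rabs_triang|]. destruct (F_slice s Hs) as [P1 [P2 P3]].
    apply Rplus_le_compat; [apply fejer_bound; auto; intros; apply HF; exact Hs|].
    apply apx_bound; auto. }
  assert (S0 : sepH al l r (3 * (M0 + CB)) w).
  { apply (sepH_ulim al l r _ (apx Wq false 2)); [|exact Lw]. intros n Hn.
    apply (sepH_lip al l r (M0 + CB) _ (apx Wq true 1 n) (apx Ws false 1 n)); auto; try lra.
    - intros q s Hs. apply Rle_trans with CB; [apply apx_bound; auto|lra].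
    - intros q s Hs. apply apx_cont; auto.
    - intros q s Hs. apply Rle_trans with CB; [apply apx_bound; auto|lra].
    - intros q s Hs. apply Rle_trans with CB; [apply apx_bound; auto; lra|lra]. }
  assert (S1 : sepH al l r (3 * (M0 + CB)) wq).
  { apply (sepH_ulim al l r _ (apx Wq true 1)); [|exact Lq]. intros n Hn.
    apply (sepH_lip al l r (M0 + CB) _ (fun q s => -1 * apx Wq false 0 n q s) (apx Ws true 0 n)); auto; try lra.
    - intros q s Hs. apply Rle_trans with CB; [apply apx_bound; auto|lra].
    - intros q s Hs. apply apx_cont; auto.
    - intros q s Hs. rewrite Rabs_mult, Rabs_m1, Rmult_1_l. apply Rle_trans with CB; [apply apx_bound; auto|lra].
    - intros q s Hs. apply Rle_trans with CB; [apply apx_bound; auto; lra|lra]. }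
  assert (S2 : sepH al l r (3 * (M0 + CB)) ws).
  { apply (sepH_ulim al l r _ (apx Ws false 1)); [|exact Ls]. intros n Hn.
    apply (sepH_lip al l r (M0 + CB) _ (apx Ws true 0 n) (assN n)); auto; try lra.
    - intros q s Hs. apply Rle_trans with CB; [apply apx_bound; auto|lra].
    - intros; apply assN_derive; assumption.
    - intros q s Hs. apply apx_cont; auto.
    - intros q s Hs. apply Rle_trans with CB; [apply apx_bound; auto|lra].
    - intros q s Hs. apply BSS; [exact Hn|lra]. }
  assert (ESS : forall q s, l <= s <= r -> wss q s = F q s + vqq q s).
  { intros q s Hs. apply (seqlim_unique (fun n => assN n q s)); [exact (ulim_seqlim _ _ _ q s Lss Hs)|].
    replace (F q s + vqq q s) with (1 * F q s + 1 * vqq q s) by ring.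
    assert (SF : seqlim (fun n => fejer n (fun q => F q s) q) (F q s)).
    { intros eps He. destruct (fejer_cvg al M0 eps ltac:(lra) HM0 He) as [N1 [_ H1]]. exists N1. intros n Hn.
      destruct (F_slice s Hs) as [P1 [P2 P3]]. exact (H1 n Hn _ P1 P2 q). }
    eapply seqlim_ext; [|apply seqlim_lin; [exact SF|exact (ulim_seqlim _ _ _ q s Lvqq Hs)]].
    intros n _. unfold assN. simpl. ring. }
  assert (Scomb : sepH al l r (M0 + CB) wss).
  { destruct HF as [F1 F2 F3]. destruct Sqq as [V1 V2 V3]. split.
    - intros q s Hs. rewrite ESS by exact Hs. eapply Rle_trans; [apply Rabs_triang|]. apply Rplus_le_compat; auto.
    - intros q q' s Hs. rewrite !ESS by exact Hs.
      replace (F q s + vqq q s - (F q' s + vqq q' s)) with ((F q s - F q' s) + (vqq q s - vqq q' s)) by ring.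
      rewrite Rmult_plus_distr_r. eapply Rle_trans; [apply Rabs_triang|]. apply Rplus_le_compat; auto.
    - intros q s s' Hs Hs'. rewrite !ESS by assumption.
      replace (F q s + vqq q s - (F q s' + vqq q s')) with ((F q s - F q s') + (vqq q s - vqq q s')) by ring.
      rewrite Rmult_plus_distr_r. eapply Rle_trans; [apply Rabs_triang|]. apply Rplus_le_compat; auto. }
  assert (Sqq' : sepH al l r CB wqq).
  { destruct Sqq as [V1 V2 V3]. unfold wqq. split.
    - intros. rewrite Rabs_mult, Rabs_m1, Rmult_1_l. auto.
    - intros. rewrite <- Rmult_minus_distr_l, Rabs_mult, Rabs_m1, Rmult_1_l. auto.
    - intros. rewrite <- Rmult_minus_distr_l, Rabs_mult, Rabs_m1, Rmult_1_l. auto. }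
  exists w, (mkDer2 ws wq wss wsq wqq).
  split; [|split].
  - unfold IsC2a. cbn [dp dq dpp dpq dqq].
    split; [split|].
    { intros q s Hs. apply (seqlim_unique (fun n => apx Wq false 2 n (q + 2 * PI) s)).
      - exact (ulim_seqlim _ _ _ (q + 2 * PI) s Lw Hs).
      - eapply seqlim_ext; [|exact (ulim_seqlim _ _ _ q s Lw Hs)]. intros n _. simpl. symmetry. apply trig_periodic. }
    { apply (sepH_holder2 al l r (3 * (M0 + CB))); auto; lra. }
    split; [apply (sepH_holder2 al l r (3 * (M0 + CB))); auto; lra|].
    split; [apply (sepH_holder2 al l r (3 * (M0 + CB))); auto; lra|].
    split; [apply (sepH_holder2 al l r (M0 + CB)); auto; lra|].
    split; [apply (sepH_holder2 al l r CB); auto; lra|].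
    split; [apply (sepH_holder2 al l r CB); auto; lra|].
    intros q s Hs. split; [|split; [|split; [|split; [|split]]]].
    + apply (lim_s l r (apx Wq false 2) (apx Ws false 1)); auto. intros; apply apx_cont; auto; lra.
    + apply (lim_q l r (apx Wq false 2) (apx Wq true 1)); auto. intros n q' s' _. exact (derive_cont _ _ _ (Dq1 n q' s')).
    + apply (lim_s l r (apx Ws false 1) assN); auto; [intros; apply assN_derive; assumption|].
      intros n q' s' Hn Hs'. unfold assN. apply cont_plus; [|apply apx_cont; auto; lra].
      apply (hol_cont_loc al M0 _ l r); [lra|exact Hs'|]. intros y Hy. apply fejer_s; [exact Hn|lra|lra].
    + apply (lim_q l r (apx Ws false 1) (apx Ws true 0)); auto. intros n q' s' _. apply trig_continuous.
    + apply (lim_s l r (apx Wq true 1) (apx Ws true 0)); auto. intros; apply apx_cont; auto; lra.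
    + apply (lim_q l r (apx Wq true 1) (fun N q s => -1 * apx Wq false 0 N q s)); auto.
      intros n q' s' _. apply cont_mult; [apply continuous_const|apply trig_continuous].
  - intros q s Hs. cbn [dpp dqq]. rewrite ESS by exact Hs. unfold wqq. ring.
  - intros q s Hs. cbn [dp dqq]. split; [exact (ulim_seqlim _ _ _ q s Lw Hs)|].
    split; [exact (ulim_seqlim _ _ _ q s Ls Hs)|]. exact (ulim_seqlim _ _ _ q s Lqq Hs).
Qed.
End Layer.

(** * Solvability of the flattened transmission problem at high frequency *)

(** The interface lies at [s = 0]. Continuity of [v_p] becomes a jump of [w_s] proportional to [w],
    because [w = a v] and [a] has different slopes on the two sides. *)
Record Wsol (al h1 h2 kap sig bt ct : R) (F1 F2 : R -> R -> R) (z : R -> R)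
    (w1 : R -> R -> R) (d1 : Der2) (w2 : R -> R -> R) (d2 : Der2) : Prop := mkWsol {
  Ws_1 : IsC2a al (- h1) 0 w1 d1;
  Ws_2 : IsC2a al 0 h2 w2 d2;
  Ws_F1 : forall q s, - h1 <= s <= 0 -> dpp d1 q s + dqq d1 q s = F1 q s;
  Ws_F2 : forall q s, 0 <= s <= h2 -> dpp d2 q s + dqq d2 q s = F2 q s;
  Ws_bot : forall q, w1 q (- h1) = 0;
  Ws_cont : forall q, w1 q 0 = w2 q 0;
  Ws_jump : forall q, dp d1 q 0 - dp d2 q 0 = kap * w1 q 0;
  Ws_top : forall q, - sig * dqq d2 q h2 + bt * w2 q h2 - ct * dp d2 q h2 = z q }.

(** Continues slices constantly beyond the layer, so that Fourier coefficients of the data become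
    continuous functions on the whole line. *)
Definition clamp (l r s : R) : R := Rmax l (Rmin r s).

Lemma clamp_in l r s : l <= r -> l <= clamp l r s <= r.
Proof.
  intros H. unfold clamp. split; [apply Rmax_l|]. apply Rmax_lub; [exact H|apply Rmin_l].
Qed.

Lemma clamp_id l r s : l <= s <= r -> clamp l r s = s.
Proof. intros H. unfold clamp. rewrite Rmin_right, Rmax_right by lra. reflexivity. Qed.

Lemma clamp_lip l r s s' : l <= r -> Rabs (clamp l r s - clamp l r s') <= Rabs (s - s').
Proof.
  intros H. unfold clamp, Rmax, Rmin.
  repeat destruct (Rle_dec _ _); unfold Rabs; repeat destruct (Rcase_abs _); lra.
Qed.

Lemma fejer_unif N al M f : (1 <= N)%nat -> 0 < al -> per1 f -> hol1 al M f -> (forall q, Rabs (f q) <= M) ->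
  good N al (mul (fm N) (fc f)) M.
Proof.
  intros HN Hal Hp Hh HB. assert (Hc : forall q, continuous f q) by (intros; apply (hol1_cont al M); assumption).
  split.
  - intros q. rewrite <- fejer_fm. apply fejer_bound; auto.
  - intros q h. rewrite <- !fejer_fm. pose proof (fejer_hol N al M f HN Hal Hp Hh (q + h) q) as H.
    replace (q + h - q) with h in H by ring. exact H.
Qed.

(** Geometric mean of a Hoelder bound [A p^2] and a sup bound [B]; in use [p] is [|h|^(al/2)]. *)
Lemma interp_hol A B p x e : 0 <= x -> 0 <= p -> 0 <= e -> x <= A * (p * p) -> x <= B -> 0 <= A -> A * B <= e * e -> x <= e * p.
Proof.
  intros Hx Hp He H1 H2 HA HAB. apply Rsqr_incr_0_var; [|apply Rmult_le_pos; assumption]. unfold Rsqr.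
  apply Rle_trans with (A * (p * p) * B).
  - apply Rmult_le_compat; assumption.
  - replace (A * (p * p) * B) with (A * B * (p * p)) by ring. replace (e * p * (e * p)) with (e * e * (p * p)) by ring.
    apply Rmult_le_compat_r; nra.
Qed.

(** Interpolation between the uniform [C^al] bound and uniform convergence; the price is the halved
    exponent. *)
Lemma fejer_cauchy al M eps : 0 < al -> 0 <= M -> 0 < eps -> exists N0, forall N N', (N0 <= N)%nat -> (N0 <= N')%nat ->
  forall f, per1 f -> hol1 al M f -> good (Nat.max N N') (al / 2) (mul (fun k => fm N k - fm N' k) (fc f)) eps.
Proof.
  intros Hal HM He.
  (* The first bound makes the sup norm of the difference, [2 d], at most [eps]; the second makes
     [(2 M) (4 d) <= eps^2], as the interpolation requires. *)
  pose (d := Rmin (eps / 2) (eps * eps / (8 * (M + 1)))).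
  assert (Hd : 0 < d) by (apply Rmin_glb_lt; [lra|apply Rdiv_lt_0_compat; nra]).
  assert (Hd1 : d <= eps / 2) by apply Rmin_l.
  assert (Hd2 : 8 * (M + 1) * d <= eps * eps).
  { replace (eps * eps) with (8 * (M + 1) * (eps * eps / (8 * (M + 1)))) by (field; lra).
    apply Rmult_le_compat_l; [lra|apply Rmin_r]. }
  destruct (fejer_cvg al M d Hal HM Hd) as [N0 [HN2 H0]].
  exists N0. intros N N' HN HN' f Hp Hh.
  assert (E : forall q, trig (Nat.max N N') (mul (fun k => fm N k - fm N' k) (fc f)) q = fejer N f q - fejer N' f q).
  { intros q. rewrite <- trig_fm_diff, !fejer_fm. reflexivity. }
  assert (S : forall q, Rabs (fejer N f q - fejer N' f q) <= 2 * d).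
  { intros q. pose proof (H0 N HN f Hp Hh q) as A1. pose proof (H0 N' HN' f Hp Hh q) as A2.
    apply Rabs_le_between in A1, A2. apply Rabs_le. lra. }
  split.
  - intros q. rewrite E. specialize (S q). lra.
  - intros q h. rewrite !E. pose proof (S q) as S1. pose proof (S (q + h)) as S2.
    pose proof (fejer_hol N al M f ltac:(lia) Hal Hp Hh (q + h) q) as A1.
    pose proof (fejer_hol N' al M f ltac:(lia) Hal Hp Hh (q + h) q) as A2.
    replace (q + h - q) with h in A1, A2 by ring.
    apply (interp_hol (2 * M) (4 * d) (pw (al / 2) (Rabs h))).
    + apply Rabs_pos.
    + apply pw_nonneg.
    + lra.
    + rewrite pw_pow2 by apply Rabs_pos. apply Rabs_le_between in A1, A2. apply Rabs_le. lra.
    + apply Rabs_le_between in S1, S2. apply Rabs_le. lra.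
    + lra.
    + nra.
Qed.

Section Solve.
Variables (al h1 h2 kap sig bt ct : R).
Hypotheses (Hal : 0 < al < 1) (Hh1 : 0 < h1) (Hh2 : 0 < h2) (Hsig : sig <> 0).

Lemma pint_scal f m : pint f -> pint (fun t => m * f t) /\
  forall g a b, (forall x, continuous g x) ->
    integral (fun t => g t * (m * f t)) a b = m * integral (fun t => g t * f t) a b.
Proof.
  intros Hf. assert (H : forall g a b, (forall x, continuous g x) ->
    RI (fun t => g t * (m * f t)) a b (m * integral (fun t => g t * f t) a b)).
  { intros g a b Hg. apply (RI_ext (fun t => m * (g t * f t))); [intros; ring|]. apply RI_scal, Hf, Hg. }
  assert (E : forall g a b, (forall x, continuous g x) ->
    integral (fun t => g t * (m * f t)) a b = m * integral (fun t => g t * f t) a b).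
  { intros g a b Hg. apply integral_unique, H, Hg. }
  split; [|exact E]. intros g a b Hg. rewrite E by exact Hg. apply H, Hg.
Qed.

Lemma U_scal (m : nat -> R) (c : fam) i k s : (forall i k, pint (c i k)) ->
  Uq h1 h2 (scalef m c) i k s = m k * Uq h1 h2 c i k s /\ Us h1 h2 (scalef m c) i k s = m k * Us h1 h2 c i k s.
Proof.
  intros Hc. destruct (pint_scal (c i k) (m k) (Hc i k)) as [_ E].
  unfold Uq, Us, Dp, Dm, scalef. 
  rewrite (E (fun t => exp (INR k * t)) _ _ (fun x => expk_cont (INR k) x)),
    (E (fun t => exp (- (INR k * t))) _ _ (fun x => expmk_cont (INR k) x)). split; ring.
Qed.

(** The system is diagonal in frequency. Fejer means of one solution, and differences of such means,
    therefore solve it for the correspondingly smoothed data. *)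
Lemma Sys_mul K m c z x1 x2 x3 : (forall i k, pint (c i k)) -> Sys h1 h2 kap sig bt ct K c z x1 x2 x3 ->
  Sys h1 h2 kap sig bt ct K (scalef m c) (mul m z) (mul m x1) (mul m x2) (mul m x3).
Proof.
  intros Hc [A B C D E F G H].
  assert (U : forall i k s, Uq h1 h2 (scalef m c) i k s = m k * Uq h1 h2 c i k s) by (intros; apply U_scal; exact Hc).
  assert (V : forall i k s, Us h1 h2 (scalef m c) i k s = m k * Us h1 h2 c i k s) by (intros; apply U_scal; exact Hc).
  split; try (apply highfreq_mul; assumption).
  - intros t i k Hk. unfold scalef, at_. specialize (A t i k Hk). unfold at_ in A. rewrite A. ring.
  - intros i k. unfold mul at 1. rewrite F. unfold comb3, rhs1, cadd, mul, at_. rewrite !U. ring.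
  - intros i k. unfold mul at 1. rewrite G. unfold comb3, rhs2, cadd, mul, at_. rewrite !U, !V. ring.
  - intros i k. unfold mul at 1. rewrite H. unfold comb3, rhs3, cadd, mul, at_. rewrite !U. ring.
Qed.

Definition cdata (F1 F2 : R -> R -> R) : fam := fun i k =>
  glue (fun s => fc (fun q => F1 q (clamp (- h1) 0 s)) i k) (fun s => fc (fun q => F2 q (clamp 0 h2 s)) i k).

Lemma fc_clamp_cont l r M F i k s : l <= r -> 0 <= M -> sepH al l r M F ->
  continuous (fun s => fc (fun q => F q (clamp l r s)) i k) s.
Proof.
  intros Hlr HM [HB Hq Hs]. apply (hol_cont al (2 * M)); [lra|]. intros y.
  assert (C : forall s, forall q, continuous (fun q => F q (clamp l r s)) q).
  { intros s' q. apply (hol1_cont al M); [lra|]. intros q1 q2. apply Hq. apply clamp_in; exact Hlr. }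
  replace (fc (fun q => F q (clamp l r y)) i k - fc (fun q => F q (clamp l r s)) i k)
    with (fc (fun q => F q (clamp l r y)) i k + -1 * fc (fun q => F q (clamp l r s)) i k) by ring.
  rewrite <- fc_lin by apply C. rewrite Rmult_assoc. apply fc_le.
  - intros q. apply cont_plus; [apply C|]. apply cont_mult; [apply continuous_const|apply C].
  - intros q. replace (F q (clamp l r y) + -1 * F q (clamp l r s)) with (F q (clamp l r y) - F q (clamp l r s)) by ring.
    eapply Rle_trans; [apply Hs; apply clamp_in; exact Hlr|]. apply Rmult_le_compat_l; [exact HM|].
    apply pw_le; [lra|]. apply clamp_lip; exact Hlr.
Qed.

(** The coefficients are solved for once, without truncation. The a priori bound is then used twice:
    at exponent [al] for the Fejer means and at [al / 2] for their differences. *)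
Lemma hf_solve : exists K0, (1 <= K0)%nat /\ forall K, (K0 <= K)%nat -> forall F1 F2 z M, 0 <= M ->
  (forall q s, - h1 <= s <= 0 -> F1 (q + 2 * PI) s = F1 q s) -> sepH al (- h1) 0 M F1 ->
  (forall q s, 0 <= s <= h2 -> F2 (q + 2 * PI) s = F2 q s) -> sepH al 0 h2 M F2 ->
  per1 z -> hol1 al M z -> (forall q, Rabs (z q) <= M) ->
  (forall s, - h1 <= s <= 0 -> highfreq K (fc (fun q => F1 q s))) ->
  (forall s, 0 <= s <= h2 -> highfreq K (fc (fun q => F2 q s))) -> highfreq K (fc z) ->
  exists w1 d1 w2 d2, Wsol al h1 h2 kap sig bt ct F1 F2 z w1 d1 w2 d2.
Proof.
  destruct (hf_exists h1 h2 kap sig bt ct Hh1 Hh2) as [K0 HK0].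
  exists (K0 + 1)%nat. split; [lia|]. intros K HK F1 F2 z M HM P1 S1 P2 S2 Pz Hz Bz HF1 HF2 HFz.
  assert (HFK : hf h1 h2 kap sig bt ct K) by (apply HK0; lia).
  destruct (apriori h1 h2 kap sig bt ct Hh1 Hh2 al K Hal HFK) as [C [HC AP]].
  destruct (apriori h1 h2 kap sig bt ct Hh1 Hh2 (al / 2) K ltac:(lra) HFK) as [C' [HC' AP']].
  pose (c := cdata F1 F2).
  assert (Cc1 : forall i k s, continuous (fun s => fc (fun q => F1 q (clamp (- h1) 0 s)) i k) s)
    by (intros; apply (fc_clamp_cont _ _ M); auto; lra).
  assert (Cc2 : forall i k s, continuous (fun s => fc (fun q => F2 q (clamp 0 h2 s)) i k) s)
    by (intros; apply (fc_clamp_cont _ _ M); auto; lra).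
  assert (Hpint : forall i k, pint (c i k)) by (intros; apply pint_glue; auto).
  assert (Hcc : forall i k s, - h1 < s < 0 \/ 0 < s < h2 -> continuous (c i k) s).
  { intros i k s [H|H]; [apply glue_cont_neg|apply glue_cont_pos]; auto; lra. }
  assert (Hslice : forall t, exists f, per1 f /\ hol1 al M f /\ (forall q, Rabs (f q) <= M) /\ highfreq K (fc f) /\
     forall i k, c i k t = fc f i k).
  { intros t. unfold c, cdata, glue. destruct (Rle_dec t 0).
    - pose proof (clamp_in (- h1) 0 t ltac:(lra)) as Ht.
      exists (fun q => F1 q (clamp (- h1) 0 t)). destruct S1 as [X1 X2 X3].
      split; [intros q; apply P1; exact Ht|]. split; [intros q q'; apply X2; exact Ht|].
      split; [intros q; apply X1; exact Ht|]. split; [apply HF1; exact Ht|reflexivity].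
    - pose proof (clamp_in 0 h2 t ltac:(lra)) as Ht.
      exists (fun q => F2 q (clamp 0 h2 t)). destruct S2 as [X1 X2 X3].
      split; [intros q; apply P2; exact Ht|]. split; [intros q q'; apply X2; exact Ht|].
      split; [intros q; apply X1; exact Ht|]. split; [apply HF2; exact Ht|reflexivity]. }
  assert (Hchf : forall t, highfreq K (at_ c t)).
  { intros t i k Hk. destruct (Hslice t) as [f [_ [_ [_ [Hf E]]]]]. unfold at_. rewrite E. apply Hf; exact Hk. }
  destruct (Sys_exists h1 h2 kap sig bt ct K c (fc z) HFK Hchf HFz) as [x1 [x2 [x3 HS]]].
  assert (Wsc : forall m, (forall i k s, Wq1 h1 h2 (scalef m c) (mul m x1) (mul m x2) (mul m x3) i k s = scalef m (Wq1 h1 h2 c x1 x2 x3) i k s) /\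
     (forall i k s, Ws1 h1 h2 (scalef m c) (mul m x1) (mul m x2) (mul m x3) i k s = scalef m (Ws1 h1 h2 c x1 x2 x3) i k s) /\
     (forall i k s, Wq2 h1 h2 (scalef m c) (mul m x1) (mul m x2) (mul m x3) i k s = scalef m (Wq2 h1 h2 c x1 x2 x3) i k s) /\
     (forall i k s, Ws2 h1 h2 (scalef m c) (mul m x1) (mul m x2) (mul m x3) i k s = scalef m (Ws2 h1 h2 c x1 x2 x3) i k s)).
  { intros m. unfold Wq1, Wq2, Ws1, Ws2.
    repeat split; intros i k s; destruct (U_scal m c i k s Hpint) as [EU EV]; rewrite ?EU, ?EV; unfold scalef, mul; ring. }
  assert (Pm : forall m i k, pint (scalef m c i k)) by (intros m i k; apply (pint_scal (c i k) (m k)); apply Hpint).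
  assert (Cm : forall m i k s, - h1 < s < 0 \/ 0 < s < h2 -> continuous (scalef m c i k) s).
  { intros m i k s H. apply cont_mult; [apply continuous_const|apply Hcc; exact H]. }
  assert (Bu : forall N, (1 <= N)%nat ->
     block N al (C * M) (- h1) 0 (scalef (fm N) (Wq1 h1 h2 c x1 x2 x3)) /\
     block N al (C * M) (- h1) 0 (scalef (fm N) (Ws1 h1 h2 c x1 x2 x3)) /\
     block N al (C * M) 0 h2 (scalef (fm N) (Wq2 h1 h2 c x1 x2 x3)) /\
     block N al (C * M) 0 h2 (scalef (fm N) (Ws2 h1 h2 c x1 x2 x3))).
  { intros N HN. destruct (Wsc (fm N)) as [E1 [E2 [E3 E4]]].
    destruct (AP N _ _ _ _ _ M HM (Sys_mul K (fm N) c _ _ _ _ Hpint HS) (Pm (fm N)) (Cm (fm N))) as [A1 [A2 [A3 A4]]].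
    - intros t _. destruct (Hslice t) as [f [Q1 [Q2 [Q3 [_ E]]]]].
      destruct (fejer_unif N al M f HN ltac:(lra) Q1 Q2 Q3) as [_ H].
      intros q h. rewrite !(trig_ext N (at_ (scalef (fm N) c) t) (mul (fm N) (fc f))); [apply H| |];
      intros i k _; unfold at_, scalef, mul; rewrite E; reflexivity.
    - apply fejer_unif; auto; lra.
    - split; [|split; [|split]]; eapply block_ext; [exact E1|exact A1|exact E2|exact A2|exact E3|exact A3|exact E4|exact A4]. }
  assert (Bc : forall eps, 0 < eps -> exists N0, forall N N', (N0 <= N)%nat -> (N0 <= N')%nat ->
     let n := Nat.max N N' in let m := fun k => fm N k - fm N' k in
     block n (al / 2) eps (- h1) 0 (scalef m (Wq1 h1 h2 c x1 x2 x3)) /\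
     block n (al / 2) eps (- h1) 0 (scalef m (Ws1 h1 h2 c x1 x2 x3)) /\
     block n (al / 2) eps 0 h2 (scalef m (Wq2 h1 h2 c x1 x2 x3)) /\
     block n (al / 2) eps 0 h2 (scalef m (Ws2 h1 h2 c x1 x2 x3))).
  { intros eps He. pose (e := eps / (C' + 1)). assert (He' : 0 < e) by (apply Rdiv_lt_0_compat; lra).
    assert (Ee : C' * e <= eps).
    { replace eps with ((C' + 1) * e) at 1 by (unfold e; field; lra). nra. }
    destruct (fejer_cauchy al M e ltac:(lra) HM He') as [N0 H0]. exists N0. intros N N' HN HN' n m.
    destruct (Wsc m) as [E1 [E2 [E3 E4]]].
    destruct (AP' n _ _ _ _ _ e (Rlt_le _ _ He') (Sys_mul K m c _ _ _ _ Hpint HS) (Pm m) (Cm m)) as [A1 [A2 [A3 A4]]].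
    - intros t _. destruct (Hslice t) as [f [Q1 [Q2 [Q3 [_ E]]]]].
      destruct (H0 N N' HN HN' f Q1 Q2) as [_ H]. fold n m in H.
      intros q h. rewrite !(trig_ext n (at_ (scalef m c) t) (mul m (fc f))); [apply H| |];
      intros i k _; unfold at_, scalef, mul; rewrite E; reflexivity.
    - apply H0; auto.
    - split; [|split; [|split]]; (apply (block_weaken _ _ (C' * e)); [exact Ee|]); eapply block_ext;
      [exact E1|exact A1|exact E2|exact A2|exact E3|exact A3|exact E4|exact A4]. }
  assert (HWhf : forall s, highfreq K (at_ (Wq1 h1 h2 c x1 x2 x3) s) /\ highfreq K (at_ (Ws1 h1 h2 c x1 x2 x3) s) /\
      highfreq K (at_ (Wq2 h1 h2 c x1 x2 x3) s) /\ highfreq K (at_ (Ws2 h1 h2 c x1 x2 x3) s)).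
  { intros s. destruct HS as [_ _ X1 X2 X3 _ _ _]. destruct (U_highfreq h1 h2 K c s Hchf) as [U V].
    unfold Wq1, Wq2, Ws1, Ws2.
    repeat split; intros i k Hk; unfold at_; specialize (U i k Hk); specialize (V i k Hk); unfold at_ in U, V;
    rewrite ?U, ?V, X1, X2, X3 by exact Hk; ring. }
  assert (HWd : forall i k s, - h1 < s < 0 \/ 0 < s < h2 -> _)
    by (intros i k s H; exact (W_derive h1 h2 c x1 x2 x3 i k s (Hpint i k) (Hcc i k s H))).
  cbv beta in HWd.
  assert (HUc : forall i k s, continuous (Uq h1 h2 c i k) s /\ continuous (Us h1 h2 c i k) s).
  { intros i k s. pose proof (Dp_cont (- h1) (c i k) k s (Hpint i k)). pose proof (Dm_cont h2 (c i k) k s (Hpint i k)).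
    unfold Uq, Us. split; (apply cont_plus; (apply cont_mult; [apply continuous_const|]);
    (apply cont_mult; [apply continuous_const|assumption])). }
  assert (Hpc : forall u v x k s, continuous (fun s => pexp (u * s + v) k * x) s).
  { intros u v x k s. unfold pexp. apply @ex_derive_continuous. auto_derive. exact I. }
  assert (Hpc' : forall u v x k s, continuous (fun s => - (pexp (u * s + v) k * x)) s).
  { intros u v x k s. unfold pexp. apply @ex_derive_continuous. auto_derive. exact I. }
  destruct HFK as [HK2 [HO HFK']].
  assert (HCM : 0 <= C * M) by (apply Rmult_le_pos; lra).
  destruct (layer_limit al (- h1) 0 M (C * M) K F1 c (Wq1 h1 h2 c x1 x2 x3) (Ws1 h1 h2 c x1 x2 x3)) as [w1 [d1 [I1 [J1 L1]]]];
    auto; try lra; try lia.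
  { intros i k s Hs. unfold c, cdata, glue. destruct (Rle_dec s 0); [|lra]. rewrite clamp_id by lra. reflexivity. }
  { intros s. exact (proj1 (HWhf s)). } { intros s. exact (proj1 (proj2 (HWhf s))). }
  { intros i k s Hs. exact (proj1 (HWd i k s (or_introl Hs))). } { intros i k s Hs. exact (proj1 (proj2 (HWd i k s (or_introl Hs)))). }
  { intros i k s _. unfold Wq1. apply cont_plus; [apply (HUc i k s)|]; apply cont_plus; [apply Hpc|]; apply cont_plus; [apply Hpc|apply Hpc]. }
  { intros i k s _. unfold Ws1. apply cont_plus; [apply (HUc i k s)|]; apply cont_plus; [apply Hpc'|]; apply cont_plus; [apply Hpc|apply Hpc]. }
  { intros N HN. exact (proj1 (Bu N HN)). } { intros N HN. exact (proj1 (proj2 (Bu N HN))). }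
  { intros eps He. destruct (Bc eps He) as [N0 H0]. exists N0. intros N N' HN HN'. exact (proj1 (H0 N N' HN HN')). }
  { intros eps He. destruct (Bc eps He) as [N0 H0]. exists N0. intros N N' HN HN'. exact (proj1 (proj2 (H0 N N' HN HN'))). }
  destruct (layer_limit al 0 h2 M (C * M) K F2 c (Wq2 h1 h2 c x1 x2 x3) (Ws2 h1 h2 c x1 x2 x3)) as [w2 [d2 [I2 [J2 L2]]]];
    auto; try lra; try lia.
  { intros i k s Hs. unfold c, cdata, glue. destruct (Rle_dec s 0); [lra|]. rewrite clamp_id by lra. reflexivity. }
  { intros s. exact (proj1 (proj2 (proj2 (HWhf s)))). } { intros s. exact (proj2 (proj2 (proj2 (HWhf s)))). }
  { intros i k s Hs. exact (proj1 (proj2 (proj2 (HWd i k s (or_intror Hs))))). } { intros i k s Hs. exact (proj2 (proj2 (proj2 (HWd i k s (or_intror Hs))))). }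
  { intros i k s _. unfold Wq2. apply cont_plus; [apply (HUc i k s)|]; apply cont_plus; [apply Hpc|]; apply cont_plus; [apply Hpc|apply Hpc]. }
  { intros i k s _. unfold Ws2. apply cont_plus; [apply (HUc i k s)|]; apply cont_plus; [apply Hpc'|]; apply cont_plus; [apply Hpc|apply Hpc']. }
  { intros N HN. exact (proj1 (proj2 (proj2 (Bu N HN)))). } { intros N HN. exact (proj2 (proj2 (proj2 (Bu N HN)))). }
  { intros eps He. destruct (Bc eps He) as [N0 H0]. exists N0. intros N N' HN HN'. exact (proj1 (proj2 (proj2 (H0 N N' HN HN')))). }
  { intros eps He. destruct (Bc eps He) as [N0 H0]. exists N0. intros N N' HN HN'. exact (proj2 (proj2 (proj2 (H0 N N' HN HN')))). }
  assert (HB : forall i k, Wq1 h1 h2 c x1 x2 x3 i k (- h1) = 0 /\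
     Wq1 h1 h2 c x1 x2 x3 i k 0 = Wq2 h1 h2 c x1 x2 x3 i k 0 /\
     invk k * Ws1 h1 h2 c x1 x2 x3 i k 0 - invk k * Ws2 h1 h2 c x1 x2 x3 i k 0
       = kap * (invk k * (invk k * Wq1 h1 h2 c x1 x2 x3 i k 0)) /\
     sig * Wq2 h1 h2 c x1 x2 x3 i k h2 + bt * (invk k * (invk k * Wq2 h1 h2 c x1 x2 x3 i k h2))
      - ct * (invk k * Ws2 h1 h2 c x1 x2 x3 i k h2) = fc z i k).
  { intros i k. destruct (le_lt_dec K k) as [Hk|Hk].
    - destruct (W_boundary h1 h2 kap sig bt ct Hsig K c (fc z) x1 x2 x3 i k HS Hk ltac:(lia)) as [B1 [B2 [B3 B4]]].
      split; [exact B1|]. split; [exact B2|]. split; [|exact B4].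
      rewrite <- Rmult_minus_distr_l, B3. unfold invk. ring.
    - destruct (HWhf (- h1)) as [Z1 _]. destruct (HWhf 0) as [Z2 [Z3 [Z4 Z5]]]. destruct (HWhf h2) as [_ [_ [Z6 Z7]]].
      specialize (Z1 i k Hk). specialize (Z2 i k Hk). specialize (Z3 i k Hk). specialize (Z4 i k Hk).
      specialize (Z5 i k Hk). specialize (Z6 i k Hk). specialize (Z7 i k Hk). unfold at_ in *.
      rewrite Z1, Z2, Z3, Z4, Z5, Z6, Z7, HFz by exact Hk. repeat split; ring. }
  exists w1, d1, w2, d2. split; auto.
  - intros q. destruct (L1 q (- h1) ltac:(lra)) as [A _].
    apply (seqlim_unique (fun N => apx (Wq1 h1 h2 c x1 x2 x3) false 2 N q (- h1)) _ _ A).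
    eapply seqlim_ext; [|apply (seqlim_const 0)]. intros N _. unfold apx.
    rewrite (trig_ext N _ (mul (fun _ => 0) (fc z))); [rewrite trig_zero_mul; reflexivity|].
    intros i k _. unfold mul. simpl. unfold mul, cj, at_. rewrite (proj1 (HB i k)). ring.
  - intros q. destruct (L1 q 0 ltac:(lra)) as [A _]. destruct (L2 q 0 ltac:(lra)) as [B _].
    apply (seqlim_unique _ _ _ A). eapply seqlim_ext; [|exact B]. intros N _. unfold apx. apply trig_ext.
    intros i k _. unfold mul. simpl. unfold mul, cj, at_. rewrite (proj1 (proj2 (HB i k))). reflexivity.
  - intros q. destruct (L1 q 0 ltac:(lra)) as [A [A' _]]. destruct (L2 q 0 ltac:(lra)) as [_ [B' _]].
    pose proof (seqlim_lin _ _ _ _ 1 (-1) A' B') as D. pose proof (seqlim_lin _ _ _ _ kap 0 A A) as E.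
    replace (dp d1 q 0 - dp d2 q 0) with (1 * dp d1 q 0 + -1 * dp d2 q 0) by ring.
    replace (kap * w1 q 0) with (kap * w1 q 0 + 0 * w1 q 0) by ring.
    apply (seqlim_unique _ _ _ D). eapply seqlim_ext; [|exact E]. intros N _. simpl. unfold apx.
    rewrite <- !trig_scal, <- !trig_add. apply trig_ext. intros i k _.
    unfold cadd, mul. simpl. unfold mul, cj, at_. pose proof (proj1 (proj2 (proj2 (HB i k)))) as Q.
    transitivity (fm N k * (kap * (invk k * (invk k * Wq1 h1 h2 c x1 x2 x3 i k 0)))); [ring|]. rewrite <- Q. ring.
  - intros q. destruct (L2 q h2 ltac:(lra)) as [A [B D]].
    pose proof (seqlim_lin _ _ _ _ 1 (- ct) (seqlim_lin _ _ _ _ (- sig) bt D A) B) as E.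
    replace (- sig * dqq d2 q h2 + bt * w2 q h2 - ct * dp d2 q h2)
      with (1 * (- sig * dqq d2 q h2 + bt * w2 q h2) + - ct * dp d2 q h2) by ring.
    apply (seqlim_unique _ _ _ E).
    assert (SF : seqlim (fun n => fejer n z q) (z q)).
    { intros eps He. destruct (fejer_cvg al M eps ltac:(lra) HM He) as [N1 [_ Q1]]. exists N1. intros n Hn.
      exact (Q1 n Hn _ Pz Hz q). }
    eapply seqlim_ext; [|exact SF]. intros N _. simpl. unfold apx. rewrite fejer_fm.
    rewrite <- !trig_scal, <- !trig_add, <- !trig_scal, <- !trig_add. apply trig_ext. intros i k _.
    unfold cadd, mul. simpl. unfold mul, cj, at_. rewrite <- (proj2 (proj2 (proj2 (HB i k)))). ring.
Qed.
End Solve.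

(** * Low frequencies *)

Lemma sepH_comb al l r M M' u v a b : 0 <= M -> 0 <= M' -> sepH al l r M u -> sepH al l r M' v ->
  sepH al l r (Rabs a * M + Rabs b * M') (fun q s => a * u q s + b * v q s).
Proof.
  intros HM HM' [A1 A2 A3] [B1 B2 B3].
  assert (E : forall x y X Y p, 0 <= p -> Rabs x <= X * p -> Rabs y <= Y * p ->
     Rabs (a * x + b * y) <= (Rabs a * X + Rabs b * Y) * p).
  { intros x y X Y p Hp Hx Hy. eapply Rle_trans; [apply Rabs_triang|]. rewrite !Rabs_mult.
    pose proof (Rabs_pos a). pose proof (Rabs_pos b). nra. }
  split.
  - intros q s Hs. rewrite <- Rmult_1_r. apply E; [lra|rewrite Rmult_1_r; auto|rewrite Rmult_1_r; auto].
  - intros q q' s Hs. replace (_ - _) with (a * (u q s - u q' s) + b * (v q s - v q' s)) by ring.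
    apply E; auto using pw_nonneg.
  - intros q s s' Hs Hs'. replace (_ - _) with (a * (u q s - u q s') + b * (v q s - v q s')) by ring.
    apply E; auto using pw_nonneg.
Qed.

Lemma holder2_comb al l r u v a b : 0 < al -> holder2 al l r u -> holder2 al l r v ->
  holder2 al l r (fun q s => a * u q s + b * v q s).
Proof.
  intros Hal Hu Hv. destruct (holder2_sepH _ _ _ _ Hu) as [M [HM SM]]. destruct (holder2_sepH _ _ _ _ Hv) as [M' [HM' SM']].
  apply (sepH_holder2 al l r (Rabs a * M + Rabs b * M')); auto.
  - pose proof (Rabs_pos a). pose proof (Rabs_pos b). nra.
  - apply sepH_comb; assumption.
Qed.

Definition Der2_comb (a b : R) (d d' : Der2) : Der2 :=
  mkDer2 (fun q s => a * dp d q s + b * dp d' q s) (fun q s => a * dq d q s + b * dq d' q s)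
    (fun q s => a * dpp d q s + b * dpp d' q s) (fun q s => a * dpq d q s + b * dpq d' q s)
    (fun q s => a * dqq d q s + b * dqq d' q s).

Lemma derivable_comb f g x l m a b : derivable_pt_lim f x l -> derivable_pt_lim g x m ->
  derivable_pt_lim (fun y => a * f y + b * g y) x (a * l + b * m).
Proof.
  rewrite <- !is_derive_Reals. intros H1 H2. apply D_plus; apply D_scal; assumption.
Qed.

Lemma IsC2a_comb al l r u v d d' a b : 0 < al -> IsC2a al l r u d -> IsC2a al l r v d' ->
  IsC2a al l r (fun q s => a * u q s + b * v q s) (Der2_comb a b d d').
Proof.
  intros Hal [[P1 A1] [A2 [A3 [A4 [A5 [A6 A7]]]]]] [[P2 B1] [B2 [B3 [B4 [B5 [B6 B7]]]]]].
  unfold IsC2a. cbn [Der2_comb dp dq dpp dpq dqq].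
  split; [split; [intros q p Hp; rewrite P1, P2 by exact Hp; reflexivity|apply holder2_comb; assumption]|].
  do 5 (split; [apply holder2_comb; assumption|]).
  intros q p Hp. destruct (A7 q p Hp) as [C1 [C2 [C3 [C4 [C5 C6]]]]]. destruct (B7 q p Hp) as [D1 [D2 [D3 [D4 [D5 D6]]]]].
  split; [|split; [|split; [|split; [|split]]]]; apply derivable_comb; assumption.
Qed.

Lemma Wsol_comb al h1 h2 kap sig bt ct F1 F2 z w1 d1 w2 d2 F1' F2' z' w1' d1' w2' d2' a b : 0 < al ->
  Wsol al h1 h2 kap sig bt ct F1 F2 z w1 d1 w2 d2 -> Wsol al h1 h2 kap sig bt ct F1' F2' z' w1' d1' w2' d2' ->
  Wsol al h1 h2 kap sig bt ct (fun q s => a * F1 q s + b * F1' q s) (fun q s => a * F2 q s + b * F2' q s)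
    (fun q => a * z q + b * z' q) (fun q s => a * w1 q s + b * w1' q s) (Der2_comb a b d1 d1')
    (fun q s => a * w2 q s + b * w2' q s) (Der2_comb a b d2 d2').
Proof.
  intros Hal [A1 A2 A3 A4 A5 A6 A7 A8] [B1 B2 B3 B4 B5 B6 B7 B8].
  split; cbn [Der2_comb dp dq dpp dpq dqq].
  - apply IsC2a_comb; assumption.
  - apply IsC2a_comb; assumption.
  - intros q s Hs. rewrite <- A3, <- B3 by exact Hs. ring.
  - intros q s Hs. rewrite <- A4, <- B4 by exact Hs. ring.
  - intros q. rewrite A5, B5. ring.
  - intros q. rewrite A6, B6. reflexivity.
  - intros q. specialize (A7 q). specialize (B7 q).
    transitivity (a * (dp d1 q 0 - dp d2 q 0) + b * (dp d1' q 0 - dp d2' q 0)); [ring|]. rewrite A7, B7. ring.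
  - intros q. rewrite <- A8, <- B8. ring.
Qed.

Lemma Wsol_ext al h1 h2 kap sig bt ct F1 F2 z w1 d1 w2 d2 F1' F2' z' :
  (forall q s, - h1 <= s <= 0 -> F1 q s = F1' q s) -> (forall q s, 0 <= s <= h2 -> F2 q s = F2' q s) ->
  (forall q, z q = z' q) ->
  Wsol al h1 h2 kap sig bt ct F1 F2 z w1 d1 w2 d2 -> Wsol al h1 h2 kap sig bt ct F1' F2' z' w1 d1 w2 d2.
Proof.
  intros E1 E2 E3 [A1 A2 A3 A4 A5 A6 A7 A8]. split; auto.
  - intros q s Hs. rewrite <- E1 by exact Hs. auto.
  - intros q s Hs. rewrite <- E2 by exact Hs. auto.
  - intros q. rewrite <- E3. auto.
Qed.

Definition Ck (k : nat) (x : R) : R := cosh (INR k * x).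
(** The value at [k = 0] is the limit, so mode 0 follows the same formulas as the others. *)
Definition Sk (k : nat) (x : R) : R := if Nat.eq_dec k 0 then x else sinh (INR k * x) / INR k.

Lemma Ck_derive k x : is_derive (Ck k) x (INR k * INR k * Sk k x).
Proof.
  apply (D_eq _ _ (INR k * sinh (INR k * x))).
  - unfold Sk. destruct (Nat.eq_dec k 0) as [->|N]; [simpl; ring|].
    assert (INR k <> 0) by (apply not_0_INR; exact N). field. assumption.
  - unfold Ck. apply (D_comp cosh (fun x => INR k * x)); [|apply is_derive_linear].
    apply is_derive_Reals, derivable_pt_lim_cosh.
Qed.

Lemma Sk_derive k x : is_derive (Sk k) x (Ck k x).
Proof.
  unfold Sk, Ck. destruct (Nat.eq_dec k 0) as [->|N].
  - simpl INR. rewrite Rmult_0_l, cosh_0. apply (D_ext (fun y => 1 * y)); [intros; ring|]. apply is_derive_linear.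
  - assert (INR k <> 0) by (apply not_0_INR; exact N).
    apply (D_eq _ _ (INR k * cosh (INR k * x) * / INR k)); [field; assumption|].
    apply (D_scal_r (fun x => sinh (INR k * x))). apply (D_comp sinh (fun x => INR k * x)); [|apply is_derive_linear].
    apply is_derive_Reals, derivable_pt_lim_sinh.
Qed.

Lemma Ck_0 k : Ck k 0 = 1.
Proof. unfold Ck. rewrite Rmult_0_r. apply cosh_0. Qed.
Lemma Sk_0 k : Sk k 0 = 0.
Proof. unfold Sk. destruct (Nat.eq_dec k 0); [reflexivity|]. rewrite Rmult_0_r, sinh_0. unfold Rdiv; ring. Qed.

Lemma Ck_Sk k x : Ck k x * Ck k x - INR k * INR k * (Sk k x * Sk k x) = 1.
Proof.
  unfold Ck, Sk. destruct (Nat.eq_dec k 0) as [->|N]; [simpl; rewrite Rmult_0_l, cosh_0; ring|].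
  assert (INR k <> 0) by (apply not_0_INR; exact N). rewrite cosh_sinh_sqr. field. assumption.
Qed.

Lemma Ck_cont k x : continuous (Ck k) x.
Proof. exact (derive_cont _ _ _ (Ck_derive k x)). Qed.
Lemma Sk_cont k x : continuous (Sk k) x.
Proof. exact (derive_cont _ _ _ (Sk_derive k x)). Qed.

(** Variation of constants, with the kernel [Sk (s - t)] expanded as [Sk s Ck t - Ck s Sk t] so that
    [s] leaves the integrals. *)
Lemma ivp k (f : R -> R) a y0 y1 : (forall x, continuous f x) -> exists y y' : R -> R,
  y a = y0 /\ y' a = y1 /\ (forall s, is_derive y s (y' s)) /\
  (forall s, is_derive y' s (INR k * INR k * y s + f s)).
Proof.
  intros Hf.
  assert (Hp : pint f).
  { intros g u v Hg. apply RI_continuous. intros x. apply cont_mult; auto. }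
  pose (I1 s := integral (fun t => Ck k t * f t) a s). pose (I2 s := integral (fun t => Sk k t * f t) a s).
  assert (D1 : forall s, is_derive I1 s (Ck k s * f s)).
  { intros s. apply (integral_derive_r f (Ck k)); auto using Ck_cont. }
  assert (D2 : forall s, is_derive I2 s (Sk k s * f s)).
  { intros s. apply (integral_derive_r f (Sk k)); auto using Sk_cont. }
  assert (Z : forall g, integral g a a = 0).
  { intros g. apply integral_unique. exact (@is_RInt_point R_NormedModule g a). }
  assert (DC : forall s, is_derive (fun s => Ck k (s - a)) s (INR k * INR k * Sk k (s - a))).
  { intros s. apply (D_eq _ _ (1 * (INR k * INR k * Sk k (s - a)))); [ring|].
    apply (D_comp (Ck k) (fun s => s - a)); [apply Ck_derive|]. auto_derive; [exact I|ring]. }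
  assert (DS : forall s, is_derive (fun s => Sk k (s - a)) s (Ck k (s - a))).
  { intros s. apply (D_eq _ _ (1 * Ck k (s - a))); [ring|].
    apply (D_comp (Sk k) (fun s => s - a)); [apply Sk_derive|]. auto_derive; [exact I|ring]. }
  exists (fun s => (y0 * Ck k (s - a) + y1 * Sk k (s - a)) + (Sk k s * I1 s - Ck k s * I2 s)),
    (fun s => (y0 * (INR k * INR k * Sk k (s - a)) + y1 * Ck k (s - a)) + (Ck k s * I1 s - INR k * INR k * Sk k s * I2 s)).
  assert (E : forall g, g = a -> a - a = 0) by (intros; ring).
  split; [|split; [|split]].
  - unfold I1, I2. rewrite !Z, (E a eq_refl), Ck_0, Sk_0. ring.
  - unfold I1, I2. rewrite !Z, (E a eq_refl), Ck_0, Sk_0. ring.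
  - intros s. eapply D_eq; [|apply D_plus; [apply D_plus; apply D_scal; [apply DC|apply DS]|
      apply D_minus; apply D_mult; [apply Sk_derive|apply D1|apply Ck_derive|apply D2]]]. simpl. ring.
  - intros s. eapply D_eq; [|apply D_plus; [apply D_plus; apply D_scal; [apply D_scal, DS|apply DC]|
      apply D_minus; apply D_mult; [apply Ck_derive|apply D1|apply D_scal, Sk_derive|apply D2]]]. simpl.
    pose proof (Ck_Sk k s) as Q.
    transitivity (INR k * INR k * (y0 * Ck k (s - a) + y1 * Sk k (s - a) + (Sk k s * I1 s - Ck k s * I2 s))
      + (Ck k s * Ck k s - INR k * INR k * (Sk k s * Sk k s)) * f s); [ring|]. rewrite Q. ring.
Qed.

(** * Two-point problems for single modes *)

Section Modes.
Variables (al h1 h2 kap sig bt ct : R).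
Hypotheses (Hal : 0 < al < 1) (Hh1 : 0 < h1) (Hh2 : 0 < h2) (Hsig : 0 < sig).

(* The solution of the homogeneous mode [k] equation vanishing at the bottom, and its top boundary value. *)
Definition phi1 (k : nat) (s : R) : R := Sk k (s + h1).
Definition phi1' (k : nat) (s : R) : R := Ck k (s + h1).
Definition phi2 (k : nat) (s : R) : R := Sk k h1 * Ck k s + (Ck k h1 - kap * Sk k h1) * Sk k s.
Definition phi2' (k : nat) (s : R) : R := Sk k h1 * (INR k * INR k * Sk k s) + (Ck k h1 - kap * Sk k h1) * Ck k s.
Definition tk (k : nat) : R := (sig * (INR k * INR k) + bt) * phi2 k h2 - ct * phi2' k h2.

Lemma phi_derive k s : is_derive (phi1 k) s (phi1' k s) /\ is_derive (phi1' k) s (INR k * INR k * phi1 k s) /\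
  is_derive (phi2 k) s (phi2' k s) /\ is_derive (phi2' k) s (INR k * INR k * phi2 k s).
Proof.
  assert (T : is_derive (fun s => s + h1) s 1) by (auto_derive; [exact I|ring]).
  split; [|split; [|split]].
  - apply (D_eq _ _ (1 * Ck k (s + h1))); [unfold phi1'; ring|]. apply (D_comp (Sk k) (fun s => s + h1)); [apply Sk_derive|exact T].
  - apply (D_eq _ _ (1 * (INR k * INR k * Sk k (s + h1)))); [unfold phi1; ring|].
    apply (D_comp (Ck k) (fun s => s + h1)); [apply Ck_derive|exact T].
  - apply D_plus; apply D_scal; [apply Ck_derive|apply Sk_derive].
  - eapply D_eq; [|apply D_plus; apply D_scal; [apply D_scal, Sk_derive|apply Ck_derive]]. unfold phi2. ring.
Qed.

Lemma phi_values k : phi1 k (- h1) = 0 /\ phi1' k (- h1) = 1 /\ phi2 k 0 = phi1 k 0 /\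
  phi1' k 0 - phi2' k 0 = kap * phi1 k 0.
Proof.
  unfold phi1, phi1', phi2, phi2'. replace (- h1 + h1) with 0 by ring. rewrite Rplus_0_l, !Ck_0, !Sk_0.
  repeat split; ring.
Qed.

(** Shooting from the bottom through the interface leaves one free multiple [m] of the homogeneous
    solution, which the top condition determines unless [tk k = 0]. What cannot be met is recorded
    as the residual [e]. *)
Lemma mode_solve k (f1 f2 : R -> R) zeta : (forall x, continuous f1 x) -> (forall x, continuous f2 x) ->
  exists (y1 y1' y2 y2' : R -> R) (e : R),
    (forall s, is_derive y1 s (y1' s)) /\ (forall s, is_derive y1' s (INR k * INR k * y1 s + f1 s)) /\
    (forall s, is_derive y2 s (y2' s)) /\ (forall s, is_derive y2' s (INR k * INR k * y2 s + f2 s)) /\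
    y1 (- h1) = 0 /\ y1 0 = y2 0 /\ y1' 0 - y2' 0 = kap * y1 0 /\
    (sig * (INR k * INR k) + bt) * y2 h2 - ct * y2' h2 = zeta - e /\ (tk k <> 0 -> e = 0).
Proof.
  intros C1 C2. destruct (ivp k f1 (- h1) 0 0 C1) as [u1 [u1' [A1 [A2 [A3 A4]]]]].
  destruct (ivp k f2 0 (u1 0) (u1' 0 - kap * u1 0) C2) as [u2 [u2' [B1 [B2 [B3 B4]]]]].
  pose (v := (sig * (INR k * INR k) + bt) * u2 h2 - ct * u2' h2).
  (* In the degenerate case any multiple would leave the same residual; 0 is taken. *)
  pose (m := if Req_EM_T (tk k) 0 then 0 else (zeta - v) / tk k).
  exists (fun s => u1 s + m * phi1 k s), (fun s => u1' s + m * phi1' k s),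
    (fun s => u2 s + m * phi2 k s), (fun s => u2' s + m * phi2' k s), (zeta - v - m * tk k).
  destruct (phi_values k) as [P1 [P2 [P3 P4]]].
  split; [|split; [|split; [|split; [|split; [|split; [|split; [|split]]]]]]].
  - intros s. destruct (phi_derive k s) as [Q _]. apply D_plus; [apply A3|apply D_scal, Q].
  - intros s. destruct (phi_derive k s) as [_ [Q _]]. eapply D_eq; [|apply D_plus; [apply A4|apply D_scal, Q]]. ring.
  - intros s. destruct (phi_derive k s) as [_ [_ [Q _]]]. apply D_plus; [apply B3|apply D_scal, Q].
  - intros s. destruct (phi_derive k s) as [_ [_ [_ Q]]]. eapply D_eq; [|apply D_plus; [apply B4|apply D_scal, Q]]. ring.
  - cbv beta. rewrite A1, P1. ring.
  - cbv beta. rewrite B1, P3. reflexivity.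
  - cbv beta. rewrite B2. transitivity (kap * u1 0 + m * (phi1' k 0 - phi2' k 0)); [ring|]. rewrite P4. ring.
  - unfold tk, v. ring.
  - intros Ht. unfold m. destruct (Req_EM_T (tk k) 0); [contradiction|]. field. exact Ht.
Qed.

Definition ebas' (i : bool) (k : nat) (y : R) : R := if i then - INR k * sin (INR k * y) else INR k * cos (INR k * y).

Lemma ebas_derive i k y : is_derive (ebas i k) y (ebas' i k y) /\ is_derive (ebas' i k) y (- (INR k * INR k) * ebas i k y).
Proof. destruct i; unfold ebas, ebas'; split; auto_derive; try exact I; ring. Qed.

Lemma ebas'_le i k y : Rabs (ebas' i k y) <= INR k.
Proof.
  pose proof (pos_INR k). pose proof (ebas_le1 (negb i) k y) as E. pose proof (Rabs_pos (ebas (negb i) k y)).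
  destruct i; simpl negb in *; unfold ebas in *; unfold ebas';
  rewrite Rabs_mult, ?Rabs_Ropp, (Rabs_right (INR k)) by lra; nra.
Qed.

Lemma ebas_periodic i k y : ebas i k (y + 2 * PI) = ebas i k y.
Proof.
  unfold ebas. replace (INR k * (y + 2 * PI)) with (INR k * y + 2 * INR k * PI) by ring.
  destruct i; [apply cos_period|apply sin_period].
Qed.

Definition holI (l r A : R) (g : R -> R) : Prop := (forall s, l <= s <= r -> Rabs (g s) <= A) /\
  (forall s s', l <= s <= r -> l <= s' <= r -> Rabs (g s - g s') <= A * pw al (Rabs (s - s'))).

Lemma holI_C1 l r (g g' : R -> R) : (forall s, is_derive g s (g' s)) -> (forall s, continuous g' s) ->
  exists A, 0 <= A /\ holI l r A g.
Proof.
  intros Hg Hc. destruct (Rlt_dec r l) as [H|H].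
  { exists 0. split; [lra|]. split; intros; lra. }
  destruct (continuity_ab_maj (fun s => Rabs (g s)) l r ltac:(lra)) as [m [Hm _]].
  { intros c _. apply continuous_pt. apply (continuous_comp g Rabs); [exact (derive_cont _ _ _ (Hg c))|].
    apply continuous_pt, Rcontinuity_abs. }
  destruct (continuity_ab_maj (fun s => Rabs (g' s)) l r ltac:(lra)) as [m' [Hm' _]].
  { intros c _. apply continuous_pt. apply (continuous_comp g' Rabs); [apply Hc|].
    apply continuous_pt, Rcontinuity_abs. }
  pose proof (Rabs_pos (g m)). pose proof (Rabs_pos (g' m')).
  exists (Rabs (g' m') + 2 * Rabs (g m)). split; [lra|]. split.
  - intros s Hs. specialize (Hm s Hs). simpl in Hm. lra.
  - assert (L : forall s s', l <= s <= r -> l <= s' <= r -> s <= s' -> Rabs (g s' - g s) <= Rabs (g' m') * (s' - s)).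
    { intros s s' Hs Hs' Hss. apply (lipschitz_derive g g'); auto.
      - intros x _. exact (derive_cont _ _ _ (Hg x)).
      - intros x Hx. apply (Hm' x). lra. }
    intros s s' Hs Hs'. replace (2 * Rabs (g m)) with (Rabs (2 * Rabs (g m))) by (rewrite Rabs_right; lra).
    apply lip_pw; try lra; [apply Rabs_pos| |].
    + destruct (Rle_dec s s').
      * rewrite Rabs_minus_sym, (Rabs_minus_sym s), (Rabs_right (s' - s)) by lra. apply L; auto.
      * rewrite (Rabs_right (s - s')) by lra. apply L; auto; lra.
    + pose proof (Hm s Hs) as Q1. pose proof (Hm s' Hs') as Q2. simpl in Q1, Q2.
      apply Rabs_le_between in Q1, Q2. apply Rabs_le. lra.
Qed.

Lemma sepH_prod l r A B g h : 0 <= A -> 0 <= B -> holI l r A g -> (forall q, Rabs (h q) <= B) -> hol1 al B h ->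
  sepH al l r (A * B) (fun q s => g s * h q).
Proof.
  intros HA HB [G1 G2] H1 H2. split.
  - intros q s Hs. rewrite Rabs_mult. apply Rmult_le_compat; auto using Rabs_pos.
  - intros q q' s Hs. rewrite <- Rmult_minus_distr_l, Rabs_mult, Rmult_assoc.
    apply Rmult_le_compat; auto using Rabs_pos.
  - intros q s s' Hs Hs'. rewrite <- Rmult_minus_distr_r, Rabs_mult.
    replace (A * B * pw al (Rabs (s - s'))) with (A * pw al (Rabs (s - s')) * B) by ring.
    apply Rmult_le_compat; auto using Rabs_pos.
Qed.

Lemma hol1_lip h h' B L : 0 <= L -> (forall q, Rabs (h q) <= B) -> (forall q, is_derive h q (h' q)) ->
  (forall q, Rabs (h' q) <= L) -> hol1 al (L + 2 * B) h.
Proof.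
  intros HL HB Hd HL' q q'. assert (B0 : 0 <= B) by (eapply Rle_trans; [apply Rabs_pos|apply (HB 0)]).
  replace (2 * B) with (Rabs (2 * B)) by (rewrite Rabs_right; lra).
  apply lip_pw; try lra; [apply Rabs_pos| |].
  - apply (lipschitz_derive_R h h'); auto.
  - pose proof (HB q) as Q1. pose proof (HB q') as Q2. apply Rabs_le_between in Q1, Q2. apply Rabs_le. lra.
Qed.

Lemma ebas_hol i k : exists B, 0 <= B /\ (forall q, Rabs (ebas i k q) <= B) /\ hol1 al B (ebas i k) /\
  (forall q, Rabs (ebas' i k q) <= B) /\ hol1 al B (ebas' i k).
Proof.
  pose proof (pos_INR k) as Hk.
  pose (B := INR k * INR k + 2 * INR k + 2).
  assert (E1 : forall q, Rabs (ebas i k q) <= 1) by (intros; apply ebas_le1).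
  assert (E2 : forall q, Rabs (ebas' i k q) <= INR k) by (intros; apply ebas'_le).
  assert (M : forall C h, C <= B -> hol1 al C h -> hol1 al B h).
  { intros C h HC H q q'. eapply Rle_trans; [apply H|]. apply Rmult_le_compat_r; [apply pw_nonneg|exact HC]. }
  exists B. split; [unfold B; nra|]. split; [intros q; specialize (E1 q); unfold B; nra|].
  split; [|split; [intros q; specialize (E2 q); unfold B; nra|]].
  - apply (M (INR k + 2 * 1)); [unfold B; nra|]. apply (hol1_lip _ (ebas' i k)); auto. intros q; exact (proj1 (ebas_derive i k q)).
  - apply (M (INR k * INR k + 2 * INR k)); [unfold B; nra|].
    apply (hol1_lip _ (fun y => - (INR k * INR k) * ebas i k y)); auto; [nra|intros q; exact (proj2 (ebas_derive i k q))|].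
    intros q. rewrite Rabs_mult, Rabs_Ropp, Rabs_right by nra. specialize (E1 q). pose proof (Rabs_pos (ebas i k q)). nra.
Qed.

Lemma mode_IsC2a l r A k i (y y' f : R -> R) : 0 <= A -> (forall s, is_derive y s (y' s)) ->
  (forall s, is_derive y' s (INR k * INR k * y s + f s)) -> (forall s, continuous f s) -> holI l r A f ->
  IsC2a al l r (fun q s => y s * ebas i k q)
    (mkDer2 (fun q s => y' s * ebas i k q) (fun q s => y s * ebas' i k q)
       (fun q s => (INR k * INR k * y s + f s) * ebas i k q) (fun q s => y' s * ebas' i k q)
       (fun q s => - (INR k * INR k) * y s * ebas i k q)).
Proof.
  intros HA Hy Hy' Hf [F1 F2].
  assert (Cy : forall s, continuous y s) by (intros s; exact (derive_cont _ _ _ (Hy s))).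
  assert (Cy' : forall s, continuous y' s) by (intros s; exact (derive_cont _ _ _ (Hy' s))).
  destruct (holI_C1 l r y y' Hy Cy') as [A0 [HA0 H0]].
  destruct (holI_C1 l r y' _ Hy') as [A1 [HA1 H1]].
  { intros s. apply cont_plus; [apply cont_mult; [apply continuous_const|apply Cy]|apply Hf]. }
  destruct (ebas_hol i k) as [B [HB [E1 [E2 [E3 E4]]]]].
  pose proof (pos_INR k) as Hk. assert (Hkk : 0 <= INR k * INR k) by nra.
  assert (H2 : holI l r (INR k * INR k * A0 + A) (fun s => INR k * INR k * y s + f s)).
  { destruct H0 as [G1 G2]. split.
    - intros s Hs. eapply Rle_trans; [apply Rabs_triang|]. rewrite Rabs_mult, (Rabs_right (INR k * INR k)) by lra.
      specialize (G1 s Hs). specialize (F1 s Hs). nra.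
    - intros s s' Hs Hs'. replace (_ - _) with (INR k * INR k * (y s - y s') + (f s - f s')) by ring.
      eapply Rle_trans; [apply Rabs_triang|]. rewrite Rabs_mult, (Rabs_right (INR k * INR k)) by lra.
      specialize (G2 s s' Hs Hs'). specialize (F2 s s' Hs Hs'). nra. }
  assert (H3 : holI l r (INR k * INR k * A0) (fun s => - (INR k * INR k) * y s)).
  { destruct H0 as [G1 G2]. split.
    - intros s Hs. rewrite Rabs_mult, Rabs_Ropp, (Rabs_right (INR k * INR k)) by lra. specialize (G1 s Hs). nra.
    - intros s s' Hs Hs'. rewrite <- Rmult_minus_distr_l, Rabs_mult, Rabs_Ropp, (Rabs_right (INR k * INR k)) by lra.
      specialize (G2 s s' Hs Hs'). nra. }
  assert (HH : forall A g h, 0 <= A -> holI l r A g -> (forall q, Rabs (h q) <= B) -> hol1 al B h ->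
    holder2 al l r (fun q s => g s * h q)).
  { intros A' g h HA' Hg Hh Hh'. apply (sepH_holder2 al l r (A' * B)); [lra|apply Rmult_le_pos; assumption|].
    apply sepH_prod; assumption. }
  assert (0 <= INR k * INR k * A0) by (apply Rmult_le_pos; lra).
  unfold IsC2a. cbn [dp dq dpp dpq dqq].
  split; [split; [intros q p Hp; rewrite ebas_periodic; reflexivity|apply (HH A0); auto]|].
  split; [apply (HH A1); auto|]. split; [apply (HH A0); auto|].
  split; [apply (HH (INR k * INR k * A0 + A)); auto; lra|].
  split; [apply (HH A1); auto|]. split; [apply (HH (INR k * INR k * A0)); auto|].
  intros q s Hs. rewrite <- !is_derive_Reals. destruct (ebas_derive i k q) as [De De'].
  split; [|split; [|split; [|split; [|split]]]].
  - apply D_scal_r, Hy.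
  - apply D_scal, De.
  - apply D_scal_r, Hy'.
  - apply D_scal, De.
  - apply D_scal_r, Hy.
  - eapply D_eq; [|apply D_scal, De']. ring.
Qed.

Lemma mode_Wsol k i (f1 f2 : R -> R) A zeta : 0 <= A -> (forall x, continuous f1 x) -> (forall x, continuous f2 x) ->
  holI (- h1) 0 A f1 -> holI 0 h2 A f2 ->
  exists w1 d1 w2 d2 e, (tk k <> 0 -> e = 0) /\
    Wsol al h1 h2 kap sig bt ct (fun q s => f1 s * ebas i k q) (fun q s => f2 s * ebas i k q)
      (fun q => (zeta - e) * ebas i k q) w1 d1 w2 d2.
Proof.
  intros HA C1 C2 H1 H2.
  destruct (mode_solve k f1 f2 zeta C1 C2) as [y1 [y1' [y2 [y2' [e [D1 [D2 [D3 [D4 [B1 [B2 [B3 [B4 B5]]]]]]]]]]]]].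
  eexists _, _, _, _, e. split; [exact B5|].
  pose proof (mode_IsC2a (- h1) 0 A k i y1 y1' f1 HA D1 D2 C1 H1) as I1.
  pose proof (mode_IsC2a 0 h2 A k i y2 y2' f2 HA D3 D4 C2 H2) as I2.
  split; [exact I1|exact I2| | | | | |]; cbn [dp dq dpp dpq dqq].
  - intros; ring.
  - intros; ring.
  - intros q. cbv beta. rewrite B1. ring.
  - intros q. cbv beta. rewrite B2. reflexivity.
  - intros q. cbv beta. rewrite <- Rmult_minus_distr_r, B3. ring.
  - intros q. cbv beta. rewrite <- B4. ring.
Qed.
End Modes.

(** * Solvability up to finitely many top residuals *)

Section FullSolve.
Variables (al h1 h2 kap sig bt ct : R).
Hypotheses (Hal : 0 < al < 1) (Hh1 : 0 < h1) (Hh2 : 0 < h2) (Hsig : 0 < sig).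

Lemma cosh_sinh_bounds x : 1 <= x -> 1 <= sinh x /\ sinh x <= cosh x <= 2 * sinh x.
Proof.
  intros Hx. pose proof (sinh_ge x ltac:(lra)). pose proof (cosh_minus_sinh x).
  pose proof (exp_pos (- x)). pose proof (exp_neg_le1 x ltac:(lra)). lra.
Qed.

(** For large [k], [k phi2] is at least [sinh (k h1) sinh (k h2)] and [phi2'] at most 7 times that
    product, so [sig k^2 phi2] beats [ct phi2']. *)
Lemma tk_nonzero : exists K, forall k, (K <= k)%nat -> tk h1 h2 kap sig bt ct k <> 0.
Proof.
  pose proof (Rabs_pos kap) as A1. pose proof (Rabs_pos bt) as A2. pose proof (Rabs_pos ct) as A3.
  assert (I1 : 0 < / h1) by (apply Rinv_0_lt_compat; lra). assert (I2 : 0 < / h2) by (apply Rinv_0_lt_compat; lra).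
  assert (I3 : 0 <= (Rabs bt + 7 * Rabs ct) / sig) by (apply Rmult_le_pos; [lra|left; apply Rinv_0_lt_compat; lra]).
  destruct (INR_unbounded (1 + Rabs kap + / h1 + / h2 + (Rabs bt + 7 * Rabs ct) / sig)) as [K HK].
  exists K. intros k Hk. apply le_INR in Hk.
  set (x := INR k) in *. assert (Hx : 1 + Rabs kap + / h1 + / h2 + (Rabs bt + 7 * Rabs ct) / sig < x) by lra.
  assert (E1 : 1 <= x * h1) by (replace 1 with (/ h1 * h1) by (field; lra); apply Rmult_le_compat_r; lra).
  assert (E2 : 1 <= x * h2) by (replace 1 with (/ h2 * h2) by (field; lra); apply Rmult_le_compat_r; lra).
  assert (E3 : Rabs bt + 7 * Rabs ct < sig * x).
  { replace (Rabs bt + 7 * Rabs ct) with (sig * ((Rabs bt + 7 * Rabs ct) / sig)) by (field; lra).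
    apply Rmult_lt_compat_l; lra. }
  destruct (cosh_sinh_bounds _ E1) as [X1 Y1]. destruct (cosh_sinh_bounds _ E2) as [X2 Y2].
  assert (ES : forall h, Sk k h = sinh (x * h) / x).
  { intros h. unfold Sk. destruct (Nat.eq_dec k 0) as [E|E]; [|reflexivity].
    exfalso. assert (x = 0) by (unfold x; rewrite E; reflexivity). lra. }
  intros T. unfold tk, phi2, phi2' in T. rewrite !ES in T. unfold Ck in T. fold x in T.
  set (a1 := sinh (x * h1)) in *. set (a2 := sinh (x * h2)) in *.
  set (c1 := cosh (x * h1)) in *. set (c2 := cosh (x * h2)) in *.
  pose (r := kap / x).
  assert (Hr : Rabs r <= 1).
  { unfold r, Rdiv. rewrite Rabs_mult, (Rabs_right (/ x)) by (apply Rle_ge; left; apply Rinv_0_lt_compat; lra).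
    apply Rmult_le_reg_r with x; [lra|]. rewrite Rmult_assoc, Rinv_l by lra. lra. }
  (* The relation [tk k = 0] multiplied by [x = k], which clears the denominators of [Sk]. *)
  assert (T2 : (sig * (x * x) + bt) * (a1 * c2 + (c1 - r * a1) * a2) - ct * x * (a1 * a2 + (c1 - r * a1) * c2) = 0).
  { rewrite <- (Rmult_0_r x), <- T. unfold r. field. lra. }
  assert (P : 1 <= a1 * a2) by nra.
  assert (ra : Rabs (r * a1) <= a1) by (rewrite Rabs_mult, (Rabs_right a1) by lra; pose proof (Rabs_pos r); nra).
  apply Rabs_le_between in ra.
  assert (Q1 : a1 * a2 <= a1 * c2 + (c1 - r * a1) * a2) by nra.
  (* [c1 - r a1 <= 3 a1] and [c2 <= 2 a2], whence [7 = 1 + 3 * 2]. *)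
  assert (Q2 : 0 <= a1 * a2 + (c1 - r * a1) * c2 <= 7 * (a1 * a2)).
  { assert (0 <= (c1 - r * a1) * c2 <= 3 * a1 * (2 * a2)); [|nra].
    split; [nra|]. apply Rmult_le_compat; nra. }
  assert (Q3 : Rabs ct * x * 7 < sig * (x * x) + bt).
  { pose proof (Rle_abs (- bt)). rewrite Rabs_Ropp in H. nra. }
  assert (Q4 : (sig * (x * x) + bt) * (a1 * a2) <= (sig * (x * x) + bt) * (a1 * c2 + (c1 - r * a1) * a2))
    by (apply Rmult_le_compat_l; nra).
  assert (Q5 : ct * x * (a1 * a2 + (c1 - r * a1) * c2) <= Rabs ct * x * (7 * (a1 * a2))).
  { pose proof (Rle_abs ct). apply Rle_trans with (Rabs ct * x * (a1 * a2 + (c1 - r * a1) * c2)).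
    - apply Rmult_le_compat_r; nra.
    - apply Rmult_le_compat_l; nra. }
  nra.
Qed.

Definition data (F1 F2 : R -> R -> R) (z : R -> R) (M : R) : Prop :=
  (forall q s, - h1 <= s <= 0 -> F1 (q + 2 * PI) s = F1 q s) /\ sepH al (- h1) 0 M F1 /\
  (forall q s, 0 <= s <= h2 -> F2 (q + 2 * PI) s = F2 q s) /\ sepH al 0 h2 M F2 /\
  per1 z /\ hol1 al M z /\ (forall q, Rabs (z q) <= M).

Lemma slice_cont l r M F s q : sepH al l r M F -> l <= s <= r -> continuous (fun q => F q s) q.
Proof. intros [_ H _] Hs. apply (hol1_cont al M); [lra|]. intros x y. apply H; exact Hs. Qed.

Lemma fc_holI l r M F i k : l <= r -> 0 <= M -> sepH al l r M F ->
  holI al l r (2 * M) (fun s => fc (fun q => F q (clamp l r s)) i k).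
Proof.
  intros Hlr HM HF. pose proof HF as [H1 H2 H3]. split.
  - intros s Hs. apply fc_le.
    + intros q. apply (slice_cont l r M); [exact HF|apply clamp_in; exact Hlr].
    + intros q. apply H1. apply clamp_in; exact Hlr.
  - intros s s' Hs Hs'. rewrite !clamp_id by assumption.
    replace (fc (fun q => F q s) i k - fc (fun q => F q s') i k)
      with (fc (fun q => F q s) i k + -1 * fc (fun q => F q s') i k) by ring.
    rewrite <- fc_lin by (intros; apply (slice_cont l r M); assumption). rewrite Rmult_assoc. apply fc_le.
    + intros q. apply cont_plus; [|apply cont_mult; [apply continuous_const|]]; apply (slice_cont l r M); assumption.
    + intros q. replace (F q s + -1 * F q s') with (F q s - F q s') by ring. apply H3; assumption.
Qed.

Lemma Wsol_zero : Wsol al h1 h2 kap sig bt ct (fun _ _ => 0) (fun _ _ => 0) (fun _ => 0)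
  (fun _ _ => 0) (mkDer2 (fun _ _ => 0) (fun _ _ => 0) (fun _ _ => 0) (fun _ _ => 0) (fun _ _ => 0))
  (fun _ _ => 0) (mkDer2 (fun _ _ => 0) (fun _ _ => 0) (fun _ _ => 0) (fun _ _ => 0) (fun _ _ => 0)).
Proof.
  assert (H : forall l r, holder2 al l r (fun _ _ => 0)).
  { intros l r. apply (sepH_holder2 al l r 0); try lra.
    split; intros; rewrite ?Rminus_diag, Rabs_R0; lra. }
  assert (I : forall l r, IsC2a al l r (fun _ _ => 0) (mkDer2 (fun _ _ => 0) (fun _ _ => 0) (fun _ _ => 0) (fun _ _ => 0) (fun _ _ => 0))).
  { intros l r. unfold IsC2a. cbn [dp dq dpp dpq dqq]. split; [split; [intros q p _; reflexivity|apply H]|].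
    do 5 (split; [apply H|]). intros q p Hp. do 5 (split; [apply derivable_pt_lim_const|]). apply derivable_pt_lim_const. }
  split; auto; cbn [dp dq dpp dpq dqq]; intros; ring.
Qed.

Lemma low_solve F1 F2 z M n : 0 <= M -> data F1 F2 z M ->
  exists w1 d1 w2 d2 (e : coef), (forall i k, tk h1 h2 kap sig bt ct k <> 0 -> e i k = 0) /\
    Wsol al h1 h2 kap sig bt ct (fun q s => trig n (fc (fun q => F1 q (clamp (- h1) 0 s))) q)
      (fun q s => trig n (fc (fun q => F2 q (clamp 0 h2 s))) q) (fun q => trig n (fc z) q - trig n e q) w1 d1 w2 d2.
Proof.
  intros HM [P1 [S1 [P2 [S2 _]]]].
  induction n as [|n [w1 [d1 [w2 [d2 [e [He IH]]]]]]].
  - eexists _, _, _, _, (fun _ _ => 0). split; [auto|]. eapply Wsol_ext; [| | |exact Wsol_zero];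
    intros; unfold trig; simpl; ring.
  - assert (MS : forall i, exists w1 d1 w2 d2 e, (tk h1 h2 kap sig bt ct n <> 0 -> e = 0) /\
      Wsol al h1 h2 kap sig bt ct (fun q s => fc (fun q => F1 q (clamp (- h1) 0 s)) i n * ebas i n q)
        (fun q s => fc (fun q => F2 q (clamp 0 h2 s)) i n * ebas i n q)
        (fun q => (fc z i n - e) * ebas i n q) w1 d1 w2 d2).
    { intros i. apply (mode_Wsol al h1 h2 kap sig bt ct Hal n i _ _ (2 * M)); [lra| | | |].
      - intros x. apply (fc_clamp_cont al Hal _ _ M); auto; lra.
      - intros x. apply (fc_clamp_cont al Hal _ _ M); auto; lra.
      - apply fc_holI; auto; lra.
      - apply fc_holI; auto; lra. }
    destruct (MS true) as [u1 [c1 [u2 [c2 [e1 [He1 HS1]]]]]]. destruct (MS false) as [v1 [b1 [v2 [b2 [e2 [He2 HS2]]]]]].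
    eexists _, _, _, _, (fun (i : bool) (k : nat) => if Nat.eq_dec k n then (if i then e1 else e2) else e i k). split.
    + intros i k Hk. destruct (Nat.eq_dec k n) as [->|N]; [destruct i; auto|auto].
    + eapply Wsol_ext; [| | |exact (Wsol_comb al h1 h2 kap sig bt ct _ _ _ _ _ _ _ _ _ _ _ _ _ _ 1 1 ltac:(lra)
        IH (Wsol_comb al h1 h2 kap sig bt ct _ _ _ _ _ _ _ _ _ _ _ _ _ _ 1 1 ltac:(lra) HS1 HS2))]; cbv beta.
      * intros q s _. unfold trig, ebas. simpl rsum. ring.
      * intros q s _. unfold trig, ebas. simpl rsum. ring.
      * intros q. assert (E : trig (S n) (fun i k => if Nat.eq_dec k n then (if i then e1 else e2) else e i k) q
          = trig n e q + (e1 * ebas true n q + e2 * ebas false n q)).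
        { unfold trig. simpl rsum. destruct (Nat.eq_dec n n); [|lia]. f_equal.
          apply rsum_ext. intros k Hk. destruct (Nat.eq_dec k n); [lia|reflexivity]. }
        rewrite E. unfold trig, ebas. simpl rsum. ring.
Qed.

Lemma sepH_trig l r n (g : fam) : (forall i k, exists A, 0 <= A /\ holI al l r A (g i k)) ->
  exists M, 0 <= M /\ sepH al l r M (fun q s => trig n (at_ g s) q).
Proof.
  intros Hg. induction n as [|n [M [HM IH]]].
  - exists 0. split; [lra|]. split; intros; unfold trig; simpl; rewrite ?Rminus_diag, Rabs_R0; lra.
  - destruct (Hg true n) as [A [HA G1]]. destruct (Hg false n) as [A' [HA' G2]].
    destruct (ebas_hol al Hal true n) as [B [HB [E1 [E2 _]]]]. destruct (ebas_hol al Hal false n) as [B' [HB' [E1' [E2' _]]]].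
    pose proof (sepH_prod al l r A B (g true n) (ebas true n) HA HB G1 E1 E2) as S1.
    pose proof (sepH_prod al l r A' B' (g false n) (ebas false n) HA' HB' G2 E1' E2') as S2.
    assert (0 <= A * B) by (apply Rmult_le_pos; assumption). assert (0 <= A' * B') by (apply Rmult_le_pos; assumption).
    pose proof (sepH_comb al l r _ _ _ _ 1 1 H H0 S1 S2) as S3. rewrite Rabs_R1 in S3.
    pose proof (sepH_comb al l r M (1 * (A * B) + 1 * (A' * B')) _ _ 1 1 HM ltac:(lra) IH S3) as S4. rewrite Rabs_R1 in S4.
    exists (1 * M + 1 * (1 * (A * B) + 1 * (A' * B'))). split; [lra|].
    assert (E : forall q s, trig (S n) (at_ g s) q = 1 * trig n (at_ g s) q + 1 * (1 * (g true n s * ebas true n q) + 1 * (g false n s * ebas false n q))).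
    { intros q s. unfold trig, at_, ebas. simpl rsum. ring. }
    destruct S4 as [X1 X2 X3]. split.
    + intros q s Hs. rewrite E. apply X1; exact Hs.
    + intros q q' s Hs. rewrite !E. apply X2; exact Hs.
    + intros q s s' Hs Hs'. rewrite !E. apply X3; assumption.
Qed.

Lemma remove_low K f : (forall q, continuous f q) ->
  highfreq K (fc (fun q => 1 * f q + -1 * trig K (fc f) q)).
Proof.
  intros Hf i k Hk.
  assert (E : fc (fun q => 1 * f q + -1 * trig K (fc f) q) i k = fc f i k + -1 * fc (trig K (fc f)) i k).
  { rewrite <- fc_lin; [|exact Hf|intros; apply trig_continuous]. unfold fc. f_equal.
    assert (EX : forall y, (1 * f y + -1 * trig K (fc f) y) * ebas i k y = (f y + -1 * trig K (fc f) y) * ebas i k y) by (intros; ring).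
    unfold integral. apply RInt_ext. intros x _. apply EX. }
  rewrite E. destruct i.
  - rewrite fc_trig by (auto; congruence). ring.
  - destruct (Nat.eq_dec k 0) as [->|N]; [rewrite !fc_sin0; ring|]. rewrite fc_trig by auto. ring.
Qed.

(** Frequencies below [K] are solved one by one, and the data minus this Fourier polynomial have
    only high frequencies. The obstruction [e] enters the top datum alone. *)
Lemma W_solve : exists K, (forall k, (K <= k)%nat -> tk h1 h2 kap sig bt ct k <> 0) /\
  forall F1 F2 z M, 0 <= M -> data F1 F2 z M ->
  exists w1 d1 w2 d2 (e : coef), (forall i k, tk h1 h2 kap sig bt ct k <> 0 -> e i k = 0) /\
    Wsol al h1 h2 kap sig bt ct F1 F2 (fun q => z q - trig K e q) w1 d1 w2 d2.
Proof.
  destruct tk_nonzero as [K1 HK1]. destruct (hf_solve al h1 h2 kap sig bt ct Hal Hh1 Hh2 ltac:(lra)) as [K2 [_ HK2]].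
  pose (K := (K1 + K2)%nat). exists K. split; [intros k Hk; apply HK1; unfold K in Hk; lia|].
  intros F1 F2 z M HM HD. destruct (low_solve F1 F2 z M K HM HD) as [u1 [c1 [u2 [c2 [e [He HL]]]]]].
  destruct HD as [P1 [S1 [P2 [S2 [Pz [Hz Bz]]]]]].
  pose (G1 := fun (i : bool) (k : nat) s => fc (fun q => F1 q (clamp (- h1) 0 s)) i k).
  pose (G2 := fun (i : bool) (k : nat) s => fc (fun q => F2 q (clamp 0 h2 s)) i k).
  destruct (sepH_trig (- h1) 0 K G1) as [M1 [HM1 T1]].
  { intros i k. exists (2 * M). split; [lra|]. apply fc_holI; auto; lra. }
  destruct (sepH_trig 0 h2 K G2) as [M2 [HM2 T2]].
  { intros i k. exists (2 * M). split; [lra|]. apply fc_holI; auto; lra. }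
  (* The top datum is treated as a function on the degenerate strip [[0, 0]], so that the estimates
     for the layers apply to it. *)
  destruct (sepH_trig 0 0 K (fun i k _ => fc z i k)) as [M3 [HM3 T3]].
  { intros i k. exists (Rabs (fc z i k)). split; [apply Rabs_pos|]. split.
    - intros; lra.
    - intros. rewrite Rminus_diag, Rabs_R0. apply Rmult_le_pos; [apply Rabs_pos|apply pw_nonneg]. }
  pose (H1 := fun q s => 1 * F1 q s + -1 * trig K (at_ G1 s) q).
  pose (H2 := fun q s => 1 * F2 q s + -1 * trig K (at_ G2 s) q).
  pose (hz := fun q => 1 * z q + -1 * trig K (fc z) q).
  assert (Rm1 : Rabs (-1) = 1) by (rewrite Rabs_left; lra).
  pose (MM := M + (M1 + M2 + M3)).
  assert (W : forall l r N u, N <= MM -> sepH al l r N u -> sepH al l r MM u).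
  { intros l r N u HN [X1 X2 X3]. split.
    - intros q s Hs. specialize (X1 q s Hs). lra.
    - intros q q' s Hs. eapply Rle_trans; [apply X2; exact Hs|]. apply Rmult_le_compat_r; [apply pw_nonneg|exact HN].
    - intros q s s' Hs Hs'. eapply Rle_trans; [apply X3; assumption|]. apply Rmult_le_compat_r; [apply pw_nonneg|exact HN]. }
  assert (SH1 : sepH al (- h1) 0 MM H1).
  { apply (W _ _ (Rabs 1 * M + Rabs (-1) * M1)); [rewrite Rabs_R1, Rm1; unfold MM; lra|]. apply sepH_comb; assumption. }
  assert (SH2 : sepH al 0 h2 MM H2).
  { apply (W _ _ (Rabs 1 * M + Rabs (-1) * M2)); [rewrite Rabs_R1, Rm1; unfold MM; lra|]. apply sepH_comb; assumption. }
  assert (SHz : sepH al 0 0 MM (fun q _ => hz q)).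
  { apply (W _ _ (Rabs 1 * M + Rabs (-1) * M3)); [rewrite Rabs_R1, Rm1; unfold MM; lra|].
    apply (sepH_comb al 0 0 M M3 (fun q _ => z q)); auto. split.
    - intros; apply Bz.
    - intros; apply Hz.
    - intros. rewrite Rminus_diag, Rabs_R0. apply Rmult_le_pos; [lra|apply pw_nonneg]. }
  assert (C1 : forall s q, - h1 <= s <= 0 -> continuous (fun q => F1 q s) q) by (intros; apply (slice_cont (- h1) 0 M); assumption).
  assert (C2 : forall s q, 0 <= s <= h2 -> continuous (fun q => F2 q s) q) by (intros; apply (slice_cont 0 h2 M); assumption).
  destruct (HK2 K ltac:(unfold K; lia) H1 H2 hz MM ltac:(unfold MM; lra)) as [v1 [b1 [v2 [b2 HH]]]].
  - intros q s Hs. unfold H1. rewrite P1, trig_periodic by exact Hs. reflexivity.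
  - exact SH1.
  - intros q s Hs. unfold H2. rewrite P2, trig_periodic by exact Hs. reflexivity.
  - exact SH2.
  - intros q. unfold hz. rewrite Pz, trig_periodic. reflexivity.
  - intros q q'. apply (sepH_q _ _ _ _ _ SHz q q' 0). lra.
  - intros q. apply (sepH_b _ _ _ _ _ SHz q 0). lra.
  - intros s Hs. unfold H1, at_, G1. rewrite clamp_id by exact Hs. apply remove_low. intros; apply C1; exact Hs.
  - intros s Hs. unfold H2, at_, G2. rewrite clamp_id by exact Hs. apply remove_low. intros; apply C2; exact Hs.
  - unfold hz. apply remove_low. intros; apply (hol1_cont al M); [lra|exact Hz].
  - eexists _, _, _, _, e. split; [exact He|].
    eapply Wsol_ext; [| | |exact (Wsol_comb al h1 h2 kap sig bt ct _ _ _ _ _ _ _ _ _ _ _ _ _ _ 1 1 ltac:(lra) HL HH)]; cbv beta.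
    + intros q s Hs. unfold H1. change (at_ G1 s) with (fc (fun q => F1 q (clamp (- h1) 0 s))). ring.
    + intros q s Hs. unfold H2. change (at_ G2 s) with (fc (fun q => F2 q (clamp 0 h2 s))).
      ring.
    + intros q. unfold hz. ring.
Qed.
End FullSolve.

(** * Flattening the coefficients *)

(* With [ds = dp / a] and [w = a v] the operator of a layer of constant vorticity becomes
   [a^3 L v = w_ss + w_qq]: the coefficient [a] is an affine function of [s], as in the
   reduction of the radial Laplacian in dimension three. *)

Lemma holI_mult al l r A B g h : 0 <= A -> 0 <= B -> holI al l r A g -> holI al l r B h ->
  holI al l r (2 * (A * B)) (fun s => g s * h s).
Proof.
  intros HA HB [G1 G2] [H1 H2]. split.
  - intros s Hs. rewrite Rabs_mult. specialize (G1 s Hs). specialize (H1 s Hs).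
    pose proof (Rabs_pos (g s)). pose proof (Rabs_pos (h s)). nra.
  - intros s s' Hs Hs'. replace (g s * h s - g s' * h s') with (g s * (h s - h s') + (g s - g s') * h s') by ring.
    eapply Rle_trans; [apply Rabs_triang|]. rewrite !Rabs_mult.
    pose proof (G1 s Hs). pose proof (H1 s' Hs'). pose proof (G2 s s' Hs Hs'). pose proof (H2 s s' Hs Hs').
    pose proof (Rabs_pos (g s)). pose proof (Rabs_pos (h s')). pose proof (Rabs_pos (g s - g s')).
    pose proof (Rabs_pos (h s - h s')). pose proof (pw_nonneg al (Rabs (s - s'))).
    assert (Rabs (g s) * Rabs (h s - h s') <= A * (B * pw al (Rabs (s - s')))) by (apply Rmult_le_compat; assumption).
    assert (Rabs (g s - g s') * Rabs (h s') <= (A * pw al (Rabs (s - s'))) * B) by (apply Rmult_le_compat; assumption).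
    lra.
Qed.

Lemma holI_pow al l r A g n : 0 <= A -> holI al l r A g -> exists B, 0 <= B /\ holI al l r B (fun s => g s ^ n).
Proof.
  intros HA Hg. induction n as [|n [B [HB IH]]].
  - exists 1. split; [lra|]. split; intros; simpl; [rewrite Rabs_R1; lra|].
    rewrite Rminus_diag, Rabs_R0, Rmult_1_l. apply pw_nonneg.
  - exists (2 * (A * B)). split; [nra|]. apply (holI_mult al l r A B g (fun s => g s ^ n)); assumption.
Qed.

Lemma sepH_mulp al l r A M g u : 0 <= A -> 0 <= M -> holI al l r A g -> sepH al l r M u ->
  sepH al l r (2 * (A * M)) (fun q s => u q s * g s).
Proof.
  intros HA HM [G1 G2] [U1 U2 U3]. assert (0 <= A * M) by (apply Rmult_le_pos; assumption). split.
  - intros q s Hs. rewrite Rabs_mult. specialize (G1 s Hs). specialize (U1 q s Hs).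
    pose proof (Rabs_pos (g s)). pose proof (Rabs_pos (u q s)). nra.
  - intros q q' s Hs. rewrite <- Rmult_minus_distr_r, Rabs_mult. specialize (G1 s Hs). specialize (U2 q q' s Hs).
    pose proof (Rabs_pos (g s)). pose proof (Rabs_pos (u q s - u q' s)). pose proof (pw_nonneg al (Rabs (q - q'))).
    apply Rle_trans with (M * pw al (Rabs (q - q')) * A); [apply Rmult_le_compat; assumption|]. nra.
  - intros q s s' Hs Hs'. apply (holI_mult al l r M A (fun s => u q s) g HM HA) in Hs' as Hm; auto.
    + replace (2 * (A * M)) with (2 * (M * A)) by ring.
      apply (holI_mult al l r M A (fun s => u q s) g HM HA); auto; split; auto.
    + split; auto.
    + split; auto.
Qed.

Lemma holder2_mulp al l r A g u : 0 < al -> 0 <= A -> holI al l r A g -> holder2 al l r u ->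
  holder2 al l r (fun q s => u q s * g s).
Proof.
  intros Hal HA Hg Hu. destruct (holder2_sepH _ _ _ _ Hu) as [M [HM HS]].
  apply (sepH_holder2 al l r (2 * (A * M))); auto; [nra|]. apply sepH_mulp; assumption.
Qed.

Lemma sepH_comp al l r l' r' M L u (f : R -> R) : 0 < al -> 0 <= M -> 0 <= L ->
  (forall s, l <= s <= r -> l' <= f s <= r') ->
  (forall s s', l <= s <= r -> l <= s' <= r -> Rabs (f s - f s') <= L * Rabs (s - s')) ->
  sepH al l' r' M u -> sepH al l r (M * (1 + pw al L)) (fun q s => u q (f s)).
Proof.
  intros Hal HM HL Hf Hlip [U1 U2 U3]. pose proof (pw_nonneg al L).
  assert (HMM : M <= M * (1 + pw al L)) by nra. split.
  - intros q s Hs. eapply Rle_trans; [apply U1, Hf, Hs|exact HMM].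
  - intros q q' s Hs. eapply Rle_trans; [apply U2, Hf, Hs|]. apply Rmult_le_compat_r; [apply pw_nonneg|exact HMM].
  - intros q s s' Hs Hs'. eapply Rle_trans; [apply U3; apply Hf; assumption|].
    pose proof (pw_le al _ _ ltac:(lra) (Hlip s s' Hs Hs')) as P. rewrite pw_mult in P by (auto using Rabs_pos).
    pose proof (pw_nonneg al (Rabs (s - s'))). nra.
Qed.

Lemma holder2_compf al l r l' r' L u (f : R -> R) : 0 < al -> 0 <= L ->
  (forall s, l <= s <= r -> l' <= f s <= r') ->
  (forall s s', l <= s <= r -> l <= s' <= r -> Rabs (f s - f s') <= L * Rabs (s - s')) ->
  holder2 al l' r' u -> holder2 al l r (fun q s => u q (f s)).
Proof.
  intros Hal HL H1 H2 Hu. destruct (holder2_sepH _ _ _ _ Hu) as [M [HM HS]]. pose proof (pw_nonneg al L).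
  apply (sepH_holder2 al l r (M * (1 + pw al L))); auto; [nra|]. apply (sepH_comp al l r l' r'); assumption.
Qed.

Lemma lip_sym l r f L : (forall s s', l <= s <= s' -> s' <= r -> Rabs (f s' - f s) <= L * (s' - s)) ->
  forall s s', l <= s <= r -> l <= s' <= r -> Rabs (f s - f s') <= L * Rabs (s - s').
Proof.
  intros H s s' Hs Hs'. destruct (Rle_dec s s').
  - rewrite Rabs_minus_sym, (Rabs_minus_sym s), (Rabs_right (s' - s)) by lra. apply H; lra.
  - rewrite (Rabs_right (s - s')) by lra. apply H; lra.
Qed.

Section Flatten.
Variables (al l r p1 gam a1 : R).
Hypotheses (Hal : 0 < al < 1) (Hlr : l < r) (Ha1 : 0 < a1).

(** The square of [a] in one layer, written from the interface, where both layers share the value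
    [a1]. *)
Definition Af (p : R) : R := a1 * a1 - 2 * gam * (p - p1).
Definition af (p : R) : R := sqrt (Af p).
Definition ia (p : R) : R := / af p.
(** The integral of [1 / a] from [p1] to [p], i.e. [(a1 - a) / gam] rationalised so that [gam = 0]
    is included. *)
Definition sv (p : R) : R := 2 * (p - p1) / (af p + a1).
(** The inverse of [sv], quadratic because [dp/ds = a = a1 - gam s]. *)
Definition pv (s : R) : R := p1 + a1 * s - gam * (s * s) / 2.

Hypothesis HA : forall p, l <= p <= r -> 0 < Af p.

Lemma af_pos p : l <= p <= r -> 0 < af p.
Proof. intros H. apply sqrt_lt_R0, HA, H. Qed.

Lemma af_sqr p : l <= p <= r -> af p * af p = Af p.
Proof. intros H. apply sqrt_sqrt. left. apply HA, H. Qed.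

Lemma af_p1 : af p1 = a1.
Proof. unfold af, Af. rewrite Rminus_diag, Rmult_0_r, Rminus_0_r. apply sqrt_square. lra. Qed.

Lemma sv_p1 : sv p1 = 0.
Proof. unfold sv. rewrite Rminus_diag, Rmult_0_r. unfold Rdiv. ring. Qed.

Lemma af_derive p : l <= p <= r -> is_derive af p (- gam * ia p).
Proof.
  intros H. pose proof (af_pos p H).
  apply (D_eq _ _ (-2 * gam * / (2 * sqrt (Af p)))); [unfold ia; fold (af p); field; lra|].
  apply (D_comp sqrt Af); [apply is_derive_Reals, derivable_pt_lim_sqrt, HA, H|].
  unfold Af. auto_derive; [exact I|ring].
Qed.

Lemma ia_derive p : l <= p <= r -> is_derive ia p (gam * ia p ^ 3).
Proof.
  intros H. pose proof (af_pos p H). unfold ia at 1.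
  apply (D_eq _ _ (- (- gam * ia p) / (af p) ^ 2)); [unfold ia; field; lra|].
  apply is_derive_inv; [apply af_derive, H|lra].
Qed.

Lemma sv_af p : l <= p <= r -> a1 - gam * sv p = af p.
Proof.
  intros H. pose proof (af_pos p H). pose proof (af_sqr p H) as E. unfold sv.
  apply (Rmult_eq_reg_r (af p + a1)); [|lra].
  replace ((a1 - gam * (2 * (p - p1) / (af p + a1))) * (af p + a1)) with (a1 * (af p + a1) - 2 * gam * (p - p1)) by (field; lra).
  unfold Af in E. lra.
Qed.

Lemma pv_sv p : l <= p <= r -> pv (sv p) = p.
Proof.
  intros H. pose proof (af_pos p H). pose proof (sv_af p H) as E. unfold pv.
  replace (p1 + a1 * sv p - gam * (sv p * sv p) / 2) with (p1 + sv p * ((a1 - gam * sv p) + a1) / 2) by field.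
  rewrite E. unfold sv. field. lra.
Qed.

Lemma sv_derive p : l <= p <= r -> is_derive sv p (ia p).
Proof.
  intros H. pose proof (af_pos p H). pose proof (af_sqr p H) as E. unfold sv.
  apply (D_eq _ _ (2 * / (af p + a1) + 2 * (p - p1) * (- (- gam * ia p) / (af p + a1) ^ 2))).
  - unfold ia. apply (Rmult_eq_reg_r (af p * (af p + a1) ^ 2)); [|apply Rgt_not_eq; apply Rmult_lt_0_compat; [lra|nra]].
    field_simplify; [|lra|lra]. unfold Af in E. nra.
  - apply (D_mult (fun p => 2 * (p - p1)) (fun p => / (af p + a1))).
    + auto_derive; [exact I|ring].
    + apply (is_derive_inv (fun p => af p + a1)); [|lra]. apply (D_eq _ _ (- gam * ia p + 0)); [ring|].
      apply (D_plus af (fun _ => a1)); [apply af_derive, H|apply D_const].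
Qed.

Lemma ia_pos p : l <= p <= r -> 0 < ia p.
Proof. intros H. apply Rinv_0_lt_compat, af_pos, H. Qed.

Lemma sv_lt p p' : l <= p -> p < p' -> p' <= r -> sv p < sv p'.
Proof.
  intros H1 H2 H3. destruct (MVT_gen sv p p' ia) as [c [Hc E]].
  - rewrite Rmin_left, Rmax_right by lra. intros x Hx. apply sv_derive. lra.
  - rewrite Rmin_left, Rmax_right by lra. intros x Hx. apply continuous_pt.
    apply (derive_cont _ _ _ (sv_derive x ltac:(lra))).
  - rewrite Rmin_left, Rmax_right in Hc by lra. pose proof (ia_pos c ltac:(lra)). nra.
Qed.

(** [Af] is affine, so its minimum over the layer is attained at an end point. *)
Lemma ia_bound : exists B, 0 <= B /\ forall p, l <= p <= r -> ia p <= B.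
Proof.
  pose (m := Rmin (Af l) (Af r)).
  assert (Hm : 0 < m) by (apply Rmin_glb_lt; apply HA; lra).
  exists (/ sqrt m). split; [left; apply Rinv_0_lt_compat, sqrt_lt_R0, Hm|].
  intros p Hp. apply Rinv_le_contravar; [apply sqrt_lt_R0, Hm|]. apply sqrt_le_1_alt.
  unfold m, Af. destruct (Rle_dec 0 gam).
  - apply Rle_trans with (Af r); [apply Rmin_r|]. unfold Af. nra.
  - apply Rle_trans with (Af l); [apply Rmin_l|]. unfold Af. nra.
Qed.

Lemma sv_lip : exists L, 0 <= L /\ forall p p', l <= p <= r -> l <= p' <= r -> Rabs (sv p - sv p') <= L * Rabs (p - p').
Proof.
  destruct ia_bound as [B [HB H]]. exists B. split; [exact HB|]. apply lip_sym. intros s s' Hs Hs'.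
  apply (lipschitz_derive sv ia); [lra| | |].
  - intros x Hx. apply sv_derive; lra.
  - intros x Hx. apply (derive_cont _ _ _ (sv_derive x ltac:(lra))).
  - intros x Hx. rewrite Rabs_right; [apply H; lra|]. apply Rle_ge; left; apply ia_pos; lra.
Qed.

Lemma ia_holI : exists B, 0 <= B /\ holI al l r B ia.
Proof.
  destruct ia_bound as [B [HB H]].
  assert (B1 : forall p, l <= p <= r -> Rabs (ia p) <= B).
  { intros p Hp. rewrite Rabs_right; [apply H, Hp|apply Rle_ge; left; apply ia_pos, Hp]. }
  pose (L := Rabs gam * B ^ 3). assert (HL : 0 <= L) by (apply Rmult_le_pos; [apply Rabs_pos|apply pow_le, HB]).
  assert (Lip : forall p p', l <= p <= r -> l <= p' <= r -> Rabs (ia p - ia p') <= L * Rabs (p - p')).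
  { apply lip_sym. intros s s' Hs Hs'. apply (lipschitz_derive ia (fun p => gam * ia p ^ 3)); [lra| | |].
    - intros x Hx. apply ia_derive; lra.
    - intros x Hx. apply (derive_cont _ _ _ (ia_derive x ltac:(lra))).
    - intros x Hx. rewrite Rabs_mult. apply Rmult_le_compat_l; [apply Rabs_pos|].
      rewrite <- RPow_abs. apply pow_incr. split; [apply Rabs_pos|apply B1; lra]. }
  exists (L + 2 * B). split; [lra|]. split.
  - intros p Hp. specialize (B1 p Hp). lra.
  - intros p p' Hp Hp'. replace (2 * B) with (Rabs (2 * B)) by (rewrite Rabs_right; lra).
    apply lip_pw; try lra; [apply Rabs_pos|apply Lip; assumption|].
    pose proof (B1 p Hp) as Q1. pose proof (B1 p' Hp') as Q2. apply Rabs_le_between in Q1, Q2. apply Rabs_le. lra.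
Qed.

(** Chain rule for [v = w / a], from [s_p = 1 / a] and [(1/a)_p = gam / a^3]. *)
Definition flatD (w : R -> R -> R) (d : Der2) : Der2 := mkDer2
  (fun q p => dp d q (sv p) * ia p ^ 2 + gam * (w q (sv p) * ia p ^ 3))
  (fun q p => dq d q (sv p) * ia p)
  (fun q p => dpp d q (sv p) * ia p ^ 3 + (3 * gam * (dp d q (sv p) * ia p ^ 4) + 3 * (gam * gam) * (w q (sv p) * ia p ^ 5)))
  (fun q p => dpq d q (sv p) * ia p ^ 2 + gam * (dq d q (sv p) * ia p ^ 3))
  (fun q p => dqq d q (sv p) * ia p).

Lemma flatten w d : IsC2a al (sv l) (sv r) w d -> IsC2a al l r (fun q p => w q (sv p) * ia p) (flatD w d).
Proof.
  intros [[Hp Hw] [H1 [H2 [H3 [H4 [H5 HD]]]]]].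
  destruct sv_lip as [L [HL Lip]]. destruct ia_holI as [B [HB HI]].
  assert (Hin : forall p, l <= p <= r -> sv l <= sv p <= sv r).
  { intros p Hp'. split.
    - destruct (Req_dec l p) as [->|N]; [lra|]. left; apply sv_lt; lra.
    - destruct (Req_dec p r) as [->|N]; [lra|]. left; apply sv_lt; lra. }
  assert (HC : forall u n, holder2 al (sv l) (sv r) u -> holder2 al l r (fun q p => u q (sv p) * ia p ^ n)).
  { intros u n Hu. destruct (holI_pow al l r B ia n HB HI) as [B' [HB' HI']].
    apply (holder2_mulp al l r B' (fun p => ia p ^ n) (fun q p => u q (sv p))); auto; [lra|].
    apply (holder2_compf al l r (sv l) (sv r) L); auto. lra. }
  assert (HC1 : forall u, holder2 al (sv l) (sv r) u -> holder2 al l r (fun q p => u q (sv p) * ia p)).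
  { intros u Hu. apply (holder2_mulp al l r B ia (fun q p => u q (sv p))); auto; [lra|].
    apply (holder2_compf al l r (sv l) (sv r) L); auto. lra. }
  assert (HL2 : forall u v b, holder2 al l r u -> holder2 al l r v -> holder2 al l r (fun q p => u q p + b * v q p)).
  { intros u v b Hu Hv. destruct (holder2_comb al l r u v 1 b ltac:(lra) Hu Hv) as [[X1 Y1] [X2 Y2]]. split.
    - exists X1. intros q p Hq. specialize (Y1 q p Hq). rewrite Rmult_1_l in Y1. exact Y1.
    - exists X2. intros q1 p1' q2 p2 Q1 Q2 Q3. specialize (Y2 q1 p1' q2 p2 Q1 Q2 Q3). rewrite !Rmult_1_l in Y2. exact Y2. }
  assert (HL3 : forall u v b c, holder2 al l r u -> holder2 al l r v -> holder2 al l r (fun q p => b * u q p + c * v q p)).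
  { intros; apply holder2_comb; auto; lra. }
  assert (HL1 : forall u v, holder2 al l r u -> holder2 al l r v -> holder2 al l r (fun q p => u q p + v q p)).
  { intros u v Hu Hv. destruct (holder2_comb al l r u v 1 1 ltac:(lra) Hu Hv) as [[X1 Y1] [X2 Y2]]. split.
    - exists X1. intros q p Hq. specialize (Y1 q p Hq). rewrite !Rmult_1_l in Y1. exact Y1.
    - exists X2. intros q1 p1' q2 p2 Q1 Q2 Q3. specialize (Y2 q1 p1' q2 p2 Q1 Q2 Q3). rewrite !Rmult_1_l in Y2. exact Y2. }
  unfold IsC2a, flatD. cbn [dp dq dpp dpq dqq].
  split; [split|].
  { intros q p Hp'. rewrite Hp by (apply Hin, Hp'). reflexivity. }
  { apply HC1; exact Hw. }
  split; [apply HL2; apply HC; assumption|]. split; [apply HC1; assumption|].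
  split; [apply HL1; [apply HC; assumption|apply HL3; apply HC; assumption]|].
  split; [apply HL2; apply HC; assumption|]. split; [apply HC1; assumption|].
  intros q p Hp'. assert (Hpc : l <= p <= r) by lra.
  assert (Hs : sv l < sv p < sv r) by (split; apply sv_lt; lra).
  destruct (HD q (sv p) Hs) as [D1 [D2 [D3 [D4 [D5 D6]]]]].
  rewrite <- is_derive_Reals in D1, D2, D3, D4, D5, D6.
  pose proof (sv_derive p Hpc) as DS. pose proof (ia_derive p Hpc) as DI.
  assert (DIn : forall n, is_derive (fun p => ia p ^ n) p (INR n * gam * ia p ^ (n + 2))).
  { intros n. eapply D_eq; [|apply is_derive_pow, DI]. destruct n as [|n]; [simpl; ring|].
    replace (S n + 2)%nat with (n + 3)%nat by lia. simpl pred. rewrite pow_add. ring. }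
  rewrite <- !is_derive_Reals.
  pose proof (D_comp (fun s => w q s) sv p _ _ D1 DS) as E1.
  pose proof (D_comp (fun s => dp d q s) sv p _ _ D3 DS) as E3.
  pose proof (D_comp (fun s => dq d q s) sv p _ _ D5 DS) as E5.
  split; [|split; [|split; [|split; [|split]]]].
  - eapply D_eq; [|apply D_mult; [exact E1|exact DI]]. simpl. ring.
  - apply D_scal_r. exact D2.
  - eapply D_eq; [|apply D_plus; [apply D_mult; [exact E3|apply (DIn 2%nat)]|apply D_scal, D_mult; [exact E1|apply (DIn 3%nat)]]].
    simpl. ring.
  - apply D_plus; [|apply D_scal]; apply D_scal_r; assumption.
  - eapply D_eq; [|apply D_mult; [exact E5|exact DI]]. simpl. ring.
  - apply D_scal_r. exact D6.
Qed.

(** The terms of [v_pp] in [w_s] and in [w] cancel exactly against [3 gam v_p / a^2]. *)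
Lemma flatten_eq w d q p : l <= p <= r ->
  dpp (flatD w d) q p + dqq (flatD w d) q p / af p ^ 2 - 3 * gam * dp (flatD w d) q p / af p ^ 2
  = (dpp d q (sv p) + dqq d q (sv p)) * ia p ^ 3.
Proof.
  intros H. pose proof (af_pos p H). unfold flatD, ia. cbn [dp dq dpp dpq dqq]. field. lra.
Qed.

Lemma pv_in s : sv l <= s <= sv r -> l <= pv s <= r.
Proof.
  intros Hs.
  assert (E1 : 0 < a1 - gam * sv l) by (rewrite sv_af by lra; apply af_pos; lra).
  assert (E2 : 0 < a1 - gam * sv r) by (rewrite sv_af by lra; apply af_pos; lra).
  assert (D : forall x, is_derive pv x (a1 - gam * x)) by (intros x; unfold pv; auto_derive; [exact I|field]).
  assert (P : forall x, sv l <= x <= sv r -> 0 <= a1 - gam * x).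
  { intros x Hx. destruct (Rle_dec 0 gam); nra. }
  assert (M : forall x y, sv l <= x -> x <= y -> y <= sv r -> pv x <= pv y).
  { intros x y H1 H2 H3. apply (increasing_derive pv (fun x => a1 - gam * x)); auto.
    - intros t _. exact (derive_cont _ _ _ (D t)).
    - intros t Ht. apply P. lra. }
  rewrite <- (pv_sv l), <- (pv_sv r) by lra. split; apply M; lra.
Qed.

(** The datum transported to the variable [s] and multiplied by [a^3]. *)
Definition flatF (f : R -> R -> R) (q s : R) : R := f q (pv s) * (a1 - gam * s) ^ 3.

Lemma flatF_sepH f : holder2 al l r f -> exists M, 0 <= M /\ sepH al (sv l) (sv r) M (flatF f).
Proof.
  intros Hf. destruct (holder2_sepH _ _ _ _ Hf) as [M [HM HS]].
  destruct (holI_C1 al Hal (sv l) (sv r) (fun s => a1 - gam * s) (fun _ => - gam)) as [A [HA' HI]].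
  { intros s. auto_derive; [exact I|ring]. }
  { intros s. apply continuous_const. }
  destruct (holI_pow al _ _ A _ 3 HA' HI) as [A3 [HA3 HI3]].
  assert (L : exists L, 0 <= L /\ forall s s', sv l <= s <= sv r -> sv l <= s' <= sv r -> Rabs (pv s - pv s') <= L * Rabs (s - s')).
  { destruct HI as [HI1 _]. exists A. split; [exact HA'|]. apply lip_sym. intros s s' Hs Hs'.
    assert (D : forall x, is_derive pv x (a1 - gam * x)) by (intros x; unfold pv; auto_derive; [exact I|field]).
    apply (lipschitz_derive pv (fun x => a1 - gam * x)); auto; try lra.
    - intros x _. exact (derive_cont _ _ _ (D x)).
    - intros x Hx. apply HI1. lra. }
  destruct L as [L [HL Lip]]. pose proof (pw_nonneg al L).
  exists (2 * (A3 * (M * (1 + pw al L)))). split; [apply Rmult_le_pos; [lra|]; apply Rmult_le_pos; nra|].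
  apply (sepH_mulp al (sv l) (sv r) A3 (M * (1 + pw al L)) (fun s => (a1 - gam * s) ^ 3) (fun q s => f q (pv s))); auto; [nra|].
  apply (sepH_comp al (sv l) (sv r) l r M L); auto; [lra|]. intros s Hs. apply pv_in, Hs.
Qed.

Lemma flatF_inv f q p : l <= p <= r -> flatF f q (sv p) * ia p ^ 3 = f q p.
Proof.
  intros H. pose proof (af_pos p H). unfold flatF. rewrite pv_sv, sv_af by exact H. unfold ia. field. lra.
Qed.
End Flatten.

(** * Fourier coefficients of classical solutions *)

(** Derivatives are prescribed only inside the layer; identities reach the boundary lines by Hoelder
    continuity. *)
Lemma closure_eq al l r u v M : 0 < al -> l < r ->
  (forall s s', l <= s <= r -> l <= s' <= r -> Rabs (u s - u s') <= M * pw al (Rabs (s - s'))) ->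
  (forall s s', l <= s <= r -> l <= s' <= r -> Rabs (v s - v s') <= M * pw al (Rabs (s - s'))) ->
  (forall s, l < s < r -> u s = v s) -> forall s, l <= s <= r -> u s = v s.
Proof.
  intros Hal Hlr Hu Hv E s Hs. destruct (Req_dec (u s) (v s)) as [|N]; [assumption|exfalso].
  pose (d := Rabs (u s - v s)). assert (Hd : 0 < d) by (apply Rabs_pos_lt; lra).
  pose proof (Rabs_pos M).
  destruct (pw_small al (d / (4 * (Rabs M + 1))) Hal) as [h [Hh Hp]]; [apply Rdiv_lt_0_compat; lra|].
  assert (X : exists t, l < t < r /\ Rabs (s - t) < h).
  { pose (k := Rmin (h / 2) ((r - l) / 4)).
    assert (Hk : 0 < k) by (apply Rmin_glb_lt; lra).
    assert (k <= h / 2) by apply Rmin_l. assert (k <= (r - l) / 4) by apply Rmin_r.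
    destruct (Rle_dec s ((l + r) / 2)).
    - exists (s + k). split; [lra|]. replace (s - (s + k)) with (- k) by ring. rewrite Rabs_Ropp, Rabs_right; lra.
    - exists (s - k). split; [lra|]. replace (s - (s - k)) with k by ring. rewrite Rabs_right; lra. }
  destruct X as [t [Ht1 Ht2]]. specialize (Hp _ Ht2).
  pose proof (Hu s t Hs ltac:(lra)) as A1. pose proof (Hv s t Hs ltac:(lra)) as A2. specialize (E t Ht1).
  pose proof (pw_nonneg al (Rabs (s - t))). pose proof (Rle_abs M).
  assert (B : M * pw al (Rabs (s - t)) <= d / 4).
  { apply Rle_trans with ((Rabs M + 1) * (d / (4 * (Rabs M + 1)))); [nra|]. right. field. lra. }
  assert (C : d <= Rabs (u s - u t) + Rabs (v s - v t)).
  { unfold d. replace (u s - v s) with ((u s - u t) + - (v s - v t)) by (rewrite E; ring).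
    eapply Rle_trans; [apply Rabs_triang|]. rewrite Rabs_Ropp. lra. }
  lra.
Qed.

Lemma holder2_closure al l r u v : 0 < al -> l < r -> holder2 al l r u -> holder2 al l r v ->
  (forall q s, l < s < r -> u q s = v q s) -> forall q s, l <= s <= r -> u q s = v q s.
Proof.
  intros Hal Hlr Hu Hv E q. destruct (holder2_sepH _ _ _ _ Hu) as [M [HM [_ _ U]]].
  destruct (holder2_sepH _ _ _ _ Hv) as [M' [HM' [_ _ V]]].
  apply (closure_eq al l r (u q) (v q) (M + M')); auto.
  - intros s s' Hs Hs'. eapply Rle_trans; [apply U; assumption|]. apply Rmult_le_compat_r; [apply pw_nonneg|lra].
  - intros s s' Hs Hs'. eapply Rle_trans; [apply V; assumption|]. apply Rmult_le_compat_r; [apply pw_nonneg|lra].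
Qed.

(** [inX] and [LT] each choose derivative data for the same function; these must be identified
    before the interface conditions can meet the equation. *)
Lemma IsC2a_unique al l r u d d' : 0 < al -> l < r -> IsC2a al l r u d -> IsC2a al l r u d' ->
  forall q s, l <= s <= r -> dp d q s = dp d' q s /\ dpp d q s = dpp d' q s /\ dqq d q s = dqq d' q s.
Proof.
  intros Hal Hlr [_ [A1 [A2 [A3 [A4 [A5 A6]]]]]] [_ [B1 [B2 [B3 [B4 [B5 B6]]]]]].
  assert (Hdp : forall q s, l < s < r -> dp d q s = dp d' q s).
  { intros q s Hs. destruct (A6 q s Hs) as [C1 _]. destruct (B6 q s Hs) as [D1 _].
    exact (uniqueness_limite _ _ _ _ C1 D1). }
  assert (Hdq : forall q s, l < s < r -> dq d q s = dq d' q s).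
  { intros q s Hs. destruct (A6 q s Hs) as [_ [C1 _]]. destruct (B6 q s Hs) as [_ [D1 _]].
    exact (uniqueness_limite _ _ _ _ C1 D1). }
  assert (Hdpp : forall q s, l < s < r -> dpp d q s = dpp d' q s).
  { intros q s Hs. destruct (A6 q s Hs) as [_ [_ [C1 _]]]. destruct (B6 q s Hs) as [_ [_ [D1 _]]].
    apply is_derive_Reals in C1. apply is_derive_Reals in D1.
    apply (uniqueness_limite (fun t => dp d' q t) s); apply is_derive_Reals; [|exact D1].
    apply (is_derive_ext_loc (fun t => dp d q t)); [|exact C1].
    assert (Hm : 0 < Rmin (s - l) (r - s)) by (apply Rmin_glb_lt; lra).
    exists (mkposreal _ Hm). intros y Hy. change (Rabs (y - s) < Rmin (s - l) (r - s)) in Hy.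
    pose proof (Rmin_l (s - l) (r - s)). pose proof (Rmin_r (s - l) (r - s)). apply Rabs_lt_between in Hy.
    apply Hdp. lra. }
  assert (Hdqq : forall q s, l < s < r -> dqq d q s = dqq d' q s).
  { intros q s Hs. destruct (A6 q s Hs) as [_ [_ [_ [_ [_ C1]]]]]. destruct (B6 q s Hs) as [_ [_ [_ [_ [_ D1]]]]].
    apply is_derive_Reals in C1. apply is_derive_Reals in D1.
    apply (uniqueness_limite (fun t => dq d' t s) q); apply is_derive_Reals; [|exact D1].
    apply (D_ext (fun t => dq d t s)); [|exact C1]. intros y. apply Hdq, Hs. }
  intros q s Hs. split; [|split].
  - apply (holder2_closure al l r); assumption.
  - apply (holder2_closure al l r); assumption.
  - apply (holder2_closure al l r); assumption.
Qed.

(** Differentiation under the integral, with the remainder of the difference bounded uniformly in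
    [q] by [M |h|^(1 + al)]. *)
Lemma fc_derive (al l r M : R) (u v : R -> R -> R) i k (p : R) : 0 < al < 1 -> 0 <= M -> l < p < r ->
  (forall q s : R, l <= s <= r -> continuous (fun q : R => u q s) q) -> sepH al l r M v ->
  (forall q s, l < s < r -> derivable_pt_lim (fun s => u q s) s (v q s)) ->
  is_derive (fun s => fc (fun q => u q (clamp l r s)) i k) p (fc (fun q => v q p) i k).
Proof.
  intros Hal HM Hp Cu HV Hd. apply is_derive_Reals. intros eps He.
  assert (Cv : forall q, continuous (fun q => v q p) q).
  { intros q. apply (slice_cont al Hal l r M); [exact HV|lra]. }
  destruct (pw_small al (eps / (2 * M + 1)) ltac:(lra)) as [h0 [Hh0 Hpw]]; [apply Rdiv_lt_0_compat; lra|].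
  assert (Hm : 0 < Rmin h0 (Rmin (p - l) (r - p))) by (repeat apply Rmin_glb_lt; lra).
  exists (mkposreal _ Hm). intros h Hh Hlt. simpl in Hlt.
  pose proof (Rmin_l h0 (Rmin (p - l) (r - p))). pose proof (Rmin_r h0 (Rmin (p - l) (r - p))).
  pose proof (Rmin_l (p - l) (r - p)). pose proof (Rmin_r (p - l) (r - p)).
  assert (Hint : forall y, Rabs (y - p) <= Rabs h -> l < y < r).
  { intros y Hy. assert (Hy2 : Rabs (y - p) < Rmin (p - l) (r - p)) by lra. apply Rabs_lt_between in Hy2. lra. }
  assert (Hph : l < p + h < r) by (apply Hint; replace (p + h - p) with h by ring; lra).
  rewrite !clamp_id by lra.
  set (W := fun q => (u q (p + h) + -1 * u q p) + - h * v q p).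
  assert (EW : fc W i k = fc (fun q => u q (p + h)) i k - fc (fun q => u q p) i k - h * fc (fun q => v q p) i k).
  { unfold W. rewrite (fc_lin (fun q => u q (p + h) + -1 * u q p) (fun q => v q p)).
    - rewrite (fc_lin (fun q => u q (p + h)) (fun q => u q p)) by (intros; apply Cu; lra). ring.
    - intros q. apply cont_plus; [apply Cu; lra|]. apply cont_mult; [apply continuous_const|apply Cu; lra].
    - exact Cv. }
  assert (BW : Rabs (fc W i k) <= 2 * (M * pw al (Rabs h) * Rabs h)).
  { apply fc_le.
    - intros q. apply cont_plus; [apply cont_plus; [apply Cu; lra|apply cont_mult; [apply continuous_const|apply Cu; lra]]|].
      apply cont_mult; [apply continuous_const|apply Cv].
    - intros q. unfold W.
      assert (Hder : forall y, l < y < r -> is_derive (fun y => u q y - v q p * y) y (v q y - v q p)).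
      { intros y Hy. apply D_minus; [apply is_derive_Reals, Hd, Hy|apply is_derive_linear]. }
      assert (Gen : forall a b, a <= b -> (forall y, a <= y <= b -> Rabs (y - p) <= Rabs h) ->
        Rabs ((u q b - v q p * b) - (u q a - v q p * a)) <= M * pw al (Rabs h) * (b - a)).
      { intros a b Hab Hy. apply (lipschitz_derive (fun y => u q y - v q p * y) (fun y => v q y - v q p)); auto.
        - intros y Hy'. apply Hder, Hint, Hy. lra.
        - intros y Hy'. apply (derive_cont _ _ _ (Hder y (Hint y (Hy y Hy')))).
        - intros y Hy'. pose proof (Hint y (Hy y ltac:(lra))). eapply Rle_trans; [apply (sepH_s _ _ _ _ _ HV); lra|].
          apply Rmult_le_compat_l; [exact HM|]. apply pw_le; [lra|]. apply Hy. lra. }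
      destruct (Rle_dec 0 h).
      + rewrite (Rabs_right h) in * by lra.
        replace (u q (p + h) + -1 * u q p + - h * v q p) with ((u q (p + h) - v q p * (p + h)) - (u q p - v q p * p)) by ring.
        replace (M * pw al h * h) with (M * pw al h * (p + h - p)) by ring. apply Gen; [lra|].
        intros y Hy. rewrite Rabs_right; lra.
      + rewrite (Rabs_left h) in * by lra. rewrite <- Rabs_Ropp.
        replace (- (u q (p + h) + -1 * u q p + - h * v q p)) with ((u q p - v q p * p) - (u q (p + h) - v q p * (p + h))) by ring.
        replace (M * pw al (- h) * - h) with (M * pw al (- h) * (p - (p + h))) by ring. apply Gen; [lra|].
        intros y Hy. rewrite Rabs_left1; lra. }
  assert (Hh' : 0 < Rabs h) by (apply Rabs_pos_lt; exact Hh).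
  specialize (Hpw (Rabs h) ltac:(lra)). pose proof (pw_nonneg al (Rabs h)).
  replace ((fc (fun q => u q (p + h)) i k - fc (fun q => u q p) i k) / h - fc (fun q => v q p) i k)
    with (fc W i k * / h) by (rewrite EW; field; exact Hh).
  rewrite Rabs_mult, Rabs_inv. apply Rle_lt_trans with (2 * M * pw al (Rabs h)).
  - apply Rmult_le_reg_r with (Rabs h); [exact Hh'|]. rewrite Rmult_assoc, Rinv_l, Rmult_1_r by lra. lra.
  - apply Rle_lt_trans with ((2 * M + 1) * pw al (Rabs h)); [nra|].
    replace eps with ((2 * M + 1) * (eps / (2 * M + 1))) by (field; lra). apply Rmult_lt_compat_l; lra.
Qed.

(** Two integrations by parts inside the layer, the boundary terms cancelling by periodicity; the
    boundary lines follow by closure. *)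
Lemma fc_qq (al l r : R) (u : R -> R -> R) d i k (p : R) : 0 < al < 1 -> l < r -> IsC2a al l r u d -> l <= p <= r ->
  fc (fun q => dqq d q p) i k = - (INR k * INR k) * fc (fun q => u q p) i k.
Proof.
  intros Hal Hlr [[HP Hu] [A1 [A2 [A3 [A4 [A5 A6]]]]]].
  destruct (holder2_sepH _ _ _ _ Hu) as [M [HM SM]]. destruct (holder2_sepH _ _ _ _ A5) as [M' [HM' SM']].
  assert (Cu : forall q s, l <= s <= r -> continuous (fun q => u q s) q) by (intros; apply (slice_cont al Hal l r M); assumption).
  assert (Cqq : forall q s, l <= s <= r -> continuous (fun q => dqq d q s) q) by (intros; apply (slice_cont al Hal l r M'); assumption).
  assert (Op : forall s, l < s < r -> fc (fun q => dqq d q s) i k = - (INR k * INR k) * fc (fun q => u q s) i k).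
  { intros s Hs.
    assert (Dq : forall q, is_derive (fun q => u q s) q (dq d q s)) by (intros q; apply is_derive_Reals; apply (A6 q s Hs)).
    assert (Dqq : forall q, is_derive (fun q => dq d q s) q (dqq d q s)) by (intros q; apply is_derive_Reals; apply (A6 q s Hs)).
    (* [IsC2a] asserts periodicity of [u] alone; that of [u_q] follows from uniqueness of
       derivatives. *)
    assert (Pq : forall q, dq d (q + 2 * PI) s = dq d q s).
    { intros q. apply (uniqueness_limite (fun q => u q s) q); apply is_derive_Reals; [|apply Dq].
      apply (D_ext (fun t => u (t + 2 * PI) s)); [intros t; apply HP; lra|].
      apply (D_eq _ _ (1 * dq d (q + 2 * PI) s)); [ring|].
      apply (D_comp (fun t => u t s) (fun t => t + 2 * PI)); [apply Dq|auto_derive; [exact I|ring]]. }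
    assert (Pe' : forall q, ebas' i k (q + 2 * PI) = ebas' i k q).
    { intros q. unfold ebas'. replace (INR k * (q + 2 * PI)) with (INR k * q + 2 * INR k * PI) by ring.
      destruct i; rewrite ?sin_period, ?cos_period; reflexivity. }
    pose proof PI_RGT_0.
    assert (Z : RI (fun q => dqq d q s * ebas i k q + (INR k * INR k) * (u q s * ebas i k q)) (- PI) PI 0).
    { replace 0 with ((dq d PI s * ebas i k PI - u PI s * ebas' i k PI)
         - (dq d (- PI) s * ebas i k (- PI) - u (- PI) s * ebas' i k (- PI))).
      - apply (RI_derive (fun q => dq d q s * ebas i k q - u q s * ebas' i k q)); [lra| |].
        + intros q _. destruct (ebas_derive i k q) as [E1 E2].
          eapply D_eq; [|apply D_minus; apply D_mult; [apply Dqq|exact E1|apply Dq|exact E2]]. cbv beta. ring.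
        + intros q _. apply cont_plus; [apply cont_mult; [apply Cqq; lra|apply ebas_cont]|].
          apply cont_mult; [apply continuous_const|]. apply cont_mult; [apply Cu; lra|apply ebas_cont].
      - replace PI with (- PI + 2 * PI) at 1 2 3 4 by ring. rewrite Pq, Pe', ebas_periodic, HP by lra. ring. }
    assert (Y : RI (fun q => dqq d q s * ebas i k q + (INR k * INR k) * (u q s * ebas i k q)) (- PI) PI
       (integral (fun q => dqq d q s * ebas i k q) (- PI) PI + (INR k * INR k) * integral (fun q => u q s * ebas i k q) (- PI) PI)).
    { apply RI_plus; [|apply RI_scal]; apply RI_continuous; intros q;
      (apply cont_mult; [first [apply Cqq; lra|apply Cu; lra]|apply ebas_cont]). }
    pose proof (RI_unique _ _ _ _ _ Z Y) as E. unfold fc.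
    transitivity (cnst k * (0 - (INR k * INR k) * integral (fun q => u q s * ebas i k q) (- PI) PI)); [|ring].
    f_equal. lra. }
  revert p.
  pose proof (fc_holI al Hal l r M' (dqq d) i k ltac:(lra) HM' SM') as [_ F1].
  pose proof (fc_holI al Hal l r M u i k ltac:(lra) HM SM) as [_ F2].
  pose proof (pos_INR k).
  apply (closure_eq al l r (fun p => fc (fun q => dqq d q p) i k) (fun p => - (INR k * INR k) * fc (fun q => u q p) i k)
    (2 * M' + INR k * INR k * (2 * M))); auto; [lra| |].
  - intros s s' Hs Hs'. specialize (F1 s s' Hs Hs'). rewrite !clamp_id in F1 by assumption.
    eapply Rle_trans; [exact F1|]. apply Rmult_le_compat_r; [apply pw_nonneg|nra].
  - intros s s' Hs Hs'. specialize (F2 s s' Hs Hs'). rewrite !clamp_id in F2 by assumption.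
    rewrite <- Rmult_minus_distr_l, Rabs_mult, Rabs_Ropp, Rabs_right by nra.
    pose proof (pw_nonneg al (Rabs (s - s'))).
    apply Rle_trans with (INR k * INR k * (2 * M * pw al (Rabs (s - s')))); [apply Rmult_le_compat_l; nra|]. nra.
Qed.

(** * Uniqueness for the mode equations *)

Lemma ode_unique l r (y y' A B : R -> R) C : l <= r -> 0 <= C ->
  (forall p, l < p < r -> is_derive y p (y' p)) ->
  (forall p, l < p < r -> is_derive y' p (A p * y p + B p * y' p)) ->
  (forall p, l <= p <= r -> continuous y p) -> (forall p, l <= p <= r -> continuous y' p) ->
  (forall p, l < p < r -> Rabs (A p) <= C) -> (forall p, l < p < r -> Rabs (B p) <= C) ->
  y l = 0 -> y' l = 0 -> forall p, l <= p <= r -> y p = 0 /\ y' p = 0.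
Proof.
  intros Hlr HC D1 D2 C1 C2 HA HB Z1 Z2 p Hp.
  (* Gronwall for [E = y^2 + y'^2]: in [E' = 2 y y' + 2 A y y' + 2 B y'^2] the three terms are at
     most [E], [C E] and [2 C E]. *)
  pose (c := 1 + 3 * C).
  pose (E := fun p => y p * y p + y' p * y' p).
  assert (H : - (E l * exp (- (c * l))) <= - (E p * exp (- (c * p)))).
  { apply (increasing_derive (fun p => - (E p * exp (- (c * p))))
      (fun p => - ((y' p * y p + y p * y' p + ((A p * y p + B p * y' p) * y' p + y' p * (A p * y p + B p * y' p))) * exp (- (c * p))
         + E p * (- c * exp (- (c * p)))))); [lra| | |].
    - intros x Hx. apply (D_ext (fun p => -1 * (E p * exp (- (c * p))))); [intros; ring|].
      eapply D_eq; [|apply D_scal, D_mult; [apply D_plus; apply D_mult; [apply D1|apply D1|apply D2|apply D2]; lra|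
        instantiate (1 := - c * exp (- (c * x))); auto_derive; [exact I|ring]]]. unfold E. cbv beta. ring.
    - intros x Hx. apply (continuous_opp (fun p => E p * exp (- (c * p)))). apply cont_mult; [|apply expmk_cont].
      unfold E. apply cont_plus; apply cont_mult; first [apply C1; lra|apply C2; lra].
    - intros x Hx. pose proof (exp_pos (- (c * x))). specialize (HA x ltac:(lra)). specialize (HB x ltac:(lra)).
      apply Rabs_le_between in HA, HB. unfold E, c.
      replace (- ((y' x * y x + y x * y' x + ((A x * y x + B x * y' x) * y' x + y' x * (A x * y x + B x * y' x)))
        * exp (- ((1 + 3 * C) * x)) + (y x * y x + y' x * y' x) * (- (1 + 3 * C) * exp (- ((1 + 3 * C) * x)))))
        with (((1 + 3 * C) * (y x * y x + y' x * y' x) - 2 * (y x * y' x) - 2 * A x * (y x * y' x) - 2 * B x * (y' x * y' x))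
          * exp (- ((1 + 3 * C) * x))) by ring.
      apply Rmult_le_pos; [|left; exact H].
      pose proof (Rle_0_sqr (y' x)) as Q0. pose proof (Rle_0_sqr (y x)) as Q0'.
      pose proof (Rle_0_sqr (y x + y' x)) as R1. pose proof (Rle_0_sqr (y x - y' x)) as R2. unfold Rsqr in Q0, Q0', R1, R2.
      assert (Q1 : - (y x * y x + y' x * y' x) <= 2 * (y x * y' x) <= y x * y x + y' x * y' x) by lra.
      assert (Q2 : A x * (2 * (y x * y' x)) <= C * (y x * y x + y' x * y' x)).
      { destruct (Rle_dec 0 (2 * (y x * y' x))).
        - apply Rle_trans with (C * (2 * (y x * y' x))); [apply Rmult_le_compat_r; lra|apply Rmult_le_compat_l; lra].
        - assert (- C * (2 * (y x * y' x)) <= C * (y x * y x + y' x * y' x)).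
          { replace (- C * (2 * (y x * y' x))) with (C * - (2 * (y x * y' x))) by ring. apply Rmult_le_compat_l; lra. }
          nra. }
      assert (Q3 : B x * (y' x * y' x) <= C * (y' x * y' x)) by (apply Rmult_le_compat_r; lra).
      assert (0 <= C * (y x * y x)) by (apply Rmult_le_pos; lra). lra. }
  assert (El : E l = 0) by (unfold E; rewrite Z1, Z2; ring). rewrite El, Rmult_0_l, Ropp_0 in H.
  pose proof (exp_pos (- (c * p))).
  assert (E p <= 0). { apply Rmult_le_reg_r with (exp (- (c * p))); [assumption|]. lra. }
  unfold E in H1. pose proof (Rle_0_sqr (y p)). pose proof (Rle_0_sqr (y' p)). unfold Rsqr in *.
  split; nra.
Qed.

Section LayerModes.
Variables (al l r p1 gam a1 : R).
Hypotheses (Hal : 0 < al < 1) (Hlr : l < r) (Ha1 : 0 < a1).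
Hypothesis HA : forall p, l <= p <= r -> 0 < Af p1 gam a1 p.

(** Profile in the original variable [p] of a mode [phi] in [s], i.e. [v = w / a]; [Yf'] is its
    derivative. *)
Definition Yf (phi : R -> R) (p : R) : R := phi (sv p1 gam a1 p) * ia p1 gam a1 p.
Definition Yf' (phi phi' : R -> R) (p : R) : R :=
  phi' (sv p1 gam a1 p) * ia p1 gam a1 p ^ 2 + gam * (phi (sv p1 gam a1 p) * ia p1 gam a1 p ^ 3).

Lemma Yf_derive (phi phi' : R -> R) k p : (forall s, is_derive phi s (phi' s)) ->
  (forall s, is_derive phi' s (k * phi s)) -> l <= p <= r ->
  is_derive (Yf phi) p (Yf' phi phi' p) /\
  is_derive (Yf' phi phi') p (k * ia p1 gam a1 p ^ 2 * Yf phi p + 3 * gam * ia p1 gam a1 p ^ 2 * Yf' phi phi' p).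
Proof.
  intros D1 D2 Hp. pose proof (sv_derive l r p1 gam a1 Ha1 HA p Hp) as DS.
  pose proof (ia_derive l r p1 gam a1 HA p Hp) as DI.
  pose proof (D_comp phi (sv p1 gam a1) p _ _ (D1 _) DS) as E1.
  pose proof (D_comp phi' (sv p1 gam a1) p _ _ (D2 _) DS) as E2.
  assert (DI2 : is_derive (fun p => ia p1 gam a1 p ^ 2) p (2 * gam * ia p1 gam a1 p ^ 4)).
  { eapply D_eq; [|apply is_derive_pow, DI]. simpl. ring. }
  assert (DI3 : is_derive (fun p => ia p1 gam a1 p ^ 3) p (3 * gam * ia p1 gam a1 p ^ 5)).
  { eapply D_eq; [|apply is_derive_pow, DI]. simpl. ring. }
  split.
  - eapply D_eq; [|apply D_mult; [exact E1|exact DI]]. unfold Yf'. ring.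
  - eapply D_eq; [|apply D_plus; [apply D_mult; [exact E2|exact DI2]|apply D_scal, D_mult; [exact E1|exact DI3]]].
    unfold Yf, Yf'. ring.
Qed.

(** The Fourier coefficient of a classical solution satisfies the mode equation inside the layer,
    and its Cauchy data at [l] then determine it up to the other boundary. *)
Lemma layer_mode u d i k (phi phi' : R -> R) m : IsC2a al l r u d ->
  (forall q p, l <= p <= r -> 0 = dpp d q p + dqq d q p / af p1 gam a1 p ^ 2 - 3 * gam * dp d q p / af p1 gam a1 p ^ 2) ->
  (forall s, is_derive phi s (phi' s)) -> (forall s, is_derive phi' s (INR k * INR k * phi s)) ->
  fc (fun q => u q l) i k = m * Yf phi l -> fc (fun q => dp d q l) i k = m * Yf' phi phi' l ->
  forall p, l <= p <= r -> fc (fun q => u q p) i k = m * Yf phi p /\ fc (fun q => dp d q p) i k = m * Yf' phi phi' p.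
Proof.
  intros HI Heq D1 D2 I1 I2. pose proof HI as [[HP Hu] [A1 [A2 [A3 [A4 [A5 A6]]]]]].
  destruct (holder2_sepH _ _ _ _ Hu) as [M0 [HM0 S0]]. destruct (holder2_sepH _ _ _ _ A1) as [M1 [HM1 S1]].
  destruct (holder2_sepH _ _ _ _ A3) as [M2 [HM2 S2]]. destruct (holder2_sepH _ _ _ _ A5) as [M3 [HM3 S3]].
  destruct (ia_bound l r p1 gam a1 Hlr HA) as [B [HB Bia]].
  pose (y p := fc (fun q => u q (clamp l r p)) i k - m * Yf phi p).
  pose (y' p := fc (fun q => dp d q (clamp l r p)) i k - m * Yf' phi phi' p).
  pose proof (pos_INR k) as Hk. assert (Hkk : 0 <= INR k * INR k) by nra.
  assert (Sb : forall p, l <= p <= r -> 0 <= ia p1 gam a1 p ^ 2 <= B ^ 2).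
  { intros p Hp. pose proof (ia_pos l r p1 gam a1 HA p Hp). pose proof (Bia p Hp). nra. }
  assert (Hgam : 0 <= Rabs (3 * gam)) by apply Rabs_pos.
  assert (Z : forall p, l <= p <= r -> y p = 0 /\ y' p = 0).
  { apply (ode_unique l r y y' (fun p => INR k * INR k * ia p1 gam a1 p ^ 2) (fun p => 3 * gam * ia p1 gam a1 p ^ 2)
      ((INR k * INR k + Rabs (3 * gam)) * B ^ 2)); [lra|apply Rmult_le_pos; [lra|apply pow_le, HB]| | | | | | | |].
    - intros p Hp. unfold y, y'. destruct (Yf_derive phi phi' (INR k * INR k) p D1 D2 ltac:(lra)) as [E1 _].
      apply D_minus; [|apply D_scal, E1]. rewrite (clamp_id l r p) by lra.
      apply (fc_derive al l r M1); auto; [intros; apply (slice_cont al Hal l r M0); assumption|].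
      intros q s Hs. apply (A6 q s Hs).
    - intros p Hp. unfold y, y'. destruct (Yf_derive phi phi' (INR k * INR k) p D1 D2 ltac:(lra)) as [_ E2].
      assert (E3 : is_derive (fun p => fc (fun q => dp d q (clamp l r p)) i k) p (fc (fun q => dpp d q p) i k)).
      { apply (fc_derive al l r M2); auto; [intros; apply (slice_cont al Hal l r M1); assumption|].
        intros q s Hs. apply (A6 q s Hs). }
      eapply D_eq; [|apply D_minus; [exact E3|apply D_scal, E2]]. rewrite (clamp_id l r p) by lra.
      assert (Cp : forall q, continuous (fun q => dp d q p) q) by (intros; apply (slice_cont al Hal l r M1); [exact S1|lra]).
      assert (Cqq : forall q, continuous (fun q => dqq d q p) q) by (intros; apply (slice_cont al Hal l r M3); [exact S3|lra]).
      assert (Q : fc (fun q => dpp d q p) i k = INR k * INR k * ia p1 gam a1 p ^ 2 * fc (fun q => u q p) i k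
         + 3 * gam * ia p1 gam a1 p ^ 2 * fc (fun q => dp d q p) i k).
      { pose proof (fc_qq al l r u d i k p Hal Hlr HI ltac:(lra)) as FQ.
        transitivity (fc (fun q => (0 + - ia p1 gam a1 p ^ 2 * dqq d q p) + 3 * gam * ia p1 gam a1 p ^ 2 * dp d q p) i k).
        - unfold fc, integral. f_equal. apply RInt_ext. intros q _. change (@eq R (dpp d q p * ebas i k q)
            ((0 + - ia p1 gam a1 p ^ 2 * dqq d q p + 3 * gam * ia p1 gam a1 p ^ 2 * dp d q p) * ebas i k q)).
          f_equal. specialize (Heq q p ltac:(lra)). pose proof (af_pos l r p1 gam a1 HA p ltac:(lra)).
          unfold ia. unfold Rdiv in Heq. rewrite <- pow_inv in Heq. lra.
        - rewrite (fc_lin (fun q => 0 + - ia p1 gam a1 p ^ 2 * dqq d q p) (fun q => dp d q p)); [| |exact Cp].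
          2:{ intros q. apply cont_plus; [apply continuous_const|apply cont_mult; [apply continuous_const|apply Cqq]]. }
          rewrite (fc_lin (fun _ => 0) (fun q => dqq d q p)); [|intros; apply continuous_const|exact Cqq].
          rewrite FQ. replace (fc (fun _ => 0) i k) with 0; [ring|].
          symmetry. rewrite (fc_unique (fun _ => 0) i k 0); [ring|].
          pose proof (RI_const 0 (- PI) PI) as H0. rewrite Rmult_0_r in H0. apply (RI_ext (fun _ => 0)); [intros; ring|exact H0]. }
      rewrite Q. ring.
    - intros p Hp. apply cont_minus; [apply (fc_clamp_cont al Hal l r M0); auto; lra|].
      apply cont_mult; [apply continuous_const|].
      apply (derive_cont _ _ _ (proj1 (Yf_derive phi phi' (INR k * INR k) p D1 D2 Hp))).
    - intros p Hp. apply cont_minus; [apply (fc_clamp_cont al Hal l r M1); auto; lra|].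
      apply cont_mult; [apply continuous_const|].
      apply (derive_cont _ _ _ (proj2 (Yf_derive phi phi' (INR k * INR k) p D1 D2 Hp))).
    - intros p Hp. pose proof (Sb p ltac:(lra)). rewrite Rabs_right by nra. nra.
    - intros p Hp. pose proof (Sb p ltac:(lra)). rewrite Rabs_mult, (Rabs_right (ia p1 gam a1 p ^ 2)) by lra. nra.
    - unfold y. rewrite clamp_id by lra. rewrite I1. ring.
    - unfold y'. rewrite clamp_id by lra. rewrite I2. ring. }
  intros p Hp. destruct (Z p Hp) as [Z1 Z2]. unfold y in Z1. unfold y' in Z2. rewrite clamp_id in Z1, Z2 by exact Hp. lra.
Qed.
End LayerModes.

(** * Kernel and cokernel *)

(* [pair_of] enumerates the trigonometric basis: [2k] is [cos (k q)], [2k+1] is [sin (k q)]. *)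
Definition pair_of (j : nat) : bool * nat := (Nat.even j, Nat.div2 j).
Definition ebp (p : bool * nat) : R -> R := ebas (fst p) (snd p).
Definition lsum (l : list nat) (f : nat -> R) : R := fold_right (fun j s => f j + s) 0 l.

Lemma lsum_app l l' f : lsum (l ++ l') f = lsum l f + lsum l' f.
Proof. unfold lsum. induction l as [|a l IH]; simpl; [ring|]. rewrite IH. ring. Qed.

Lemma lsum_filter P l f : (forall j, P j = false -> f j = 0) -> lsum (filter P l) f = lsum l f.
Proof.
  intros H. induction l as [|a l IH]; [reflexivity|]. simpl. destruct (P a) eqn:E; simpl; rewrite IH; [reflexivity|].
  rewrite (H a E). ring.
Qed.

Lemma pair_of_even k : pair_of (2 * k) = (true, k).
Proof. unfold pair_of. rewrite Nat.even_mul, Nat.div2_double. reflexivity. Qed.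

Lemma pair_of_odd k : pair_of (2 * k + 1) = (false, k).
Proof.
  unfold pair_of. rewrite Nat.add_1_r, Nat.even_succ, Nat.div2_succ_double.
  f_equal. rewrite <- Nat.negb_even, Nat.even_mul. reflexivity.
Qed.

Lemma pair_of_inj j j' : pair_of j = pair_of j' -> j = j'.
Proof.
  intros E. unfold pair_of in E. injection E as E1 E2.
  rewrite (Nat.div2_odd j), (Nat.div2_odd j'), E2, <- !Nat.negb_even, E1. reflexivity.
Qed.

Lemma lsum_seq K (e : coef) q :
  lsum (seq 0 (2 * K)) (fun j => e (fst (pair_of j)) (snd (pair_of j)) * ebp (pair_of j) q) = trig K e q.
Proof.
  induction K as [|K IH]; [reflexivity|].
  replace (2 * S K)%nat with (2 * K + 2)%nat by lia. rewrite seq_app, lsum_app, IH. simpl (seq (0 + 2 * K) 2).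
  unfold trig. cbn [rsum]. f_equal. unfold lsum. cbn [fold_right].
  replace (0 + 2 * K)%nat with (2 * K)%nat by lia. replace (S (2 * K)) with (2 * K + 1)%nat by lia.
  change (K + (K + 0))%nat with (2 * K)%nat. replace (S (2 * K)) with (2 * K + 1)%nat by lia.
  rewrite pair_of_even, pair_of_odd. unfold ebp, ebas. simpl. ring.
Qed.

Lemma lc1_ext n c c' f f' q : (forall j, (j < n)%nat -> c j * f j q = c' j * f' j q) -> lc1 n c f q = lc1 n c' f' q.
Proof.
  induction n as [|n IH]; intros H; [reflexivity|]. simpl. rewrite (H n) by lia. rewrite IH; [reflexivity|].
  intros; apply H; lia.
Qed.

Lemma lc2_lc1 n c c' (f : nat -> R -> R -> R) f' q p : (forall j, (j < n)%nat -> c j * f j q p = c' j * f' j q) ->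
  lc2 n c f q p = lc1 n c' f' q.
Proof.
  induction n as [|n IH]; intros H; [reflexivity|]. simpl. rewrite (H n) by lia. rewrite IH; [reflexivity|].
  intros; apply H; lia.
Qed.

Lemma lc1_list (l : list nat) (a : nat -> R) (f : nat -> R -> R) q :
  lc1 (length l) (fun n => a (nth n l 0%nat)) (fun n => f (nth n l 0%nat)) q = lsum l (fun j => a j * f j q).
Proof.
  induction l as [|x l IH] using rev_ind; [reflexivity|].
  rewrite length_app, lsum_app. simpl length. rewrite Nat.add_1_r. simpl lc1.
  rewrite nth_middle. rewrite <- IH. f_equal.
  - apply lc1_ext. intros j Hj. rewrite app_nth1 by exact Hj. reflexivity.
  - unfold lsum. simpl. ring.
Qed.

Definition dlt (a b : bool * nat) : R := if Bool.eqb (fst a) (fst b) then (if Nat.eq_dec (snd a) (snd b) then 1 else 0) else 0.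

Lemma fc_ebas p i k : (i, k) <> (false, 0%nat) -> fc (ebp p) i k = dlt p (i, k).
Proof.
  intros H. destruct p as [i' k']. unfold ebp. simpl fst; simpl snd.
  rewrite (fc_unique _ i k _ (RI_ebas_ebas i' i k' k)). unfold dlt. simpl fst; simpl snd.
  destruct (Bool.eqb i' i) eqn:E; [|ring]. apply Bool.eqb_prop in E. subst i'.
  destruct (Nat.eq_dec k' k); [|ring]. pose proof PI_RGT_0. unfold cnst, nrm.
  destruct (Nat.eq_dec k 0) as [->|N]; [|field; lra]. destruct i; [field; lra|]. exfalso; apply H; reflexivity.
Qed.

Lemma lc1_cont n c p q : continuous (fun q => lc1 n c (fun j => ebp (p j)) q) q.
Proof.
  induction n as [|n IH]; simpl; [apply continuous_const|].
  apply cont_plus; [exact IH|]. apply cont_mult; [apply continuous_const|apply ebas_cont].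
Qed.

Lemma fc_0 i k : fc (fun _ => 0) i k = 0.
Proof.
  rewrite (fc_unique (fun _ => 0) i k 0); [ring|]. pose proof (RI_const 0 (- PI) PI) as H0. rewrite Rmult_0_r in H0.
  apply (RI_ext (fun _ => 0)); [intros; ring|exact H0].
Qed.

Lemma fc_ext f g i k : (forall q, f q = g q) -> fc f i k = fc g i k.
Proof.
  intros H. unfold fc, integral. f_equal. apply RInt_ext. intros q _. rewrite H. reflexivity.
Qed.

Lemma fc_lc1 n c p i k : (i, k) <> (false, 0%nat) ->
  fc (fun q => lc1 n c (fun j => ebp (p j)) q) i k = rsum n (fun j => c j * dlt (p j) (i, k)).
Proof.
  intros H. induction n as [|n IH]; simpl; [apply fc_0|].
  rewrite (fc_lin (fun q => lc1 n c (fun j => ebp (p j)) q) (ebp (p n)) (c n)).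
  - rewrite IH, fc_ebas by exact H. reflexivity.
  - intros; apply lc1_cont.
  - intros; apply ebas_cont.
Qed.

(** Orthogonality isolates the [n]-th coefficient, because distinct positions of a duplicate-free
    list carry distinct basis functions. *)
Lemma fc_lc1_nth (l : list nat) n c : NoDup l -> (n < length l)%nat -> pair_of (nth n l 0%nat) <> (false, 0%nat) ->
  fc (fun q => lc1 (length l) c (fun j => ebp (pair_of (nth j l 0%nat))) q)
     (fst (pair_of (nth n l 0%nat))) (snd (pair_of (nth n l 0%nat))) = c n.
Proof.
  intros ND Hn Hp.
  rewrite (fc_lc1 (length l) c (fun j => pair_of (nth j l 0%nat))) by (rewrite <- surjective_pairing; exact Hp).
  rewrite <- surjective_pairing. rewrite (rsum_single _ n); [|exact Hn|].
  - unfold dlt. rewrite Bool.eqb_reflx. destruct (Nat.eq_dec _ _); [ring|congruence].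
  - intros j Hj Hne. unfold dlt. destruct (Bool.eqb _ _) eqn:E1; [|ring]. destruct (Nat.eq_dec _ _) as [E2|]; [|ring].
    exfalso. apply Hne. apply (proj1 (NoDup_nth l 0%nat) ND); auto. apply pair_of_inj.
    apply Bool.eqb_prop in E1. rewrite (surjective_pairing (pair_of (nth j l 0%nat))), E1, E2.
    symmetry; apply surjective_pairing.
Qed.

Lemma Sk_pos k x : 0 < x -> 0 < Sk k x.
Proof.
  intros Hx. unfold Sk. destruct (Nat.eq_dec k 0) as [_|N]; [exact Hx|].
  assert (0 < INR k) by (apply lt_0_INR; lia). apply Rdiv_lt_0_compat; [|assumption].
  unfold sinh. pose proof (exp_increasing (- (INR k * x)) (INR k * x)).
  assert (0 < INR k * x) by (apply Rmult_lt_0_compat; assumption). lra.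
Qed.

Lemma trig_extend K n (m : coef) q : (K <= n)%nat -> (forall i k, (K <= k)%nat -> m i k = 0) -> trig n m q = trig K m q.
Proof.
  intros H Hm. unfold trig. apply rsum_le_ext; [exact H|]. intros k Hk. rewrite !Hm by lia. ring.
Qed.

Lemma fourier_trig al M f K (m : coef) q : 0 < al < 1 -> 0 <= M -> per1 f -> hol1 al M f ->
  (forall i k, fc f i k = m i k) -> (forall i k, (K <= k)%nat -> m i k = 0) -> f q = trig K m q.
Proof.
  intros Hal HM Hper Hf Hm HK.
  destruct (sepH_trig al Hal 0 0 K (fun i k _ => m i k)) as [B [HB [B1 B2 B3]]].
  { intros i k. exists (Rabs (m i k)). split; [apply Rabs_pos|]. split; intros; [lra|].
    rewrite Rminus_diag, Rabs_R0. apply Rmult_le_pos; [apply Rabs_pos|apply pw_nonneg]. }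
  assert (Ht : hol1 al B (trig K m)) by (intros q0 q1; apply (B2 q0 q1 0); lra).
  assert (Cf : forall y : R, continuous f y) by (intros; apply (hol1_cont al M); [lra|exact Hf]).
  enough (E : f q + -1 * trig K m q = 0) by lra.
  apply (fourier_unique al (M + B) (fun q => f q + -1 * trig K m q)); [lra|lra| | |].
  - intros y. rewrite Hper, trig_periodic. reflexivity.
  - intros y y'. replace (f y + -1 * trig K m y - (f y' + -1 * trig K m y')) with ((f y - f y') - (trig K m y - trig K m y')) by ring.
    eapply Rle_trans; [apply Rabs_triang|]. rewrite Rabs_Ropp. specialize (Hf y y'). specialize (Ht y y'). lra.
  - intros i k. assert (D : (i = false /\ k = 0%nat) \/ (i = false -> k <> 0%nat)).
    { destruct i; [right; discriminate|]. destruct k; [left; auto|right; discriminate]. }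
    destruct D as [[-> ->]|D]; [apply fc_sin0|].
    rewrite (fc_lin f (trig K m)); [|exact Cf|intros; apply trig_continuous].
    (* [fc_trig] reads coefficients below the degree only, so the polynomial is padded with zeros
       beyond [k]. *)
    rewrite Hm, (fc_ext (trig K m) (trig (Nat.max K (S k)) m)) by (intros; symmetry; apply trig_extend; [lia|exact HK]).
    rewrite fc_trig by (try lia; exact D). ring.
Qed.

Definition badl (P : nat -> bool) (K : nat) : list nat := filter P (seq 0 (2 * K)).

Lemma lc1_badl P K (m : coef) q :
  (forall j, P j = false -> m (fst (pair_of j)) (snd (pair_of j)) * ebp (pair_of j) q = 0) ->
  lc1 (length (badl P K)) (fun n => m (fst (pair_of (nth n (badl P K) 0%nat))) (snd (pair_of (nth n (badl P K) 0%nat))))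
    (fun n => ebp (pair_of (nth n (badl P K) 0%nat))) q = trig K m q.
Proof.
  intros H. rewrite (lc1_list (badl P K) (fun j => m (fst (pair_of j)) (snd (pair_of j))) (fun j => ebp (pair_of j))).
  unfold badl. rewrite (lsum_filter P _ _ H). apply lsum_seq.
Qed.

Lemma lc2_zero n c q p : lc2 n c (fun _ _ _ => 0) q p = 0.
Proof. induction n as [|n IH]; [reflexivity|]. simpl. rewrite IH. ring. Qed.

(** * The operator [(L, T)] *)

Section Water.
Variables (g sigma p0 p1 g1 g2 al lam : R).
Hypotheses (Hsigma : 0 < sigma) (Hp01 : p0 < p1) (Hp10 : p1 < 0) (Hal : 0 < al < 1).
Hypothesis Hlam : forall p, p0 <= p <= 0 -> 2 * Gam g1 g2 p1 p < lam.

Definition a1 : R := sqrt (lam - 2 * g2 * p1).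
Definition h1 : R := - sv p1 g1 a1 p0.
Definition h2 : R := sv p1 g2 a1 0.
Definition kap : R := (g2 - g1) / a1.
(** At the top [a = sqrt lam], so [v = w / a] and [a^3 v_p = a w_s + g2 w]. Substituting in the
    bracket of [T] gives the coefficients [sg], [bt], [ct]. *)
Definition sg : R := sigma / sqrt lam.
Definition bt : R := g / sqrt lam - g2.
Definition ct : R := sqrt lam.

Lemma lam_pos : 0 < lam.
Proof.
  pose proof (Hlam 0 ltac:(lra)) as H. unfold Gam in H. destruct (Rle_dec p1 0); [|lra]. lra.
Qed.

Lemma a1_sqr : 0 < lam - 2 * g2 * p1.
Proof.
  pose proof (Hlam p1 ltac:(lra)) as H. unfold Gam in H. destruct (Rle_dec p1 p1); [|lra]. lra.
Qed.

Lemma a1_pos : 0 < a1.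
Proof. apply sqrt_lt_R0, a1_sqr. Qed.

Lemma Af1 p : p0 <= p <= p1 -> Af p1 g1 a1 p = lam - 2 * Gam g1 g2 p1 p.
Proof.
  intros Hp. unfold Af, a1. rewrite sqrt_sqrt by (left; apply a1_sqr). unfold Gam.
  destruct (Rle_dec p1 p); [|ring]. assert (p = p1) as -> by lra. ring.
Qed.

Lemma Af2 p : p1 <= p <= 0 -> Af p1 g2 a1 p = lam - 2 * Gam g1 g2 p1 p.
Proof.
  intros Hp. unfold Af, a1. rewrite sqrt_sqrt by (left; apply a1_sqr). unfold Gam.
  destruct (Rle_dec p1 p); [|lra]. ring.
Qed.

Lemma HA1 p : p0 <= p <= p1 -> 0 < Af p1 g1 a1 p.
Proof. intros Hp. rewrite Af1 by exact Hp. pose proof (Hlam p ltac:(lra)). lra. Qed.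
Lemma HA2 p : p1 <= p <= 0 -> 0 < Af p1 g2 a1 p.
Proof. intros Hp. rewrite Af2 by exact Hp. pose proof (Hlam p ltac:(lra)). lra. Qed.

Lemma aa1 p : p0 <= p <= p1 -> aa lam g1 g2 p1 p = af p1 g1 a1 p.
Proof. intros Hp. unfold aa, af. rewrite Af1 by exact Hp. reflexivity. Qed.
Lemma aa2 p : p1 <= p <= 0 -> aa lam g1 g2 p1 p = af p1 g2 a1 p.
Proof. intros Hp. unfold aa, af. rewrite Af2 by exact Hp. reflexivity. Qed.

Lemma af_top : af p1 g2 a1 0 = sqrt lam.
Proof.
  unfold af. rewrite Af2 by lra. unfold Gam. destruct (Rle_dec p1 0); [|lra]. f_equal. ring.
Qed.

Lemma h1_pos : 0 < h1.
Proof.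
  unfold h1. pose proof (sv_lt p0 p1 p1 g1 a1 a1_pos HA1 p0 p1 ltac:(lra) ltac:(lra) ltac:(lra)) as H.
  rewrite (sv_p1 p1 g1 a1) in H. lra.
Qed.

Lemma h2_pos : 0 < h2.
Proof.
  unfold h2. pose proof (sv_lt p1 0 p1 g2 a1 a1_pos HA2 p1 0 ltac:(lra) ltac:(lra) ltac:(lra)) as H.
  rewrite (sv_p1 p1 g2 a1) in H. lra.
Qed.

Lemma sg_pos : 0 < sg.
Proof. apply Rdiv_lt_0_compat; [exact Hsigma|apply sqrt_lt_R0, lam_pos]. Qed.

Definition toX (w1 w2 : R -> R -> R) : XE :=
  mkXE (fun q p => w1 q (sv p1 g1 a1 p) * ia p1 g1 a1 p) (fun q p => w2 q (sv p1 g2 a1 p) * ia p1 g2 a1 p).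

Lemma Wsol_toX F1 F2 z w1 d1 w2 d2 y : Wsol al h1 h2 kap sg bt ct F1 F2 z w1 d1 w2 d2 ->
  (forall q p, p0 <= p <= p1 -> y1 y q p = F1 q (sv p1 g1 a1 p) * ia p1 g1 a1 p ^ 3) ->
  (forall q p, p1 <= p <= 0 -> y2 y q p = F2 q (sv p1 g2 a1 p) * ia p1 g2 a1 p ^ 3) ->
  (forall q, yz y q = 2 / lam * z q) ->
  inX al p0 p1 (toX w1 w2) /\ LT g sigma g1 g2 al p0 p1 lam (toX w1 w2) y.
Proof.
  intros [A1 A2 A3 A4 A5 A6 A7 A8] Y1 Y2 YZ.
  pose proof a1_pos as Ha. pose proof lam_pos as Hl.
  assert (S1 : sv p1 g1 a1 p1 = 0) by apply sv_p1. assert (S2 : sv p1 g2 a1 p1 = 0) by apply sv_p1.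
  assert (S0 : - h1 = sv p1 g1 a1 p0) by (unfold h1; ring).
  assert (I1 : IsC2a al p0 p1 (xv (toX w1 w2)) (flatD p1 g1 a1 w1 d1)).
  { apply (flatten al p0 p1 p1 g1 a1 Hal ltac:(lra) Ha HA1). rewrite <- S0, S1. exact A1. }
  assert (I2 : IsC2a al p1 0 (xV (toX w1 w2)) (flatD p1 g2 a1 w2 d2)).
  { apply (flatten al p1 0 p1 g2 a1 Hal ltac:(lra) Ha HA2). rewrite S2. exact A2. }
  assert (Ia1 : ia p1 g1 a1 p1 = / a1) by (unfold ia; rewrite af_p1 by exact Ha; reflexivity).
  assert (Ia2 : ia p1 g2 a1 p1 = / a1) by (unfold ia; rewrite af_p1 by exact Ha; reflexivity).
  split.
  - exists (flatD p1 g1 a1 w1 d1), (flatD p1 g2 a1 w2 d2). split; [exact I1|]. split; [exact I2|]. split.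
    + intros q. unfold toX, flatD. cbn [xv xV dp]. rewrite S1, S2, Ia1, Ia2, <- A6. split; [reflexivity|].
      replace (dp d1 q 0) with (dp d2 q 0 + kap * w1 q 0) by (rewrite <- A7; ring). unfold kap. field. lra.
    + intros q. unfold toX. cbn [xv]. rewrite <- S0, A5. ring.
  - exists (flatD p1 g1 a1 w1 d1), (flatD p1 g2 a1 w2 d2). split; [exact I1|]. split; [exact I2|]. split; [|split].
    + intros q p Hp. rewrite aa1 by exact Hp. rewrite (flatten_eq p0 p1 p1 g1 a1 HA1 w1 d1 q p Hp), Y1 by exact Hp.
      f_equal. symmetry. apply A3. rewrite S0. split.
      * destruct (Req_dec p0 p) as [<-|N]; [lra|]. left; apply (sv_lt p0 p1 p1 g1 a1 Ha HA1); lra.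
      * destruct (Req_dec p p1) as [->|N]; [lra|].
        pose proof (sv_lt p0 p1 p1 g1 a1 Ha HA1 p p1 ltac:(lra) ltac:(lra) ltac:(lra)). lra.
    + intros q p Hp. rewrite aa2 by exact Hp. rewrite (flatten_eq p1 0 p1 g2 a1 HA2 w2 d2 q p Hp), Y2 by exact Hp.
      f_equal. symmetry. apply A4. split.
      * destruct (Req_dec p1 p) as [<-|N]; [lra|].
        pose proof (sv_lt p1 0 p1 g2 a1 Ha HA2 p1 p ltac:(lra) ltac:(lra) ltac:(lra)). lra.
      * destruct (Req_dec p 0) as [->|N]; [unfold h2; lra|]. left; apply (sv_lt p1 0 p1 g2 a1 Ha HA2); lra.
    + intros q. rewrite YZ. f_equal. rewrite <- A8. unfold toX, flatD. cbn [xV dp dqq]. fold h2.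
      assert (Hc : 0 < sqrt lam) by (apply sqrt_lt_R0; exact Hl).
      assert (El : lam = sqrt lam * sqrt lam) by (symmetry; apply sqrt_sqrt; lra).
      unfold ia. rewrite af_top. unfold sg, bt, ct. set (c := sqrt lam) in *. rewrite El. field. lra.
Qed.

Definition ph1 := phi1 h1.
Definition ph1' := phi1' h1.
Definition ph2 := phi2 h1 kap.
Definition ph2' := phi2' h1 kap.
Definition TK := tk h1 h2 kap sg bt ct.

Lemma ph_derive k : (forall s, is_derive (ph1 k) s (ph1' k s)) /\ (forall s, is_derive (ph1' k) s (INR k * INR k * ph1 k s)) /\
  (forall s, is_derive (ph2 k) s (ph2' k s)) /\ (forall s, is_derive (ph2' k) s (INR k * INR k * ph2 k s)).
Proof.
  split; [|split; [|split]]; intros s; destruct (phi_derive h1 kap k s) as [D1 [D2 [D3 D4]]]; assumption.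
Qed.

(** It satisfies every homogeneous condition except the one at the top, where the defect is
    proportional to [TK k]. *)
Definition emode (i : bool) (k : nat) : XE := toX (fun q s => ph1 k s * ebas i k q) (fun q s => ph2 k s * ebas i k q).

Lemma emode_v i k q p : xv (emode i k) q p = Yf p1 g1 a1 (ph1 k) p * ebas i k q.
Proof. unfold emode, toX, Yf. cbn [xv]. ring. Qed.
Lemma emode_V i k q p : xV (emode i k) q p = Yf p1 g2 a1 (ph2 k) p * ebas i k q.
Proof. unfold emode, toX, Yf. cbn [xV]. ring. Qed.

Lemma emode_ok i k y : (forall q p, p0 <= p <= p1 -> y1 y q p = 0) -> (forall q p, p1 <= p <= 0 -> y2 y q p = 0) ->
  (forall q, yz y q = 2 / lam * (TK k * ebas i k q)) ->
  inX al p0 p1 (emode i k) /\ LT g sigma g1 g2 al p0 p1 lam (emode i k) y.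
Proof.
  intros Y1 Y2 Y3. destruct (ph_derive k) as [D1 [D2 [D3 D4]]].
  assert (D2' : forall s, is_derive (ph1' k) s (INR k * INR k * ph1 k s + 0)) by (intros s; eapply D_eq; [|apply D2]; ring).
  assert (D4' : forall s, is_derive (ph2' k) s (INR k * INR k * ph2 k s + 0)) by (intros s; eapply D_eq; [|apply D4]; ring).
  assert (H0 : forall l r, holI al l r 0 (fun _ => 0)).
  { intros l r. split; intros; rewrite ?Rminus_diag, Rabs_R0; lra. }
  pose proof (mode_IsC2a al Hal (- h1) 0 0 k i (ph1 k) (ph1' k) (fun _ => 0) ltac:(lra) D1 D2' (fun s => continuous_const 0 s) (H0 _ _)) as I1.
  pose proof (mode_IsC2a al Hal 0 h2 0 k i (ph2 k) (ph2' k) (fun _ => 0) ltac:(lra) D3 D4' (fun s => continuous_const 0 s) (H0 _ _)) as I2.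
  destruct (phi_values h1 kap k) as [V1 [V2 [V3 V4]]].
  assert (HW : exists d1 d2, Wsol al h1 h2 kap sg bt ct (fun _ _ => 0) (fun _ _ => 0) (fun q => TK k * ebas i k q)
     (fun q s => ph1 k s * ebas i k q) d1 (fun q s => ph2 k s * ebas i k q) d2).
  { eexists _, _. split; [exact I1|exact I2| | | | | |]; cbn [dp dq dpp dpq dqq].
    - intros; ring.
    - intros; ring.
    - intros q. unfold ph1. rewrite V1. ring.
    - intros q. unfold ph1, ph2. rewrite V3. reflexivity.
    - intros q. unfold ph1', ph2', ph1. rewrite <- Rmult_minus_distr_r, V4. ring.
    - intros q. unfold TK, tk, ph2, ph2'. ring. }
  destruct HW as [d1 [d2 HW]]. apply (Wsol_toX _ _ _ _ _ _ _ y HW).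
  - intros q p Hp. rewrite Y1 by exact Hp. ring.
  - intros q p Hp. rewrite Y2 by exact Hp. ring.
  - exact Y3.
Qed.

Lemma Yf_bottom k : Yf p1 g1 a1 (ph1 k) p0 = 0 /\ 0 < Yf' p1 g1 a1 (ph1 k) (ph1' k) p0.
Proof.
  destruct (phi_values h1 kap k) as [V1 [V2 _]]. assert (S0 : sv p1 g1 a1 p0 = - h1) by (unfold h1; ring).
  pose proof (ia_pos p0 p1 p1 g1 a1 HA1 p0 ltac:(lra)). unfold Yf, Yf', ph1, ph1'. rewrite S0, V1, V2. split; [ring|].
  assert (0 < ia p1 g1 a1 p0 ^ 2) by (apply pow_lt; assumption). lra.
Qed.

Lemma Yf_interface k : Yf p1 g2 a1 (ph2 k) p1 = Yf p1 g1 a1 (ph1 k) p1 /\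
  Yf' p1 g2 a1 (ph2 k) (ph2' k) p1 = Yf' p1 g1 a1 (ph1 k) (ph1' k) p1.
Proof.
  pose proof a1_pos as Ha. destruct (phi_values h1 kap k) as [_ [_ [V3 V4]]].
  unfold Yf, Yf', ph1, ph1', ph2, ph2'. rewrite !sv_p1, V3.
  assert (Ia1 : ia p1 g1 a1 p1 = / a1) by (unfold ia; rewrite af_p1 by exact Ha; reflexivity).
  assert (Ia2 : ia p1 g2 a1 p1 = / a1) by (unfold ia; rewrite af_p1 by exact Ha; reflexivity).
  rewrite Ia1, Ia2. split; [reflexivity|].
  replace (phi1' h1 k 0) with (phi2' h1 kap k 0 + kap * phi1 h1 k 0) by (rewrite <- V4; ring). unfold kap. field. lra.
Qed.

(** Only the interior data are assumed to vanish. With a zero top datum this describes the kernel;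
    with an arbitrary one it shows that the top coefficient vanishes wherever [TK k = 0], which
    makes the complement of the range direct. *)
Lemma fourier_mode x w i k : inX al p0 p1 x -> LT g sigma g1 g2 al p0 p1 lam x w ->
  (forall q p, p0 <= p <= p1 -> y1 w q p = 0) -> (forall q p, p1 <= p <= 0 -> y2 w q p = 0) ->
  exists m, (forall p, p0 <= p <= p1 -> fc (fun q => xv x q p) i k = m * Yf p1 g1 a1 (ph1 k) p) /\
    (forall p, p1 <= p <= 0 -> fc (fun q => xV x q p) i k = m * Yf p1 g2 a1 (ph2 k) p) /\
    fc (yz w) i k = m * (2 / lam * TK k).
Proof.
  intros [ev [eV [E1 [E2 [E3 E4]]]]] [dv [dV [D1 [D2 [D3 [D4 D5]]]]]] W1 W2.
  destruct (ph_derive k) as [P1 [P2 [P3 P4]]].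
  pose proof a1_pos as Ha. pose proof lam_pos as Hl.
  destruct (Yf_bottom k) as [B1 B2]. destruct (Yf_interface k) as [F1 F2].
  (* The solution vanishes at the bottom, so the slope there fixes the multiple; the slope of the
     reference profile is positive. *)
  pose (m := fc (fun q => dp dv q p0) i k / Yf' p1 g1 a1 (ph1 k) (ph1' k) p0).
  assert (L1 : forall p, p0 <= p <= p1 -> fc (fun q => xv x q p) i k = m * Yf p1 g1 a1 (ph1 k) p /\
     fc (fun q => dp dv q p) i k = m * Yf' p1 g1 a1 (ph1 k) (ph1' k) p).
  { apply (layer_mode al p0 p1 p1 g1 a1 Hal ltac:(lra) Ha HA1 _ _ i k (ph1 k) (ph1' k) m D1); auto.
    - intros q p Hp. rewrite <- aa1 by exact Hp. rewrite <- D3 by exact Hp. symmetry; apply W1; exact Hp.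
    - rewrite B1, Rmult_0_r. rewrite (fc_ext _ (fun _ => 0)) by exact E4. apply fc_0.
    - unfold m. field. lra. }
  assert (L2 : forall p, p1 <= p <= 0 -> fc (fun q => xV x q p) i k = m * Yf p1 g2 a1 (ph2 k) p /\
     fc (fun q => dp dV q p) i k = m * Yf' p1 g2 a1 (ph2 k) (ph2' k) p).
  { destruct (L1 p1 ltac:(lra)) as [K1 K2].
    apply (layer_mode al p1 0 p1 g2 a1 Hal ltac:(lra) Ha HA2 _ _ i k (ph2 k) (ph2' k) m D2); auto.
    - intros q p Hp. rewrite <- aa2 by exact Hp. rewrite <- D4 by exact Hp. symmetry; apply W2; exact Hp.
    - rewrite F1, <- K1. apply fc_ext. intros q. symmetry. apply E3.
    - rewrite F2, <- K2. apply fc_ext. intros q.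
      destruct (IsC2a_unique al p0 p1 _ dv ev ltac:(lra) Hp01 D1 E1 q p1 ltac:(lra)) as [U1 _].
      destruct (IsC2a_unique al p1 0 _ dV eV ltac:(lra) Hp10 D2 E2 q p1 ltac:(lra)) as [U2 _].
      rewrite U1, U2. symmetry. apply E3. }
  exists m. split; [intros p Hp; exact (proj1 (L1 p Hp))|]. split; [intros p Hp; exact (proj1 (L2 p Hp))|].
  destruct (L2 0 ltac:(lra)) as [T1 T2].
  pose proof (fc_qq al p1 0 (xV x) dV i k 0 Hal Hp10 D2 ltac:(lra)) as T3.
  pose proof D2 as [[_ Hu] [A1 [_ [_ [_ [A5 _]]]]]].
  destruct (holder2_sepH _ _ _ _ Hu) as [M0 [_ S0]]. destruct (holder2_sepH _ _ _ _ A1) as [M1 [_ S1]].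
  destruct (holder2_sepH _ _ _ _ A5) as [M3 [_ S3]].
  assert (C0 : forall q, continuous (fun q => xV x q 0) q) by (intros; apply (slice_cont al Hal p1 0 M0); [exact S0|lra]).
  assert (C1 : forall q, continuous (fun q => dp dV q 0) q) by (intros; apply (slice_cont al Hal p1 0 M1); [exact S1|lra]).
  assert (C3 : forall q, continuous (fun q => dqq dV q 0) q) by (intros; apply (slice_cont al Hal p1 0 M3); [exact S3|lra]).
  (* The top condition is rewritten as nested sums [f + r * g], the shape to which linearity of [fc]
     applies. *)
  rewrite (fc_ext _ (fun q => ((0 + 2 / lam * g * xV x q 0) + - (2 / lam * (lam * sqrt lam)) * dp dV q 0) + - (2 / lam * sigma) * dqq dV q 0)).
  2:{ intros q. rewrite D5. ring. }
  rewrite (fc_lin (fun q => (0 + 2 / lam * g * xV x q 0) + - (2 / lam * (lam * sqrt lam)) * dp dV q 0) (fun q => dqq dV q 0)); [| |exact C3].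
  2:{ intros q. apply cont_plus; [apply cont_plus; [apply continuous_const|]|]; (apply cont_mult; [apply continuous_const|auto]). }
  rewrite (fc_lin (fun q => 0 + 2 / lam * g * xV x q 0) (fun q => dp dV q 0)); [| |exact C1].
  2:{ intros q. apply cont_plus; [apply continuous_const|]. apply cont_mult; [apply continuous_const|auto]. }
  rewrite (fc_lin (fun _ => 0) (fun q => xV x q 0)); [|intros; apply continuous_const|exact C0].
  rewrite fc_0, T1, T2, T3, T1.
  unfold Yf, Yf', TK, tk, ia. rewrite af_top. fold h2. fold ph2. fold ph2'.
  assert (Hc : 0 < sqrt lam) by (apply sqrt_lt_R0; exact Hl).
  assert (El : lam = sqrt lam * sqrt lam) by (symmetry; apply sqrt_sqrt; lra).
  change (phi2 h1 kap k h2) with (ph2 k h2). change (phi2' h1 kap k h2) with (ph2' k h2).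
  unfold sg, bt, ct. set (c := sqrt lam) in *. rewrite El. field. lra.
Qed.

Lemma slice_fourier l r u K (m : coef) q p : inCa2 al l r u -> l <= p <= r ->
  (forall i k, fc (fun q => u q p) i k = m i k) -> (forall i k, (K <= k)%nat -> m i k = 0) -> u q p = trig K m q.
Proof.
  intros [Hper Hu] Hp Hm HK. destruct (holder2_sepH _ _ _ _ Hu) as [M [HM HS]].
  apply (fourier_trig al M (fun q => u q p)); auto.
  - intros y. apply Hper, Hp.
  - intros y y'. apply (sepH_q _ _ _ _ _ HS y y' p Hp).
Qed.

(* The pair [(false, 0)] is excluded because [sin (0 q) = 0]. *)
Definition bad (j : nat) : bool :=
  (if Req_EM_T (TK (snd (pair_of j))) 0 then true else false) && negb (Nat.eqb j 1).

Lemma bad_false j : bad j = false -> TK (snd (pair_of j)) <> 0 \/ forall q, ebp (pair_of j) q = 0.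
Proof.
  unfold bad. destruct (Req_EM_T _ 0) as [E|N]; [|left; exact N]. simpl. destruct (Nat.eqb j 1) eqn:Ej; [|discriminate].
  intros _. right. intros q. apply Nat.eqb_eq in Ej. subst j. unfold ebp, ebas, pair_of. simpl. rewrite Rmult_0_l. apply sin_0.
Qed.

Lemma bad_true j : bad j = true -> TK (snd (pair_of j)) = 0 /\ pair_of j <> (false, 0%nat).
Proof.
  unfold bad. destruct (Req_EM_T _ 0) as [E|N]; [|discriminate]. simpl. destruct (Nat.eqb j 1) eqn:Ej; [discriminate|].
  intros _. split; [exact E|]. intros H. change (false, 0%nat) with (pair_of 1) in H. apply pair_of_inj in H. subst j. discriminate.
Qed.

(** * Dimensions of kernel and cokernel *)

Section Bad.
Variable K : nat.
Hypothesis HK : forall k, (K <= k)%nat -> TK k <> 0.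
Let l := badl bad K.

Lemma badl_nth n : (n < length l)%nat ->
  TK (snd (pair_of (nth n l 0%nat))) = 0 /\ pair_of (nth n l 0%nat) <> (false, 0%nat).
Proof.
  intros Hn. apply bad_true. pose proof (nth_In l 0%nat Hn) as H. apply filter_In in H. apply H.
Qed.

Lemma badl_NoDup : NoDup l.
Proof. apply NoDup_filter, seq_NoDup. Qed.

Lemma kernel_dim : ker_dim g sigma g1 g2 al p0 p1 lam (length l).
Proof.
  pose proof lam_pos as Hl. pose proof a1_pos as Ha.
  exists (fun n => emode (fst (pair_of (nth n l 0%nat))) (snd (pair_of (nth n l 0%nat)))). split; [|split].
  - intros n Hn. destruct (badl_nth n Hn) as [E _]. apply emode_ok; try reflexivity.
    intros q. rewrite E. simpl. ring.
  - intros x Hx HL.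
    assert (FM : forall ik : bool * nat, exists m,
      (forall p, p0 <= p <= p1 -> fc (fun q => xv x q p) (fst ik) (snd ik) = m * Yf p1 g1 a1 (ph1 (snd ik)) p) /\
      (forall p, p1 <= p <= 0 -> fc (fun q => xV x q p) (fst ik) (snd ik) = m * Yf p1 g2 a1 (ph2 (snd ik)) p) /\
      fc (yz YZ0) (fst ik) (snd ik) = m * (2 / lam * TK (snd ik))).
    { intros ik. apply fourier_mode; auto. }
    destruct (functional_choice _ FM) as [m Hm]. clear FM.
    assert (Hgood : forall i k, TK k <> 0 -> m (i, k) = 0).
    { intros i k N. destruct (Hm (i, k)) as [_ [_ E]]. simpl in E. rewrite fc_0 in E.
      destruct (Rmult_integral _ _ (eq_sym E)) as [Z|Z]; [exact Z|].
      destruct (Rmult_integral _ _ Z) as [Z'|Z']; [|contradiction].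
      exfalso. assert (0 < 2 / lam) by (apply Rdiv_lt_0_compat; lra). lra. }
    destruct Hx as [dv [dV [[Iv _] [[IV _] _]]]].
    exists (fun n => m (pair_of (nth n l 0%nat))). split; intros q p Hp.
    + unfold Xlc. cbn [xv].
      rewrite (slice_fourier p0 p1 (xv x) K (fun i k => m (i, k) * Yf p1 g1 a1 (ph1 k) p) q p Iv Hp).
      * symmetry. erewrite lc2_lc1; [apply (lc1_badl bad K)|].
        -- intros j Hj. destruct (bad_false j Hj) as [N|N]; [rewrite Hgood by exact N; ring|rewrite N; ring].
        -- intros j Hj. cbv beta. rewrite emode_v, <- surjective_pairing. fold l. unfold ebp. ring.
      * intros i k. exact (proj1 (Hm (i, k)) p Hp).
      * intros i k Hk. rewrite Hgood by (apply HK, Hk). ring.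
    + unfold Xlc. cbn [xV].
      rewrite (slice_fourier p1 0 (xV x) K (fun i k => m (i, k) * Yf p1 g2 a1 (ph2 k) p) q p IV Hp).
      * symmetry. erewrite lc2_lc1; [apply (lc1_badl bad K)|].
        -- intros j Hj. destruct (bad_false j Hj) as [N|N]; [rewrite Hgood by exact N; ring|rewrite N; ring].
        -- intros j Hj. cbv beta. rewrite emode_V, <- surjective_pairing. fold l. unfold ebp. ring.
      * intros i k. exact (proj1 (proj2 (Hm (i, k))) p Hp).
      * intros i k Hk. rewrite Hgood by (apply HK, Hk). ring.
  - intros c [E _] n Hn.
    (* Independence is tested on the interface line, where the profile of mode [k] is
       [Sk k h1 / a1], hence positive. *)
    assert (Z : c n * Yf p1 g1 a1 (ph1 (snd (pair_of (nth n l 0%nat)))) p1 = 0).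
    { rewrite <- (fc_lc1_nth l n (fun n => c n * Yf p1 g1 a1 (ph1 (snd (pair_of (nth n l 0%nat)))) p1)
        badl_NoDup Hn (proj2 (badl_nth n Hn))).
      rewrite (fc_ext _ (fun _ => 0)); [apply fc_0|]. intros q. specialize (E q p1 ltac:(lra)).
      unfold Xlc, X0 in E. cbn [xv] in E. rewrite <- E. symmetry. apply lc2_lc1.
      intros j Hj. rewrite emode_v. unfold ebp. ring. }
    destruct (Rmult_integral _ _ Z) as [Z'|Z']; [exact Z'|]. exfalso.
    unfold Yf, ph1, phi1 in Z'. rewrite sv_p1, Rplus_0_l in Z'.
    pose proof (Sk_pos (snd (pair_of (nth n l 0%nat))) h1 h1_pos). pose proof (ia_pos p0 p1 p1 g1 a1 HA1 p1 ltac:(lra)).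
    assert (0 < Sk (snd (pair_of (nth n l 0%nat))) h1 * ia p1 g1 a1 p1) by (apply Rmult_lt_0_compat; assumption). lra.
Qed.

Hypothesis Hsolve : forall F1 F2 z M, 0 <= M -> data al h1 h2 F1 F2 z M -> exists w1 d1 w2 d2 (e : coef),
  (forall i k, TK k <> 0 -> e i k = 0) /\ Wsol al h1 h2 kap sg bt ct F1 F2 (fun q => z q - trig K e q) w1 d1 w2 d2.

Lemma inYZ_data y : inYZ al p0 p1 y -> exists M, 0 <= M /\
  data al h1 h2 (flatF p1 g1 a1 (y1 y)) (flatF p1 g2 a1 (y2 y)) (fun q => lam / 2 * yz y q) M.
Proof.
  pose proof lam_pos as Hl. pose proof a1_pos as Ha.
  intros [[Q1 Y1] [[Q2 Y2] [Q3 [[B HB] [C HC]]]]].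
  assert (S1 : sv p1 g1 a1 p1 = 0) by apply sv_p1. assert (S2 : sv p1 g2 a1 p1 = 0) by apply sv_p1.
  assert (S0 : sv p1 g1 a1 p0 = - h1) by (unfold h1; ring).
  destruct (flatF_sepH al p0 p1 p1 g1 a1 Hal Hp01 Ha HA1 _ Y1) as [M1 [HM1 H1]].
  destruct (flatF_sepH al p1 0 p1 g2 a1 Hal Hp10 Ha HA2 _ Y2) as [M2 [HM2 H2]].
  rewrite S0, S1 in H1. rewrite S2 in H2. fold h2 in H2.
  pose proof (Rabs_pos B) as PB. pose proof (Rle_abs B) as LB. pose proof (Rabs_pos C) as PC. pose proof (Rle_abs C) as LC.
  pose (M3 := lam / 2 * (Rabs B + Rabs C)).
  assert (HM3 : 0 <= M3) by (apply Rmult_le_pos; lra).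
  assert (Mono : forall a b M M' u, M <= M' -> sepH al a b M u -> sepH al a b M' u).
  { intros a b M M' u HMM [U1 U2 U3]. split.
    - intros q s Hs. eapply Rle_trans; [apply U1, Hs|exact HMM].
    - intros q q' s Hs. eapply Rle_trans; [apply U2, Hs|]. apply Rmult_le_compat_r; [apply pw_nonneg|exact HMM].
    - intros q s s' Hs Hs'. eapply Rle_trans; [apply U3; assumption|]. apply Rmult_le_compat_r; [apply pw_nonneg|exact HMM]. }
  exists (M1 + M2 + M3). split; [lra|]. split; [|split; [|split; [|split; [|split; [|split]]]]].
  - intros q s Hs. unfold flatF. rewrite Q1; [reflexivity|]. apply (pv_in p0 p1 p1 g1 a1 Hp01 Ha HA1). rewrite S0, S1. exact Hs.
  - apply (Mono _ _ M1); [lra|exact H1].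
  - intros q s Hs. unfold flatF. rewrite Q2; [reflexivity|]. apply (pv_in p1 0 p1 g2 a1 Hp10 Ha HA2). rewrite S2. exact Hs.
  - apply (Mono _ _ M2); [lra|exact H2].
  - intros q. rewrite Q3. reflexivity.
  - intros q q'. rewrite <- Rmult_minus_distr_l, Rabs_mult, (Rabs_right (lam / 2)) by lra.
    pose proof (pw_nonneg al (Rabs (q - q'))) as PW.
    apply Rle_trans with (M3 * pw al (Rabs (q - q'))); [|apply Rmult_le_compat_r; lra].
    unfold M3. rewrite Rmult_assoc. apply Rmult_le_compat_l; [lra|].
    destruct (Req_dec q q') as [->|N].
    + rewrite Rminus_diag, Rabs_R0. apply Rmult_le_pos; [lra|apply pw_nonneg].
    + rewrite pw_Rpower in PW |- * by (apply Rabs_pos_lt; lra). eapply Rle_trans; [apply HC, N|].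
      apply Rmult_le_compat_r; lra.
  - intros q. rewrite Rabs_mult, (Rabs_right (lam / 2)) by lra. specialize (HB q).
    apply Rle_trans with M3; [|lra]. unfold M3. apply Rmult_le_compat_l; lra.
Qed.

Lemma cokernel_dim : coker_dim g sigma g1 g2 al p0 p1 lam (length l).
Proof.
  pose proof lam_pos as Hl. pose proof a1_pos as Ha.
  exists (fun n => mkYZE (fun _ _ => 0) (fun _ _ => 0) (ebp (pair_of (nth n l 0%nat)))). split; [|split].
  - intros n Hn.
    assert (Z : forall a b, inCa2 al a b (fun _ _ => 0)).
    { intros a b. split; [intros q p _; reflexivity|]. split.
      - exists 0. intros. rewrite Rabs_R0. lra.
      - exists 0. intros. rewrite Rminus_diag, Rabs_R0. lra. }
    split; [apply Z|]. split; [apply Z|]. cbn [yz]. unfold ebp.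
    destruct (ebas_hol al Hal (fst (pair_of (nth n l 0%nat))) (snd (pair_of (nth n l 0%nat)))) as [B [HB [B1 [B2 _]]]].
    split; [intros q; apply ebas_periodic|]. split; [exists B; exact B1|]. exists B. intros q q' N.
    rewrite <- pw_Rpower by (apply Rabs_pos_lt; lra). apply B2.
  - intros y Hy. destruct (inYZ_data y Hy) as [M [HM HD]].
    destruct (Hsolve _ _ _ M HM HD) as [w1 [d1 [w2 [d2 [e [He HW]]]]]].
    (* The range element has the interior data of [y] and a top datum diminished by the residual,
       which the complement supplies. *)
    pose (w := mkYZE (y1 y) (y2 y) (fun q => 2 / lam * (lam / 2 * yz y q - trig K e q))).
    destruct (Wsol_toX _ _ _ _ _ _ _ w HW) as [X1 X2].
    { intros q p Hp. symmetry. apply (flatF_inv p0 p1 p1 g1 a1 Ha HA1). exact Hp. }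
    { intros q p Hp. symmetry. apply (flatF_inv p1 0 p1 g2 a1 Ha HA2). exact Hp. }
    { reflexivity. }
    exists (toX w1 w2), w, (fun n => 2 / lam * e (fst (pair_of (nth n l 0%nat))) (snd (pair_of (nth n l 0%nat)))).
    split; [exact X1|]. split; [exact X2|]. split; [|split].
    + intros q p _. unfold YZadd, YZlc, w. cbn [y1]. rewrite lc2_zero. ring.
    + intros q p _. unfold YZadd, YZlc, w. cbn [y2]. rewrite lc2_zero. ring.
    + intros q. unfold YZadd, YZlc, w. cbn [yz]. unfold l.
      rewrite (lc1_badl bad K (fun i k => 2 / lam * e i k)).
      * change (fun i k => 2 / lam * e i k) with (mul (fun _ => 2 / lam) e). rewrite trig_scal. field. lra.
      * intros j Hj. destruct (bad_false j Hj) as [N|N]; [rewrite He by exact N; ring|rewrite N; ring].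
  - intros x w c Hx HL [W1 [W2 W3]] n Hn. unfold YZadd, YZlc, YZ0 in W1, W2, W3. cbn [y1 y2 yz] in W1, W2, W3.
    destruct (badl_nth n Hn) as [T N].
    destruct (fourier_mode x w (fst (pair_of (nth n l 0%nat))) (snd (pair_of (nth n l 0%nat))) Hx HL) as [m [_ [_ F]]].
    { intros q p Hp. specialize (W1 q p Hp). rewrite lc2_zero in W1. lra. }
    { intros q p Hp. specialize (W2 q p Hp). rewrite lc2_zero in W2. lra. }
    (* At a degenerate index the coefficient of [yz w] vanishes, while by orthogonality it equals
       [- c n]. *)
    rewrite T in F.
    rewrite (fc_ext (yz w) (fun q => 0 + -1 * lc1 (length l) c (fun n => ebp (pair_of (nth n l 0%nat))) q)) in F.
    2:{ intros q. specialize (W3 q). lra. }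
    rewrite (fc_lin (fun _ => 0) (fun q => lc1 (length l) c (fun n => ebp (pair_of (nth n l 0%nat))) q)) in F;
      [|intros; apply continuous_const|intros; apply lc1_cont].
    rewrite fc_0, (fc_lc1_nth l n c badl_NoDup Hn N) in F. lra.
Qed.
End Bad.

Lemma water_fredholm : fredholm_index0 g sigma g1 g2 al p0 p1 lam.
Proof.
  destruct (W_solve al h1 h2 kap sg bt ct Hal h1_pos h2_pos sg_pos) as [K [HK Hs]].
  exists (length (badl bad K)). split; [apply kernel_dim, HK|apply cokernel_dim, Hs].
Qed.
End Water.

Theorem theorem3p3 (g sigma p0 p1 g1 g2 alpha : R)
  (hg : 0 < g) (hsigma : 0 < sigma) (hp : p0 < p1) (hp1 : p1 < 0)
  (halpha : 0 < alpha < 1) (hgam : g1 <> g2) :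
  forall lam : R,
    (forall p, p0 <= p <= 0 -> 2 * Gam g1 g2 p1 p < lam) ->
    fredholm_index0 g sigma g1 g2 alpha p0 p1 lam.
Proof. intros lam Hlam. apply water_fredholm; assumption. Qed.
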